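(* Let $X$ be a projective manifold of complex dimension $n$ with line bundles $L_0,\dots,L_k$ whose curvatures are Kähler forms $\omega_0,\dots,\omega_k$, and let $0\le p_i\le n-1$ for $i=1,\dots,k$. Define an extremal metric corresponding to $\mu_{\mathcal J,\vec p}$ to be a critical point $\vec h=(h_0,\dots,h_k)$ of the Calabi functional $\mathcal C_{\mathcal J,\vec p}=\|\mu_{\mathcal J,\vec p}\|^2$ on $\prod_{i=0}^k\mathrm{PSH}(X,\omega_i)$. Then an extremal metric solves $\mu_{\mathcal J,\vec p}=0$ if and only if the Futaki invariant $F_{\mathcal J,\vec p}$ is zero for all holomorphic vector fields.
   Context: $\mathrm{PSH}(X,\omega_i)=\{h\in C^\infty(X,\mathbb R)\mid\omega_{i,h}:=\omega_i+\sqrt{-1}\partial\bar\partial h>0\}$. Write, for $i=1,\dots,k$, $$A_i=\frac{n!}{(p_i+1)!(n-p_i-1)!}\frac{\omega_{i,h_i}^{p_i+1}\wedge\omega_{0,h_0}^{n-p_i-1}}{\omega_{0,h_0}^n},\qquad B_i=\frac{n!}{(n-p_i)!\,p_i!}\frac{\omega_{0,h_0}^{n-p_i}\wedge\omega_{i,h_i}^{p_i}}{\omega_{i,h_i}^n},$$ let $S_{h_0}$ be the scalar curvature of $\omega_{0,h_0}$, normalized by $S_{h_0}\frac{\omega_{0,h_0}^n}{n!}=\mathrm{Ric}(\omega_{0,h_0})\wedge\frac{\omega_{0,h_0}^{n-1}}{(n-1)!}$, and let underlines denote averages ($A_i$, $S_{h_0}$ with respect to $\omega_{0,h_0}^n$,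 $B_i$ with respect to $\omega_{i,h_i}^n$). The Calabi functional is $$\mathcal C_{\mathcal J,\vec p}(\vec h)=\int_X\Big|\sum_{i=1}^kA_i-S_{h_0}-\sum_{i=1}^k\underline{A_i}+\underline{S_{h_0}}\Big|^2\frac{\omega_{0,h_0}^n}{n!}+\sum_{j=1}^k\int_X|B_j-\underline{B_j}|^2\frac{\omega_{j,h_j}^n}{n!}.$$ The equation $\mu_{\mathcal J,\vec p}=0$ at $\vec h$ means $\sum_iA_i-S_{h_0}=\sum_i\underline{A_i}-\underline{S_{h_0}}$ and $B_j=\underline{B_j}$ for $j=1,\dots,k$. Let $\xi=(\xi_0,\dots,\xi_k)$ be a $\mathbb C^*$-action in $\prod_{i=0}^k\mathrm{Aut}(X,L_i)$ with holomorphic $\xi_i$ and $\iota_{\xi_i}\omega_i=d\theta_i$. The Futaki invariant is $$F_{\mathcal J,\vec p}(\xi)=\int_X\theta_0\Big(\sum_{i=1}^k\frac{\omega_i^{p_i+1}\wedge\omega_0^{n-p_i-1}}{(p_i+1)!(n-p_i-1)!}-\mathrm{Ric}(\omega_0)\wedge\frac{\omega_0^{n-1}}{(n-1)!}-c_0\frac{\omega_0^n}{n!}\Big)+\sum_{i=1}^k\int_X\theta_i\Big(\frac{\omega_i^{p_i}\wedge\omega_0^{n-p_i}}{p_i!(n-p_i)!}-c_i\frac{\omega_i^n}{n!}\Big),$$ where $c_0,\dots,c_k$ are constants making each parenthesis integrate to zero.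
   Formalization: The tuple ξ is taken to be one holomorphic vector field on X, the same for every L_i, with complex potentials satisfying ι_ξ ω_i = ∂̄θ_i in place of dθ_i; with independent ξ_0,…,ξ_k the claim fails, e.g. on P^1 with k=1, p_1=0. *)

(* Defs.v *)
From mathcomp Require Import all_boot all_order all_algebra all_fingroup.
From mathcomp Require Import all_classical all_reals all_analysis.
From mathcomp Require Import complex.

Set Implicit Arguments.
Unset Strict Implicit.
Unset Printing Implicit Defensive.

Import Order.TTheory GRing.Theory Num.Theory.
Import numFieldNormedType.Exports.

Local Open Scope classical_set_scope.
Local Open Scope ring_scope.

(* C^n is 'rV[R]_(n + n): the coordinates are (x_1, ..., x_n, y_1, ..., y_n),
   with z_j = x_j + i y_j. *)

Section LocalCalculus.
Variable R : realType.

Definition partial m (i : 'I_m) (f : 'rV[R]_m -> R) : 'rV[R]_m -> R :=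
  fun x => 'D_(delta_mx 0 i) f x.

(* C^oo on the open set U: iterated partial derivatives of every order exist
   and are continuous. *)
Definition smooth_on m (U : set 'rV[R]_m) (f : 'rV[R]_m -> R) : Prop :=
  forall (s : seq 'I_m) (x : 'rV[R]_m), U x ->
    {for x, continuous (foldr (@partial m) f s)} /\
    forall i : 'I_m, derivable (foldr (@partial m) f s) x (delta_mx 0 i).

(* The Lebesgue integral over R^m as an iterated integral; it is only used for
   continuous compactly supported integrands. *)
Fixpoint integral_rV m : ('rV[R]_m -> R) -> R :=
  if m is m'.+1 then
    fun f => \int[@lebesgue_measure R]_x
               integral_rV (fun v : 'rV[R]_m' =>
                              f (row_mx (const_mx x : 'rV[R]_1) v))
  else fun f => f 0.

Section Complex.
Variable n : nat.
Notation E := 'rV[R]_(n + n).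
Implicit Types (F : E -> R[i]) (u : E -> R) (j : 'I_n) (z : E).

Definition csmooth_on (U : set E) F : Prop :=
  smooth_on U (fun z => complex.Re (F z)) /\
  smooth_on U (fun z => complex.Im (F z)).

Definition cpartial (i : 'I_(n + n)) F : E -> R[i] := fun z =>
  Complex (partial i (fun z => complex.Re (F z)) z)
          (partial i (fun z => complex.Im (F z)) z).

Definition d_z j F : E -> R[i] := fun z =>
  (cpartial (lshift n j) F z - Complex 0 1 * cpartial (rshift n j) F z) / 2.
Definition d_zbar j F : E -> R[i] := fun z =>
  (cpartial (lshift n j) F z + Complex 0 1 * cpartial (rshift n j) F z) / 2.

Definition holomorphic_on (U : set E) F : Prop :=
  csmooth_on U F /\ forall z, U z -> forall j, d_zbar j F z = 0.

Definition zcoord z j : R[i] := Complex (z 0 (lshift n j)) (z 0 (rshift n j)).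

(* A matrix M stands for the (1,1)-form
     sqrt(-1) * \sum_(j, l) M j l dz_j /\ d(zbar_l),
   so that ddbar u is sqrt(-1) partial partialbar u. *)
Definition ddbar u : E -> 'M[R[i]]_n := fun z =>
  \matrix_(j, l) d_z j (d_zbar l (fun y => Complex (u y) 0)) z.

Definition posdef (M : 'M[R[i]]_n) : Prop :=
  forall v : 'rV[R[i]]_n, v != 0 -> 0 < (v *m M *m (map_mx Num.conj v)^T) 0 0.

(* The coefficient of M_1 /\ ... /\ M_n with respect to the form
   \prod_j (sqrt(-1) dz_j /\ d(zbar_j)): reordering the dz's and the dzbar's
   produces the two signatures. *)
Definition wedge_coef (M : 'I_n -> 'M[R[i]]_n) : R[i] :=
  \sum_(s : 'S_n) \sum_(t : 'S_n)
    (-1) ^+ s * (-1) ^+ t * \prod_l M l (s l) (t l).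

(* a^q /\ b^(n - q), for q <= n; the coefficient is real on real forms. *)
Definition wedge_pow (q : nat) (a b : 'M[R[i]]_n) : R :=
  complex.Re (wedge_coef (fun l => if (l < q)%N then a else b)).

Definition top_pow (a : 'M[R[i]]_n) : R := wedge_pow n a a.

End Complex.
End LocalCalculus.

(* A finite family of charts; chartV a is the inverse of chart a on its image *)
Record atlas (R : realType) (n : nat) := Atlas {
  carrier :> topologicalType;
  idx : finType;
  dom : idx -> set carrier;
  chart : idx -> carrier -> 'rV[R]_(n + n);
  chartV : idx -> 'rV[R]_(n + n) -> carrier }.

Section Atlas.
Variables (R : realType) (n : nat) (X : atlas R n).
Notation E := 'rV[R]_(n + n).

Definition im (a : idx X) (V : set X) : set E := chart a @` (dom a `&` V).

Definition mfd_smooth_on (V : set X) (f : X -> R) : Prop :=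
  forall a, smooth_on (im a V) (f \o chartV a).
Definition mfd_smooth : (X -> R) -> Prop := mfd_smooth_on setT.
Definition mfd_csmooth (f : X -> R[i]) : Prop :=
  mfd_smooth (fun x => complex.Re (f x)) /\
  mfd_smooth (fun x => complex.Im (f x)).
Definition mfd_holomorphic_on (V : set X) (f : X -> R[i]) : Prop :=
  forall a, holomorphic_on (im a V) (f \o chartV a).

Definition holomorphic_atlas : Prop :=
  [/\ forall x : X, exists a, dom a x,
      forall a : idx X, open (dom a) /\ open (im a setT),
      forall (a : idx X) (x : X), dom a x ->
        chartV a (chart a x) = x /\ {for x, continuous (chart a)},
      forall (a : idx X) (z : E), im a setT z -> {for z, continuous (chartV a)}
    & forall (a b : idx X) (j : 'I_n), holomorphic_on (im a (dom b))
        (fun z => zcoord (chart b (chartV a z)) j)].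

Definition partition_of_unity (rho : idx X -> X -> R) : Prop :=
  [/\ forall a, mfd_smooth (rho a),
      forall a x, 0 <= rho a x,
      forall a, closure [set x | rho a x != 0] `<=` dom a
    & forall x, \sum_a rho a x = 1].

End Atlas.

(* The partition of unity serves to define integration. Every compact complex
   manifold has a finite atlas and a subordinate partition of unity, and the
   integral of a top-degree form depends on neither. *)
Record compactComplexManifold (R : realType) (n : nat) := CompactManifold {
  mfd :> atlas R n;
  mfd_nonempty : [set: mfd] !=set0;
  mfd_hausdorff : hausdorff_space mfd;
  mfd_compact : compact [set: mfd];
  mfd_connected : connected [set: mfd];
  mfd_atlas : holomorphic_atlas mfd;
  pou : idx mfd -> mfd -> R;
  mfd_pou : partition_of_unity pou }.

Section Manifold.
Variables (R : realType) (n : nat) (X : compactComplexManifold R n).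
Notation E := 'rV[R]_(n + n).
Implicit Types (a b : idx X) (x : X) (z : E).

(* Z represents a map from X to P^N by homogeneous coordinates. It is injective,
   has local holomorphic lifts F, and is an immersion: F and its derivatives
   are linearly independent. On a compact X this is a closed embedding. *)
Definition projective : Prop :=
  exists (N : nat) (Z : X -> 'rV[R[i]]_N.+1),
  [/\ forall x, Z x != 0,
      forall x y, (exists c : R[i], Z y = c *: Z x) -> x = y
    & forall a x, dom a x -> exists (W : set E) (F : E -> 'rV[R[i]]_N.+1),
      [/\ open W /\ W (chart a x),
          W `<=` im a setT,
          forall l, holomorphic_on W (fun z => F z 0 l),
          forall z, W z -> exists2 c : R[i], c != 0 & F z = c *: Z (chartV a z)
        & \rank (col_mx (F (chart a x))
            (\matrix_(j < n, l < N.+1) d_z j (fun z => F z 0 l) (chart a x)))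
          = n.+1]].

(* Local scalars and (1,1)-forms: one coefficient function per chart. Values
   outside the image of the chart are irrelevant. *)
Definition lfun := idx X -> E -> R.
Definition form11 := idx X -> E -> 'M[R[i]]_n.

(* The integral over X of the top-degree form with coefficient tau with respect
   to \prod_j (sqrt(-1) dz_j /\ d(zbar_j)), which is 2^n times dx dy. *)
Definition integral_mfd (tau : lfun) : R :=
  \sum_a integral_rV (fun z =>
    \1_(im a setT) z * (pou a (chartV a z) * tau a z * 2 ^+ n)).

Definition integral_cmfd (tau : idx X -> E -> R[i]) : R[i] :=
  Complex (integral_mfd (fun a z => complex.Re (tau a z)))
          (integral_mfd (fun a z => complex.Im (tau a z))).

(* A holomorphic line bundle by its transition functions: a section is a family
   of functions with s_al = trans al be * s_be. *)
Record lineBundle := LineBundle {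
  lidx : Type;
  ldom : lidx -> set X;
  trans : lidx -> lidx -> X -> R[i];
  ldom_open : forall al, open (ldom al);
  ldom_cover : forall x, exists al, ldom al x;
  trans_neq0 : forall al be x, ldom al x -> ldom be x -> trans al be x != 0;
  trans_holo : forall al be,
    mfd_holomorphic_on (ldom al `&` ldom be) (trans al be);
  trans_cocycle : forall al be ga x, ldom al x -> ldom be x -> ldom ga x ->
    trans al be x * trans be ga x = trans al ga x }.

(* The metric |s|^2 = |s_al|^2 * exp (- phi al) on L *)
Definition hermitian_metric (L : lineBundle) (phi : lidx L -> X -> R) : Prop :=
  (forall al, mfd_smooth_on (ldom al) (phi al)) /\
  (forall al be x, ldom al x -> ldom be x ->
     phi al x - phi be x =
       ln (complex.Re (trans al be x) ^+ 2 + complex.Im (trans al be x) ^+ 2)).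

(* sqrt(-1) times the curvature of the Chern connection *)
Definition curvature_form (L : lineBundle) (phi : lidx L -> X -> R)
    (om : form11) : Prop :=
  forall al a z, im a (ldom al) z -> om a z = ddbar (phi al \o chartV a) z.

Definition positive_form (om : form11) : Prop :=
  forall a z, im a setT z -> posdef (om a z).

Definition perturb (om : form11) (h : X -> R) : form11 :=
  fun a z => om a z + ddbar (h \o chartV a) z.

Definition PSH (om : form11) (h : X -> R) : Prop :=
  mfd_smooth h /\ positive_form (perturb om h).

(* Ric = - sqrt(-1) partial partialbar (ln (det om)) *)
Definition Ric (om : form11) : form11 :=
  fun a z => - ddbar (fun y => ln (complex.Re (\det (om a y)))) z.

Definition scalar_curvature (om : form11) : lfun := fun a z =>
  (wedge_pow 1 (Ric om a z) (om a z) / (n.-1)`!%:R) /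
  (top_pow (om a z) / n`!%:R).

Definition vol (om : form11) : lfun := fun a z => top_pow (om a z) / n`!%:R.

Definition average (om : form11) (f : lfun) : R :=
  integral_mfd (fun a z => f a z * top_pow (om a z)) /
  integral_mfd (fun a z => top_pow (om a z)).

Section Functional.
Variables (k : nat) (p : 'I_k -> nat).

(* The index 0 is ord0, the indices 1, ..., k are lift ord0 i. *)
Definition forms := 'I_k.+1 -> form11.

Definition coefA (w : forms) (i : 'I_k) : lfun := fun a z =>
  n`!%:R / ((p i).+1`!%:R * (n - p i - 1)`!%:R) *
  (wedge_pow (p i).+1 (w (lift ord0 i) a z) (w ord0 a z) /
   top_pow (w ord0 a z)).

Definition coefB (w : forms) (i : 'I_k) : lfun := fun a z =>
  n`!%:R / ((n - p i)`!%:R * (p i)`!%:R) *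
  (wedge_pow (n - p i) (w ord0 a z) (w (lift ord0 i) a z) /
   top_pow (w (lift ord0 i) a z)).

Definition perturbs (om : forms) (h : 'I_k.+1 -> X -> R) : forms :=
  fun i => perturb (om i) (h i).

Definition calabi (om : forms) (h : 'I_k.+1 -> X -> R) : R :=
  let w := perturbs om h in
  integral_mfd (fun a z =>
    `| \sum_i coefA w i a z - scalar_curvature (w ord0) a z
       - \sum_i average (w ord0) (coefA w i)
       + average (w ord0) (scalar_curvature (w ord0)) | ^+ 2
    * vol (w ord0) a z)
  + \sum_j integral_mfd (fun a z =>
      `| coefB w j a z - average (w (lift ord0 j)) (coefB w j) | ^+ 2
      * vol (w (lift ord0 j)) a z).

Definition moment_zero (om : forms) (h : 'I_k.+1 -> X -> R) : Prop :=
  let w := perturbs om h in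
  forall a z, im a setT z ->
    \sum_i coefA w i a z - scalar_curvature (w ord0) a z
      = \sum_i average (w ord0) (coefA w i)
        - average (w ord0) (scalar_curvature (w ord0))
    /\ forall j, coefB w j a z = average (w (lift ord0 j)) (coefB w j).

Definition extremal (om : forms) (h : 'I_k.+1 -> X -> R) : Prop :=
  (forall i, PSH (om i) (h i)) /\
  forall f : 'I_k.+1 -> X -> R, (forall i, mfd_smooth (f i)) ->
    is_derive (0 : R) (1 : R)
      (fun t : R => calabi om (fun i x => h i x + t * f i x)) (0 : R).

(* xi = \sum_j xi_j d/dz_j *)
Definition vfield := idx X -> E -> 'rV[R[i]]_n.

Definition holomorphic_vfield (xi : vfield) : Prop :=
  (forall a j, holomorphic_on (im a setT) (fun z => xi a z 0 j)) /\
  (forall a b z, im a (dom b) z -> forall l,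
     xi b (chart b (chartV a z)) 0 l =
     \sum_j xi a z 0 j * d_z j (fun y => zcoord (chart b (chartV a y)) l) z).

(* iota_xi om = partialbar theta. For xi of type (1,0) and om of type (1,1) the
   contraction is of type (0,1); when theta is real this is equivalent to
   iota_v om = d theta for the real field v = xi + conj xi. *)
Definition holomorphy_potential (om : form11) (xi : vfield) (theta : X -> R[i])
    : Prop :=
  mfd_csmooth theta /\
  forall a z, im a setT z -> forall l,
    \sum_j Complex 0 1 * xi a z 0 j * om a z j l
      = d_zbar l (theta \o chartV a) z.

Definition futaki_top0 (om : forms) : lfun := fun a z =>
  \sum_i wedge_pow (p i).+1 (om (lift ord0 i) a z) (om ord0 a z)
           / ((p i).+1`!%:R * (n - p i - 1)`!%:R)
  - wedge_pow 1 (Ric (om ord0) a z) (om ord0 a z) / (n.-1)`!%:R.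

Definition futaki_top (om : forms) (i : 'I_k) : lfun := fun a z =>
  wedge_pow (p i) (om (lift ord0 i) a z) (om ord0 a z)
    / ((p i)`!%:R * (n - p i)`!%:R).

(* tau - c * om^n / n! for the constant c making the integral vanish *)
Definition normalized (om : form11) (tau : lfun) : lfun := fun a z =>
  tau a z - integral_mfd tau / integral_mfd (vol om) * vol om a z.

Definition integral_against (theta : X -> R[i]) (tau : lfun) : R[i] :=
  integral_cmfd (fun a z => theta (chartV a z) * Complex (tau a z) 0).

Definition futaki (om : forms) (theta : 'I_k.+1 -> X -> R[i]) : R[i] :=
  integral_against (theta ord0) (normalized (om ord0) (futaki_top0 om)) +
  \sum_i integral_against (theta (lift ord0 i))
           (normalized (om (lift ord0 i)) (futaki_top om i)).

(* Vanishing on the holomorphic vector fields of (X, L_0, ..., L_k): a field xi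
   on X lifts to L_i exactly when it has a holomorphy potential for om i. The
   C^*-action is one action on X lifted to every L_i; unless the lifts induce
   the same field on X, futaki depends on the choice of the metrics om. *)
Definition futaki_vanishes (om : forms) : Prop :=
  forall (xi : vfield) (theta : 'I_k.+1 -> X -> R[i]),
    holomorphic_vfield xi ->
    (forall i, holomorphy_potential (om i) xi (theta i)) ->
    futaki om theta = 0.

End Functional.
End Manifold.

(* Main.v *)
(** A metric solving the equation satisfies it pointwise, and the Futaki
    invariant does not depend on the representatives of the Kaehler classes, so
    it can be computed at [h], where the integrands vanish.

    Conversely put [H_0 = N_0 / V_0 - m_0] and [H_j = N_j / V_j - m_j], where
    [V_i] is the volume density of the perturbed form [w_i], [N_0], [N_j] are
    the densities on the right of the pairings in the Futaki invariant, and the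
    [m_i] are averages. Differentiating the Calabi functional directly would
    require differentiating under the integral sign. Instead,
    [(N - m V)^2 / V >= 2 H (N - m V) - H^2 V], with equality at [t = 0] along
    the ray [h + t H]; the integral of the right-hand side is a polynomial in
    [t] up to one logarithmic term, and its derivative at [0] is [2 slope].
    Integrations by parts show that the slope is a sum of integrals of
    nonnegative densities: for each [i], a positive quadratic expression in the
    difference of the gradients of [H_i] (for [w_i]) and of [H_0] (for [w_0]),
    found by diagonalising [w_0] and [w_i] simultaneously, and, by Bochner's
    identity, the square norm of [dbar grad H_0]. At an extremal metric the slope
    is [0]; hence [grad H_0] is holomorphic and is the gradient of every [H_i]
    with respect to [w_i]. The Futaki invariant of this field is, up to a
    constant factor, the sum of the integrals of [H_i^2 V_i], so it vanishes only
    if every [H_i] is [0]. *)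

Require Import Defs.
From mathcomp Require Import all_boot all_order all_algebra all_fingroup.
From mathcomp Require Import all_classical all_reals all_analysis.
From mathcomp Require Import complex ring lra.

Set Implicit Arguments.
Unset Strict Implicit.
Unset Printing Implicit Defensive.

Import Order.TTheory GRing.Theory Num.Theory.
Import numFieldNormedType.Exports.
(* Several names of Defs (im, dom, coefB, ...) also exist in MathComp. *)
Import Defs.

Local Open Scope classical_set_scope.
Local Open Scope ring_scope.

(** * Integration of continuous compactly supported functions *)

(** Integrals are iterated one-dimensional integrals in charts, so Fubini, the change of variables
    and Stokes are established first, for continuous compactly supported integrands. Forms are
    coefficient matrices, and the mixed products [w_i^q w_0^(n-q)] are coefficients of
    [det (w_0 + X w_i)]. Interpolation at integers turns such a coefficient into a fixed combination
    of determinants; mixed products then need integration by parts only for the determinant of one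
    closed form, and derivatives in a parameter become formal derivatives of polynomials. The Ricci
    form is the one ingredient that is not polynomial along a ray: Green's formula moves its
    variation onto the test function and leaves the factor [ln (det w_t / det w)], which is expanded
    to second order uniformly on [X]. The lower bound is available only for small [t >= 0]. This
    suffices: a vanishing derivative gives slope at most 0, while the slope is an integral of
    nonnegative densities. Along the ray a positive determinant is all that is used of the forms. *)

Section OneDim.
Variable R : realType.
Notation mu := (@lebesgue_measure R).

Lemma compact_support_integrable (g : R -> R) (N : R) : continuous g ->
  (forall x, N < `|x| -> g x = 0) -> mu.-integrable setT (EFin \o g).
Proof.
move=> cg sg.
have -> : EFin \o g = (EFin \o g) \_ `[-N, N].
  apply/funext => x /=; rewrite patchE; case: ifPn => // /negP h.
  rewrite sg // ltNge; apply/negP => xN; apply: h; rewrite inE /= in_itv /=.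
  by rewrite -ler_norml.
apply/integrable_restrict => //; rewrite setTI.
apply: continuous_compact_integrable; first exact: segment_compact.
exact: continuous_subspaceT.
Qed.

Lemma RintegralTE (g : R -> R) (N a b : R) :
  (forall x, N < `|x| -> g x = 0) -> a <= - N -> N <= b ->
  \int[mu]_x g x = \int[mu]_(x in `[a, b]) g x.
Proof.
move=> sg aN Nb; rewrite [RHS]Rintegral_mkcond; congr Rintegral.
apply/funext => x; rewrite patchE; case: ifPn => // /negP h.
rewrite sg // ltNge; apply/negP => xN; apply: h; rewrite inE /= in_itv /=.
move: xN; rewrite ler_norml => /andP[h1 h2].
by rewrite (le_trans aN h1) (le_trans h2 Nb).
Qed.

Lemma Rintegral_antiderivative (g F : R -> R) (N a b : R) : continuous g ->
  (forall x, N < `|x| -> g x = 0) -> a <= - N -> N <= b -> a < b ->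
  (forall x : R, is_derive x (1 : R) F (g x)) ->
  \int[mu]_x g x = F b - F a.
Proof.
move=> cg sg aN Nb ab dF.
have cF : continuous F.
  by move=> x; apply/differentiable_continuous/derivable1_diffP; case: (dF x).
rewrite (RintegralTE sg aN Nb) /Rintegral (continuous_FTC2 (F := F)) //.
- exact: continuous_subspaceT.
- split.
  + by move=> x _; case: (dF x).
  + exact: (cvg_at_right_filter (cF a)).
  + exact: (cvg_at_left_filter (cF b)).
- by move=> x _; rewrite derive1E; case: (dF x).
Qed.

Lemma antiderivative_exists (g : R -> R) (N : R) : continuous g ->
  (forall x, N < `|x| -> g x = 0) ->
  exists F : R -> R, (forall x : R, is_derive x (1 : R) F (g x)) /\
                     (forall x, x <= - N -> F x = 0).
Proof.
(* The base point lies strictly to the left of the support, so [F] is identically zero near every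
   [x <= a], where the interval [[a, x]] is empty or a point and the fundamental theorem does not
   apply. *)
move=> cg sg; pose a := - N - 1.
pose F x := \int[mu]_(t in `[a, x]) g t.
have F0 x : x <= - N -> F x = 0.
  move=> xN; rewrite /F; pose D := `[a, x]%classic : set R.
  case: (ltP N 0) => N0.
    rewrite (@eq_Rintegral _ _ _ _ _ (cst 0)); last first.
      by move=> t _; rewrite sg //; exact: (lt_le_trans N0).
    by rewrite /Rintegral integral0.
  case: (ltP a x) => ax; last first.
    rewrite /D; move: ax; rewrite le_eqVlt => /predU1P[<-|ax].
      by rewrite set_itv1 Rintegral_set1.
    rewrite set_itv_ge ?Rintegral_set0 //.
    by rewrite bnd_simp -ltNge.
  rewrite -Rintegral_itv_bndo_bndc //; last first.
    apply: (@integrableS _ _ _ mu setT) => //.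
    exact: (compact_support_integrable cg sg).
  rewrite (@eq_Rintegral _ _ _ _ _ (cst 0)).
    by rewrite /Rintegral integral0.
  move=> t; rewrite inE /= in_itv /= => /andP[_ tx]; rewrite sg //.
  rewrite ltr0_norm; first by rewrite ltrNr; apply: lt_le_trans tx xN.
  by apply: (lt_le_trans tx); apply: le_trans xN _; rewrite oppr_le0.
exists F; split=> // x.
case: (ltP a x) => ax.
  have xu : x < x + 1 by rewrite ltrDl.
  have [|dF dFE] := @continuous_FTC1_closed _ g a x (x + 1) xu _ ax (cg x).
    apply: (@integrableS _ _ _ mu setT) => //.
    exact: (compact_support_integrable cg sg).
  by apply: DeriveDef; [exact: dF | rewrite -derive1E].
have xN : x < - N by apply: (le_lt_trans ax); rewrite /a ltrBlDr ltrDl.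
have gx : g x = 0.
  case: (ltP N 0) => N0; first by rewrite sg // (lt_le_trans N0).
  rewrite sg // ltr0_norm; first by rewrite ltrNr.
  by apply: (lt_le_trans xN); rewrite oppr_le0.
rewrite gx.
apply: (@near_eq_is_derive _ _ _ (cst 0)).
- have : \forall y \near x, y < - N by apply: lt_nbhsl.
  by apply: filterS => y /ltW /F0 ->.
Qed.

Lemma is_derive_affine (F : R -> R) (c d x l : R) :
  is_derive (c * x + d) 1 F l -> is_derive x 1 (fun y => F (c * y + d)) (c * l).
Proof.
move=> h.
have hA : is_derive x (1 : R) (fun y => c * y + d) c.
  have := @is_deriveD _ _ _ (fun y : R => c * y) (cst d) x 1 c 0.
  rewrite addr0; apply.
  have := @is_deriveZ _ _ _ (@id R) c x 1 1 _; rewrite /GRing.scale /= mulr1.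
  by apply; exact: is_derive_id.
have := @is_derive1_comp _ F (fun y => c * y + d) x l c h hA.
by rewrite mulrC.
Qed.

Lemma Rintegral_affine (g : R -> R) (N c d : R) : continuous g ->
  (forall x, N < `|x| -> g x = 0) -> c != 0 ->
  `|c| * \int[mu]_x g (c * x + d) = \int[mu]_x g x.
Proof.
move=> cg sg c0.
have [F [dF _]] := antiderivative_exists cg sg.
(* Chosen so that [|c| * M >= |N| + |d| + 1]: then [|x| > M] forces [|c * x + d| > N], and the
   images of both ends [-M] and [M] lie outside the support of [g]. *)
pose M := (`|N| + `|d| + 1) / `|c| + `|N| + 1.
have ac : 0 < `|c| by rewrite normr_gt0.
have M0 : 0 < M.
  by rewrite /M ltr_wpDl // addr_ge0 // divr_ge0 // ?addr_ge0.
have cM : `|N| + `|d| + 1 <= `|c| * M.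
  have -> : `|c| * M = `|N| + `|d| + 1 + `|c| * (`|N| + 1).
    by rewrite /M; field; rewrite lt0r_neq0.
  rewrite lerDl.
  by rewrite mulr_ge0 // addr_ge0.
have NM : N <= M.
  apply: (le_trans (ler_norm N)).
  have : 0 <= (`|N| + `|d| + 1) / `|c| by rewrite divr_ge0 // !addr_ge0.
  rewrite /M; lra.
have sg' x : M < `|x| -> g (c * x + d) = 0.
  move=> Mx; apply: sg.
  have : `|c| * M < `|c| * `|x| by rewrite ltr_pM2l.
  rewrite -normrM => h.
  have := ler_normB (c * x + d) d; rewrite addrK => h2.
  have := ler_norm N; lra.
have cg' : continuous (fun x => g (c * x + d)).
  move=> x; apply: (@continuous_comp _ _ _ (fun x => c * x + d) g); last exact: cg.
  apply: continuousD; last exact: cvg_cst.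
  by apply: continuousM; [exact: cvg_cst | exact: cvg_id].
pose G x := c^-1 * F (c * x + d).
have dG (x : R) : is_derive x (1 : R) G (g (c * x + d)).
  have h : is_derive x (1 : R) (fun y => F (c * y + d)) (c * g (c * x + d)).
    by apply: is_derive_affine; exact: dF.
  have := @is_deriveZ _ _ _ _ c^-1 x 1 _ h.
  by rewrite /GRing.scale /= mulrA mulVf // mul1r.
have -> := @Rintegral_antiderivative _ G M (- M) M cg' sg' (lexx _) (lexx _) _ dG.
  2: by rewrite gtrN.
rewrite /G -mulrBr mulrA.
case: (ltP 0 c) => cp.
  rewrite (gtr0_norm cp) divff // mul1r.
  have h3 := ler_norm N; have h4 := ler_norm d; have h5 := ler_norm (- d).
  rewrite normrN in h5.
  move: cM; rewrite (gtr0_norm cp) => cM.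
  rewrite -(@Rintegral_antiderivative g F N _ _ cg sg _ _ _ dF) //.
  - by lra.
  - by lra.
  - by have := normr_ge0 N; have := normr_ge0 d; lra.
have cn : c < 0 by rewrite lt_neqAle c0.
rewrite (ltr0_norm cn) mulNr divff // mulN1r opprB.
have h3 := ler_norm N; have h4 := ler_norm d; have h5 := ler_norm (- d).
rewrite normrN in h5.
move: cM; rewrite (ltr0_norm cn) => cM.
rewrite -(@Rintegral_antiderivative g F N _ _ cg sg _ _ _ dF) //.
- by lra.
- by lra.
- by have := normr_ge0 N; have := normr_ge0 d; lra.
Qed.

End OneDim.

(** * Linearity and bounds for iterated integrals on row vectors *)

Section RowVectors.
Variable R : realType.

Definition rcons_mx m (x : R) (v : 'rV[R]_m) : 'rV[R]_m.+1 :=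
  row_mx (const_mx x : 'rV_1) v.

Lemma rcons_mxE0 m (x : R) (v : 'rV[R]_m) :
  rcons_mx x v 0 (@lshift 1 m ord0) = x.
Proof. by rewrite [LHS](@row_mxEl R 1 1 m) mxE. Qed.

Lemma rcons_mxES m (x : R) (v : 'rV[R]_m) (i : 'I_m) :
  rcons_mx x v 0 (@rshift 1 m i) = v 0 i.
Proof. exact: (@row_mxEr R 1 1 m). Qed.

Lemma rV_ext m (u w : 'rV[R]_m.+1) :
  u 0 (@lshift 1 m ord0) = w 0 (@lshift 1 m ord0) ->
  (forall i, u 0 (@rshift 1 m i) = w 0 (@rshift 1 m i)) -> u = w.
Proof.
move=> h0 hS; apply/rowP => i; case: (@split_ordP 1 m i) => j ->; last exact: hS.
by rewrite (ord1 j).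
Qed.

Lemma coord_le_norm m (v : 'rV[R]_m) i : `|v 0 i| <= `|v|.
Proof.
rewrite [leRHS]/Num.norm /= mx_normrE.
by apply/bigmax_geP; right => /=; exists (0, i).
Qed.

Lemma norm_le_coord m (v : 'rV[R]_m) (c : R) : 0 <= c ->
  (forall i, `|v 0 i| <= c) -> `|v| <= c.
Proof.
move=> c0 h; rewrite [leLHS]/Num.norm /= mx_normrE.
by apply/bigmax_leP; split => // -[i j] _ /=; rewrite (ord1 i).
Qed.

Lemma norm_rcons_mx m x (v : 'rV[R]_m) :
  `|rcons_mx x v| = Num.max `|x| `|v|.
Proof.
apply/eqP; rewrite eq_le; apply/andP; split.
  apply: norm_le_coord => [|i]; first by rewrite le_max normr_ge0.
  rewrite le_max /rcons_mx mxE; case: splitP => j _.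
    by rewrite mxE lexx.
  by rewrite coord_le_norm orbT.
rewrite ge_max; apply/andP; split.
  by have := coord_le_norm (rcons_mx x v) (@lshift 1 m ord0); rewrite rcons_mxE0.
apply: norm_le_coord => // i.
by have := coord_le_norm (rcons_mx x v) (@rshift 1 m i); rewrite rcons_mxES.
Qed.

Lemma rcons_mxB m x y (v w : 'rV[R]_m) :
  rcons_mx x v - rcons_mx y w = rcons_mx (x - y) (v - w).
Proof.
apply: rV_ext => [|i]; rewrite [LHS]mxE [X in _ + X]mxE.
  by rewrite !rcons_mxE0.
by rewrite !rcons_mxES !mxE.
Qed.

Lemma rcons_mxP m (u : 'rV[R]_m.+1) :
  u = rcons_mx (u 0 (@lshift 1 m ord0)) (@rsubmx R 1 1 m u).
Proof.
by apply: rV_ext => [|i]; rewrite ?rcons_mxE0 ?rcons_mxES // !mxE.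
Qed.

(** Continuity is required uniformly because this form passes to slices [f (rcons_mx x _)] and to
    partial integrals, so every one-dimensional integral inside [integral_rV] has a continuous,
    compactly supported integrand. *)
Definition compactly_continuous m (N : R) (f : 'rV[R]_m -> R) : Prop :=
  (forall x, N < `|x| -> f x = 0) /\
  (forall e : R, 0 < e -> exists2 d : R, 0 < d &
     forall x y, `|x - y| < d -> `|f x - f y| < e).
Notation cc := compactly_continuous.

Lemma ccW m N M (f : 'rV[R]_m -> R) : N <= M -> cc N f -> cc M f.
Proof. by move=> NM [s u]; split=> // x /(le_lt_trans NM)/s. Qed.

Lemma cc0 m N : cc N (fun _ : 'rV[R]_m => 0).
Proof.
by split=> // e e0; exists 1 => // x y _; rewrite subrr normr0.
Qed.

Lemma ccD m N (f g : 'rV[R]_m -> R) : cc N f -> cc N g ->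
  cc N (fun x => f x + g x).
Proof.
move=> [sf uf] [sg ug]; split=> [x h|e e0]; first by rewrite sf // sg // addr0.
have e2 : 0 < e / 2 by rewrite divr_gt0.
have [d d0 hd] := uf _ e2; have [d' d'0 hd'] := ug _ e2.
exists (Num.min d d'); first by rewrite lt_min d0.
move=> x y; rewrite lt_min => /andP[/hd h1 /hd' h2].
rewrite opprD addrACA (splitr e); apply: le_lt_trans (ler_normD _ _) _.
exact: ltrD.
Qed.

Lemma ccZ m N a (f : 'rV[R]_m -> R) : cc N f -> cc N (fun x => a * f x).
Proof.
move=> [sf uf]; split=> [x h|e e0]; first by rewrite sf // mulr0.
have a1 : 0 < `|a| + 1 by rewrite ltr_wpDl.
have [d d0 hd] := uf (e / (`|a| + 1)) (divr_gt0 e0 a1).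
exists d => // x y /hd; rewrite ltr_pdivlMr // -mulrBr normrM => h.
apply: le_lt_trans h; rewrite mulrC ler_wpM2l // lerDl //.
Qed.

Lemma ccN m N (f : 'rV[R]_m -> R) : cc N f -> cc N (fun x => - f x).
Proof.
move=> /(ccZ (-1)); congr cc; apply/funext => x; by rewrite mulN1r.
Qed.

Lemma ccB m N (f g : 'rV[R]_m -> R) : cc N f -> cc N g ->
  cc N (fun x => f x - g x).
Proof. by move=> hf hg; apply: ccD => //; exact: ccN. Qed.

Lemma cc_slice m N (f : 'rV[R]_m.+1 -> R) x : cc N f ->
  cc N (fun v => f (rcons_mx x v)).
Proof.
move=> [sf uf]; split=> [v h|e e0].
  by rewrite sf // norm_rcons_mx lt_max h orbT.
have [d d0 hd] := uf _ e0; exists d => // v w h; apply: hd.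
by rewrite rcons_mxB subrr norm_rcons_mx gt_max normr0 d0.
Qed.

Lemma cc_slice0 m N (f : 'rV[R]_m.+1 -> R) x : cc N f -> N < `|x| ->
  (fun v => f (rcons_mx x v)) = (fun _ => 0).
Proof.
by move=> [sf _] h; apply/funext => v; rewrite sf // norm_rcons_mx lt_max h.
Qed.

Definition ucont1 (g : R -> R) : Prop :=
  forall e : R, 0 < e -> exists2 d : R, 0 < d &
     forall x y, `|x - y| < d -> `|g x - g y| < e.

Lemma ucont1_continuous (g : R -> R) : ucont1 g -> continuous g.
Proof.
move=> ug x; apply/cvgrPdist_lt => e e0; have [d d0 hd] := ug _ e0.
by exists d => //= y; exact: hd.
Qed.

Lemma Rintegral_bound (g : R -> R) (N M : R) : continuous g -> 0 <= N ->
  (forall x : R, N < `|x| -> g x = 0) ->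
  (forall x, `|g x| <= M) ->
  `|\int[@lebesgue_measure R]_x g x| <= (2 * N + 2) * M.
Proof.
move=> cg N0 sg bg.
have [F [dF _]] := antiderivative_exists cg sg.
(* One unit beyond the support on each side, so that the interval is nondegenerate also for [N = 0].
   Its length is the factor [2 * N + 2], and the mean value theorem for an antiderivative gives the
   bound. *)
have ab : - N - 1 < N + 1 by lra.
rewrite (@Rintegral_antiderivative _ g F N (- N - 1) (N + 1)) //; [|lra|lra].
have [|c _ ->] := @MVT _ F g _ _ ab (fun x _ => dF x).
  apply: continuous_subspaceT => x.
  by apply/differentiable_continuous/derivable1_diffP; case: (dF x).
rewrite normrM mulrC (_ : N + 1 - (- N - 1) = 2 * N + 2); last by ring.
rewrite ger0_norm; last by lra.
by rewrite ler_wpM2l //; lra.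
Qed.

Lemma Rintegral_linear (f g : R -> R) (N a : R) : continuous f -> continuous g ->
  (forall x : R, N < `|x| -> f x = 0) ->
  (forall x : R, N < `|x| -> g x = 0) ->
  \int[@lebesgue_measure R]_x (a * f x + g x) =
  a * \int[@lebesgue_measure R]_x f x + \int[@lebesgue_measure R]_x g x.
Proof.
move=> cf cg sf sg.
have caf : continuous (fun x => a * f x).
  by move=> x; apply: continuousM; [exact: cvg_cst | exact: cf].
rewrite RintegralD //.
- rewrite RintegralZl //; exact: (compact_support_integrable cf sf).
- apply: (compact_support_integrable (N := N) caf) => x /sf ->; exact: mulr0.
- exact: (compact_support_integrable cg sg).
Qed.

(* The two parts are proved together by induction on the dimension: linearity
   needs the continuity of the integral over a slice, which the bound provides. *)
Definition integral_regular m := 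
  (forall N (f g : 'rV[R]_m -> R) a, 0 <= N -> cc N f -> cc N g ->
     integral_rV (fun x => a * f x + g x) = a * integral_rV f + integral_rV g) /\
  (forall N, 0 <= N -> exists2 C, 0 <= C & forall (f : 'rV[R]_m -> R) M,
     cc N f -> (forall x, `|f x| <= M) -> `|integral_rV f| <= C * M).

Lemma integral_regular_zero m : integral_regular m -> integral_rV (fun _ : 'rV[R]_m => 0) = 0.
Proof.
move=> [_ B]; have [C C0 hC] := B 0 (lexx 0).
apply/eqP; rewrite -normr_le0 -[leRHS](mulr0 C); apply: hC; first exact: cc0.
by move=> x; rewrite normr0.
Qed.

Lemma integral_regular_sub m N (f g : 'rV[R]_m -> R) : integral_regular m -> 0 <= N -> cc N f ->
  cc N g -> integral_rV (fun x => f x - g x) = integral_rV f - integral_rV g.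
Proof.
move=> [L _] N0 hf hg; have := L N g f (-1) N0 hg hf.
rewrite mulN1r addrC => <-; congr integral_rV; apply/funext => x.
by rewrite mulN1r addrC.
Qed.

Lemma integral_regular_slice m N (f : 'rV[R]_m.+1 -> R) : integral_regular m -> 0 <= N -> cc N f ->
  (forall x : R, N < `|x| -> integral_rV (fun v => f (rcons_mx x v)) = 0) /\
  ucont1 (fun x => integral_rV (fun v => f (rcons_mx x v))).
Proof.
move=> gm N0 hf; split=> [x h|e e0].
  by rewrite (cc_slice0 hf h) integral_regular_zero.
have [C C0 hC] := gm.2 N N0.
have C1 : 0 < C + 1 by rewrite ltr_wpDl.
have [d d0 hd] := hf.2 (e / (C + 1)) (divr_gt0 e0 C1).
exists d => // x y xy; rewrite -(integral_regular_sub gm N0); [|exact: cc_slice..].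
apply: (@le_lt_trans _ _ (C * (e / (C + 1)))).
  apply: hC; first by apply: ccB; exact: cc_slice.
  move=> v; apply/ltW/hd.
  by rewrite rcons_mxB norm_rcons_mx gt_max xy subrr normr0.
rewrite mulrA ltr_pdivrMr // mulrC ltr_pM2l //; lra.
Qed.

Lemma integral_regularP m : integral_regular m.
Proof.
elim: m => [|m gm].
  split=> [N f g a _ _ _ //|N N0].
  by exists 1 => // f M _ h; rewrite mul1r; exact: h.
split=> [N f g a N0 hf hg|N N0].
  have [sf uf] := integral_regular_slice gm N0 hf; have [sg ug] := integral_regular_slice gm N0 hg.
  rewrite /= -(Rintegral_linear a (ucont1_continuous uf) (ucont1_continuous ug) sf sg).
  apply: eq_Rintegral => x _; apply: (gm.1 N) => //; exact: cc_slice.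
have [C C0 hC] := gm.2 N N0.
exists ((2 * N + 2) * C); first by apply: mulr_ge0 => //; lra.
move=> f M hf bf.
have [sf uf] := integral_regular_slice gm N0 hf.
rewrite -mulrA; apply: Rintegral_bound => //; first exact: ucont1_continuous.
by move=> x; apply: hC => //; exact: cc_slice.
Qed.

Lemma integral_rV_linear m N (f g : 'rV[R]_m -> R) a :
  0 <= N -> cc N f -> cc N g ->
  integral_rV (fun x => a * f x + g x) = a * integral_rV f + integral_rV g.
Proof. exact: (integral_regularP m).1. Qed.

Lemma integral_rV_bound m N : 0 <= N ->
  exists2 C, 0 <= C & forall (f : 'rV[R]_m -> R) M,
     cc N f -> (forall x, `|f x| <= M) -> `|integral_rV f| <= C * M.
Proof. exact: (integral_regularP m).2. Qed.

Lemma integral_rV0 m : integral_rV (fun _ : 'rV[R]_m => 0) = 0.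
Proof. exact: integral_regular_zero (integral_regularP m). Qed.

Lemma integral_rVB m N (f g : 'rV[R]_m -> R) : 0 <= N -> cc N f -> cc N g ->
  integral_rV (fun x => f x - g x) = integral_rV f - integral_rV g.
Proof. exact: integral_regular_sub (integral_regularP m). Qed.

Lemma integral_rVD m N (f g : 'rV[R]_m -> R) : 0 <= N -> cc N f -> cc N g ->
  integral_rV (fun x => f x + g x) = integral_rV f + integral_rV g.
Proof.
move=> N0 hf hg; have := integral_rV_linear 1 N0 hf hg; rewrite mul1r => <-.
by congr integral_rV; apply/funext => x; rewrite mul1r.
Qed.

Lemma integral_rVZ m N (f : 'rV[R]_m -> R) a : 0 <= N -> cc N f ->
  integral_rV (fun x => a * f x) = a * integral_rV f.
Proof.
move=> N0 hf; have := integral_rV_linear a N0 hf (cc0 m N).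
rewrite integral_rV0 addr0 => <-.
by congr integral_rV; apply/funext => x; rewrite addr0.
Qed.

Lemma integral_slice m N (f : 'rV[R]_m.+1 -> R) : 0 <= N -> cc N f ->
  (forall x : R, N < `|x| -> integral_rV (fun v => f (rcons_mx x v)) = 0) /\
  ucont1 (fun x => integral_rV (fun v => f (rcons_mx x v))).
Proof. exact: integral_regular_slice (integral_regularP m). Qed.

Lemma integral_rV_ge0 m N (f : 'rV[R]_m -> R) : 0 <= N -> cc N f ->
  (forall x, 0 <= f x) -> 0 <= integral_rV f.
Proof.
move=> N0; elim: m f => [|m IH] f hf f0 //=.
by apply: Rintegral_ge0 => x _; apply: IH => //; exact: cc_slice.
Qed.

End RowVectors.
Notation cc := compactly_continuous.

(** * Exchange of coordinates and linear changes of variables *)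

Section IteratedIntegral.
Variable R : realType.

Lemma is_derive_eps (F : R -> R) (b l : R) :
  (forall e : R, 0 < e -> exists2 d : R, 0 < d & forall h : R, `|h| < d ->
     `|F (b + h) - F b - h * l| <= e * `|h|) -> is_derive b (1 : R) F l.
Proof.
move=> H.
have C : (fun h : R => h^-1 *: ((F \o shift b) (h *: (1 : R)) - F b)) @ 0^' --> l.
  apply/cvgrPdist_le => e e0; have [d d0 hd] := H _ e0.
  exists d => //= h /=; rewrite sub0r normrN => hhd h0.
  have := hd h hhd; rewrite /shift /= [h *: 1]mulr1 [h + b]addrC => hh.
  have nh : 0 < `|h| by rewrite normr_gt0.
  rewrite -(ler_pM2r nh); apply: le_trans hh.
  rewrite -normrM distrC; rewrite le_eqVlt; apply/orP; left; apply/eqP; congr `|_|.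
  by rewrite /GRing.scale /= mulrBl mulrAC mulVf // mul1r [l * h]mulrC.
by split; [apply: cvgP C | apply/cvg_lim].
Qed.

Lemma derivative_remainder (F g : R -> R) (b h e : R) :
  (forall x : R, is_derive x (1 : R) F (g x)) ->
  (forall x, `|x - b| <= `|h| -> `|g x - g b| <= e) ->
  `|F (b + h) - F b - h * g b| <= e * `|h|.
Proof.
move=> dF bg.
have cF (x y : R) : {within `[x, y], continuous F}.
  apply: continuous_subspaceT => z.
  by apply/differentiable_continuous/derivable1_diffP; case: (dF z).
case: (ltgtP h 0) => [h0|h0|->].
- have bh : b + h < b by lra.
  have [c + E] := @MVT _ F g _ _ bh (fun x _ => dF x) (cF _ _).
  rewrite in_itv /= => /andP[c1 c2].
  rewrite (_ : F (b + h) - F b = h * g c); last by lra.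
  rewrite -mulrBr normrM mulrC ler_wpM2r //; apply: bg.
  by rewrite !ltr0_norm //; lra.
- have bh : b < b + h by lra.
  have [c + E] := @MVT _ F g _ _ bh (fun x _ => dF x) (cF _ _).
  rewrite in_itv /= => /andP[c1 c2].
  rewrite (_ : F (b + h) - F b = h * g c); last by lra.
  rewrite -mulrBr normrM mulrC ler_wpM2r //; apply: bg.
  by rewrite !gtr0_norm //; lra.
- by rewrite addr0 subrr mul0r subrr normr0 mulr0.
Qed.

Lemma slice_continuous m N (F : 'rV[R]_m.+1 -> R) v : cc N F ->
  continuous (fun x => F (rcons_mx x v)).
Proof.
move=> [sF uF]; apply: ucont1_continuous => e e0; have [d d0 hd] := uF _ e0.
exists d => // x y xy; apply: hd.
by rewrite rcons_mxB norm_rcons_mx subrr normr0 gt_max xy.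
Qed.

Lemma slice_support m N (F : 'rV[R]_m.+1 -> R) v (x : R) : cc N F ->
  N < `|x| -> F (rcons_mx x v) = 0.
Proof. by move=> hF /(cc_slice0 hF) /(congr1 (fun f => f v)). Qed.

(** Let [G v] be the antiderivative of the slice over [v] that vanishes on the far left. Then
    [Phi b], the integral of [G v b] over [v], has as derivative the integral of [F (rcons_mx b v)]
    over [v], by uniform continuity of [F]; the fundamental theorem identifies both iterated
    integrals with [Phi (N + 1)]. *)
Lemma integral_rV_swap m (N : R) (F : 'rV[R]_m.+1 -> R) : 0 <= N -> cc N F ->
  cc N (fun v => \int[@lebesgue_measure R]_x F (rcons_mx x v)) /\
  integral_rV F =
  integral_rV (fun v => \int[@lebesgue_measure R]_x F (rcons_mx x v)).
Proof.
move=> N0 hF.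
have cF v := slice_continuous (v := v) hF.
have sF v (x : R) : N < `|x| -> F (rcons_mx x v) = 0 := slice_support v hF.
pose ex v := antiderivative_exists (cF v) (sF v).
pose G v : R -> R := sval (cid (ex v)).
have dG v (x : R) : is_derive x (1 : R) (G v) (F (rcons_mx x v)).
  by rewrite /G; case: (cid (ex v)) => ? /= [].
have G0 v x : x <= - N -> G v x = 0.
  by rewrite /G; case: (cid (ex v)) => ? /= []; auto.
have ab : - N - 1 < N + 1 by lra.
have IG v : \int[@lebesgue_measure R]_x F (rcons_mx x v) = G v (N + 1).
  rewrite (Rintegral_antiderivative (N := N) (cF v) (sF v) _ _ ab (dG v)); [|lra|lra].
  by rewrite [X in _ - X]G0 ?subr0 //; lra.
have Gdiff v w b e : 0 <= e ->
    (forall x, `|F (rcons_mx x v) - F (rcons_mx x w)| <= e) ->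
    `|G v b - G w b| <= e * (`|b| + N).
  move=> e0 he; case: (leP b (- N)) => bN.
    by rewrite !G0 // subrr normr0 mulr_ge0 // addr_ge0.
  have dD (x : R) : is_derive x (1 : R) (fun x => G v x - G w x)
      (F (rcons_mx x v) - F (rcons_mx x w)).
    by apply: is_deriveB.
  have [|c _ E] := @MVT _ _ _ _ _ bN (fun x _ => dD x).
    apply: continuous_subspaceT => z.
    by apply/differentiable_continuous/derivable1_diffP; case: (dD z).
  move: E; rewrite (G0 v (- N)) // (G0 w (- N)) // subrr subr0 => ->.
  rewrite normrM ler_pM //; rewrite opprK ger0_norm; last by lra.
  by have := ler_norm b; lra.
have ccG b : cc N (fun v => G v b).
  split=> [v Nv|e e0].
    have /Gdiff := lexx (0 : R) => /(_ v v b).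
    have F0 x : F (rcons_mx x v) = 0.
      by apply: hF.1; rewrite norm_rcons_mx lt_max Nv orbT.
    case: (leP b (- N)) => bN _; first exact: G0.
    have [|c _ ] := @MVT _ _ _ _ _ bN (fun x _ => dG v x).
      apply: continuous_subspaceT => z.
      by apply/differentiable_continuous/derivable1_diffP; case: (dG v z).
    by rewrite F0 mul0r (G0 v (- N)) // subr0.
  have p : 0 < `|b| + N + 1 by rewrite ltr_wpDl // addr_ge0.
  have [d d0 hd] := hF.2 (e / (`|b| + N + 1)) (divr_gt0 e0 p).
  exists d => // v w vw.
  apply: (@le_lt_trans _ _ (e / (`|b| + N + 1) * (`|b| + N))).
    apply: Gdiff; first by rewrite divr_ge0 ?ltW.
    move=> x; apply/ltW/hd.
    by rewrite rcons_mxB subrr norm_rcons_mx normr0 gt_max d0.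
  by rewrite mulrAC ltr_pdivrMr // ltr_pM2l //; lra.
split; first by under eq_fun do rewrite IG; exact: ccG.
under [in RHS]eq_fun do rewrite IG.
have [sI uI] := integral_slice N0 hF.
pose Phi b := integral_rV (fun v => G v b).
rewrite (_ : integral_rV F = Phi (N + 1) - Phi (- N - 1)).
  rewrite /Phi (_ : (fun v => G v (- N - 1)) = fun _ => 0).
    by rewrite integral_rV0 subr0.
  by apply/funext => v; apply: G0; lra.
apply: (Rintegral_antiderivative (N := N)); rewrite ?lerBlDr //; [|lra|lra|].
  exact: ucont1_continuous.
move=> b; apply: is_derive_eps => e e0.
have [C C0 hC] := @integral_rV_bound R m N N0.
have C1 : 0 < C + 1 by lra.
have [d d0 hd] := hF.2 (e / (C + 1)) (divr_gt0 e0 C1).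
exists d => // h hh; rewrite /Phi.
rewrite -(integral_rVB N0 (ccG _) (ccG _)).
rewrite -(integral_rVZ _ N0 (cc_slice b hF)).
rewrite -(integral_rVB N0 (ccB (ccG _) (ccG _)) (ccZ _ (cc_slice b hF))).
apply: (@le_trans _ _ (C * (e / (C + 1) * `|h|))).
  apply: hC; first by apply: ccB; [exact: ccB | apply: ccZ; exact: cc_slice].
  move=> v; apply: (derivative_remainder (dG v)) => x xb.
  apply/ltW/hd; rewrite rcons_mxB subrr norm_rcons_mx normr0 gt_max d0 andbT.
  exact: le_lt_trans hh.
rewrite mulrA ler_wpM2r // mulrA ler_pdivrMr // mulrC ler_wpM2l ?ltW //; lra.
Qed.

Lemma cc_translate m (N : R) (f : 'rV[R]_m -> R) c : cc N f ->
  cc (N + `|c|) (fun v => f (v + c)).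
Proof.
move=> [sf uf]; split=> [x Nx|e e0].
  apply: sf; have := ler_normD (x + c) (- c); rewrite addrK normrN; lra.
have [d d0 hd] := uf _ e0; exists d => // x y h; apply: hd.
by rewrite opprD addrACA subrr addr0.
Qed.

Lemma rcons_mxD m x y (v w : 'rV[R]_m) :
  rcons_mx x v + rcons_mx y w = rcons_mx (x + y) (v + w).
Proof.
have -> : rcons_mx y w = 0 - rcons_mx (- y) (- w).
  have -> : 0 = rcons_mx 0 (0 : 'rV[R]_m).
    by apply: rV_ext => [|i]; rewrite ?rcons_mxE0 ?rcons_mxES !mxE.
  by rewrite rcons_mxB !sub0r !opprK.
by rewrite add0r; rewrite rcons_mxB !opprK.
Qed.

Lemma integral_rV_translate m (N : R) (f : 'rV[R]_m -> R) c : 0 <= N ->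
  cc N f -> integral_rV (fun v => f (v + c)) = integral_rV f.
Proof.
move=> N0; elim: m N f c N0 => [|m IH] N f c N0 hf.
  by rewrite /=; congr f; apply/rowP => -[].
rewrite (rcons_mxP c); set x0 := c 0 _; set c' := rsubmx _.
have [sI uI] := integral_slice N0 hf.
rewrite /=; under eq_Rintegral => x _.
  under eq_fun do rewrite -/(rcons_mx _ _) rcons_mxD.
  rewrite (IH N (fun v => f (rcons_mx (x + x0) v)) c' N0); last exact: cc_slice.
  over.
have := Rintegral_affine x0 (ucont1_continuous uI) sI (oner_neq0 R).
rewrite normr1 mul1r => <-; congr Rintegral; apply/funext => x.
by rewrite mul1r.
Qed.

Lemma mulmx_bound m k (M : 'M[R]_(m, k)) :
  exists2 K, 0 < K & forall v : 'rV[R]_m, `|v *m M| <= K * `|v|.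
Proof.
pose K := \sum_i \sum_j `|M i j| + 1.
have S0 : 0 <= \sum_i \sum_j `|M i j|.
  by apply: sumr_ge0 => i _; apply: sumr_ge0.
exists K => [|v]; first by rewrite /K ltr_wpDl.
apply: norm_le_coord => [|j]; first by rewrite mulr_ge0 // addr_ge0.
rewrite mxE; apply: le_trans (ler_norm_sum _ _ _) _.
rewrite /K mulrDl mul1r.
apply: (@le_trans _ _ ((\sum_i \sum_j `|M i j|) * `|v|)); last by rewrite lerDl.
rewrite mulr_suml; apply: ler_sum => i _.
rewrite normrM mulrC ler_pM // ?coord_le_norm //.
by rewrite (bigD1 j) //= lerDl sumr_ge0.
Qed.

Lemma cc_linear m (N : R) (f : 'rV[R]_m -> R) (M : 'M[R]_m) : 0 <= N ->
  M \in unitmx -> cc N f ->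
  exists2 N', 0 <= N' & cc N' (fun v => f (v *m M)).
Proof.
move=> N0 uM [sf uf].
have [K K0 hK] := mulmx_bound M; have [K' K'0 hK'] := mulmx_bound (invmx M).
exists (K' * N); first by rewrite mulr_ge0 // ltW.
split=> [v h|e e0].
  apply: sf; rewrite -(ltr_pM2l K'0); apply: lt_le_trans h _.
  by rewrite -{1}(mulmxK uM v).
have [d d0 hd] := uf _ e0; exists (d / K); first by rewrite divr_gt0.
move=> x y; rewrite ltr_pdivlMr // mulrC => h; apply: hd.
by rewrite -mulmxBl; apply: le_lt_trans (hK _) h.
Qed.

Definition integral_equivariant m (M : 'M[R]_m) := M \in unitmx /\
  forall (N : R) (f : 'rV[R]_m -> R), 0 <= N -> cc N f ->
  `|\det M| * integral_rV (fun v => f (v *m M)) = integral_rV f.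

Lemma integral_equivariantM m (M1 M2 : 'M[R]_m) :
  integral_equivariant M1 -> integral_equivariant M2 ->
  integral_equivariant (M1 *m M2).
Proof.
move=> [u1 h1] [u2 h2]; split=> [|N f N0 hf]; first by rewrite unitmx_mul u1.
have [N' N'0 hf'] := cc_linear N0 u2 hf.
rewrite -(h2 N f N0 hf) -(h1 N' _ N'0 hf') det_mulmx normrM mulrCA mulrA.
by congr (_ * _); congr integral_rV; apply/funext => v; rewrite mulmxA.
Qed.

Lemma rcons_mx_block m (x : R) (v : 'rV[R]_m) a r c S :
  rcons_mx x v *m (block_mx a r c S : 'M[R]_(1 + m)) =
  rcons_mx (x * a 0 0 + (v *m c) 0 0) (x *: r + v *m S).
Proof.
rewrite [LHS](@mul_row_block _ 1 1 m 1 m); congr row_mx.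
  by apply/rowP => i; rewrite !mxE !ord1 big_ord1 !mxE.
by congr (_ + _); apply/matrixP => i j; rewrite !mxE big_ord1 !mxE !ord1.
Qed.

Lemma unitmx_ublock m (a : 'M[R]_1) (r : 'M[R]_(1, m)) (S : 'M[R]_m) :
  ((block_mx a r 0 S : 'M[R]_(1 + m)) \in unitmx) = (a 0 0 != 0) && (S \in unitmx).
Proof.
rewrite !unitmxE det_ublock unitrM det_mx11 unitfE; congr (_ && _).
Qed.

(** This shear translates the first coordinate by an amount depending on the others; with
    [integral_rV_swap] the first coordinate is integrated innermost, where a translation is
    invisible. *)
Lemma integral_equivariant_lower m (c : 'cV[R]_m) :
  integral_equivariant (block_mx 1%:M 0 c 1%:M : 'M[R]_(1 + m)).
Proof.
have D : \det (block_mx 1%:M 0 c 1%:M : 'M[R]_(1 + m)) = 1.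
  by rewrite det_lblock !det1 mulr1.
have U : (block_mx 1%:M 0 c 1%:M : 'M[R]_(1 + m)) \in unitmx.
  by rewrite unitmxE D unitr1.
split=> // N f N0 hf; rewrite D normr1 mul1r.
have [N' N'0 hf'] := cc_linear N0 U hf.
rewrite (integral_rV_swap N'0 hf').2 (integral_rV_swap N0 hf).2.
congr integral_rV; apply/funext => v.
have := Rintegral_affine ((v *m c) 0 0) (slice_continuous (v := v) hf)
  (fun x => @slice_support _ _ _ v x hf) (oner_neq0 R).
rewrite normr1 mul1r => <-; congr Rintegral; apply/funext => x.
by rewrite rcons_mx_block mxE mulr1 scaler0 add0r mulmx1 mul1r.
Qed.

(** For a fixed first coordinate [x] the remaining ones undergo [S] and a translation by [x *: r];
    the outer integral is then rescaled by [a 0 0]. *)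
Lemma integral_equivariant_upper m (a : 'M[R]_1) (r : 'rV[R]_m) (S : 'M[R]_m) :
  a 0 0 != 0 -> integral_equivariant S ->
  integral_equivariant (block_mx a r 0 S : 'M[R]_(1 + m)).
Proof.
move=> a0 [uS hS]; split=> [|N f N0 hf]; first by rewrite unitmx_ublock a0.
rewrite det_ublock det_mx11 normrM.
have [sI uI] := integral_slice N0 hf.
have [C C0 hC] := @integral_rV_bound R m N N0.
rewrite -[RHS](Rintegral_affine 0 (ucont1_continuous uI) sI a0).
rewrite -mulrA; congr (_ * _).
have U : (block_mx a r 0 S : 'M[R]_(1 + m)) \in unitmx by rewrite unitmx_ublock a0.
have [N' N'0 hf'] := cc_linear N0 U hf.
have [sI' uI'] := integral_slice N'0 hf'.
have z : continuous (fun _ : R => 0 : R) by move=> x; exact: cvg_cst.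
have := @Rintegral_linear _ _ (fun _ : R => 0) N' `|\det S|
  (ucont1_continuous uI') z sI' (fun _ _ => erefl).
rewrite [X in _ + X](_ : _ = 0); last by rewrite /Rintegral integral0.
rewrite addr0 => <-; congr Rintegral; apply/funext => x; rewrite addr0.
have := integral_rV_translate (x *: r) N0 (cc_slice (a 0 0 * x + 0) hf).
move=> <-.
have cct := cc_translate (x *: r) (cc_slice (a 0 0 * x + 0) hf).
rewrite -(hS _ _ _ cct) ?addr_ge0 //; congr (_ * _); congr integral_rV.
by apply/funext => v; rewrite rcons_mx_block mulmx0 mxE [x * _]mulrC [v *m S + _]addrC.
Qed.

(** Block elimination, by induction on the dimension: a matrix with nonzero pivot is a lower shear
    times an upper block triangular matrix, whose lower corner is the Schur complement and is
    covered by induction. *)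
Lemma integral_rV_linear_change m (M : 'M[R]_m) : M \in unitmx ->
  integral_equivariant M.
Proof.
elim: m M => [|m IH] M uM.
  split=> // N f N0 hf; rewrite /= det_mx00 normr1 mul1r; congr f.
  by apply/rowP => -[].
have pivot (B : 'M[R]_(1 + m)) : B 0 0 != 0 -> B \in unitmx ->
    integral_equivariant B.
  move=> B0 uB; rewrite -(submxK B).
  set a := ulsubmx B; set r := ursubmx B; set c := dlsubmx B; set D := drsubmx B.
  have aE : a 0 0 = B 0 0 by rewrite !mxE; congr (B _ _); exact/val_inj.
  have E : block_mx a r c D = block_mx 1%:M 0 ((a 0 0)^-1 *: c) 1%:M *m
      block_mx a r 0 (D - (a 0 0)^-1 *: (c *m r)).
    rewrite mulmx_block !mul1mx !mul0mx !addr0.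
    have -> : (a 0 0)^-1 *: c *m a = c.
      rewrite -scalemxAl [a]mx11_scalar mul_mx_scalar scalerA mxE /=.
      by rewrite mulVf ?scale1r // aE.
    by rewrite -scalemxAl addrC subrK.
  rewrite E; apply: integral_equivariantM.
    exact: integral_equivariant_lower.
  apply: integral_equivariant_upper; first by rewrite aE.
  apply: IH; move: uB; rewrite -(submxK B) -/a -/r -/c -/D E unitmx_mul.
  by rewrite unitmx_ublock => /andP[_ /andP[]].
have [M0|M0] := eqVneq (M 0 0) 0; last exact: pivot.
have [i Mi] : exists i, M i 0 != 0.
  apply/existsP; apply: contraLR uM; rewrite negb_exists => /forallP H.
  rewrite unitmxE (expand_det_col M 0) big1 ?unitr0 // => i _.
  by have /eqP -> := negPn (H i); rewrite mul0r.
have [j ij] : exists j, i = rshift 1 j.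
  case: (@split_ordP 1 m i) => j ij; last by exists j.
  by move: Mi; rewrite ij (ord1 j) (_ : lshift m ord0 = 0) ?M0 ?eqxx //; exact/val_inj.
pose e : 'rV[R]_m := delta_mx 0 j.
(* Column 0 has a nonzero entry in some row [i] other than row 0. [T 1] adds that row to row 0 and
   so creates a nonzero pivot; [T (-1)] undoes it. *)
pose T t : 'M[R]_(1 + m) := block_mx 1%:M (t *: e) 0 1%:M.
have uT t : T t \in unitmx by rewrite unitmx_ublock mxE oner_neq0 unitmx1.
have eT t : integral_equivariant (T t).
  apply: integral_equivariant_upper; first by rewrite mxE oner_neq0.
  by apply: IH; exact: unitmx1.
have -> : M = T (-1) *m (T 1 *m M).
  rewrite mulmxA (_ : T (-1) *m T 1 = 1%:M) ?mul1mx //.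
  rewrite /T mulmx_block !mul1mx !mulmx1 !mul0mx !mulmx0 !addr0 !add0r.
  by rewrite -scalerDl subrr scale0r -scalar_mx_block.
apply: integral_equivariantM => //; apply: pivot; last by rewrite unitmx_mul uT.
have z0 : (0 : 'I_m.+1) = @lshift 1 m 0 by exact/val_inj.
have TE l : T 1 0 (@rshift 1 m l) = (l == j)%:R.
  by rewrite z0 block_mxEur !mxE eqxx mul1r.
have T0 : T 1 0 (@lshift 1 m 0) = 1 by rewrite z0 block_mxEul mxE.
rewrite mxE (@big_split_ord _ _ _ 1 m) /= big_ord1 T0 mul1r.
rewrite [M _ _](_ : _ = 0); last first.
  by rewrite -[RHS]M0; congr (M _ _); exact/val_inj.
rewrite add0r.
rewrite (bigD1 j) //= big1 ?addr0; last first.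
  by move=> l /negPf jl; rewrite TE jl mul0r.
by rewrite TE eqxx mul1r -ij.
Qed.

End IteratedIntegral.

(** * Integrals of derivatives, Fubini's theorem, nonnegative integrands with zero integral *)

Section IntegralCalculus.
Variable R : realType.

Lemma derive_line_eq (V W : normedModType R) (f : V -> W) (g : R -> W) a v (t : R) :
  (forall h, g (h + t) = f (h *: v + a)) ->
  (derivable g t (1 : R) <-> derivable f a v) /\ 'D_1 g t = 'D_v f a.
Proof.
move=> E.
have EE : (fun h : R => h^-1 *: ((g \o shift t) (h *: (1 : R)) - g t)) =
          (fun h : R => h^-1 *: ((f \o shift a) (h *: v) - f a)).
  apply/funext => h; congr (_ *: _).
  rewrite /shift /= [h *: 1]mulr1 E; congr (_ - _).
  by rewrite -[t in LHS]add0r E scale0r add0r.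
by rewrite /derivable /derive EE.
Qed.

Lemma derive_affine_eq (V V' W : normedModType R) (f : V -> W) (g : V' -> W)
    a v b w :
  (forall h : R, g (h *: w + b) = f (h *: v + a)) ->
  (derivable g b w <-> derivable f a v) /\ 'D_w g b = 'D_v f a.
Proof.
move=> E.
have EE : (fun h : R => h^-1 *: ((g \o shift b) (h *: w) - g b)) =
          (fun h : R => h^-1 *: ((f \o shift a) (h *: v) - f a)).
  apply/funext => h; congr (_ *: _).
  rewrite /shift /= E; congr (_ - _).
  by have := E 0; rewrite !scale0r !add0r.
by rewrite /derivable /derive EE.
Qed.

Lemma rcons_mx_delta0 m (h x : R) (v : 'rV[R]_m) :
  rcons_mx (h + x) v = h *: delta_mx 0 (@lshift 1 m ord0) + rcons_mx x v.
Proof.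
apply: rV_ext => [|i]; rewrite ?rcons_mxE0 ?rcons_mxES [RHS]mxE.
  by rewrite rcons_mxE0 !mxE !eqxx mulr1.
by rewrite rcons_mxES !mxE eq_rlshift andbF mulr0 add0r.
Qed.

Lemma rcons_mx_deltaS m (h x : R) (v : 'rV[R]_m) j :
  rcons_mx x (h *: delta_mx 0 j + v) =
  h *: delta_mx 0 (@rshift 1 m j) + rcons_mx x v.
Proof.
apply: rV_ext => [|i]; rewrite ?rcons_mxE0 ?rcons_mxES [RHS]mxE.
  by rewrite rcons_mxE0 !mxE eq_lrshift andbF mulr0 add0r.
by rewrite rcons_mxES !mxE; congr (_ * (_ && _)%:R + _).
Qed.

Lemma integral_partial0 m (N : R) (f : 'rV[R]_m -> R) i : 0 <= N -> cc N f ->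
  (forall x, derivable f x (delta_mx 0 i)) -> cc N (partial i f) ->
  integral_rV (partial i f) = 0.
Proof.
move=> N0; elim: m f i => [|m IH] f i hf df hdf; first by case: i df hdf.
case: (@split_ordP 1 m i) => j ij; rewrite {i}ij in df hdf *.
  rewrite (ord1 j) in df hdf *.
  rewrite (integral_rV_swap N0 hdf).2 -[RHS](integral_rV0 R m).
  congr integral_rV; apply/funext => v.
  have line (x : R) := derive_line_eq (f := f) (g := fun y => f (rcons_mx y v))
    (fun h => congr1 f (rcons_mx_delta0 h x v)).
  have dl (x : R) : is_derive x (1 : R) (fun y => f (rcons_mx y v))
     (partial (@lshift 1 m ord0) f (rcons_mx x v)).
    by split; [apply/(line x).1 | exact: (line x).2].
  rewrite (Rintegral_antiderivative (N := N) _ _ _ _ _ dl (a := - N - 1) (b := N + 1)).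
  - by rewrite !(slice_support v hf) ?subrr //;
      [rewrite ltr0_norm; lra | rewrite ger0_norm; lra].
  - exact: slice_continuous hdf.
  - by move=> x; exact: slice_support hdf.
  - lra.
  - lra.
  - lra.
rewrite /= (_ : (fun x => _) = (fun _ => 0)); first by rewrite /Rintegral integral0.
apply/funext => x.
have line v := derive_affine_eq (f := f) (g := fun w => f (rcons_mx x w))
  (fun h => congr1 f (rcons_mx_deltaS h x v j)).
have E : (fun v => partial (@rshift 1 m j) f (rcons_mx x v)) =
    partial j (fun w => f (rcons_mx x w)).
  by apply/funext => v; rewrite /partial (line v).2.
rewrite -[fun v => _]/(fun v => partial (@rshift 1 m j) f (rcons_mx x v)) E.
apply: IH.
- exact: cc_slice.
- by move=> v; apply/(line v).1.
- by rewrite -E; exact: cc_slice.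
Qed.

Definition cc2 m k (N : R) (f : 'rV[R]_m -> 'rV[R]_k -> R) : Prop :=
  (forall x y, N < `|x| \/ N < `|y| -> f x y = 0) /\
  (forall e : R, 0 < e -> exists2 d : R, 0 < d &
     forall x y x' y', `|x - x'| < d -> `|y - y'| < d ->
     `|f x y - f x' y'| < e).

Lemma cc2_l m k N (f : 'rV[R]_m -> 'rV[R]_k -> R) y : cc2 N f -> 
  cc N (fun x => f x y).
Proof.
move=> [s u]; split=> [x h|e e0]; first by apply: s; left.
have [d d0 hd] := u _ e0; exists d => // x x' h; apply: hd => //.
by rewrite subrr normr0.
Qed.

Lemma cc2_int m k N (f : 'rV[R]_m -> 'rV[R]_k -> R) : 0 <= N -> cc2 N f -> 
  cc N (fun y => integral_rV (fun x => f x y)).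
Proof.
move=> N0 hf; split=> [y h|e e0].
  rewrite -[RHS](integral_rV0 R m); congr integral_rV; apply/funext => x.
  by apply: hf.1; right.
have [C C0 hC] := @integral_rV_bound R m N N0.
have C1 : 0 < C + 1 by lra.
have [d d0 hd] := hf.2 (e / (C + 1)) (divr_gt0 e0 C1).
exists d => // y y' h.
rewrite -(integral_rVB N0 (cc2_l y hf) (cc2_l y' hf)).
apply: (@le_lt_trans _ _ (C * (e / (C + 1)))).
  apply: hC; first by apply: ccB; exact: cc2_l.
  by move=> x; apply/ltW/hd => //; rewrite subrr normr0.
by rewrite mulrA ltr_pdivrMr // mulrC ltr_pM2l //; lra.
Qed.

Lemma cc2_slice m k N (f : 'rV[R]_m.+1 -> 'rV[R]_k -> R) x0 : cc2 N f -> 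
  cc2 N (fun x y => f (rcons_mx x0 x) y).
Proof.
move=> [s u]; split=> [x y [h|h]|e e0].
- by apply: s; left; rewrite norm_rcons_mx lt_max h orbT.
- by apply: s; right.
have [d d0 hd] := u _ e0; exists d => // x y x' y' h1 h2; apply: hd => //.
by rewrite rcons_mxB subrr norm_rcons_mx normr0 gt_max d0.
Qed.

(** The first coordinate of [x] is moved to the front of [y] to form the vector [w]. Through this
    intermediate function the induction in Fubini's theorem passes one coordinate at a time by
    [integral_rV_swap]. *)
Lemma cc2_param m k N (f : 'rV[R]_m.+1 -> 'rV[R]_k -> R) : 0 <= N -> cc2 N f -> 
  cc N (fun w : 'rV[R]_k.+1 =>
     integral_rV (fun x => f (rcons_mx (w 0 (@lshift 1 k ord0)) x)
                             (@rsubmx R 1 1 k w))).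
Proof.
move=> N0 hf; apply: cc2_int => //; case: hf => s u.
have nl (w : 'rV[R]_k.+1) : `|w| =
    Num.max `|w 0 (@lshift 1 k ord0)| `|@rsubmx R 1 1 k w|.
  by rewrite {1}(rcons_mxP w) norm_rcons_mx.
split=> [x w [h|]|e e0].
- by apply: s; left; rewrite norm_rcons_mx lt_max h orbT.
- rewrite nl lt_max => /orP[h|h]; apply: s; last by right.
  by left; rewrite norm_rcons_mx lt_max h.
have [d d0 hd] := u _ e0; exists d => // x w x' w' h1.
rewrite nl gt_max => /andP[h2 h3]; apply: hd.
  rewrite rcons_mxB norm_rcons_mx gt_max h1 andbT.
  by move: h2; rewrite !mxE.
by move: h3; rewrite linearB.
Qed.

Lemma integral_rV_fubini m k (N : R) (f : 'rV[R]_m -> 'rV[R]_k -> R) :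
  0 <= N -> cc2 N f ->
  integral_rV (fun x => integral_rV (fun y => f x y)) =
  integral_rV (fun y => integral_rV (fun x => f x y)).
Proof.
move=> N0; elim: m f => [|m IH] f hf //.
pose g (w : 'rV[R]_k.+1) := integral_rV (fun x => f (rcons_mx (w 0 (@lshift 1 k ord0)) x)
                             (@rsubmx R 1 1 k w)).
have hg : cc N g by exact: cc2_param.
have gE x0 y : g (rcons_mx x0 y) = integral_rV (fun x => f (rcons_mx x0 x) y).
  rewrite /g rcons_mxE0; congr integral_rV; apply/funext => x; congr f.
  by apply/rowP => i; rewrite mxE rcons_mxES.
transitivity (integral_rV g).
  rewrite /=; congr Rintegral; apply/funext => x0.
  rewrite (IH (fun x y => f (rcons_mx x0 x) y)); last exact: cc2_slice.
  by congr integral_rV; apply/funext => y; rewrite -gE.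
rewrite (integral_rV_swap N0 hg).2; congr integral_rV; apply/funext => y.
by rewrite /=; congr Rintegral; apply/funext => x0; rewrite gE.
Qed.

(** An antiderivative is monotone and has equal values at both ends, hence is constant near every
    point between them, and its derivative vanishes there. *)
Lemma Rintegral_eq0 (g : R -> R) (N : R) : continuous g -> 0 <= N ->
  (forall x : R, N < `|x| -> g x = 0) -> (forall x, 0 <= g x) ->
  \int[@lebesgue_measure R]_x g x = 0 -> forall x, g x = 0.
Proof.
move=> cg N0 sg g0 I0 x.
have [F [dF _]] := antiderivative_exists cg sg.
have cF (a b : R) : {within `[a, b], continuous F}.
  apply: continuous_subspaceT => z.
  by apply/differentiable_continuous/derivable1_diffP; case: (dF z).
have mono (a b : R) : a <= b -> F a <= F b.
  rewrite le_eqVlt => /predU1P[->//|ab].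
  have [c _ E] := @MVT _ F g _ _ ab (fun x _ => dF x) (cF _ _).
  by rewrite -subr_ge0 E mulr_ge0 // subr_ge0 ltW.
pose b := N + `|x| + 1; pose a := - b.
have nx := normr_ge0 x.
have xa : a < x by rewrite /a /b; have := ler_norm (- x); rewrite normrN; lra.
have xb : x < b by rewrite /b; have := ler_norm x; lra.
have E : F b = F a.
  apply/eqP; rewrite -subr_eq0 -I0; apply/eqP.
  by rewrite -(Rintegral_antiderivative (N := N) cg sg _ _ _ dF) // /a /b; lra.
have [_ <-] := dF x.
have -> : 'D_1 F x = 'D_1 (cst (F a)) x; last by rewrite derive_cst.
apply: near_eq_derive.
have h1 : \forall y \near x, a < y by apply: lt_nbhsr.
have h2 : \forall y \near x, y < b by apply: lt_nbhsl.
apply: filterS2 h1 h2 => y ya yb.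
apply/eqP; rewrite /cst eq_le; apply/andP.
by split; first rewrite -E; apply: mono; exact: ltW.
Qed.

Lemma integral_rV_eq0 m (N : R) (f : 'rV[R]_m -> R) : 0 <= N -> cc N f ->
  (forall x, 0 <= f x) -> integral_rV f = 0 -> forall x, f x = 0.
Proof.
move=> N0; elim: m f => [|m IH] f hf f0.
  by rewrite /= => h x; rewrite -[RHS]h; congr f; apply/rowP => -[].
move=> I0 u; rewrite (rcons_mxP u); set x := u 0 _; set v := rsubmx _.
have [sI uI] := integral_slice N0 hf.
apply: (IH (fun v => f (rcons_mx x v))) => //; first exact: cc_slice.
apply: (Rintegral_eq0 (ucont1_continuous uI) N0 sI _ I0) => y.
by apply: (integral_rV_ge0 N0) => //; exact: cc_slice.
Qed.

End IntegralCalculus.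

(** * Change of variables *)

Section ChangeOfVariables.
Variable R : realType.

(** A Lebesgue number principle: a property that persists at smaller scales and holds locally at
    some scale holds on a compact set at a single scale. Uniform moduli of continuity come from it
    directly; for uniform bounds the scale is the inverse of the bound. *)
Lemma compact_uniform m (K : set 'rV[R]_m) (Q : R -> 'rV[R]_m -> Prop) :
  compact K ->
  (forall t t' y, 0 < t -> t <= t' -> Q t' y -> Q t y) ->
  (forall y0, K y0 -> exists2 r : R, 0 < r & forall y, `|y - y0| < r -> Q r y) ->
  exists2 t : R, 0 < t & forall y, K y -> Q t y.
Proof.
move=> /compact_near_coveringP cK mono loc.
have H : \forall t \near (0 : R)^'+, K `<=` Q t.
  apply: cK => y0 /loc [r r0 hr].
  exists (ball y0 r, [set t | 0 < t <= r]).
    split; first exact: nbhsx_ballx.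
    near=> t; apply/andP; split; first by near: t; exact: nbhs_right_gt.
    by near: t; exact: nbhs_right_le.
  move=> [y t] /= []; rewrite -ball_normE /= distrC => yr /andP[t0 tr].
  exact: mono t0 tr (hr _ yr).
have [t /= [t0 ht]] : exists t, 0 < t /\ K `<=` Q t.
  apply: (@filter_ex _ ((0 : R)^'+)).
  near=> t; split; last by near: t.
  by near: t; exact: nbhs_right_gt.
by exists t.
Unshelve. all: by end_near. Qed.

Lemma continuousE m k (f : 'rV[R]_m -> 'rV[R]_k) x : {for x, continuous f} <->
  forall e : R, 0 < e -> exists2 d : R, 0 < d &
    forall y, `|y - x| < d -> `|f y - f x| < e.
Proof.
split=> [/cvgrPdist_lt H e e0|H].
  have /nbhs_ballP[d d0 hd] := H e e0; exists d => // y yx.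
  by rewrite distrC; apply: hd; rewrite -ball_normE /= distrC.
move=> A /nbhs_ballP[e e0 he]; have [d d0 hd] := H e e0.
apply/nbhs_ballP; exists d => // y; rewrite -ball_normE /= distrC => /hd h.
by apply: he; rewrite -ball_normE /= distrC.
Qed.

Lemma continuousER m (f : 'rV[R]_m -> R) x : {for x, continuous f} <->
  forall e : R, 0 < e -> exists2 d : R, 0 < d &
    forall y, `|y - x| < d -> `|f y - f x| < e.
Proof.
split=> [/cvgrPdist_lt H e e0|H].
  have /nbhs_ballP[d d0 hd] := H e e0; exists d => // y yx.
  by rewrite distrC; apply: hd; rewrite -ball_normE /= distrC.
move=> A /nbhs_ballP[e e0 he]; have [d d0 hd] := H e e0.
apply/nbhs_ballP; exists d => // y; rewrite -ball_normE /= distrC => /hd h.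
by apply: he; rewrite -ball_normE /= distrC.
Qed.

Lemma openE m (U : set 'rV[R]_m) x : open U -> U x -> exists2 d : R, 0 < d &
  forall y, `|y - x| < d -> U y.
Proof.
move=> oU Ux; have /nbhs_ballP[d d0 hd] := open_nbhs_nbhs (conj oU Ux).
by exists d => // y yx; apply: hd; rewrite -ball_normE /= distrC.
Qed.

Lemma compact_norm_bound m (K : set 'rV[R]_m) : compact K ->
  exists2 N : R, 0 <= N & forall x, K x -> `|x| <= N.
Proof.
move=> /compact_bounded [M [_ hM]]; exists (`|M| + 1); first by rewrite addr_ge0.
by move=> x Kx; apply: (hM (`|M| + 1)) => //; have := ler_norm M; lra.
Qed.

Lemma compact_unif_continuous m k (K : set 'rV[R]_m) (f : 'rV[R]_m -> 'rV[R]_k) :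
  compact K -> (forall x, K x -> {for x, continuous f}) ->
  forall e : R, 0 < e -> exists2 d : R, 0 < d &
    forall x y, K x -> `|y - x| < d -> `|f y - f x| < e.
Proof.
move=> cK cf e e0.
have [||t t0 ht] := @compact_uniform _ K
  (fun t x => forall y, `|y - x| < t -> `|f y - f x| < e) cK; last first.
- by exists t => // x y Kx; exact: ht.
2: by move=> t t' x _ tt' H y /lt_le_trans/(_ tt'); exact: H.
- move=> x0 /cf /continuousE /(_ (e / 2)) []; first by rewrite divr_gt0.
  move=> d d0 hd; exists (d / 2); first by rewrite divr_gt0.
  move=> x xd y yd; rewrite -(subrKA (f x0)) (splitr e).
  apply: le_lt_trans (ler_normD _ _) _; apply: ltrD; last first.
    by rewrite distrC; apply: hd; lra.
  apply: hd; rewrite -(subrKA x) (splitr d).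
  by apply: le_lt_trans (ler_normD _ _) _; exact: ltrD.
Qed.

Lemma cc_compact m (U K : set 'rV[R]_m) (f : 'rV[R]_m -> R) : open U ->
  compact K -> K `<=` U -> (forall x, U x -> {for x, continuous f}) ->
  (forall x, ~ K x -> f x = 0) -> exists2 N : R, 0 <= N & cc N f.
Proof.
move=> oU cK KU cf f0; have [N N0 hN] := compact_norm_bound cK.
exists N => //; split=> [x Nx|e e0].
  by apply: f0 => /hN; rewrite leNgt Nx.
have [||t t0 ht] := @compact_uniform _ K
  (fun t x => forall y, `|y - x| < t -> `|f y - f x| < e) cK; last first.
- exists t => // x y xy; have [Kx|nKx] := pselect (K x).
    by rewrite distrC; apply: ht => //; rewrite distrC.
  have [Ky|nKy] := pselect (K y); first exact: ht.
  by rewrite !f0 // subrr normr0.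
2: by move=> t t' x _ tt' H y /lt_le_trans/(_ tt'); exact: H.
- move=> x0 /KU/cf /continuousER /(_ (e / 2)) []; first by rewrite divr_gt0.
  move=> d d0 hd; exists (d / 2); first by rewrite divr_gt0.
  move=> x xd y yd; rewrite -(subrKA (f x0)) (splitr e).
  apply: le_lt_trans (ler_normD _ _) _; apply: ltrD; last first.
    by rewrite distrC; apply: hd; lra.
  apply: hd; rewrite -(subrKA x) (splitr d).
  by apply: le_lt_trans (ler_normD _ _) _; exact: ltrD.
Qed.

Lemma closed_norm_ball_compact m (N : R) :
  compact [set x : 'rV[R]_m | `|x| <= N].
Proof.
apply: bounded_closed_compact.
  exists N; split; first exact: num_real.
  by move=> M NM x /= /le_trans; apply; exact: ltW.
apply: (@closed_comp _ _ (fun x : 'rV[R]_m => `|x|) [set r | r <= N]).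
  by move=> x _; exact: norm_continuous.
exact: closed_le.
Qed.

Lemma cc_bounded m (N : R) (f : 'rV[R]_m -> R) : cc N f ->
  exists2 B : R, 0 < B & forall x, `|f x| <= B.
Proof.
move=> [sf uf].
have [||t t0 ht] := @compact_uniform _ _ (fun t y => `|f y| <= t^-1)
    (@closed_norm_ball_compact m N); last first.
- exists t^-1 => [|x]; first by rewrite invr_gt0.
  case: (leP `|x| N) => [|/sf ->]; first exact: ht.
  by rewrite normr0 invr_ge0 ltW.
- move=> y0 _; have [d d0 hd] := uf 1 ltr01.
  have p : 0 < `|f y0| + 1 by rewrite ltr_wpDl.
  exists (Num.min d (`|f y0| + 1)^-1); first by rewrite lt_min d0 invr_gt0.
  move=> y; rewrite lt_min => /andP[/hd h _].
  apply: (@le_trans _ _ (`|f y0| + 1)).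
    by have := ler_distD 0 (f y) (f y0); have := lerB_dist (f y) (f y0); lra.
  rewrite -[leLHS]invrK lef_pV2 ?posrE ?invr_gt0 //.
  + by rewrite ge_min lexx orbT.
  + by rewrite lt_min d0 invr_gt0.
- move=> t t' y t0 tt' /le_trans; apply.
  by rewrite lef_pV2 ?posrE // (lt_le_trans t0).
Qed.

(** The normalised tent function: the mollifier only has to be continuous, as it is never
    differentiated. *)
Lemma bump_exists m : exists phi : 'rV[R]_m -> R,
  [/\ cc 1 phi, forall x, 0 <= phi x & integral_rV phi = 1].
Proof.
pose b (x : 'rV[R]_m) : R := Num.max 0 (1 - `|x|).
have ccb : cc 1 b.
  split=> [x x1|e e0]; first by rewrite /b max_l // subr_le0 ltW.
  exists e => // x y xy; apply: le_lt_trans xy.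
  have := ler_dist_dist x y => h.
  rewrite /b; case: (leP 0 (1 - `|x|)) => hx; case: (leP 0 (1 - `|y|)) => hy.
  - rewrite (_ : _ - _ = `|y| - `|x|); last by ring.
    by rewrite distrC.
  - rewrite subr0 ger0_norm //; move: h; rewrite ler_norml; lra.
  - rewrite sub0r normrN ger0_norm //; move: h; rewrite ler_norml; lra.
  - by rewrite subrr normr0.
have b0 x : 0 <= b x by rewrite /b le_max lexx.
have I0 := integral_rV_ge0 ler01 ccb b0.
have I1 : integral_rV b != 0.
  apply/eqP => /(integral_rV_eq0 ler01 ccb b0) /(_ 0).
  by rewrite /b normr0 subr0 max_r ?ler01 // => /eqP; rewrite oner_eq0.
exists (fun x => (integral_rV b)^-1 * b x); split.
- exact: ccZ.
- by move=> x; rewrite mulr_ge0 // invr_ge0.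
- by rewrite (integral_rVZ _ ler01 ccb) mulVf.
Qed.

Lemma integral_rV_scale m (N : R) (F : 'rV[R]_m -> R) (e : R) x1 : 0 <= N ->
  cc N F -> 0 < e ->
  integral_rV F = e ^+ m * integral_rV (fun w => F (x1 + e *: w)).
Proof.
move=> N0 hF e0.
have U : (e%:M : 'M[R]_m) \in unitmx.
  by rewrite unitmxE det_scalar unitrX // unitfE gt_eqF.
have [_ h] := integral_rV_linear_change U.
have := h _ _ (addr_ge0 N0 (normr_ge0 x1)) (cc_translate x1 hF).
rewrite (integral_rV_translate x1 N0 hF) => <-.
rewrite det_scalar ger0_norm ?exprn_ge0 ?ltW //; congr (_ * _).
congr integral_rV; apply/funext => w.
by rewrite mul_mx_scalar addrC.
Qed.

(** From [b <= e + eta * a] and [a <= k * b] with [eta] small, the error [k * eta * a <= a / 2] is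
    absorbed on the left. The hypotheses are multiplied out so that, with products as atoms, the
    claim is linear. *)
Lemma inverse_bound_aux (a b k e eta : R) : k * b <= k * (e + eta * a) ->
  a <= k * b -> eta * (2 * k) * a <= a -> a <= 2 * k * e.
Proof. lra. Qed.

Variables (m : nat) (U V K : set 'rV[R]_m) (psi chi : 'rV[R]_m -> 'rV[R]_m).
Variables (J : 'rV[R]_m -> 'M[R]_m) (f g : 'rV[R]_m -> R) (N : R).
Hypotheses (N0 : 0 <= N) (hf : cc N f) (hg : cc N g).
Hypotheses (oU : open U) (oV : open V) (cK : compact K) (KV : K `<=` V).
Hypothesis psiV : forall x, U x -> V (psi x) /\ chi (psi x) = x.
Hypothesis chiU : forall y, V y -> U (chi y) /\ psi (chi y) = y.
Hypothesis cpsi : forall x, U x -> {for x, continuous psi}.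
Hypothesis cchi : forall y, V y -> {for y, continuous chi}.
Hypothesis uJ : forall x, U x -> J x \in unitmx.
(** Strict differentiability: both [x] and [x'] vary near [x0]. The mollified integral is centred at
    points [x1] other than [x0], and the one linear map [J x0] has to serve them all. *)
Hypothesis dpsi : forall x0, U x0 -> forall e : R, 0 < e ->
  exists2 d : R, 0 < d & forall x x', `|x - x0| < d -> `|x' - x0| < d ->
    `|psi x' - psi x - (x' - x) *m J x0| <= e * `|x' - x|.
Hypothesis f0 : forall y, ~ K y -> f y = 0.
Hypothesis g0 : forall x, ~ U x -> g x = 0.
Hypothesis gE : forall x, U x -> g x = f (psi x) * `|\det (J x)|.

Section Mollifier.
Variable phi : 'rV[R]_m -> R.
Hypothesis hphi : cc 1 phi.
Hypothesis Iphi : integral_rV phi = 1.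

Let ker e x y := g x * phi (e^-1 *: (psi x - y)).
Let D e y := integral_rV (fun x => ker e x y).

Lemma g_support x : g x != 0 -> U x /\ K (psi x).
Proof.
move=> gx; have Ux : U x by apply: contrapT => /g0 /eqP; rewrite (negPf gx).
split=> //; apply: contrapT => /f0 h; move: gx.
by rewrite gE // h mul0r eqxx.
Qed.

Lemma phi_scaled e z : 0 < e -> e < `|z| -> phi (e^-1 *: z) = 0.
Proof.
move=> e0 ez; apply: hphi.1; rewrite normrZ gtr0_norm ?invr_gt0 //.
by rewrite mulrC ltr_pdivlMr // mul1r.
Qed.

Lemma phi_scaled_ucont e : 0 < e -> forall eta : R, 0 < eta ->
  exists2 d : R, 0 < d & forall z z' : 'rV[R]_m, `|z - z'| < d ->
    `|phi (e^-1 *: z) - phi (e^-1 *: z')| < eta.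
Proof.
move=> e0 eta eta0; have [d d0 hd] := hphi.2 _ eta0.
exists (e * d) => [|z z' h]; first by rewrite mulr_gt0.
apply: hd; rewrite -scalerBr normrZ gtr0_norm ?invr_gt0 //.
by rewrite mulrC ltr_pdivrMr // mulrC.
Qed.

Lemma ker_cc2 : exists2 N' : R, 0 <= N' &
  forall e, 0 < e -> e < 1 -> cc2 N' (ker e) /\ cc N' f.
Proof.
have [M M0 hM] := compact_norm_bound cK.
exists (N + M + 1) => [|e e0 e1]; first by rewrite !addr_ge0.
split; last by apply: ccW hf; lra.
split=> [x y H|eta eta0].
  rewrite /ker; have [->|gx] := eqVneq (g x) 0; first by rewrite mul0r.
  have [_ /hM px] := g_support gx.
  case: H => H.
    by move: gx; rewrite hg.1 ?eqxx //; lra.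
  rewrite phi_scaled ?mulr0 //.
  have h2 : `|y| <= `|psi x - y| + `|psi x|.
    by rewrite distrC; apply: le_trans (ler_normD _ _); rewrite subrK.
  rewrite ltNge; apply/negP => h; move: H; rewrite ltNge => /negP; apply.
  apply: (le_trans h2); apply: le_trans (lerD h px) _.
  by rewrite -addrA [M + 1]addrC addrA lerD2r; exact: ler_wpDl N0 (ltW e1).
have [B B0 hB] := cc_bounded hphi.
have [G G0 hG] := cc_bounded hg.
have p1 : 0 < eta / 2 / B by rewrite !divr_gt0.
have p2 : 0 < eta / 2 / G by rewrite !divr_gt0.
have [d1 d10 hd1] := hg.2 _ p1.
have [d2 d20 hd2] := phi_scaled_ucont e0 p2.
have cC : compact (chi @` K).
  apply: continuous_compact => //; apply: continuous_in_subspaceT => y.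
  by rewrite inE => /KV /cchi.
have cpsiC x : (chi @` K) x -> {for x, continuous psi}.
  by move=> [y /KV/chiU [h _] <-]; exact: cpsi.
have d22 : 0 < d2 / 2 by rewrite divr_gt0.
have [d3 d30 hd3] := compact_unif_continuous cC cpsiC d22.
have claim x x' y y' : g x' != 0 -> `|x - x'| < Num.min d1 (Num.min d3 (d2 / 2)) ->
    `|y - y'| < Num.min d1 (Num.min d3 (d2 / 2)) -> `|ker e x y - ker e x' y'| < eta.
  move=> gx'; rewrite !lt_min => /and3P[h1 h2 _] /and3P[_ _ h3].
  have [Ux' Kx'] := g_support gx'.
  have Cx' : (chi @` K) x' by exists (psi x') => //; exact: (psiV Ux').2.
  rewrite /ker -(subrKA (g x' * phi (e^-1 *: (psi x - y)))) -mulrBl -mulrBr.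
  rewrite (splitr eta); apply: le_lt_trans (ler_normD _ _) _; rewrite !normrM.
  apply: ltr_leD.
    apply: (@le_lt_trans _ _ (`|g x - g x'| * B)); first by rewrite ler_wpM2l.
    by rewrite -ltr_pdivlMr //; exact: hd1.
  apply: (@le_trans _ _ (G * (eta / 2 / G))); last first.
    by rewrite mulrC divfK // gt_eqF.
  apply: ler_pM => //; apply/ltW/hd2.
  rewrite opprD opprK addrACA [- y + y']addrC -opprB.
  apply: le_lt_trans (ler_normD _ _) _; rewrite normrN (splitr d2).
  by apply: ltrD; rewrite distrC //; exact: hd3.
exists (Num.min d1 (Num.min d3 (d2 / 2))).
  by rewrite !lt_min d10 d30 divr_gt0.
move=> x y x' y' h1 h2.
have [gx'|gx'] := eqVneq (g x') 0; last exact: claim.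
have [gx|gx] := eqVneq (g x) 0; first by rewrite /ker gx gx' !mul0r subrr normr0.
by rewrite distrC; apply: claim => //; rewrite distrC.
Qed.

(** After the substitution [x = x1 + e *: w] the integrand is close to [g x0 * phi (w *m J x0)],
    uniformly in [w]. The integral of the latter is [f (psi x0)] by the linear change of variables,
    since [g x0] carries the factor [|det (J x0)|]. *)
Lemma mollify_local x0 (del : R) : U x0 -> 0 < del ->
  exists2 rho : R, 0 < rho & forall e x1, 0 < e -> e < rho -> `|x1 - x0| < rho ->
    `|D e (psi x1) / e ^+ m - f (psi x0)| <= del.
Proof.
move=> Ux0 del0.
have [N' N'0 hker] := ker_cc2.
have [c c0 hc] := cc_bounded hphi.
set L := J x0; have uL : L \in unitmx := uJ Ux0.
have [K' K'0 hK'] := mulmx_bound (invmx L).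
have hL (v : 'rV[R]_m) : `|v| <= K' * `|v *m L| by have := hK' (v *m L); rewrite mulmxK.
(* If [psi x] is within [e] of [psi x1], then [x] is within [2 * K' * e] of [x1], the factor 2
   absorbing the error of linearisation. So [W] bounds the rescaled support for all small [e]. *)
pose W := 2 * K'; have W0 : 0 < W by rewrite mulr_gt0.
have [C C0 hC] := @integral_rV_bound R m W (ltW W0).
pose del1 := del / (C + 1).
have C1 : 0 < C + 1 by lra.
have del10 : 0 < del1 by rewrite divr_gt0.
have p1 : 0 < del1 / 2 / c by rewrite !divr_gt0.
have [d1 d10 hd1] := hg.2 _ p1.
have ng : 0 < `|g x0| + 1 by rewrite ltr_wpDl.
have p2 : 0 < del1 / 2 / (`|g x0| + 1) by rewrite !divr_gt0.
have [d2 d20 hd2] := hphi.2 _ p2.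
pose eta := Num.min (2 * K')^-1 (d2 / (2 * W)).
have eta0 : 0 < eta by rewrite lt_min invr_gt0 !mulr_gt0 // invr_gt0 mulr_gt0.
have eta1 : eta * (2 * K') <= 1.
  by rewrite -ler_pdivlMr ?mulr_gt0 // mul1r ge_min lexx.
have eta2 : eta * W < d2.
  apply: (@le_lt_trans _ _ (d2 / 2)); last by lra.
  have : eta <= d2 / (2 * W) by rewrite ge_min lexx orbT.
  rewrite ler_pdivlMr ?mulr_gt0 // => h.
  by rewrite ler_pdivlMr // -mulrA [W * 2]mulrC.
have [dS dS0 hdS] := dpsi Ux0 eta0.
have [Vy0 chiy0] := psiV Ux0.
have /continuousE /(_ dS dS0) [d3 d30 hd3] := cchi Vy0.
have d32 : 0 < d3 / 2 by rewrite divr_gt0.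
have /continuousE /(_ (d3 / 2) d32) [d4 d40 hd4] := cpsi Ux0.
have [d5 d50 hd5] := openE oU Ux0.
have W1 : 0 < 1 + W by lra.
pose q := Num.min d1 (Num.min dS d5).
have q0 : 0 < q by rewrite !lt_min d10 dS0 d50.
pose rho := Num.min (q / (1 + W)) (Num.min (Num.min d4 (d3 / 2)) 1).
exists rho; first by rewrite !lt_min divr_gt0 // d40 d32 ltr01.
move=> e x1 e0; rewrite !lt_min.
move=> /andP[e1 /andP[/andP[_ e3] e4]] /andP[r1 /andP[/andP[r2 r3] _]].
have r1' : `|x1 - x0| * (1 + W) < q by rewrite -ltr_pdivlMr.
have e1' : e * (1 + W) < q by rewrite -ltr_pdivlMr.
have x1q : `|x1 - x0| < q.
  by apply: le_lt_trans r1'; rewrite mulrDr mulr1 lerDl mulr_ge0 // ltW.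
have [hker1 _] := hker e e0 e4.
have ccx := cc2_l (psi x1) hker1.
have -> : D e (psi x1) = e ^+ m *
    integral_rV (fun w => ker e (x1 + e *: w) (psi x1)).
  exact: integral_rV_scale N'0 ccx e0.
rewrite mulrAC divff; last by rewrite expf_neq0 // gt_eqF.
rewrite mul1r; set A := (X in integral_rV X).
have fE : f (psi x0) = integral_rV (fun w => g x0 * phi (w *m L)).
  have [N1 N10 hl] := cc_linear ler01 uL hphi.
  rewrite (integral_rVZ _ N10 hl) gE // -mulrA.
  by rewrite ((integral_rV_linear_change uL).2 _ _ ler01 hphi) Iphi mulr1.
have ccA : cc W A.
  split=> [w Ww|]; last first.
    have U1 : (e%:M : 'M[R]_m) \in unitmx.
      by rewrite unitmxE det_scalar unitrX // unitfE gt_eqF.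
    have N2 : 0 <= N' + `|x1| by rewrite addr_ge0.
    have [N3 _ []] := cc_linear N2 U1 (cc_translate x1 ccx).
    move=> _ uA eta' eta'0; have [d d0 hd] := uA _ eta'0.
    exists d => // w w' /hd; rewrite !mul_mx_scalar /A.
    by rewrite ![x1 + _]addrC.
  rewrite /A /ker; set x := x1 + e *: w.
  have [->|gx] := eqVneq (g x) 0; first by rewrite mul0r.
  have [Ux Kx] := g_support gx.
  case: (ltP e `|psi x - psi x1|) => [h|h]; first by rewrite phi_scaled ?mulr0.
  (* A point [x] of [U] far from [x1] might still have [psi x] near [psi x1]; continuity of [chi] at
     [psi x0] rules this out and brings [x] into the range where [dpsi] applies. *)
  exfalso.
  have px1 : `|psi x1 - psi x0| < d3 / 2 by apply: hd4.
  have px : `|psi x - psi x0| < d3.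
    rewrite -(subrKA (psi x1)) (splitr d3).
    apply: le_lt_trans (ler_normD _ _) _; apply: ltrD => //.
    by apply: le_lt_trans h _.
  have xS : `|x - x0| < dS.
    by have := hd3 _ px; rewrite chiy0 (psiV Ux).2.
  have x1S : `|x1 - x0| < dS by move: x1q; rewrite !lt_min => /and3P[].
  have hS := hdS _ _ x1S xS.
  have E : x - x1 = e *: w by rewrite /x addrC addKr.
  have h1 : `|(x - x1) *m L| <= e + eta * `|x - x1|.
    have h2 : `|(x - x1) *m L| <=
        `|psi x - psi x1 - (x - x1) *m L| + `|psi x - psi x1|.
      by rewrite distrC; apply: le_trans (ler_normD _ _); rewrite subrK.
    lra.
  have h2 : K' * `|(x - x1) *m L| <= K' * (e + eta * `|x - x1|).
    by rewrite ler_wpM2l // ltW.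
  have h3 := hL (x - x1).
  have h4 : eta * (2 * K') * `|x - x1| <= `|x - x1|.
    by rewrite -[leRHS]mul1r ler_wpM2r.
  have h5 := inverse_bound_aux h2 h3 h4.
  move: h5; rewrite E normrZ (gtr0_norm e0) mulrC ler_pM2r //.
  by rewrite -/W leNgt Ww.
have ccP : cc W (fun w => g x0 * phi (w *m L)).
  have [N1 N10 [_ ul]] := cc_linear ler01 uL hphi.
  apply: ccZ; split=> // w Ww; apply: hphi.1.
  have h := hL w; rewrite -(ltr_pM2l K'0) mulr1; apply: lt_le_trans h.
  by apply: le_lt_trans Ww; rewrite /W; lra.
rewrite fE -(integral_rVB (ltW W0) ccA ccP).
apply: (@le_trans _ _ (C * del1)); last first.
  by rewrite /del1 mulrA ler_pdivrMr // mulrC ler_wpM2l ?ltW //; lra.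
apply: hC; first exact: ccB.
move=> w; case: (leP `|w| W) => Ww; last first.
  by rewrite ccA.1 // ccP.1 // subrr normr0 ltW.
rewrite /A /ker; set x := x1 + e *: w.
have E : x - x1 = e *: w by rewrite /x addrC addKr.
have nE : `|x - x1| = e * `|w| by rewrite E normrZ gtr0_norm.
have ewW : e * `|w| <= e * W by rewrite ler_wpM2l // ltW.
have xq : `|x - x0| < q.
  rewrite -(subrKA x1); apply: le_lt_trans (ler_normD _ _) _; rewrite nE.
  have [m1|m1] := leP `|x1 - x0| e; first by lra.
  have h : e * W <= `|x1 - x0| * W by rewrite ler_wpM2r // ltW.
  by lra.
move: (xq) x1q; rewrite !lt_min => /and3P[q1 qS q5] /and3P[t1 tS t5].
have Ux : U x by apply: hd5.
rewrite -(subrKA (g x0 * phi (e^-1 *: (psi x - psi x1)))) -mulrBl -mulrBr.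
apply: le_trans (ler_normD _ _) _; rewrite !normrM (splitr del1).
apply: lerD.
  apply: (@le_trans _ _ (`|g x - g x0| * c)); first by rewrite ler_wpM2l.
  by rewrite -ler_pdivlMr //; apply/ltW/hd1.
apply: (@le_trans _ _ ((`|g x0| + 1) * (del1 / 2 / (`|g x0| + 1)))); last first.
  by rewrite mulrC divfK // gt_eqF.
apply: ler_pM => //; first by lra.
apply/ltW/hd2.
have -> : e^-1 *: (psi x - psi x1) - w *m L =
    e^-1 *: (psi x - psi x1 - (x - x1) *m L).
  by rewrite [RHS]scalerBr E -scalemxAl scalerA mulVf ?gt_eqF // scale1r.
rewrite normrZ gtr0_norm ?invr_gt0 // mulrC ltr_pdivrMr //.
apply: le_lt_trans (hdS _ _ tS qS) _; rewrite nE mulrCA mulrC ltr_pM2r //.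
by apply: le_lt_trans eta2; rewrite ler_wpM2l // ltW.
Qed.

Lemma mollify_uniform (del : R) : 0 < del ->
  exists2 rho : R, 0 < rho & forall e y, 0 < e -> e < rho ->
    `|D e y / e ^+ m - f y| <= del.
Proof.
move=> del0.
have [||t t0 ht] := @compact_uniform _ K (fun t k => forall e y, 0 < e -> e < t ->
    `|y - k| < t -> `|D e y / e ^+ m - f y| <= del) cK; last first.
- exists t => // e y e0 et.
  have [[k Kk yk]|nk] := pselect (exists2 k, K k & `|y - k| < t).
    exact: ht yk.
  have -> : f y = 0.
    by apply: f0 => Ky; apply: nk; exists y => //; rewrite subrr normr0.
  rewrite /D (_ : (fun x => ker e x y) = (fun _ => 0)).
    by rewrite integral_rV0 mul0r subrr normr0 ltW.
  apply/funext => x; rewrite /ker.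
  have [->|gx] := eqVneq (g x) 0; first by rewrite mul0r.
  have [_ Kx] := g_support gx.
  rewrite phi_scaled ?mulr0 //; apply: (lt_le_trans et); rewrite leNgt.
  by apply/negP => h; apply: nk; exists (psi x); rewrite // distrC.
- move=> y0 Ky0; have [Ux0 px0] := chiU (KV Ky0).
  have del2 : 0 < del / 2 by rewrite divr_gt0.
  have [rho rho0 hrho] := mollify_local Ux0 del2.
  have /continuousE /(_ rho rho0) [d1 d10 hd1] := cchi (KV Ky0).
  have [d2 d20 hd2] := openE oV (KV Ky0).
  have [d3 d30 hd3] := hf.2 _ del2.
  pose r := Num.min rho (Num.min (d1 / 2) (Num.min (d2 / 2) (d3 / 2))).
  exists r; first by rewrite !lt_min rho0 !divr_gt0.
  move=> k; rewrite !lt_min => /and4P[_ k1 k2 k3] e y e0.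
  rewrite !lt_min => /and4P[erho _ _ _] /and4P[_ y1 y2 y3].
  have tri := ler_distD k y y0.
  have Vy : V y by apply: hd2; lra.
  have [Ux px] := chiU Vy.
  have h1 := hrho e (chi y) e0 erho (hd1 y ltac:(lra)).
  have h2 := hd3 y y0 ltac:(lra).
  rewrite px px0 in h1.
  rewrite -(subrKA (f y0)) (splitr del); apply: le_trans (ler_normD _ _) _.
  by apply: lerD => //; rewrite distrC ltW.
- move=> t t' k _ tt' H e y e0 et yk; apply: H => //; exact: lt_le_trans tt'.
Qed.

Lemma integral_phi_flip p e : 0 < e ->
  integral_rV (fun y => phi (e^-1 *: (p - y))) = e ^+ m.
Proof.
move=> e0.
have u1 : ((- e^-1)%:M : 'M[R]_m) \in unitmx.
  by rewrite unitmxE det_scalar unitrX // unitfE oppr_eq0 invr_eq0 gt_eqF.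
have hp : cc (1 + `|e^-1 *: p|) (fun v => phi (v + e^-1 *: p)).
  exact: cc_translate.
have := (integral_rV_linear_change u1).2 _ _ (addr_ge0 ler01 (normr_ge0 _)) hp.
rewrite (integral_rV_translate _ ler01 hphi) Iphi det_scalar normrX normrN.
rewrite gtr0_norm ?invr_gt0 // => h.
rewrite -[RHS]mulr1 -h mulrA -exprMn divff ?gt_eqF // expr1n mul1r.
congr integral_rV; apply/funext => y.
by rewrite mul_mx_scalar scalerBr scaleNr addrC.
Qed.

(* Both sides are computed from the double integral of
   [g x * phi ((psi x - y) / e)]: integrating over y first gives the integral of
   g, and integrating over x first gives f y in the limit, by the linear case of
   the change of variables. *)
Lemma change_of_variables_mollified : integral_rV g = integral_rV f.
Proof.
have [N' N'0 hker] := ker_cc2.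
have [C C0 hC] := @integral_rV_bound R m N' N'0.
apply/eqP; rewrite -subr_eq0 -normr_le0; apply/ler_addgt0Pr => eps eps0.
rewrite add0r.
have C1 : 0 < C + 1 by lra.
have [rho rho0 hrho] := mollify_uniform (divr_gt0 eps0 C1).
pose e := Num.min (rho / 2) (1 / 2).
have e0 : 0 < e by rewrite lt_min !divr_gt0.
have e1 : e < 1 by rewrite gt_min; apply/orP; right; lra.
have erho : e < rho by rewrite gt_min; apply/orP; left; lra.
have [hk hf'] := hker e e0 e1.
have em : e ^+ m != 0 by rewrite expf_neq0 // gt_eqF.
have ccD' : cc N' (fun y => (e ^+ m)^-1 * D e y).
  by apply: ccZ; apply: cc2_int.
have Ig : integral_rV g = integral_rV (fun y => (e ^+ m)^-1 * D e y).
  rewrite (integral_rVZ _ N'0 (cc2_int N'0 hk)).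
  rewrite -(integral_rV_fubini N'0 hk).
  have E x : integral_rV (fun y => ker e x y) = g x * e ^+ m.
    rewrite -(integral_phi_flip (psi x) e0) /ker.
    have [Bp Bp0 _] := cc_bounded hphi.
    have hp : exists2 N1 : R, 0 <= N1 &
        cc N1 (fun y => phi (e^-1 *: (psi x - y))).
      have u1 : ((- e^-1)%:M : 'M[R]_m) \in unitmx.
        by rewrite unitmxE det_scalar unitrX // unitfE oppr_eq0 invr_eq0 gt_eqF.
      have [N1 N10 h] := cc_linear (addr_ge0 ler01 (normr_ge0 _)) u1
        (cc_translate (e^-1 *: psi x) hphi).
      exists N1 => //; move: h; congr cc; apply/funext => y.
      by rewrite mul_mx_scalar scalerBr scaleNr addrC.
    by case: hp => N1 N10 hp; rewrite (integral_rVZ _ N10 hp).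
  under eq_fun do rewrite E mulrC.
  by rewrite (integral_rVZ _ N0 hg) mulrA mulVf // mul1r.
rewrite Ig -(integral_rVB N'0 ccD' hf').
apply: (@le_trans _ _ (C * (eps / (C + 1)))).
  apply: hC; first exact: ccB.
  by move=> y; rewrite mulrC; exact: hrho.
by rewrite mulrA ler_pdivrMr // mulrC ler_wpM2l ?ltW //; lra.
Qed.

End Mollifier.

Lemma change_of_variables : integral_rV g = integral_rV f.
Proof.
have [phi [hphi _ Iphi]] := bump_exists m.
exact: (change_of_variables_mollified hphi Iphi).
Qed.

End ChangeOfVariables.

(** * Smooth functions and their partial derivatives *)

Section SmoothFunctions.
Variable R : realType.

Lemma dist_aux (c a b e : R) :
  `|c - a| <= e -> `|c - b| <= e -> `|b - a| <= e + e.
Proof.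
move=> h1 h2; rewrite -(subrKA c); apply: le_trans (ler_normD _ _) _.
by rewrite lerD // distrC.
Qed.

Section OneOpenSet.
Variables (m : nat) (U : set 'rV[R]_m).
Hypothesis oU : open U.
Implicit Types (f g : 'rV[R]_m -> R) (x : 'rV[R]_m).

Notation e_ i := (delta_mx 0 i : 'rV[R]_m).

(** Smoothness graded by order: [smooth_on] quantifies over lists of partial derivatives, while
    closure under products, inverses and composition is proved by induction on the order. *)
Fixpoint Ck k f : Prop :=
  (forall x, U x -> {for x, continuous f}) /\
  (if k is k'.+1 then
     (forall x, U x -> forall i, derivable f x (e_ i)) /\
     forall i, Ck k' (partial i f)
   else True).

Lemma smooth_onP f : smooth_on U f <-> forall k, Ck k f.
Proof.
split=> [H k|H s].
  elim: k f H => [|k IH] f H /=; first by split=> // x Ux; exact: (H [::] x Ux).1.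
  split; first by move=> x Ux; exact: (H [::] x Ux).1.
  split; first by move=> x Ux; exact: (H [::] x Ux).2.
  move=> i; apply: IH => s x Ux.
  by have := H (rcons s i) x Ux; rewrite foldr_rcons.
elim/last_ind: s f H => [|s i IH] f H x Ux.
  by split; [exact: (H 0%N).1 | exact: (H 1%N).2.1].
rewrite foldr_rcons; apply: IH => // k; exact: (H k.+1).2.2.
Qed.

Lemma Ck_cont k f : Ck k f -> forall x, U x -> {for x, continuous f}.
Proof. by case: k => [|k] []. Qed.

Lemma Ck_pred k f : Ck k.+1 f -> Ck k f.
Proof.
elim: k f => [|k IH] f [c [d p]]; first by split.
by split=> //; split=> // i; apply: IH.
Qed.

Lemma near_U x (P : 'rV[R]_m -> Prop) : U x -> (forall y, U y -> P y) ->
  \forall y \near x, P y.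
Proof. by move=> Ux H; apply: filterS H _; exact: open_nbhs_nbhs. Qed.

Lemma partial_ext f g : (forall x, U x -> f x = g x) ->
  forall x, U x -> forall i,
    partial i f x = partial i g x /\
    (derivable f x (e_ i) -> derivable g x (e_ i)).
Proof.
move=> E x Ux i; have nE : {near x, f =1 g} by exact: near_U.
split; first exact: near_eq_derive.
by apply: near_eq_derivable.
Qed.

Lemma cont_ext f g x : (forall y, U y -> f y = g y) -> U x ->
  {for x, continuous f} -> {for x, continuous g}.
Proof.
move=> E Ux /continuousER H; apply/continuousER => e e0.
have [d d0 hd] := H e e0; have [d' d'0 hd'] := openE oU Ux.
exists (Num.min d d') => [|y]; first by rewrite lt_min d0.
by rewrite lt_min => /andP[/hd h /hd' Uy]; rewrite -!E.
Qed.

Lemma Ck_ext k f g : (forall x, U x -> f x = g x) -> Ck k f -> Ck k g.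
Proof.
elim: k f g => [|k IH] f g E H.
  by split=> // x Ux; exact: cont_ext E Ux (Ck_cont H Ux).
case: H => c [d p]; split.
  by move=> x Ux; exact: cont_ext E Ux (c x Ux).
split=> [x Ux i|i]; first by have [_] := partial_ext E Ux i; apply; exact: d.
by apply: IH (p i) => x Ux; have [] := partial_ext E Ux i.
Qed.

Lemma Ck_cst k (c : R) : Ck k (fun _ => c).
Proof.
elim: k c => [|k IH] c; first by split=> // x _; exact: cst_continuous.
split; first by move=> x _; exact: cst_continuous.
split=> [x _ i|i]; first exact: derivable_cst.
by apply: Ck_ext (IH 0) => x _; rewrite /partial derive_cst.
Qed.

Lemma CkD k f g : Ck k f -> Ck k g -> Ck k (fun x => f x + g x).
Proof.
elim: k f g => [|k IH] f g [cf hf] [cg hg].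
  by split=> // x Ux; apply: continuousD; [exact: cf|exact: cg].
split; first by move=> x Ux; apply: continuousD; [exact: cf|exact: cg].
case: hf => df pf; case: hg => dg pg.
split=> [x Ux i|i]; first by apply: derivableD; [exact: df|exact: dg].
apply: Ck_ext (IH _ _ (pf i) (pg i)) => x Ux.
by rewrite /partial deriveD //; [exact: df|exact: dg].
Qed.

Lemma CkM k f g : Ck k f -> Ck k g -> Ck k (fun x => f x * g x).
Proof.
elim: k f g => [|k IH] f g hf hg.
  split=> // x Ux; apply: continuousM; [exact: Ck_cont hf _ Ux|exact: Ck_cont hg _ Ux].
have hf' := Ck_pred hf; have hg' := Ck_pred hg.
case: hf hg => cf [df pf] [cg [dg pg]].
split; first by move=> x Ux; apply: continuousM; [exact: cf|exact: cg].
split=> [x Ux i|i]; first by apply: derivableM; [exact: df|exact: dg].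
apply: Ck_ext (CkD (IH _ _ hf' (pg i)) (IH _ _ hg' (pf i))) => x Ux.
by rewrite /partial deriveM //; [exact: df|exact: dg].
Qed.

Lemma CkV k f : (forall x, U x -> f x != 0) -> Ck k f -> Ck k (fun x => (f x)^-1).
Proof.
move=> f0; elim: k => [|k IH] hf.
  by split=> // x Ux; apply: continuousV; [exact: f0|exact: Ck_cont hf _ Ux].
have hv := IH (Ck_pred hf).
case: hf => cf [df pf].
split; first by move=> x Ux; apply: continuousV; [exact: f0|exact: cf].
split=> [x Ux i|i]; first by apply: derivableV; [exact: f0|exact: df].
apply: Ck_ext (CkM (Ck_cst k (-1)) (CkM (CkM hv hv) (pf i))) => x Ux.
rewrite /partial deriveV //; [|exact: f0|exact: df].
by rewrite mulN1r /GRing.scale /= mulNr -exprVn expr2.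
Qed.

Lemma is_derive_comp1 (F : R -> R) f x v (df dF : R) :
  is_derive (f x) (1 : R) F dF -> is_derive x v f df ->
  is_derive x v (fun y => F (f y)) (dF * df).
Proof.
move=> hF [d E].
have line0 (h : R) : h *: v + x = (h + 0) *: v + x by rewrite addr0.
have [A B] := @derive_line_eq R _ _ f (fun s : R => f (s *: v + x)) x v 0
  (fun h => congr1 f (esym (line0 h))).
have hl : is_derive (0 : R) (1 : R) (fun s : R => f (s *: v + x)) df.
  by split; [exact/A | rewrite B].
have f00 : f x = f (0 *: v + x) by rewrite scale0r add0r.
rewrite f00 in hF.
have [A' B'] := @is_derive1_comp R F (fun s : R => f (s *: v + x)) 0 _ _ hF hl.
have [C D] := @derive_line_eq R _ _ (fun y => F (f y))
  (fun s : R => F (f (s *: v + x))) x v 0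
  (fun h => congr1 (fun y => F (f y)) (esym (line0 h))).
by split; [exact: (C.1 A') | rewrite -D].
Qed.

Lemma partialD f g x i : derivable f x (e_ i) -> derivable g x (e_ i) ->
  partial i (fun y => f y + g y) x = partial i f x + partial i g x.
Proof. by move=> df dg; exact: (deriveD df dg). Qed.

Lemma partialM f g x i : derivable f x (e_ i) -> derivable g x (e_ i) ->
  partial i (fun y => f y * g y) x = f x * partial i g x + g x * partial i f x.
Proof. by move=> df dg; exact: (deriveM df dg). Qed.

Lemma smooth_cst c : smooth_on U (fun _ => c).
Proof. by apply/smooth_onP => k; exact: Ck_cst. Qed.

Lemma smoothD f g : smooth_on U f -> smooth_on U g ->
  smooth_on U (fun x => f x + g x).
Proof. by move=> /smooth_onP hf /smooth_onP hg; apply/smooth_onP => k; exact: CkD. Qed.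

Lemma smoothM f g : smooth_on U f -> smooth_on U g ->
  smooth_on U (fun x => f x * g x).
Proof. by move=> /smooth_onP hf /smooth_onP hg; apply/smooth_onP => k; exact: CkM. Qed.

Lemma smoothN f : smooth_on U f -> smooth_on U (fun x => - f x).
Proof.
move=> hf; have -> : (fun x => - f x) = (fun x => -1 * f x).
  by apply/funext => x; rewrite mulN1r.
by exact: (smoothM (smooth_cst _) hf).
Qed.

Lemma smoothB f g : smooth_on U f -> smooth_on U g ->
  smooth_on U (fun x => f x - g x).
Proof. by move=> hf hg; exact: (smoothD hf (smoothN hg)). Qed.

Lemma smoothV f : (forall x, U x -> f x != 0) -> smooth_on U f ->
  smooth_on U (fun x => (f x)^-1).
Proof. by move=> f0 /smooth_onP hf; apply/smooth_onP => k; exact: CkV. Qed.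

Lemma smooth_ext f g : (forall x, U x -> f x = g x) -> smooth_on U f ->
  smooth_on U g.
Proof. by move=> E /smooth_onP hf; apply/smooth_onP => k; exact: Ck_ext E (hf k). Qed.

Lemma smooth_partial f i : smooth_on U f -> smooth_on U (partial i f).
Proof. by move=> /smooth_onP hf; apply/smooth_onP => k; exact: (hf k.+1).2.2. Qed.

Lemma smooth_cont f : smooth_on U f -> forall x, U x -> {for x, continuous f}.
Proof. by move=> /smooth_onP hf; exact: (Ck_cont (hf 0%N)). Qed.

Lemma smooth_derivable f : smooth_on U f -> forall x, U x -> forall i,
  derivable f x (e_ i).
Proof. by move=> /smooth_onP hf; exact: (hf 1%N).2.1. Qed.

Lemma derivable_line f x v t : derivable f (t *: v + x) v ->
  is_derive t (1 : R) (fun s : R => f (s *: v + x)) ('D_v f (t *: v + x)).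
Proof.
move=> df; have [A B] := @derive_line_eq R _ _ f (fun s : R => f (s *: v + x))
  (t *: v + x) v t (fun h => congr1 f (etrans (congr1 (fun w => w + x)
     (scalerDl v h t)) (esym (addrA _ _ _)))).
by split; [exact/A | exact: B].
Qed.

Lemma line_remainder f x v (h c e : R) :
  (forall s : R, 0 <= s <= h \/ h <= s <= 0 -> derivable f (s *: v + x) v /\
     `|'D_v f (s *: v + x) - c| <= e) ->
  `|f (h *: v + x) - f x - h * c| <= e * `|h|.
Proof.
move=> H.
have fx : f x = f (0 *: v + x) by rewrite scale0r add0r.
pose df (s : R) := 'D_v f (s *: v + x).
have dl (s : R) : 0 <= s <= h \/ h <= s <= 0 ->
    is_derive s (1 : R) (fun s : R => f (s *: v + x)) (df s).
  by move=> /H [d _]; exact: derivable_line.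
have cl (a b : R) : (forall s, s \in `[a, b]%R -> 0 <= s <= h \/ h <= s <= 0) ->
    {within `[a, b], continuous (fun s : R => f (s *: v + x))}.
  move=> sub; apply: derivable_within_continuous => s /sub hs.
  by case: (dl s hs).
case: (ltgtP h 0) => [h0|h0|->]; last first.
- by rewrite scale0r add0r subrr mul0r subrr normr0 mulr0.
- have sub (s : R) : s \in `[0, h]%R -> 0 <= s <= h \/ h <= s <= 0.
    by rewrite in_itv /=; left.
  have subo (s : R) : s \in `]0, h[%R -> 0 <= s <= h \/ h <= s <= 0.
    by move=> /subset_itv_oo_cc/sub.
  have [s hs E] := @MVT R (fun s : R => f (s *: v + x)) df _ _ h0
    (fun s hs => dl s (subo s hs)) (cl _ _ sub).
  have [_ hc] := H s (subo s hs).
  move: E; rewrite -fx subr0 => ->.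
  by rewrite [h * c]mulrC -mulrBl normrM ler_wpM2r.
have sub (s : R) : s \in `[h, 0]%R -> 0 <= s <= h \/ h <= s <= 0.
  by rewrite in_itv /=; right.
have subo (s : R) : s \in `]h, 0[%R -> 0 <= s <= h \/ h <= s <= 0.
  by move=> /subset_itv_oo_cc/sub.
have [s hs E] := @MVT R (fun s : R => f (s *: v + x)) df _ _ h0
  (fun s hs => dl s (subo s hs)) (cl _ _ sub).
have [_ hc] := H s (subo s hs).
move: E; rewrite -fx sub0r => E.
rewrite (_ : f (h *: v + x) - f x = h * df s); last by lra.
by rewrite -mulrBr normrM mulrC ler_wpM2r.
Qed.

(** Passing from [x] to [x'] one coordinate at a time, the mean value theorem on each axis-parallel
    segment bounds the error by the oscillation of one partial derivative near [x0]; the constant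
    [e / (m + 1)] pays for the [m] segments. *)
Lemma strict_differentiable f x0 : smooth_on U f -> U x0 -> forall e : R, 0 < e ->
  exists2 d : R, 0 < d & forall x x', `|x - x0| < d -> `|x' - x0| < d ->
    `|f x' - f x - \sum_i (x' - x) 0 i * partial i f x0| <= e * `|x' - x|.
Proof.
move=> hf Ux0 e e0.
have [d0 d00 hd0] := openE oU Ux0.
have p : 0 < e / (m%:R + 1) by rewrite divr_gt0 // ltr_wpDl.
pose e' := e / (m%:R + 1).
have [d d00' hd] : exists2 d : R, 0 < d & forall y, `|y - x0| < d ->
    forall i, `|partial i f y - partial i f x0| < e'.
  have H i : exists2 d : R, 0 < d & forall y, `|y - x0| < d ->
      `|partial i f y - partial i f x0| < e'.
    by have /continuousER := smooth_cont (smooth_partial i hf) Ux0; apply.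
  pose dd i := sval (cid2 (H i)).
  have dd0 i : 0 < dd i by rewrite /dd; case: cid2.
  have ddP i y : `|y - x0| < dd i -> `|partial i f y - partial i f x0| < e'.
    by rewrite /dd; case: cid2 => /= t _; apply.
  exists (\big[Num.min/1]_i dd i).
    by elim/big_ind: _ => // a b a0 b0; rewrite lt_min a0.
  move=> y hy i; apply: ddP; apply: lt_le_trans hy _.
  by rewrite (bigD1 i) //= ge_min lexx.
pose D := Num.min d0 d.
exists D; first by rewrite lt_min d00 d00'.
move=> x x' hx hx'.
pose u k : 'rV[R]_m := \row_i (if (i < k)%N then x' 0 i else x 0 i).
have u0 : u 0%N = x by apply/rowP => i; rewrite !mxE.
have um : u m = x' by apply/rowP => i; rewrite !mxE ltn_ord.
have step (i : 'I_m) : `|f (u i.+1) - f (u i) - (x' - x) 0 i * partial i f x0|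
    <= e' * `|(x' - x) 0 i|.
  have uS : u i.+1 = (x' - x) 0 i *: e_ i + u i.
    apply/rowP => j; rewrite !mxE eqxx /= ltnS.
    case: (ltngtP j i) => [ji|ji|/val_inj ->].
    - by rewrite (_ : j == i = false) ?mulr0 ?add0r //; apply/eqP => E; rewrite E ltnn in ji.
    - by rewrite (_ : j == i = false) ?mulr0 ?add0r //; apply/eqP => E; rewrite E ltnn in ji.
    - by rewrite eqxx mulr1 subrK.
  rewrite uS mxE; apply: line_remainder => s hs.
  have hs' : `|s *: e_ i + u i - x0| < D.
    apply: (@le_lt_trans _ _ (Num.max `|x - x0| `|x' - x0|)); last first.
      by rewrite gt_max hx.
    apply: norm_le_coord => [|j]; first by rewrite le_max normr_ge0.
    rewrite !mxE eqxx /=.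
    have hj := coord_le_norm (x - x0) j; have hj' := coord_le_norm (x' - x0) j.
    rewrite !mxE in hj hj'.
    have [ji|ji] := eqVneq j i; last first.
      rewrite mulr0 add0r; case: ifP => _; rewrite le_max.
        by rewrite hj' orbT.
      by rewrite hj.
    rewrite ji ltnn mulr1 -ji; rewrite -ji !mxE in hs.
    move: hj hj'; rewrite !ler_norml !le_max => /andP[a1 a2] /andP[b1 b2].
    have [le|le] := leP `|x - x0| `|x' - x0|.
      by case: hs => /andP[s1 s2]; apply/andP; split; lra.
    by case: hs => /andP[s1 s2]; apply/andP; split; lra.
  move: hs'; rewrite lt_min => /andP[h1 h2]; split.
    by apply: smooth_derivable => //; exact: hd0.
  exact/ltW/hd.
have tel k : (k <= m)%N -> f (u k) - f x - \sum_(i < m | (i < k)%N) (x' - x) 0 i * partial i f x0 = 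
    \sum_(i < m | (i < k)%N) (f (u i.+1) - f (u i) - (x' - x) 0 i * partial i f x0).
  elim: k => [|k IH] km; first by rewrite !big_pred0 // u0 subrr subr0.
  have S (F : 'I_m -> R) : \sum_(i < m | (i < k.+1)%N) F i =
      F (Ordinal km) + \sum_(i < m | (i < k)%N) F i.
    rewrite (bigD1 (Ordinal km)) //=; congr (_ + _); apply: eq_bigl => i.
    by rewrite ltnS ltn_neqAle andbC.
  by rewrite !S -IH ?(ltnW km) //=; ring.
have := tel m (leqnn m); rewrite um.
have big_all (F : 'I_m -> R) : \sum_(i < m | (i < m)%N) F i = \sum_i F i.
  by apply: eq_bigl => i; rewrite ltn_ord.
rewrite !big_all => ->.
apply: le_trans (ler_norm_sum _ _ _) _.
apply: (@le_trans _ _ (\sum_(i < m) e' * `|x' - x|)).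
  apply: ler_sum => i _; apply: le_trans (step i) _.
  by apply: ler_wpM2l; [exact: ltW | exact: coord_le_norm].
rewrite sumr_const card_ord -[leLHS]mulr_natl mulrA ler_wpM2r //.
rewrite /e' mulrA ler_pdivrMr ?ltr_wpDl // [m%:R * e]mulrC.
by apply: ler_wpM2l; [exact: ltW | rewrite lerDl].
Qed.

(** The second difference of [f] over a square of side [h] is symmetric in the two directions, and
    two applications of the mean value estimate show that it equals [h^2] times either mixed
    derivative up to [e * h^2]. *)
Lemma clairaut f x i j : smooth_on U f -> U x ->
  partial i (partial j f) x = partial j (partial i f) x.
Proof.
move=> hf Ux.
suff H (k l : 'I_m) (e : R) : 0 < e -> exists2 d : R, 0 < d & forall h : R,
    0 < h -> h < d ->
    `|(f (h *: e_ k + (h *: e_ l + x)) - f (h *: e_ l + x) - f (h *: e_ k + x) + f x)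
      - h * (h * partial l (partial k f) x)| <= e * (h * h).
  apply/eqP; rewrite -subr_eq0 -normr_le0; apply/ler_addgt0Pr => e e0.
  rewrite add0r.
  have e2 : 0 < e / 2 by rewrite divr_gt0.
  have [d1 d10 H1] := H j i _ e2; have [d2 d20 H2] := H i j _ e2.
  pose h := Num.min d1 d2 / 2.
  have m0 : 0 < Num.min d1 d2 by rewrite lt_min d10.
  have h0 : 0 < h by rewrite divr_gt0.
  have hm : h < Num.min d1 d2 by rewrite /h; lra.
  move: (hm); rewrite lt_min => /andP[hd1 hd2].
  have := H1 h h0 hd1; have := H2 h h0 hd2.
  rewrite [h *: e_ j + (_ + x)]addrCA.
  set A := f (h *: e_ i + _); set B := f (_ *: e_ i + x); set C := f (_ *: e_ j + x).
  set P := partial j (partial i f) x; set Q := partial i (partial j f) x.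
  move=> a b.
  have hh : 0 < h * h by rewrite mulr_gt0.
  have : `|h * (h * Q) - h * (h * P)| <= e * (h * h).
    have E : A - B - C = A - C - B by rewrite addrAC.
    rewrite E in b; set X := A - C - B + f x in a b.
    by rewrite (splitr e) mulrDl; exact: dist_aux a b.
  rewrite -mulrBr -mulrBr mulrA normrM (gtr0_norm hh) mulrC.
  by rewrite ler_pM2r.
move=> e0.
have [d0 d00 hd0] := openE oU Ux.
have /continuousER /(_ e e0) [d1 d10 hd1] :=
  smooth_cont (smooth_partial l (smooth_partial k hf)) Ux.
pose D := Num.min d0 d1.
have D0 : 0 < D by rewrite lt_min d00.
exists (D / 2); first by rewrite divr_gt0.
move=> h h0 hD.
have nrm (s t : R) : 0 <= s <= h -> 0 <= t <= h -> `|s *: e_ k + (t *: e_ l + x) - x| < D.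
  move=> /andP[s0 sh] /andP[t0 th]; rewrite addrA addrK.
  apply: le_lt_trans (ler_normD _ _) _; rewrite !normrZ !ger0_norm //.
  have ne (i0 : 'I_m) : `|e_ i0| <= 1.
    apply: norm_le_coord => // i1; rewrite mxE; case: (_ && _) => /=.
      by rewrite normr1.
    by rewrite normr0.
  have := ler_wpM2l s0 (ne k); have := ler_wpM2l t0 (ne l); lra.
have inU (s t : R) : 0 <= s <= h -> 0 <= t <= h -> U (s *: e_ k + (t *: e_ l + x)).
  move=> hs ht; apply: hd0; apply: lt_le_trans (nrm s t hs ht) _.
  by rewrite ge_min lexx.
have hb : 0 <= h <= h by rewrite lexx andbT ltW.
have sgn (s : R) : 0 <= s <= h \/ h <= s <= 0 -> 0 <= s <= h.
  by case=> // /andP[a b]; exfalso; lra.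
pose g y := f (h *: e_ l + y) - f y.
have dg (s : R) : 0 <= s <= h -> is_derive (s *: e_ k + x) (e_ k) g
    (partial k f (s *: e_ k + (h *: e_ l + x)) - partial k f (s *: e_ k + x)).
  move=> hs.
  have U1 := inU s h hs hb; have U2 := inU s 0 hs ltac:(lra).
  rewrite scale0r add0r in U2.
  have [A B] := @derive_affine_eq R _ _ _ f (fun y => f (h *: e_ l + y))
    (s *: e_ k + (h *: e_ l + x)) (e_ k) (s *: e_ k + x) (e_ k)
    (fun t => congr1 f (etrans (addrCA _ _ _) (congr1 _ (addrCA _ _ _)))).
  have i1 : is_derive (s *: e_ k + x) (e_ k) (fun y => f (h *: e_ l + y))
      (partial k f (s *: e_ k + (h *: e_ l + x))).
    by split; [apply/A; exact: smooth_derivable | exact: B].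
  have i2 : is_derive (s *: e_ k + x) (e_ k) f (partial k f (s *: e_ k + x)).
    by split=> //; exact: smooth_derivable.
  exact: is_deriveB.
have := @line_remainder g x (e_ k) h (h * partial l (partial k f) x) (e * h).
rewrite /g (gtr0_norm h0) -mulrA.
rewrite (_ : f (h *: e_ l + (h *: e_ k + x)) - f (h *: e_ k + x) -
   (f (h *: e_ l + x) - f x) = f (h *: e_ k + (h *: e_ l + x)) -
   f (h *: e_ l + x) - f (h *: e_ k + x) + f x); last first.
  by rewrite [h *: e_ l + (h *: e_ k + x)]addrCA; ring.
apply=> s /sgn hs; have [dgs ->] := dg s hs; split=> //.
have := @line_remainder (partial k f) (s *: e_ k + x) (e_ l) h
  (partial l (partial k f) x) e.
rewrite (gtr0_norm h0) [h *: e_ l + _]addrCA; apply=> t /sgn ht.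
rewrite addrCA; split.
  by apply: smooth_derivable; [exact: smooth_partial | exact: inU].
apply/ltW/hd1; apply: lt_le_trans (nrm s t hs ht) _.
by rewrite ge_min lexx orbT.
Qed.

Lemma smooth_ln f : (forall x, U x -> 0 < f x) -> smooth_on U f ->
  smooth_on U (fun x => ln (f x)).
Proof.
move=> f0 hf.
have dl x i : U x -> is_derive x (e_ i) (fun y => ln (f y)) ((f x)^-1 * partial i f x).
  move=> Ux; apply: is_derive_comp1; first exact/is_derive1_ln/f0.
  by split=> //; exact: smooth_derivable.
have cl x : U x -> {for x, continuous (fun y => ln (f y))}.
  move=> Ux; apply: (@continuous_comp _ _ _ f (@ln R)).
    exact: smooth_cont.
  exact/continuous_ln/f0.
have hp i : smooth_on U (partial i (fun y => ln (f y))).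
  apply: (@smooth_ext (fun x => (f x)^-1 * partial i f x)).
    by move=> x Ux; rewrite [RHS]/partial; case: (dl x i Ux) => _ ->.
  apply: smoothM; last exact: smooth_partial.
  by apply: smoothV => // x /f0/gt_eqF ->.
apply/smooth_onP => -[|k]; first by split.
split=> //; split=> [x Ux i|i]; first by case: (dl x i Ux).
by have /smooth_onP := hp i.
Qed.

Lemma partial_ln f x i : U x -> (forall x, U x -> 0 < f x) -> smooth_on U f ->
  partial i (fun x => ln (f x)) x = (f x)^-1 * partial i f x.
Proof.
move=> Ux f0 hf; apply: (@derive_val _ _ _ _ _ _ _ _).
apply: is_derive_comp1; first exact/is_derive1_ln/f0.
by split=> //; exact: smooth_derivable.
Qed.

End OneOpenSet.

(** The derivative of [psi] along one axis is combined with strict differentiability of [f] at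
    [psi x]. [M] bounds the growth of [psi] along that axis and [S] the gradient of [f]; each of the
    two errors receives half of [eps]. *)
Lemma partial_comp m k (U : set 'rV[R]_m) (V : set 'rV[R]_k)
    (psi : 'rV[R]_m -> 'rV[R]_k) (f : 'rV[R]_k -> R) x i :
  open U -> open V -> U x -> V (psi x) ->
  (forall l, smooth_on U (fun y => psi y 0 l)) -> smooth_on V f ->
  derivable (fun y => f (psi y)) x (delta_mx 0 i) /\
  partial i (fun y => f (psi y)) x =
  \sum_l partial i (fun y => psi y 0 l) x * partial l f (psi x).
Proof.
move=> oU oV Ux Vx hpsi hf.
set dF := (X in _ = X).
pose e := delta_mx 0 i : 'rV[R]_m.
have [A B] := @derive_line_eq R _ _ (fun y => f (psi y))
  (fun s : R => f (psi (s *: e + x))) x e 0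
  (fun h => congr1 (fun y => f (psi (y *: e + x))) (addr0 h)).
suff [C D] : is_derive (0 : R) (1 : R) (fun s : R => f (psi (s *: e + x))) dF.
  by split; [exact: (A.1 C) | rewrite /partial -B].
apply: is_derive_eps => eps eps0.
pose M := \sum_l `|partial i (fun y => psi y 0 l) x| + 1.
have M0 : 0 < M by rewrite ltr_wpDl // sumr_ge0.
pose S := \sum_l `|partial l f (psi x)|.
have S0 : 0 <= S by rewrite sumr_ge0.
have p1 : 0 < eps / 2 / M by rewrite !divr_gt0.
have [d1 d10 hd1] := strict_differentiable oV hf Vx p1.
pose e' := Num.min 1 (eps / 2 / (S + 1)).
have S1 : 0 < S + 1 by rewrite ltr_wpDl.
have e'0 : 0 < e' by rewrite lt_min ltr01 !divr_gt0.
have [d2 d20 hd2] : exists2 d : R, 0 < d & forall h : R, `|h| < d -> forall l,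
    `|psi (h *: e + x) 0 l - psi x 0 l - h * partial i (fun y => psi y 0 l) x|
      <= e' * `|h|.
  have H l : exists2 d : R, 0 < d & forall h : R, `|h| < d ->
    `|psi (h *: e + x) 0 l - psi x 0 l - h * partial i (fun y => psi y 0 l) x|
      <= e' * `|h|.
    have [d d0 hd] := strict_differentiable oU (hpsi l) Ux e'0.
    exists d => // h hh.
    have ne : `|h *: e| <= `|h|.
      rewrite normrZ ler_piMr // norm_le_coord // => j; rewrite mxE.
      by case: (_ && _) => /=; rewrite ?normr1 ?normr0.
    have := hd x (h *: e + x); rewrite subrr normr0 addrK => H.
    have := H d0 (le_lt_trans ne hh).
    rewrite (bigD1 i) //= big1 ?addr0; last first.
      by move=> j ji; rewrite !mxE (negPf ji) andbF mulr0 mul0r.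
    rewrite !mxE !eqxx mulr1 => /le_trans; apply.
    by rewrite ler_wpM2l // ltW.
  pose dd l := sval (cid2 (H l)).
  have dd0 l : 0 < dd l by rewrite /dd; case: cid2.
  exists (\big[Num.min/1]_l dd l).
    by elim/big_ind: _ => // a b a0 b0; rewrite lt_min a0.
  move=> h hh l.
  have hl : `|h| < dd l by apply: lt_le_trans hh _; rewrite (bigD1 l) //= ge_min lexx.
  by move: hl; rewrite /dd; case: cid2 => /= t _; apply.
exists (Num.min d2 (d1 / (M + 1))).
  by rewrite lt_min d20 divr_gt0 // ltr_wpDl // ltW.
move=> h; rewrite lt_min => /andP[/hd2 H2]; rewrite ltr_pdivlMr; last by lra.
move=> hM; rewrite add0r scale0r add0r.
have npsi : `|psi (h *: e + x) - psi x| <= M * `|h|.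
  apply: norm_le_coord => [|l]; first by rewrite mulr_ge0 // ltW.
  rewrite !mxE -[X in `|X|](subrK (h * partial i (fun y => psi y 0 l) x)).
  apply: le_trans (ler_normD _ _) _; rewrite normrM.
  have Ml : `|partial i (fun y => psi y 0 l) x| + 1 <= M.
    by rewrite lerD2r (bigD1 l) //= lerDl sumr_ge0.
  have e'1 : e' <= 1 by rewrite ge_min lexx.
  have := H2 l; have := ler_wpM2r (normr_ge0 h) Ml.
  by have := ler_wpM2r (normr_ge0 h) e'1; rewrite mulrDl; lra.
have h1 : `|psi (h *: e + x) - psi x| < d1.
  by apply: le_lt_trans npsi _; have := normr_ge0 h; lra.
have h0 : `|psi x - psi x| < d1 by rewrite subrr normr0.
have := hd1 _ _ h0 h1.
set T := \sum_l _; move=> h2.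
have hT : `|T - h * dF| <= eps / 2 * `|h|.
  rewrite /T /dF mulr_sumr -sumrB.
  apply: le_trans (ler_norm_sum _ _ _) _.
  apply: (@le_trans _ _ (\sum_l e' * `|h| * `|partial l f (psi x)|)).
    apply: ler_sum => l _; rewrite !mxE mulrA -mulrBl normrM ler_wpM2r //.
  rewrite -mulr_sumr mulrAC ler_wpM2r // -/S.
  have : e' <= eps / 2 / (S + 1) by rewrite ge_min lexx orbT.
  rewrite ler_pdivlMr // => h3; have e'S : 0 <= e' by exact: ltW.
  by apply: le_trans h3; rewrite ler_wpM2l // lerDl.
rewrite -(subrKA T) (splitr eps) mulrDl.
apply: le_trans (ler_normD _ _) _; apply: lerD => //.
apply: (le_trans h2).
apply: (@le_trans _ _ (eps / 2 / M * (M * `|h|))).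
  by rewrite ler_wpM2l // ltW.
by rewrite mulrA divfK // gt_eqF.
Qed.

End SmoothFunctions.

Opaque smooth_on.

Section Composition.
Variable R : realType.

Lemma Ck_sum m (U : set 'rV[R]_m) k (I : Type) (r : seq I)
    (F : I -> 'rV[R]_m -> R) : open U ->
  (forall i, Ck U k (F i)) -> Ck U k (fun x => \sum_(i <- r) F i x).
Proof.
move=> oU H; elim: r => [|i r IH].
  by apply: (Ck_ext oU _ (Ck_cst oU k 0)) => x _; rewrite big_nil.
by apply: (Ck_ext oU _ (CkD oU (H i) IH)) => x _; rewrite big_cons.
Qed.

Lemma continuous_coords m k (psi : 'rV[R]_m -> 'rV[R]_k) x :
  (forall l, {for x, continuous (fun y => psi y 0 l)}) ->
  {for x, continuous psi}.
Proof.
move=> H; apply/continuousE => e e0.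
have e2 : 0 < e / 2 by rewrite divr_gt0.
have H' l : exists2 d : R, 0 < d & forall y, `|y - x| < d ->
    `|psi y 0 l - psi x 0 l| < e / 2.
  by have /continuousER := H l; apply.
pose dd l := sval (cid2 (H' l)).
have dd0 l : 0 < dd l by rewrite /dd; case: cid2.
exists (\big[Num.min/1]_l dd l).
  by elim/big_ind: _ => // a b a0 b0; rewrite lt_min a0.
move=> y hy; apply: (@le_lt_trans _ _ (e / 2)); last by lra.
apply: norm_le_coord => [|l]; first exact: ltW.
have : `|y - x| < dd l by apply: lt_le_trans hy _; rewrite (bigD1 l) //= ge_min lexx.
by rewrite /dd; case: cid2 => /= t _ ht /ht/ltW; rewrite !mxE.
Qed.

Lemma smooth_comp m k (U : set 'rV[R]_m) (V : set 'rV[R]_k)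
    (psi : 'rV[R]_m -> 'rV[R]_k) (f : 'rV[R]_k -> R) : open U -> open V ->
  (forall x, U x -> V (psi x)) -> (forall l, smooth_on U (fun y => psi y 0 l)) ->
  smooth_on V f -> smooth_on U (fun y => f (psi y)).
Proof.
move=> oU oV UV hpsi hf; apply/smooth_onP => N.
have cpsi x : U x -> {for x, continuous psi}.
  move=> Ux; apply: continuous_coords => l.
  exact: smooth_cont (hpsi l) _ Ux.
have cc' g : smooth_on V g -> forall x, U x -> {for x, continuous (fun y => g (psi y))}.
  move=> hg x Ux; apply: (@continuous_comp _ _ _ psi g); first exact: cpsi.
  exact: smooth_cont hg _ (UV x Ux).
elim: N f hf => [|N IH] f hf; first by split=> //; exact: cc'.
split; first exact: cc'.
split=> [x Ux i|i]; first by case: (partial_comp i oU oV Ux (UV x Ux) hpsi hf).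
apply: (Ck_ext oU (f := fun x => \sum_l partial i (fun y => psi y 0 l) x *
    partial l f (psi x))).
  by move=> x Ux; case: (partial_comp i oU oV Ux (UV x Ux) hpsi hf).
apply: Ck_sum => // l; apply: CkM => //.
  by have /smooth_onP := smooth_partial i (hpsi l).
by apply: IH; exact: smooth_partial.
Qed.

End Composition.

Lemma derivable_mul (R : realType) m (f g : 'rV[R]_m -> R) x v :
  derivable f x v -> derivable g x v -> derivable (fun y => f y * g y) x v.
Proof. by move=> df dg; have := derivableM df dg. Qed.

Lemma partial_mul_sub (R : realType) m (f g h k : 'rV[R]_m -> R) x i :
  derivable f x (delta_mx 0 i) -> derivable g x (delta_mx 0 i) ->
  derivable h x (delta_mx 0 i) -> derivable k x (delta_mx 0 i) ->
  partial i (fun y => f y * g y - h y * k y) x =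
  f x * partial i g x + g x * partial i f x -
  (h x * partial i k x + k x * partial i h x).
Proof.
move=> df dg dh dk.
have d1 := derivable_mul df dg; have d2 := derivable_mul dh dk.
rewrite -(partialM df dg) -(partialM dh dk).
by have := deriveB d1 d2.
Qed.

Lemma partial_mul_add (R : realType) m (f g h k : 'rV[R]_m -> R) x i :
  derivable f x (delta_mx 0 i) -> derivable g x (delta_mx 0 i) ->
  derivable h x (delta_mx 0 i) -> derivable k x (delta_mx 0 i) ->
  partial i (fun y => f y * g y + h y * k y) x =
  f x * partial i g x + g x * partial i f x +
  (h x * partial i k x + k x * partial i h x).
Proof.
move=> df dg dh dk.
have d1 := derivable_mul df dg; have d2 := derivable_mul dh dk.
rewrite -(partialM df dg) -(partialM dh dk).
by have := partialD d1 d2.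
Qed.

(** * Determinants with a replaced row *)

Section RowReplacement.
Variable A0 : comNzRingType.

Definition setrow k (A : 'M[A0]_k) p (v : 'I_k -> A0) : 'M[A0]_k :=
  \matrix_(i, j) if i == p then v j else A i j.

Lemma det_setrow k (A : 'M[A0]_k) p v :
  \det (setrow A p v) = \sum_j v j * cofactor A p j.
Proof.
rewrite (expand_det_row _ p); apply: eq_bigr => j _.
rewrite mxE eqxx; congr (_ * (_ * \det _)); apply/matrixP => a b.
by rewrite !mxE eq_sym (negPf (neq_lift _ _)).
Qed.

Lemma det_setrow_swap k (A : 'M[A0]_k) j p e c : j != p ->
  \det (setrow (setrow A j e) p c) = - \det (setrow (setrow A p e) j c).
Proof.
move=> jp; rewrite -mulN1r -[X in X * _]/((-1) ^+ true).
rewrite -(_ : tperm j p = true :> bool); last by rewrite odd_tperm jp.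
rewrite -det_perm -det_mulmx -row_permE; congr determinant.
apply/matrixP => a b; rewrite !mxE.
case: tpermP => [->|->|/eqP aj /eqP ap].
- by rewrite (negPf jp) eqxx eq_sym (negPf jp) eqxx.
- by rewrite !eqxx.
- by rewrite (negPf aj) (negPf ap).
Qed.

(* This form of the adjugate makes the Piola identity an antisymmetry in two
   rows. *)
Lemma adj_setrow k (A : 'M[A0]_k) l j :
  (\adj A) l j = \det (setrow A j (fun q => (q == l)%:R)).
Proof.
rewrite det_setrow mxE (bigD1 l) //= big1 ?addr0 => [|q /negPf ql].
  by rewrite eqxx mul1r.
by rewrite ql mul0r.
Qed.

End RowReplacement.

(** * Wirtinger derivatives and derivatives of determinants *)

Section ComplexCalculus.
Variables (R : realType) (n : nat).
Notation E := 'rV[R]_(n + n).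
Notation C := R[i].
Notation Re := complex.Re.
Notation Im := complex.Im.

Lemma ReD (x y : C) : Re (x + y) = Re x + Re y.
Proof. by case: x y => a b [c d]. Qed.
Lemma ImD (x y : C) : Im (x + y) = Im x + Im y.
Proof. by case: x y => a b [c d]. Qed.
Lemma ReM (x y : C) : Re (x * y) = Re x * Re y - Im x * Im y.
Proof. by case: x y => a b [c d]. Qed.
Lemma ImM (x y : C) : Im (x * y) = Re x * Im y + Im x * Re y.
Proof. by case: x y => a b [c d]. Qed.
Lemma ReN (x : C) : Re (- x) = - Re x.
Proof. by case: x. Qed.
Lemma ImN (x : C) : Im (- x) = - Im x.
Proof. by case: x. Qed.
Lemma Re_conj (x : C) : Re (x^*) = Re x.
Proof. by case: x. Qed.
Lemma Im_conj (x : C) : Im (x^*) = - Im x.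
Proof. by case: x. Qed.
Lemma complexE2 (x y : C) : Re x = Re y -> Im x = Im y -> x = y.
Proof. by case: x y => a b [c d] /= -> ->. Qed.
Lemma complexV (x : C) : Re (x^-1) = Re x / (Re x ^+ 2 + Im x ^+ 2) /\
  Im (x^-1) = - Im x / (Re x ^+ 2 + Im x ^+ 2).
Proof. by case: x => a b; split=> //=; rewrite mulNr. Qed.

Variable U : set E.
Hypothesis oU : open U.
Implicit Types (F G : E -> C).
Notation csm := (csmooth_on U).

Lemma csmP F : csm F <-> smooth_on U (fun z => Re (F z)) /\
  smooth_on U (fun z => Im (F z)).
Proof. by []. Qed.
Opaque csmooth_on.

Lemma csm_cst (c : C) : csm (fun _ => c).
Proof. by apply/csmP; split; exact: smooth_cst. Qed.

Lemma csmRe F : csm F -> smooth_on U (fun z => Re (F z)).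
Proof. by case/csmP. Qed.

Lemma csm_ext F G : (forall z, U z -> F z = G z) -> csm F -> csm G.
Proof.
move=> E /csmP[h1 h2]; apply/csmP; split.
  by apply: (smooth_ext oU _ h1) => z Uz; rewrite E.
by apply: (smooth_ext oU _ h2) => z Uz; rewrite E.
Qed.

Lemma csmD F G : csm F -> csm G -> csm (fun z => F z + G z).
Proof.
move=> /csmP[f1 f2] /csmP[g1 g2]; apply/csmP; split.
  by apply: (smooth_ext oU _ (smoothD oU f1 g1)) => z _; rewrite ReD.
by apply: (smooth_ext oU _ (smoothD oU f2 g2)) => z _; rewrite ImD.
Qed.

Lemma csmM F G : csm F -> csm G -> csm (fun z => F z * G z).
Proof.
move=> /csmP[f1 f2] /csmP[g1 g2]; apply/csmP; split.
  apply: (smooth_ext oU _ (smoothB oU (smoothM oU f1 g1) (smoothM oU f2 g2))).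
  by move=> z _; rewrite ReM.
apply: (smooth_ext oU _ (smoothD oU (smoothM oU f1 g2) (smoothM oU f2 g1))).
by move=> z _; rewrite ImM.
Qed.

Lemma csmZ (c : C) F : csm F -> csm (fun z => c * F z).
Proof. by apply: csmM; exact: csm_cst. Qed.

Lemma csmN F : csm F -> csm (fun z => - F z).
Proof. by move=> /(csmZ (-1)); apply: csm_ext => z _; rewrite mulN1r. Qed.

Lemma csm_conj F : csm F -> csm (fun z => (F z)^*).
Proof.
move=> /csmP[f1 f2]; apply/csmP; split.
  by apply: (smooth_ext oU _ f1) => z _; rewrite Re_conj.
by apply: (smooth_ext oU _ (smoothN oU f2)) => z _; rewrite Im_conj.
Qed.

Lemma csmV F : (forall z, U z -> F z != 0) -> csm F -> csm (fun z => (F z)^-1).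
Proof.
move=> F0 /csmP[f1 f2].
pose N := fun z => Re (F z) * Re (F z) + Im (F z) * Im (F z).
have N0 z : U z -> N z != 0.
  move=> /F0; apply: contra; rewrite /N -!expr2 paddr_eq0 ?sqr_ge0 //.
  rewrite !sqrf_eq0 => /andP[/eqP h1 /eqP h2].
  by apply/eqP; apply: complexE2.
have sN : smooth_on U (fun z => (N z)^-1).
  apply: (smoothV oU N0).
  exact: (smoothD oU (smoothM oU f1 f1) (smoothM oU f2 f2)).
apply/csmP; split.
  apply: (smooth_ext oU _ (smoothM oU f1 sN)) => z _.
  by rewrite (complexV (F z)).1 !expr2.
apply: (smooth_ext oU _ (smoothM oU (smoothN oU f2) sN)) => z _.
by rewrite (complexV (F z)).2 !expr2.
Qed.

Lemma csm_sum (I : Type) (r : seq I) (P : pred I) (F : I -> E -> C) :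
  (forall i, P i -> csm (F i)) -> csm (fun z => \sum_(i <- r | P i) F i z).
Proof.
move=> H; elim: r => [|i r IH].
  by apply: (csm_ext _ (csm_cst 0)) => x _; rewrite big_nil.
case Pi : (P i).
  by apply: (csm_ext _ (csmD (H i Pi) IH)) => x _; rewrite big_cons Pi.
by apply: (csm_ext _ IH) => x _; rewrite big_cons Pi.
Qed.

Lemma csm_prod (I : Type) (r : seq I) (P : pred I) (F : I -> E -> C) :
  (forall i, P i -> csm (F i)) -> csm (fun z => \prod_(i <- r | P i) F i z).
Proof.
move=> H; elim: r => [|i r IH].
  by apply: (csm_ext _ (csm_cst 1)) => x _; rewrite big_nil.
case Pi : (P i).
  by apply: (csm_ext _ (csmM (H i Pi) IH)) => x _; rewrite big_cons Pi.
by apply: (csm_ext _ IH) => x _; rewrite big_cons Pi.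
Qed.

Lemma csm_real (u : E -> R) : smooth_on U u -> csm (fun z => Complex (u z) 0).
Proof. by move=> hu; apply/csmP; split; [exact: hu | exact: (smooth_cst oU 0)]. Qed.

Lemma csm_det k (M : E -> 'M[C]_k) : (forall i j, csm (fun z => M z i j)) ->
  csm (fun z => \det (M z)).
Proof.
move=> hM; apply: csm_sum => s _; apply: csmZ; apply: csm_prod => i _.
exact: hM.
Qed.

Lemma csm_adj k (M : E -> 'M[C]_k) i j : (forall i j, csm (fun z => M z i j)) ->
  csm (fun z => (\adj (M z)) i j).
Proof.
move=> hM; apply: (csm_ext (F := fun z => (-1) ^+ (j + i) *
    \det (row' j (col' i (M z))))).
  by move=> z _; rewrite mxE.
apply: csmZ; apply: csm_det => k' l.
by apply: csm_ext (hM (lift j k') (lift i l)) => z _; rewrite !mxE.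
Qed.

(** A common interface for the real partial derivatives and for [d_z] and [d_zbar]: being stable
    under constant complex combinations, it lets the sum, product and determinant rules be proved
    once. *)
Record derivation_on (D : (E -> C) -> E -> C) : Prop := Derivation {
  dv_smooth : forall F, csm F -> csm (D F);
  dv_ext : forall F G, (forall z, U z -> F z = G z) ->
     forall z, U z -> D F z = D G z;
  dv_cst : forall c z, U z -> D (fun _ => c) z = 0;
  dvD : forall F G, csm F -> csm G -> forall z, U z ->
     D (fun y => F y + G y) z = D F z + D G z;
  dvM : forall F G, csm F -> csm G -> forall z, U z ->
     D (fun y => F y * G y) z = D F z * G z + F z * D G z }.

Lemma derivation_cpartial i : derivation_on (cpartial i).
Proof.
split.
- by move=> F /csmP[h1 h2]; apply/csmP; split; exact: smooth_partial.
- move=> F G H z Uz; apply: complexE2 => /=.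
    by apply: (partial_ext oU _ Uz i).1 => y Uy; rewrite H.
  by apply: (partial_ext oU _ Uz i).1 => y Uy; rewrite H.
- by move=> c z Uz; apply: complexE2 => /=; rewrite /partial derive_cst.
- move=> F G /csmP[f1 f2] /csmP[g1 g2] z Uz.
  have a1 := @smooth_derivable R _ U _ f1 z Uz i; have a2 := @smooth_derivable R _ U _ f2 z Uz i.
  have b1 := @smooth_derivable R _ U _ g1 z Uz i; have b2 := @smooth_derivable R _ U _ g2 z Uz i.
  apply: complexE2; rewrite ?ReD ?ImD /=.
    rewrite -(partialD a1 b1).
    by congr (partial i _ z); apply/funext => y; rewrite ReD.
  rewrite -(partialD a2 b2).
  by congr (partial i _ z); apply/funext => y; rewrite ImD.
- move=> F G /csmP[f1 f2] /csmP[g1 g2] z Uz.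
  have a1 := @smooth_derivable R _ U _ f1 z Uz i; have a2 := @smooth_derivable R _ U _ f2 z Uz i.
  have b1 := @smooth_derivable R _ U _ g1 z Uz i; have b2 := @smooth_derivable R _ U _ g2 z Uz i.
  apply: complexE2; rewrite ?ReD ?ImD !(ReM, ImM) /=.
    have -> : (fun y => Re (F y * G y)) = (fun y => Re (F y) * Re (G y) -
        Im (F y) * Im (G y)) by apply/funext => y; rewrite ReM.
    by rewrite (partial_mul_sub a1 b1 a2 b2); ring.
  have -> : (fun y => Im (F y * G y)) = (fun y => Re (F y) * Im (G y) +
      Im (F y) * Re (G y)) by apply/funext => y; rewrite ImM.
  by rewrite (partial_mul_add a1 b2 a2 b1); ring.
Qed.

Lemma derivation_comb (a b : C) D1 D2 : derivation_on D1 -> derivation_on D2 ->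
  derivation_on (fun F z => a * D1 F z + b * D2 F z).
Proof.
move=> h1 h2; split.
- move=> F hF; apply: csmD; apply: csmZ; exact: dv_smooth.
- by move=> F G H z Uz; rewrite (dv_ext h1 H Uz) (dv_ext h2 H Uz).
- by move=> c z Uz; rewrite (dv_cst h1) // (dv_cst h2) // !mulr0 addr0.
- by move=> F G hF hG z Uz; rewrite (dvD h1) // (dvD h2) //; ring.
- by move=> F G hF hG z Uz; rewrite (dvM h1) // (dvM h2) //; ring.
Qed.

Lemma d_zE j : @d_z R n j = (fun F z => 2^-1 * cpartial (lshift n j) F z +
  (- Complex 0 1 / 2) * cpartial (rshift n j) F z).
Proof. by apply/funext => F; apply/funext => z; rewrite /d_z; ring. Qed.

Lemma d_zbarE j : @d_zbar R n j = (fun F z => 2^-1 * cpartial (lshift n j) F z +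
  (Complex 0 1 / 2) * cpartial (rshift n j) F z).
Proof. by apply/funext => F; apply/funext => z; rewrite /d_zbar; ring. Qed.

Lemma derivation_d_z j : derivation_on (d_z j).
Proof. by rewrite d_zE; apply: derivation_comb; exact: derivation_cpartial. Qed.

Lemma derivation_d_zbar j : derivation_on (d_zbar j).
Proof. by rewrite d_zbarE; apply: derivation_comb; exact: derivation_cpartial. Qed.

Section Derivation.
Variable D : (E -> C) -> E -> C.
Hypothesis hD : derivation_on D.

Lemma dvZ c F z : csm F -> U z -> D (fun y => c * F y) z = c * D F z.
Proof.
move=> hF Uz; rewrite (dvM hD (csm_cst c) hF Uz) (dv_cst hD) // mul0r add0r //.
Qed.

Lemma dvN F z : csm F -> U z -> D (fun y => - F y) z = - D F z.
Proof.
move=> hF Uz; rewrite -mulN1r -dvZ //.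
by apply: (dv_ext hD) => // y _; rewrite mulN1r.
Qed.

Lemma dvB F G z : csm F -> csm G -> U z ->
  D (fun y => F y - G y) z = D F z - D G z.
Proof. by move=> hF hG Uz; rewrite (dvD hD hF (csmN hG) Uz) dvN. Qed.

Lemma dv_sum (I : Type) (r : seq I) (P : pred I) (F : I -> E -> C) z :
  (forall i, P i -> csm (F i)) -> U z ->
  D (fun y => \sum_(i <- r | P i) F i y) z = \sum_(i <- r | P i) D (F i) z.
Proof.
move=> H Uz; elim: r => [|i r IH].
  rewrite big_nil -[RHS](dv_cst hD 0 Uz); apply: (dv_ext hD) => // y _.
  by rewrite big_nil.
rewrite big_cons; case Pi : (P i).
  rewrite -IH -(dvD hD) //; [|exact: H|exact: csm_sum].
  by apply: (dv_ext hD) => // y _; rewrite big_cons Pi.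
by rewrite -IH; apply: (dv_ext hD) => // y _; rewrite big_cons Pi.
Qed.

Lemma dv_prod k (F : 'I_k -> E -> C) z : (forall i, csm (F i)) -> U z ->
  D (fun y => \prod_i F i y) z = \sum_i D (F i) z * \prod_(j | j != i) F j z.
Proof.
move=> H Uz; elim: k F H => [|k IH] F H.
  rewrite big_ord0 -[RHS](dv_cst hD 1 Uz); apply: (dv_ext hD) => // y _.
  by rewrite big_ord0.
have -> : D (fun y => \prod_i F i y) z =
    D (fun y => F ord0 y * \prod_i F (lift ord0 i) y) z.
  by apply: (dv_ext hD) => // y _; rewrite big_ord_recl.
rewrite (dvM hD) //; last by apply: csm_prod => i _.
rewrite (IH (fun i => F (lift ord0 i))) // big_ord_recl; congr (_ + _).
  congr (_ * _); rewrite [RHS]big_mkcond big_ord_recl /= mul1r.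
  by apply: eq_bigr => i _.
rewrite mulr_sumr; apply: eq_bigr => i _; rewrite mulrCA; congr (_ * _).
rewrite [RHS]big_mkcond big_ord_recl /= big_mkcond; congr (_ * _).
Qed.

Lemma dvV F z : (forall z, U z -> F z != 0) -> csm F -> U z ->
  D (fun y => (F y)^-1) z = - D F z / F z ^+ 2.
Proof.
move=> F0 hF Uz.
have hV := csmV F0 hF.
have : D (fun y => F y * (F y)^-1) z = 0.
  rewrite -(dv_cst hD 1 Uz); apply: (dv_ext hD) => // y /F0 Fy.
  by rewrite divff.
rewrite (dvM hD) // => /eqP; rewrite addrC addr_eq0 => /eqP h.
apply: (mulfI (F0 z Uz)); rewrite h; field; exact: F0.
Qed.

Definition Dmx k l (M : E -> 'M[C]_(k, l)) z : 'M[C]_(k, l) :=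
  \matrix_(i, j) D (fun y => M y i j) z.

Lemma dv_det_row k (M : E -> 'M[C]_k) z : (forall i j, csm (fun z => M z i j)) ->
  U z -> D (fun y => \det (M y)) z =
  \sum_p \det (setrow (M z) p (fun j => D (fun y => M y p j) z)).
Proof.
move=> hM Uz; rewrite /determinant dv_sum //; last first.
  by move=> s _; apply: csmZ; apply: csm_prod => i _.
rewrite exchange_big /=; apply: eq_bigr => s _.
rewrite dvZ //; last by apply: csm_prod => i _.
rewrite dv_prod // mulr_sumr; apply: eq_bigr => p _; congr (_ * _).
rewrite [RHS](bigD1 p) //= mxE eqxx; congr (_ * _).
by apply: eq_bigr => i /negPf ip; rewrite mxE ip.
Qed.

(** Jacobi's formula, in the trace form in which [\adj (M z)] later plays the part of [M^(n-1)]. *)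
Lemma dv_det k (M : E -> 'M[C]_k) z : (forall i j, csm (fun z => M z i j)) ->
  U z -> D (fun y => \det (M y)) z = \tr (\adj (M z) *m Dmx M z).
Proof.
move=> hM Uz; rewrite dv_det_row // mxtrace_mulC; apply: eq_bigr => p _.
rewrite det_setrow mxE; apply: eq_bigr => j _; rewrite !mxE //.
Qed.

End Derivation.

Section Piola.
Variable D : 'I_n -> (E -> C) -> E -> C.
Hypothesis hD : forall j, derivation_on (D j).

(** With the adjugate written by row replacement, the derivative falls on the rows [p] different
    from [j], the replaced row being constant. Closedness makes the resulting determinants change
    sign when [j] and [p] are exchanged, so their sum vanishes. This removes the derivatives of
    [\adj (M z)] from integrations by parts. *)
Lemma piola (M : E -> 'M[C]_n) z l : (forall i j, csm (fun z => M z i j)) ->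
  U z -> (forall j p q, D j (fun y => M y p q) z = D p (fun y => M y j q) z) ->
  \sum_j D j (fun y => (\adj (M y)) l j) z = 0.
Proof.
move=> hM Uz cl.
pose e : 'I_n -> C := fun q => (q == l)%:R.
pose X j p := \det (setrow (setrow (M z) j e) p (fun q => D j (fun y => M y p q) z)).
have adjE A j : (\adj A) l j = \det (setrow A j e) by exact: adj_setrow.
have step j : D j (fun y => (\adj (M y)) l j) z = \sum_(p | p != j) X j p.
  have -> : D j (fun y => (\adj (M y)) l j) z = D j (fun y => \det (setrow (M y) j e)) z.
    by apply: (dv_ext (hD j)) Uz => y _; exact: adjE.
  have hS a b : csm (fun y => setrow (M y) j e a b).
    case aj : (a == j).
      by apply: csm_ext (csm_cst (e b)) => y _; rewrite mxE aj.
    by apply: csm_ext (hM a b) => y _; rewrite mxE aj.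
  rewrite (dv_det_row (hD j)) // (bigD1 j) //= det_setrow big1 ?add0r.
    apply: eq_bigr => p pj; congr (\det (setrow _ p _)); apply/funext => q.
    by apply: (dv_ext (hD j)) => // y _; rewrite mxE (negPf pj).
  move=> q _.
  have -> : D j (fun y => setrow (M y) j e j q) z = D j (fun _ => e q) z.
    by apply: (dv_ext (hD j)) Uz => y _; rewrite mxE eqxx.
  by rewrite (dv_cst (hD j)) // mul0r.
rewrite (eq_bigr _ (fun j _ => step j)).
set S := \sum_j _.
have : S = - S.
  rewrite {1}/S; under eq_bigr do rewrite big_mkcond.
  rewrite exchange_big /= -sumrN; apply: eq_bigr => j _.
  rewrite -sumrN [RHS]big_mkcond /=; apply: eq_bigr => p _.
  rewrite eq_sym; case: eqVneq => //= pj.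
  have e1 : (fun q => D j (fun y => M y p q) z) = (fun q => D p (fun y => M y j q) z).
    by apply/funext => q; rewrite cl.
  by rewrite /X e1; exact: (det_setrow_swap _ _ _ pj).
move/eqP; rewrite -addr_eq0 -mulr2n mulrn_eq0 /= => /eqP //.
Qed.

End Piola.

Definition commute_on (D D' : (E -> C) -> E -> C) := forall F z, csm F -> U z ->
  D (D' F) z = D' (D F) z.

Lemma commute_cpartial i j : commute_on (cpartial i) (cpartial j).
Proof.
move=> F z /csmP[h1 h2] Uz; apply: complexE2 => /=; exact: (clairaut oU).
Qed.

Lemma commute_comb a b D1 D2 D' : derivation_on D1 -> derivation_on D2 ->
  derivation_on D' -> commute_on D1 D' -> commute_on D2 D' ->
  commute_on (fun F z => a * D1 F z + b * D2 F z) D'.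
Proof.
move=> h1 h2 h' c1 c2 F z hF Uz.
have s1 := dv_smooth h1 hF; have s2 := dv_smooth h2 hF.
rewrite (dvD h' (csmZ a s1) (csmZ b s2) Uz).
by rewrite (dvZ h' a s1 Uz) (dvZ h' b s2 Uz) c1 // c2.
Qed.

Lemma commute_sym D D' : commute_on D D' -> commute_on D' D.
Proof. by move=> h F z hF Uz; rewrite h. Qed.

Lemma commute_dz_cpartial j i : commute_on (d_z j) (cpartial i).
Proof.
rewrite d_zE; apply: commute_comb; try exact: derivation_cpartial;
  exact: commute_cpartial.
Qed.

Lemma commute_dzbar_cpartial j i : commute_on (d_zbar j) (cpartial i).
Proof.
rewrite d_zbarE; apply: commute_comb; try exact: derivation_cpartial;
  exact: commute_cpartial.
Qed.

Lemma commute_dz_dz j l : commute_on (d_z j) (d_z l).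
Proof.
rewrite [d_z j]d_zE; apply: commute_comb; try exact: derivation_cpartial.
- exact: derivation_d_z.
- by apply: commute_sym; exact: commute_dz_cpartial.
- by apply: commute_sym; exact: commute_dz_cpartial.
Qed.

Lemma commute_dz_dzbar j l : commute_on (d_z j) (d_zbar l).
Proof.
rewrite d_zE; apply: commute_comb; try exact: derivation_cpartial.
- exact: derivation_d_zbar.
- by apply: commute_sym; exact: commute_dzbar_cpartial.
- by apply: commute_sym; exact: commute_dzbar_cpartial.
Qed.

Lemma commute_dzbar_dzbar j l : commute_on (d_zbar j) (d_zbar l).
Proof.
rewrite [d_zbar j]d_zbarE; apply: commute_comb; try exact: derivation_cpartial.
- exact: derivation_d_zbar.
- by apply: commute_sym; exact: commute_dzbar_cpartial.
- by apply: commute_sym; exact: commute_dzbar_cpartial.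
Qed.

Lemma conj_I : (Complex 0 1 : C)^* = - Complex 0 1.
Proof. by apply: complexE2 => /=; rewrite ?oppr0. Qed.

Lemma conj_half : (2^-1 : C)^* = 2^-1.
Proof. by rewrite fmorphV /= rmorph_nat. Qed.

Lemma cpartial_conj i F z : csm F -> U z ->
  cpartial i (fun y => (F y)^*) z = (cpartial i F z)^*.
Proof.
move=> /csmP[h1 h2] Uz; apply: complexE2; rewrite ?Re_conj ?Im_conj /=.
  by congr partial; apply/funext => y; rewrite Re_conj.
have -> : (fun y => Im ((F y)^*)) = - (fun y => Im (F y)).
  by apply/funext => y; rewrite Im_conj.
by rewrite /partial deriveN //; exact: (smooth_derivable h2 Uz).
Qed.

Lemma d_z_conj j F z : csm F -> U z ->
  d_z j (fun y => (F y)^*) z = (d_zbar j F z)^*.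
Proof.
move=> hF Uz; rewrite d_zE d_zbarE (cpartial_conj _ hF Uz) (cpartial_conj _ hF Uz).
move: (cpartial _ F z) (cpartial _ F z) => x y.
by rewrite rmorphD !rmorphM /= conj_half conj_I.
Qed.

Lemma d_zbar_conj j F z : csm F -> U z ->
  d_zbar j (fun y => (F y)^*) z = (d_z j F z)^*.
Proof.
move=> hF Uz; rewrite d_zE d_zbarE (cpartial_conj _ hF Uz) (cpartial_conj _ hF Uz).
move: (cpartial _ F z) (cpartial _ F z) => x y.
by rewrite rmorphD !rmorphM /= conj_half rmorphN /= conj_I opprK.
Qed.

Lemma csm_ln (u : E -> R) : (forall z, U z -> 0 < u z) -> smooth_on U u ->
  csm (fun z => Complex (ln (u z)) 0).
Proof. by move=> u0 hu; apply: csm_real; exact: smooth_ln. Qed.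

Lemma cpartial_ln i (u : E -> R) z : (forall z, U z -> 0 < u z) ->
  smooth_on U u -> U z ->
  cpartial i (fun y => Complex (ln (u y)) 0) z =
  cpartial i (fun y => Complex (u y) 0) z / Complex (u z) 0.
Proof.
move=> u0 hu Uz; apply: (mulIf (x := Complex (u z) 0)).
  by apply/eqP => -[] h; have := u0 z Uz; rewrite h ltxx.
rewrite divfK; last by apply/eqP => -[] h; have := u0 z Uz; rewrite h ltxx.
have u1 : u z != 0 by rewrite gt_eqF // u0.
apply: complexE2; rewrite ?ReM ?ImM /= /partial !derive_cst.
  rewrite mulr0 subr0 -[X in X * _]/(partial i (fun y => ln (u y)) z).
  by rewrite (@partial_ln R _ U u z i Uz u0 hu) mulrAC mulVf // mul1r.
by rewrite mulr0 mul0r addr0.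
Qed.

Lemma d_z_ln j (u : E -> R) z : (forall z, U z -> 0 < u z) ->
  smooth_on U u -> U z ->
  d_z j (fun y => Complex (ln (u y)) 0) z =
  d_z j (fun y => Complex (u y) 0) z / Complex (u z) 0.
Proof. by move=> u0 hu Uz; rewrite d_zE !cpartial_ln // mulrDl !mulrA. Qed.

Lemma d_zbar_ln j (u : E -> R) z : (forall z, U z -> 0 < u z) ->
  smooth_on U u -> U z ->
  d_zbar j (fun y => Complex (ln (u y)) 0) z =
  d_zbar j (fun y => Complex (u y) 0) z / Complex (u z) 0.
Proof. by move=> u0 hu Uz; rewrite d_zbarE !cpartial_ln // mulrDl !mulrA. Qed.

End ComplexCalculus.
Notation csm := csmooth_on.

(** * Determinants of pencils and mixed discriminants *)

Section DeterminantPencil.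
Variable A0 : comNzRingType.

Lemma deriv_prod k (F : 'I_k -> {poly A0}) :
  (\prod_i F i)^`() = \sum_i (F i)^`() * \prod_(j | j != i) F j.
Proof.
elim: k F => [|k IH] F; first by rewrite !big_ord0 derivC.
rewrite big_ord_recl derivM IH big_ord_recl; congr (_ + _).
  congr (_ * _); rewrite [RHS]big_mkcond big_ord_recl /= mul1r.
  by apply: eq_bigr => i _.
rewrite mulr_sumr; apply: eq_bigr => i _; rewrite mulrCA; congr (_ * _).
by rewrite [RHS]big_mkcond big_ord_recl /= big_mkcond; congr (_ * _).
Qed.

Lemma deriv_det k (M : 'M[{poly A0}]_k) :
  (\det M)^`() = \tr (\adj M *m map_mx (fun p => p^`()) M).
Proof.
rewrite mxtrace_mulC.
transitivity (\sum_p \det (setrow M p (fun j => (M p j)^`()))).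
  rewrite raddf_sum /= exchange_big /=; apply: eq_bigr => s _.
  rewrite -(rmorph_sign (polyC : A0 -> {poly A0})) mul_polyC derivZ deriv_prod.
  rewrite scaler_sumr; apply: eq_bigr => p _; rewrite -mul_polyC; congr (_ * _).
  rewrite [RHS](bigD1 p) //= mxE eqxx; congr (_ * _).
  by apply: eq_bigr => i /negPf ip; rewrite mxE ip.
apply: eq_bigr => p _; rewrite det_setrow mxE; apply: eq_bigr => j _.
by rewrite !mxE.
Qed.

Definition pencil_mx k (M U : 'M[A0]_k) : 'M[{poly A0}]_k :=
  map_mx polyC M + 'X *: map_mx polyC U.

(** Its coefficient of [X^q] is, up to factorials, the wedge of [q] copies of [U] and [k - q] copies
    of [M] ([wedge_coefE]), so one polynomial stands for all mixed discriminants of the pair. *)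
Definition pencil k (M U : 'M[A0]_k) : {poly A0} := \det (pencil_mx M U).

Lemma pencil_mx_eval k (M U : 'M[A0]_k) t :
  map_mx (horner_eval t) (pencil_mx M U) = M + t *: U.
Proof.
by apply/matrixP => i j; rewrite !mxE /horner_eval !hornerE.
Qed.

Lemma pencil_eval k (M U : 'M[A0]_k) t : (pencil M U).[t] = \det (M + t *: U).
Proof.
by rewrite -[LHS]/(horner_eval t _) /pencil -det_map_mx pencil_mx_eval.
Qed.

Lemma pencil0 k (M U : 'M[A0]_k) : (pencil M U)`_0 = \det M.
Proof. by rewrite -horner_coef0 pencil_eval scale0r addr0. Qed.

Lemma pencil1 k (M U : 'M[A0]_k) : (pencil M U)`_1 = \tr (\adj M *m U).
Proof.
have -> : (pencil M U)`_1 = ((pencil M U)^`()).[0].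
  by rewrite horner_coef0 coef_deriv.
rewrite /pencil deriv_det -[LHS]/(horner_eval 0 _).
rewrite -trace_map_mx map_mxM map_mx_adj pencil_mx_eval scale0r addr0.
congr (\tr (_ *m _)); apply/matrixP => i j.
by rewrite /pencil_mx !mxE /horner_eval derivD derivC derivM derivX derivC
  add0r mul1r mulr0 addr0; exact: hornerC.
Qed.

Lemma pencil_congr k (J M U K : 'M[A0]_k) :
  pencil (J *m M *m K) (J *m U *m K) = (\det J * \det K)%:P * pencil M U.
Proof.
rewrite /pencil; have -> : pencil_mx (J *m M *m K) (J *m U *m K) =
    map_mx polyC J *m pencil_mx M U *m map_mx polyC K.
  by rewrite /pencil_mx !map_mxM mulmxDr mulmxDl -scalemxAr -scalemxAl.
by rewrite !det_mulmx !det_map_mx polyCM mulrAC.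
Qed.

Lemma adj_congr k (J M U K : 'M[A0]_k) :
  \tr (\adj (J *m M *m K) *m (J *m U *m K)) =
  \det J * \det K * \tr (\adj M *m U).
Proof. by rewrite -!pencil1 pencil_congr coefCM. Qed.

Lemma size_pencil k (M U : 'M[A0]_k) : (size (pencil M U) <= k.+1)%N.
Proof.
rewrite /pencil /determinant; apply: (leq_trans (size_sum _ _ _)).
apply/bigmax_leqP => s _.
rewrite -(rmorph_sign (polyC : A0 -> {poly A0})) mul_polyC.
apply: leq_trans (size_scale_leq _ _) _.
apply: leq_trans (size_prod_leq _ _) _.
rewrite cardT size_enum_ord leq_subLR -[X in (_ <= X + _)%N]card_ord addnS ltnS.
rewrite -sum1_card -[X in (_ <= _ + X)%N](card_ord k) -sum1_card -big_split /=.
apply: leq_sum => i _; rewrite !mxE addn1.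
apply: leq_trans (size_polyD _ _) _; rewrite geq_max.
rewrite (leq_trans (size_polyC_leq1 _)) //=.
by apply: leq_trans (size_polyMleq _ _) _; rewrite size_polyX add2n /= ltnS size_polyC_leq1.
Qed.

Lemma adj_diag k (d : 'I_k -> A0) (U : 'M[A0]_k) :
  \tr (\adj (\matrix_(i, j) (d i *+ (i == j))) *m U) =
  \sum_j U j j * \prod_(l | l != j) d l.
Proof.
set M := \matrix_(i, j) _.
have adjE l j : (\adj M) l j = (\prod_(q | q != j) d q) *+ (l == j).
  rewrite adj_setrow; have [->|lj] := eqVneq l j.
    have -> : setrow M j (fun q => (q == j)%:R) =
        diag_mx (\row_i (if i == j then 1 else d i)).
      apply/matrixP => a b; rewrite !mxE.
      case: (eqVneq a j) => [->|aj]; last by rewrite (eq_sym a b) eq_sym.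
      by rewrite eq_sym.
    rewrite det_diag (bigD1 j) //= mxE eqxx mul1r.
    by apply: eq_bigr => q /negPf qj; rewrite mxE qj.
  rewrite (expand_det_col _ j) big1 ?mulr0n // => i _; rewrite !mxE.
  have [ij|ij] := eqVneq i j; first by rewrite eq_sym (negPf lj) mul0r.
  by rewrite mulr0n mul0r.
apply: eq_bigr => j _; rewrite mxE (bigD1 j) //= big1 ?addr0.
  by rewrite adjE eqxx mulrC.
by move=> l lj; rewrite adjE eq_sym (negPf lj) mul0r.
Qed.

End DeterminantPencil.

(** * Wedge products of (1,1)-forms as coefficients of a pencil *)

Section MixedDiscriminant.
Variables (R : realType) (n : nat).
Notation C := R[i].

(** The positions of [A] form an arbitrary set, because expanding the determinant of the pencil over
    subsets produces all of them. *)
Definition wedge_set (S : {set 'I_n}) (A B : 'M[C]_n) : C :=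
  wedge_coef (fun l => if l \in S then A else B).

(** Relabelling the factors permutes the [dz]'s and the [dzbar]'s simultaneously; the two signs
    cancel since two-forms commute. *)
Lemma wedge_set_perm (S : {set 'I_n}) (s : 'S_n) A B :
  wedge_set (s @: S) A B = wedge_set S A B.
Proof.
rewrite /wedge_set /wedge_coef.
have sgnM (x : 'S_n) : (-1) ^+ (s^-1 * x)%g = (-1) ^+ (s^-1)%g * (-1) ^+ x :> C.
  by rewrite odd_permM signr_addb.
rewrite [LHS](reindex_inj (mulgI (s^-1)%g)) /=; apply: eq_bigr => u _.
rewrite [LHS](reindex_inj (mulgI (s^-1)%g)) /=; apply: eq_bigr => v _.
rewrite !sgnM mulrACA -expr2 sqrr_sign mul1r; congr (_ * _).
rewrite (reindex_inj (@perm_inj _ s)) /=; apply: eq_bigr => l _.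
by rewrite !permM !permK mem_imset //; exact: perm_inj.
Qed.

Lemma perm_of_cards (S T : {set 'I_n}) : #|S| = #|T| ->
  exists s : 'S_n, s @: S = T.
Proof.
move=> ST; pose e (S : {set 'I_n}) := enum S ++ enum (~: S).
have ue V : uniq (e V).
  rewrite cat_uniq !enum_uniq andbT /=; apply/hasPn => x.
  by rewrite !mem_enum inE.
have me V x : x \in e V by rewrite mem_cat !mem_enum inE orbN.
have se V : size (e V) = n by rewrite size_cat -!cardE cardsC card_ord.
case: (posnP n) => [n0|n0].
  exists 1%g; apply/setP => x; have := ltn_ord x.
  by rewrite [X in (_ < X)%N]n0 ltn0.
pose x0 := Ordinal n0.
pose f x := nth x0 (e T) (index x (e S)).
have fi : injective f.
  have iS x : (index x (e S) < n)%N by rewrite -[X in (_ < X)%N](se S) index_mem.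
  move=> x y; rewrite /f => /eqP; rewrite nth_uniq ?se //.
  by move=> /eqP /(congr1 (nth x0 (e S))); rewrite !nth_index.
exists (perm fi); apply/eqP; rewrite eqEcard card_imset; last exact: perm_inj.
rewrite [X in (_ <= X)%N]ST leqnn andbT.
apply/fintype.subsetP => _ /imsetP[x xS ->].
rewrite permE /f /e index_cat mem_enum xS nth_cat -cardE -ST cardE.
by rewrite index_mem mem_enum xS -mem_enum mem_nth // -cardE -ST cardE index_mem mem_enum.
Qed.

Lemma wedge_coef_cst (M : 'M[{poly C}]_n) :
  \sum_(s : 'S_n) \sum_(t : 'S_n) (-1) ^+ s * (-1) ^+ t *
    \prod_l M (s l) (t l) = n`!%:R * \det M.
Proof.
rewrite -(card_Sn n) -sum1_card natr_sum mulr_suml.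
apply: eq_bigr => s _; rewrite mul1r /determinant.
rewrite (reindex_inj (mulgI s)) /=; apply: eq_bigr => t _.
rewrite odd_permM signr_addb mulrA -expr2 sqrr_sign mul1r; congr (_ * _).
rewrite [RHS](reindex_inj (@perm_inj _ s)) /=.
by apply: eq_bigr => l _; rewrite permM.
Qed.

(** Expanding [n! * det (B + X A)] as a double sum over permutations and each product over subsets,
    the coefficient of [X^q] is a sum of ['C(n, q)] equal terms, one for each subset of size [q]. *)
Lemma wedge_coefE q (A B : 'M[C]_n) : (q <= n)%N ->
  wedge_coef (fun l : 'I_n => if (l < q)%N then A else B) =
  (q`! * (n - q)`!)%:R * (pencil B A)`_q.
Proof.
move=> qn; set W := wedge_coef _.
pose S0 := [set l : 'I_n | (l < q)%N]%SET.
have WS (S : {set 'I_n}) : #|S| = q -> wedge_set S A B = W.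
  move=> Sq; have [|s <-] := @perm_of_cards S0 S.
    rewrite Sq -[RHS](card_ord q) -sum1_card.
    rewrite (eq_bigl (fun l : 'I_n => (l < q)%N)) => [|l]; last by rewrite inE.
    by rewrite -(big_ord_widen _ (fun _ => 1%N) qn) sum1_card.
  rewrite wedge_set_perm /wedge_set /W; congr wedge_coef.
  by apply/funext => l; rewrite inE.
have E : n`!%:R * (pencil B A)`_q = 'C(n, q)%:R * W.
  have -> : n`!%:R * (pencil B A)`_q = (n`!%:R * pencil B A)`_q.
    by rewrite -polyC_natr coefCM.
  rewrite -wedge_coef_cst.
  have X (s t : 'S_n) : \prod_l pencil_mx B A (s l) (t l) =
      \sum_(S : {set 'I_n}) (\prod_l (if l \in S then A else B) (s l) (t l)) *: 'X^#|S|.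
    transitivity (\prod_l (('X * (A (s l) (t l))%:P) + (B (s l) (t l))%:P)).
      by apply: eq_bigr => l _; rewrite !mxE addrC.
    rewrite bigA_distr; apply: eq_bigr => S _.
    rewrite -sum1_card (big_morph (fun k => 'X^k) (exprD 'X) (expr0 'X)).
    rewrite -mul_polyC rmorph_prod big_mkcond /= [X in _ * X]big_mkcond -big_split /=.
    by apply: eq_bigr => l _; case: ifP; rewrite ?mulr1 // mulrC.
  have T : \sum_(s : 'S_n) \sum_(t : 'S_n) (-1) ^+ s * (-1) ^+ t *
      \prod_l pencil_mx B A (s l) (t l) =
      \sum_(S : {set 'I_n}) wedge_set S A B *: 'X^#|S|.
    rewrite /wedge_set /wedge_coef.
    under [RHS]eq_bigr do rewrite scaler_suml.
    rewrite [RHS]exchange_big /=; apply: eq_bigr => s _.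
    under [RHS]eq_bigr do rewrite scaler_suml.
    rewrite [RHS]exchange_big /=; apply: eq_bigr => t _.
    rewrite X mulr_sumr; apply: eq_bigr => S _.
    by rewrite -[RHS]scalerA -[RHS]mul_polyC rmorphM /= !rmorph_sign.
  rewrite T coef_sum (bigID (fun S : {set 'I_n} => #|S| == q)) /=.
  rewrite [X in _ + X]big1 ?addr0 => [|S /negPf Sq]; last first.
    by rewrite coefZ coefXn eq_sym Sq mulr0.
  rewrite (eq_bigr (fun _ => W)) => [|S /eqP Sq]; last first.
    by rewrite coefZ coefXn Sq eqxx mulr1 WS.
  rewrite sumr_const mulr_natl; congr (_ *+ _).
  by rewrite -[in RHS](card_ord n) -card_draws; apply: eq_card => S; rewrite inE.
have f0 : ('C(n, q)%:R : C) != 0 by rewrite pnatr_eq0 -lt0n bin_gt0.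
by apply: (mulfI f0); rewrite -E -(bin_fact qn) !natrM !mulrA.
Qed.

Lemma wedge_powE q (A B : 'M[C]_n) : (q <= n)%N ->
  wedge_pow q A B = (q`! * (n - q)`!)%:R * complex.Re ((pencil B A)`_q).
Proof.
move=> qn; rewrite /wedge_pow wedge_coefE //.
have Re_nat (k : nat) (x : C) : complex.Re (k%:R * x) = k%:R * complex.Re x.
  by rewrite !mulr_natl raddfMn.
exact: Re_nat.
Qed.

Lemma top_powE (A : 'M[C]_n) : top_pow A = n`!%:R * complex.Re (\det A).
Proof.
have H (x : C) : complex.Re (n`!%:R * x) = n`!%:R * complex.Re x.
  by rewrite !mulr_natl raddfMn.
rewrite /top_pow /wedge_pow /wedge_coef -H; congr complex.Re.
rewrite -(card_Sn n) -sum1_card natr_sum mulr_suml.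
apply: eq_bigr => s _; rewrite mul1r /determinant.
rewrite (reindex_inj (mulgI s)) /=; apply: eq_bigr => t _.
rewrite odd_permM signr_addb mulrA -expr2 sqrr_sign mul1r; congr (_ * _).
rewrite [RHS](reindex_inj (@perm_inj _ s)) /=.
by apply: eq_bigr => l _; rewrite permM ltn_ord.
Qed.

End MixedDiscriminant.

(** * Positive hermitian matrices *)

Section PositiveMatrices.
Variable R : realType.
Notation C := R[i].

Definition ct m k (M : 'M[C]_(m, k)) : 'M[C]_(k, m) := (map_mx Num.conj M)^T.

Lemma ctE m k (M : 'M[C]_(m, k)) i j : ct M i j = (M j i)^*.
Proof. by rewrite !mxE. Qed.

Lemma ctM m k l (M : 'M[C]_(m, k)) (N : 'M[C]_(k, l)) :
  ct (M *m N) = ct N *m ct M.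
Proof. by rewrite /ct map_mxM trmx_mul. Qed.

Lemma ctK m k (M : 'M[C]_(m, k)) : ct (ct M) = M.
Proof. by apply/matrixP => i j; rewrite !ctE conjCK. Qed.

Lemma ctD m k (M N : 'M[C]_(m, k)) : ct (M + N) = ct M + ct N.
Proof. by apply/matrixP => i j; rewrite !mxE rmorphD. Qed.

Lemma det_ct m (M : 'M[C]_m) : \det (ct M) = (\det M)^*.
Proof. by rewrite /ct det_tr det_map_mx. Qed.

Lemma ct_unit m (M : 'M[C]_m) : (ct M \in unitmx) = (M \in unitmx).
Proof. by rewrite !unitmxE det_ct !unitfE conjC_eq0. Qed.

Lemma ct_inv m (M : 'M[C]_m) : ct (invmx M) = invmx (ct M).
Proof. by rewrite /ct map_invmx trmx_inv. Qed.

Lemma mx_normsq m k (M : 'M[C]_(m, k)) :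
  \tr (ct M *m M) = \sum_j \sum_i `|M i j| ^+ 2.
Proof.
apply: eq_bigr => j _; rewrite mxE; apply: eq_bigr => i _.
by rewrite ctE mulrC normCK.
Qed.

Lemma mx_normsq_ge0 m k (M : 'M[C]_(m, k)) : 0 <= \tr (ct M *m M).
Proof.
by rewrite mx_normsq; apply: sumr_ge0 => j _; apply: sumr_ge0 => i _; rewrite exprn_ge0.
Qed.

Lemma mx_normsq_eq0 m k (M : 'M[C]_(m, k)) : \tr (ct M *m M) = 0 -> M = 0.
Proof.
rewrite mx_normsq => /eqP; rewrite psumr_eq0 => [|j _]; last first.
  by apply: sumr_ge0 => i _; rewrite exprn_ge0.
move=> /allP H; apply/matrixP => i j; rewrite mxE.
have /implyP/(_ isT) := H j (mem_index_enum j).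
rewrite psumr_eq0 => [/allP/(_ i (mem_index_enum i))|k' _]; last by rewrite exprn_ge0.
by rewrite sqrf_eq0 normr_eq0 => /eqP.
Qed.

Variable n : nat.
Implicit Types W : 'M[C]_n.

Definition herm W : Prop := ct W = W.

Lemma posdef_congr W P : P \in unitmx -> posdef W -> posdef (P *m W *m ct P).
Proof.
move=> uP pW v v0.
have v'0 : v *m P != 0.
  apply: contra v0 => /eqP h; apply/eqP.
  by rewrite -[v](mulmxK uP) h mul0mx.
have := pW _ v'0; rewrite -[(map_mx Num.conj (v *m P))^T]/(ct (v *m P)) ctM.
by rewrite !mulmxA.
Qed.

Lemma herm_congr W P : herm W -> herm (P *m W *m ct P).
Proof. by move=> hW; rewrite /herm !ctM ctK hW mulmxA. Qed.

Lemma spectral_posdef W : herm W -> posdef W ->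
  exists (P : 'M[C]_n) (d : 'I_n -> C), [/\ P *m ct P = 1%:M, P \in unitmx,
    forall j, 0 < d j & W = ct P *m diag_mx (\row_j d j) *m P].
Proof.
move=> hW pW.
have W_herm : W \is hermsymmx.
  apply/is_hermitianmxP; rewrite expr0 scale1r -[LHS]hW.
  by apply/matrixP => i j; rewrite !mxE.
have /hermitian_normalmx/orthomx_spectralP EW := W_herm.
set P := spectralmx W in EW; set s := spectral_diag W in EW.
have uP := spectral_unit W; have unP := spectral_unitarymx W.
have cP : ct P = invmx P.
  rewrite (invmx_unitary unP); apply/matrixP => i j; rewrite !mxE //.
have PP : P *m ct P = 1%:M by rewrite cP mulmxV.
exists P, (fun j => s 0 j); split; [exact: PP|exact: uP| |]; last first.
  rewrite cP {1}EW; congr (_ *m diag_mx _ *m _).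
  by apply/rowP => j; rewrite mxE.
move=> j.
have v0 : row j P != 0.
  apply/eqP => h; have : row j (P *m invmx P) = 0 by rewrite row_mul h mul0mx.
  rewrite mulmxV // => /rowP /(_ j); rewrite !mxE eqxx => /eqP.
  by rewrite oner_eq0.
have := pW _ v0; rewrite -[(map_mx Num.conj _)^T]/(ct (row j P)).
suff -> : row j P *m W *m ct (row j P) = (s 0 j)%:M by rewrite mxE eqxx.
have -> : ct (row j P) = col j (ct P) by apply/matrixP => a b; rewrite !mxE.
have -> : row j P *m W = row j (diag_mx s *m P).
  by rewrite EW -row_mul !mulmxA mulmxV // mul1mx.
have -> : row j (diag_mx s *m P) *m col j (ct P) = row j (diag_mx s) *m col j 1%:M.
  by rewrite row_mul -mulmxA; congr (_ *m _); rewrite !colE mulmxA PP.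
apply/matrixP => a b; rewrite !ord1 !mxE (bigD1 j) //= big1 ?addr0.
  by rewrite !mxE !eqxx mulr1 mulr1n.
by move=> i ij; rewrite !mxE [j == i]eq_sym (negPf ij) mulr0n mul0r.
Qed.

Lemma posdef_factor W : herm W -> posdef W ->
  exists2 P : 'M[C]_n, P \in unitmx & W = P *m ct P.
Proof.
move=> hW pW; have [P [d [PP uP d0 EW]]] := spectral_posdef hW pW.
pose D := diag_mx (\row_j sqrtC (d j)).
have cD : ct D = D.
  apply/matrixP => i j; rewrite ctE !mxE eq_sym; case: eqP => [->|_].
    by rewrite !mulr1n geC0_conj // sqrtC_ge0 ltW.
  by rewrite !mulr0n conjC0.
exists (ct P *m D).
  rewrite unitmx_mul ct_unit uP unitmxE det_diag unitfE.
  by apply/prodf_neq0 => i _; rewrite mxE sqrtC_eq0 gt_eqF.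
rewrite ctM ctK cD EW mulmxA; congr (_ *m _); rewrite -mulmxA; congr (_ *m _).
rewrite mul_diag_mx; apply/matrixP => i j; rewrite !mxE.
case: eqP => [->|_]; last by rewrite !mulr0n mulr0.
by rewrite !mulr1n -expr2 sqrtCK.
Qed.

Lemma posdef_unit W : herm W -> posdef W -> W \in unitmx.
Proof.
by move=> hW pW; have [P uP ->] := posdef_factor hW pW; rewrite unitmx_mul ct_unit uP.
Qed.

Lemma posdef_det_gt0 W : herm W -> posdef W -> 0 < \det W.
Proof.
move=> hW pW; have [P uP ->] := posdef_factor hW pW.
rewrite det_mulmx det_ct -normCK exprn_gt0 // normr_gt0.
by move: uP; rewrite unitmxE unitfE.
Qed.

(** Factor [W0 = P0 *m ct P0], bring [W1] to the corresponding coordinates and diagonalise it there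
    by a unitary matrix, which leaves the identity in place. *)
Lemma simultaneous_diag W0 W1 : herm W0 -> posdef W0 -> herm W1 -> posdef W1 ->
  exists (P : 'M[C]_n) (d : 'I_n -> C), [/\ P \in unitmx, forall j, 0 < d j,
    W0 = P *m ct P & W1 = P *m diag_mx (\row_j d j) *m ct P].
Proof.
move=> h0 p0 h1 p1; have [P0 uP0 E0] := posdef_factor h0 p0.
pose W1' := invmx P0 *m W1 *m ct (invmx P0).
have uI : invmx P0 \in unitmx by rewrite unitmx_inv.
have [S [d [SS uS d0 E1]]] :=
  spectral_posdef (herm_congr (invmx P0) h1) (posdef_congr uI p1).
have SS' : ct S *m S = 1%:M by rewrite (mulmx1C SS).
exists (P0 *m ct S), d; split=> //.
- by rewrite unitmx_mul uP0 ct_unit.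
- by rewrite ctM ctK mulmxA -(mulmxA P0) SS' mulmx1.
rewrite ctM ctK !mulmxA -(mulmxA P0) -(mulmxA P0) -(mulmxA P0) mulmxA -E1.
rewrite ct_inv !mulmxA mulmxV // mul1mx mulmxKV //.
by rewrite ct_unit.
Qed.

Lemma posdef_inv_tr_factor W : herm W -> posdef W ->
  exists2 S : 'M[C]_n, S \in unitmx & invmx W = S *m ct S.
Proof.
move=> hW pW; have [P uP ->] := posdef_factor hW pW.
exists (ct (invmx P)); first by rewrite ct_unit unitmx_inv.
have u : P *m ct P \in unitmx by rewrite unitmx_mul ct_unit uP.
have E : (P *m ct P) *m (ct (invmx P) *m invmx P) = 1%:M.
  rewrite ct_inv mulmxA -(mulmxA P) mulmxV ?ct_unit // mulmx1 mulmxV //.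
by rewrite ctK -[RHS]mul1mx -(mulVmx u) -mulmxA E mulmx1.
Qed.

(* With B_kj = dbar_k v^j, the matrix B *m W is symmetric by the Kaehler
   identity. *)
Lemma dbar_norm_ge0 W (B : 'M[C]_n) : herm W -> posdef W ->
  (B *m W)^T = B *m W ->
  0 <= \tr (map_mx Num.conj B *m B) /\
  (\tr (map_mx Num.conj B *m B) = 0 -> B = 0).
Proof.
move=> hW pW sB; have uW := posdef_unit hW pW.
have [S uS ES] := posdef_inv_tr_factor hW pW.
have [T defT] : exists T, T = B *m W by exists (B *m W).
pose Y := S^T *m T *m S.
have BE : B = T *m (S *m ct S) by rewrite -ES defT mulmxK.
have cT : map_mx Num.conj T = ct T by rewrite /ct map_trmx defT sB.
have cB : map_mx Num.conj B = ct T *m map_mx Num.conj S *m S^T.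
  rewrite [in LHS]BE map_mxM cT map_mxM mulmxA; congr (_ *m _).
  by apply/matrixP => i j; rewrite mxE ctE mxE; exact: conjCK.
have E : \tr (map_mx Num.conj B *m B) = \tr (ct Y *m Y).
  rewrite cB {1}BE /Y !ctM.
  have -> : ct S^T = map_mx Num.conj S by rewrite /ct map_trmx trmxK.
  have gen (x y t v s s' : 'M[C]_n) :
      \tr (x *m y *m t *m (v *m (s *m s'))) = \tr (s' *m (x *m y) *m (t *m v *m s)).
    by rewrite !mulmxA mxtrace_mulC !mulmxA.
  exact: gen.
split; first by rewrite E mx_normsq_ge0.
rewrite E => /mx_normsq_eq0 Y0.
have T0 : T = 0.
  have uST : S^T \in unitmx by rewrite unitmx_tr.
  by rewrite -[T](mulKmx uST) -[S^T *m T](mulmxK uS) -/Y Y0 mul0mx mulmx0.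
by rewrite BE T0 mul0mx.
Qed.

(** For invertible [W] this is [ct a *m invmx W *m a], the squared length of the covector [a]; the
    adjugate form is the one that integration by parts produces. *)
Definition gradsq W (a : 'cV[C]_n) : C := \tr (\adj W *m (a *m ct a)) / \det W.

(* The coefficient of X^(q+1) compares the gradients [W0^-1 b] and [W1^-1 a]: by
   simultaneous diagonalisation it is a positive combination of their squared
   differences. *)
Definition mixed_defect (W0 W1 : 'M[C]_n) (b a : 'cV[C]_n) : {poly C} :=
  ((gradsq W1 a)%:P * 'X + (gradsq W0 b)%:P) * pencil W0 W1 -
  \tr (\adj (pencil_mx W0 W1) *m
    ((map_mx polyC b + 'X *: map_mx polyC a) *m
     (map_mx polyC (ct b) + 'X *: map_mx polyC (ct a)))).

Lemma gradsq_congr W P a : P \in unitmx -> 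
  gradsq (P *m W *m ct P) (P *m a) = gradsq W a.
Proof.
move=> uP; rewrite /gradsq ctM.
have -> : P *m a *m (ct a *m ct P) = P *m (a *m ct a) *m ct P by rewrite !mulmxA.
have d1 : \det P != 0 by move: uP; rewrite unitmxE unitfE.
have d2 : \det (ct P) != 0 by rewrite det_ct conjC_eq0.
rewrite adj_congr !det_mulmx; have [->|dW] := eqVneq (\det W) 0.
  by rewrite mulr0 mul0r !invr0 !mulr0.
by field; rewrite dW d1 d2.
Qed.

(** Serves twice: to reduce to [W0 = 1%:M] with [W1] diagonal, and to see that the coefficients are
    densities under a change of charts. *)
Lemma mixed_defect_congr W0 W1 P b a : P \in unitmx ->
  mixed_defect (P *m W0 *m ct P) (P *m W1 *m ct P) (P *m b) (P *m a) =
  (\det P * \det (ct P))%:P * mixed_defect W0 W1 b a.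
Proof.
move=> uP; rewrite /mixed_defect !gradsq_congr // pencil_congr mulrBr.
congr (_ - _); first by rewrite mulrCA.
have -> : pencil_mx (P *m W0 *m ct P) (P *m W1 *m ct P) =
    map_mx polyC P *m pencil_mx W0 W1 *m map_mx polyC (ct P).
  by rewrite /pencil_mx !map_mxM mulmxDr mulmxDl -scalemxAr -scalemxAl.
rewrite !ctM !map_mxM.
have -> : (map_mx polyC P *m map_mx polyC b + 'X *: (map_mx polyC P *m map_mx polyC a))
    = map_mx polyC P *m (map_mx polyC b + 'X *: map_mx polyC a).
  by rewrite mulmxDr -scalemxAr.
have -> : (map_mx polyC (ct b) *m map_mx polyC (ct P) +
      'X *: (map_mx polyC (ct a) *m map_mx polyC (ct P)))
    = (map_mx polyC (ct b) + 'X *: map_mx polyC (ct a)) *m map_mx polyC (ct P).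
  by rewrite mulmxDl -scalemxAl.
rewrite [X in _ *m X](_ : _ = map_mx polyC P *m ((map_mx polyC b + 'X *: map_mx polyC a) *m
  (map_mx polyC (ct b) + 'X *: map_mx polyC (ct a))) *m map_mx polyC (ct P)).
  by rewrite adj_congr !det_map_mx polyCM.
by rewrite !mulmxA.
Qed.

Lemma diag_mxM (A0 : comNzRingType) (d : 'I_n -> A0) :
  diag_mx (\row_j d j) = \matrix_(i, j) (d i *+ (i == j)).
Proof.
apply/matrixP => i j; rewrite !mxE; case: eqP => [->//|_].
by rewrite !mulr0n.
Qed.

Lemma det_diag_row (A0 : comNzRingType) (d : 'I_n -> A0) :
  \det (diag_mx (\row_j d j)) = \prod_j d j.
Proof. by rewrite det_diag; apply: eq_bigr => j _; rewrite mxE. Qed.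

Lemma gradsq_diag (d : 'I_n -> C) a : (forall j, d j != 0) ->
  gradsq (diag_mx (\row_j d j)) a = \sum_j `|a j 0| ^+ 2 / d j.
Proof.
move=> d0; rewrite /gradsq det_diag_row diag_mxM adj_diag mulr_suml.
apply: eq_bigr => j _; rewrite [X in _ / X](bigD1 j) //=.
have -> : (a *m ct a) j j = `|a j 0| ^+ 2 by rewrite mxE big_ord1 ctE normCK.
have p0 : \prod_(i | i != j) d i != 0 by apply/prodf_neq0.
by field; rewrite p0 d0.
Qed.

(** The case of one eigenvalue [d] with inverse [i]: completing the square leaves only the square of
    [x - d * y], that is, of the difference between [x / d] and [y]. Primed letters stand for
    complex conjugates. *)
Lemma mixed_defect_aux (A0 : comNzRingType) (x x' y y' d i X : A0) : d * i = 1 ->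
  (x * x' * i * X + y * y') * (1 + d * X) - (y + X * x) * (y' + X * x') =
  (x - d * y) * (x' - d * y') * i * X.
Proof.
move=> di; apply/eqP; rewrite -subr_eq0; apply/eqP.
transitivity ((d * i - 1) *
  (x * x' * X * X + X * (x * y' + y * x') - X * y * y' * d)); first by ring.
by rewrite di subrr mul0r.
Qed.

Lemma mixed_defect_diag (d : 'I_n -> C) b a : (forall j, d j != 0) ->
  (forall j, (d j)^* = d j) ->
  mixed_defect 1%:M (diag_mx (\row_j d j)) b a =
  \sum_j (`|a j 0 - d j * b j 0| ^+ 2 / d j)%:P * 'X *
    \prod_(l | l != j) (1 + (d l)%:P * 'X).
Proof.
move=> d0 dr; rewrite /mixed_defect.
have E1 : 1%:M = diag_mx (\row_j 1) :> 'M[C]_n.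
  by apply/matrixP => i j; rewrite !mxE.
have P1 : pencil_mx 1%:M (diag_mx (\row_j d j)) =
    diag_mx (\row_j (1 + (d j)%:P * 'X)).
  apply/matrixP => i j; rewrite !mxE; case: eqP => [->|_].
    by rewrite !mulr1n mulrC.
  by rewrite !mulr0n mulr0 addr0.
rewrite gradsq_diag // {1}E1 gradsq_diag; last by move=> j; exact: oner_neq0.
rewrite /pencil P1 det_diag_row diag_mxM adj_diag.
rewrite !rmorph_sum /= mulr_suml -big_split /= mulr_suml -sumrB.
apply: eq_bigr => j _.
have dj : (d j)%:P * ((d j)^-1)%:P = 1 by rewrite -polyCM divff.
rewrite (bigD1 j) //= mulrA -mulrBl; congr (_ * _).
have cab : (a j 0 - d j * b j 0)^* = (a j 0)^* - d j * (b j 0)^*.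
  by rewrite rmorphB rmorphM; congr (_ - _ * _); exact: dr.
rewrite !mxE big_ord1 !mxE !normCK divr1 !polyCM cab !polyCB !polyCM.
exact: mixed_defect_aux.
Qed.

(** These coefficients are elementary symmetric functions of positive numbers, hence positive up to
    the number of factors. *)
Lemma prod_linear_coef (I : finType) (P : pred I) (d : I -> C) q :
  (forall j, 0 < d j) ->
  0 <= (\prod_(l | P l) (1 + (d l)%:P * 'X))`_q /\
  ((q <= #|P|)%N -> 0 < (\prod_(l | P l) (1 + (d l)%:P * 'X))`_q).
Proof.
move=> d0; rewrite -sum1_card; elim/big_rec2: _ q => [|l k p _ IH] q.
  rewrite coefC; case: q => [|q]; first by split=> //.
  by split.
rewrite mulrDl mul1r coefD -mulrA coefCM coefXM.
have [h1 h2] := IH q; case: q h1 h2 => [|q] h1 h2.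
  by rewrite mulr0 addr0; split=> // _; exact: h2.
rewrite /=; have [h3 h4] := IH q.
have h5 := mulr_ge0 (ltW (d0 l)) h3.
split; first by rewrite addr_ge0.
by rewrite add1n ltnS => /h4 h6; rewrite ltr_wpDl // mulr_gt0.
Qed.

Lemma mixed_defect_ge0 W0 W1 b a q : herm W0 -> posdef W0 -> herm W1 ->
  posdef W1 -> 0 <= (mixed_defect W0 W1 b a)`_q.+1 /\
  ((q < n)%N -> (mixed_defect W0 W1 b a)`_q.+1 = 0 ->
     invmx W1 *m a = invmx W0 *m b).
Proof.
move=> h0 p0 h1 p1.
have [P [d [uP d0 -> ->]]] := simultaneous_diag h0 p0 h1 p1.
have -> : P *m ct P = P *m 1%:M *m ct P by rewrite mulmx1.
have [a' Ea] : exists a', a = P *m a' by exists (invmx P *m a); rewrite mulKVmx.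
have [b' Eb] : exists b', b = P *m b' by exists (invmx P *m b); rewrite mulKVmx.
have dn0 j : d j != 0 by rewrite gt_eqF.
have dr j : (d j)^* = d j by rewrite geC0_conj // ltW.
have gP : 0 < \det P * \det (ct P).
  rewrite det_ct -normCK exprn_gt0 // normr_gt0.
  by move: uP; rewrite unitmxE unitfE.
rewrite {1 2}Ea {1 2}Eb mixed_defect_congr // coefCM mixed_defect_diag //.
rewrite coef_sum.
set t := fun j : 'I_n => `|a' j 0 - d j * b' j 0| ^+ 2 / d j.
set c := fun j : 'I_n => (\prod_(l | l != j) (1 + (d l)%:P * 'X))`_q.
have E j : ((t j)%:P * 'X * \prod_(l | l != j) (1 + (d l)%:P * 'X))`_q.+1 = t j * c j.
  by rewrite -mulrA coefCM coefXM.
rewrite (eq_bigr _ (fun j _ => E j)).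
have t0 j : 0 <= t j by rewrite divr_ge0 ?exprn_ge0 // ltW.
have c0 j : 0 <= c j by have [] := prod_linear_coef [pred l | l != j] q d0.
split.
  apply: mulr_ge0; first exact: ltW.
  by apply: sumr_ge0 => j _; exact: mulr_ge0.
move=> qn /eqP; rewrite mulf_eq0 (gt_eqF gP) /= psumr_eq0 => [/allP H|j _]; last first.
  exact: mulr_ge0.
have ab j : a' j 0 = d j * b' j 0.
  have := H j (mem_index_enum j); rewrite /= mulf_eq0 => /orP[].
    rewrite mulf_eq0 invr_eq0 (negPf (dn0 j)) orbF sqrf_eq0 normr_eq0 subr_eq0.
    by move=> /eqP.
  (* The remaining product has [n - 1] factors, so its coefficient of [X^q] is positive because
     [q < n], and the square has to vanish. *)
  have [_] := prod_linear_coef [pred l | l != j] q d0.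
  rewrite cardC1 card_ord -ltnS prednK; last by apply: leq_ltn_trans qn.
  by move=> /(_ qn) h; rewrite (gt_eqF h).
have Eab : a' = diag_mx (\row_j d j) *m b'.
  by rewrite mul_diag_mx; apply/matrixP => i j; rewrite !mxE ord1 ab.
rewrite Ea Eb Eab mulmx1.
have uD : diag_mx (\row_j d j) \in unitmx.
  by rewrite unitmxE det_diag_row unitfE; apply/prodf_neq0.
have u1 : P *m diag_mx (\row_j d j) *m ct P \in unitmx.
  by rewrite !unitmx_mul uP uD ct_unit.
have u2 : P *m ct P \in unitmx by rewrite unitmx_mul uP ct_unit.
have uc : ct P \in unitmx by rewrite ct_unit.
have E3 : P *m (diag_mx (\row_j d j) *m b') =
    (P *m diag_mx (\row_j d j) *m ct P) *m (invmx (ct P) *m b').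
  by rewrite -!mulmxA mulKVmx.
have E4 : P *m b' = (P *m ct P) *m (invmx (ct P) *m b').
  by rewrite -!mulmxA mulKVmx.
by rewrite E3 (mulKmx u1) E4 (mulKmx u2).
Qed.

End PositiveMatrices.

(** * Holomorphic changes of coordinates *)

Section ComplexChainRule.
Variables (R : realType) (n : nat).
Notation E := 'rV[R]_(n + n).
Notation C := R[i].
Notation Re := complex.Re.
Notation Im := complex.Im.
Opaque smooth_on.
Opaque csmooth_on.

Lemma cpartial_xE p (F : E -> C) z :
  cpartial (lshift n p) F z = d_z p F z + d_zbar p F z.
Proof. by rewrite /d_z /d_zbar; field. Qed.

Lemma cpartial_yE p (F : E -> C) z :
  cpartial (rshift n p) F z = Complex 0 1 * (d_z p F z - d_zbar p F z).
Proof.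
rewrite /d_z /d_zbar.
have ii : Complex 0 1 * Complex 0 1 = -1 :> C.
  by apply: complexE2; rewrite ?ReM ?ImM ?ReN ?ImN /=; ring.
transitivity (- (Complex 0 1 * Complex 0 1) * cpartial (rshift n p) F z).
  by rewrite ii opprK mul1r.
by field.
Qed.

Lemma d_zP j (F : E -> C) z : d_z j F z =
  (cpartial (lshift n j) F z - Complex 0 1 * cpartial (rshift n j) F z) / 2.
Proof. by []. Qed.

Lemma d_zbarP j (F : E -> C) z : d_zbar j F z =
  (cpartial (lshift n j) F z + Complex 0 1 * cpartial (rshift n j) F z) / 2.
Proof. by []. Qed.

Fact comb_aux (A0 : comNzRingType) (x x' y y' a b i k : A0) :
  (x * a + x' * b - i * (y * a + y' * b)) * k =
  (x - i * y) * k * a + (x' + - i * y') * k * b.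
Proof. ring. Qed.

Fact comb_aux' (A0 : comNzRingType) (x x' y y' a b i k : A0) :
  (x * a + x' * b + i * (y * a + y' * b)) * k =
  (x' - - i * y') * k * b + (x + i * y) * k * a.
Proof. ring. Qed.

Variables (U V : set E) (psi : E -> E).
Hypotheses (oU : open U) (oV : open V).
Hypothesis psiV : forall z, U z -> V (psi z).
Hypothesis hol : forall l, holomorphic_on U (fun z => zcoord (psi z) l).
Notation zeta l := (fun z => zcoord (psi z) l).

Lemma smooth_psi l : smooth_on U (fun z => psi z 0 l).
Proof.
case: (split_ordP l) => p ->; have [/csmP[h1 h2] _] := hol p.
  exact: h1.
exact: h2.
Qed.

Lemma csm_zeta l : csm U (zeta l).
Proof. by have [] := hol l. Qed.

Lemma csm_comp (F : E -> C) : csm V F -> csm U (fun z => F (psi z)).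
Proof.
move=> /csmP[h1 h2]; apply/csmP; split.
  exact: (smooth_comp oU oV psiV smooth_psi h1).
exact: (smooth_comp oU oV psiV smooth_psi h2).
Qed.

Lemma cpartial_comp (F : E -> C) i z : csm V F -> U z ->
  cpartial i (fun y => F (psi y)) z =
  \sum_p (cpartial i (zeta p) z * d_z p F (psi z) +
          (cpartial i (zeta p) z)^* * d_zbar p F (psi z)).
Proof.
move=> /csmP[h1 h2] Uz; have Vz := psiV Uz.
have [_ e1] := partial_comp i oU oV Uz Vz smooth_psi h1.
have [_ e2] := partial_comp i oU oV Uz Vz smooth_psi h2.
have -> : cpartial i (fun y => F (psi y)) z = \sum_l
    Complex (partial i (fun y => psi y 0 l) z) 0 * cpartial l F (psi z).
  apply: complexE2.
    rewrite /= e1 (big_morph _ (@ReD R) (erefl : Re (0 : C) = 0)); apply: eq_bigr => l _.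
    by rewrite /= mul0r subr0.
  rewrite /= e2 (big_morph _ (@ImD R) (erefl : Im (0 : C) = 0)); apply: eq_bigr => l _.
  by rewrite /= mul0r addr0.
rewrite big_split_ord /= -big_split /=; apply: eq_bigr => p _.
rewrite cpartial_xE cpartial_yE.
set a := partial i (fun y => psi y 0 (lshift n p)) z.
set b := partial i (fun y => psi y 0 (rshift n p)) z.
have -> : cpartial i (zeta p) z = Complex a 0 + Complex 0 1 * Complex b 0.
  by apply: complexE2; rewrite ?ReD ?ImD ?ReM ?ImM /= ?mul0r ?mul1r ?mulr0 ?subr0 ?add0r ?addr0.
have -> : (Complex a 0 + Complex 0 1 * Complex b 0 : C)^* =
    Complex a 0 - Complex 0 1 * Complex b 0.
  by apply: complexE2; rewrite ?Re_conj ?Im_conj ?ReD ?ImD ?ReN ?ImN ?ReM ?ImM /=; ring.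
by ring.
Qed.

Lemma d_z_comp (F : E -> C) j z : csm V F -> U z ->
  d_z j (fun y => F (psi y)) z =
  \sum_p d_z j (zeta p) z * d_z p F (psi z).
Proof.
move=> hF Uz; rewrite d_zP !cpartial_comp // mulr_sumr -sumrB mulr_suml.
apply: eq_bigr => p _.
have h0 : (d_zbar j (zeta p) z)^* = 0.
  by have [_ ->] := hol p; rewrite // rmorph0.
transitivity (d_z j (zeta p) z * d_z p F (psi z) +
  (d_zbar j (zeta p) z)^* * d_zbar p F (psi z)); last by rewrite h0 mul0r addr0.
rewrite (d_zP j (zeta p)) (d_zbarP j (zeta p)) rmorphM rmorphD rmorphM /= conj_I conj_half.
exact: comb_aux.
Qed.

Lemma d_zbar_comp (F : E -> C) j z : csm V F -> U z ->
  d_zbar j (fun y => F (psi y)) z =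
  \sum_p (d_z j (zeta p) z)^* * d_zbar p F (psi z).
Proof.
move=> hF Uz; rewrite d_zbarP !cpartial_comp // mulr_sumr -big_split mulr_suml.
apply: eq_bigr => p _ /=.
have h0 : d_zbar j (zeta p) z = 0 by have [_ ->] := hol p.
transitivity ((d_z j (zeta p) z)^* * d_zbar p F (psi z) +
  d_zbar j (zeta p) z * d_z p F (psi z)); last by rewrite h0 mul0r addr0.
rewrite (d_zP j (zeta p)) (d_zbarP j (zeta p)) rmorphM rmorphB rmorphM /= conj_I conj_half.
exact: comb_aux'.
Qed.

Definition cjac z : 'M[C]_n := \matrix_(j, p) d_z j (zeta p) z.

Definition ddbarC (F : E -> C) z : 'M[C]_n :=
  \matrix_(j, l) d_z j (d_zbar l F) z.

Lemma csm_cjac j p : csm U (fun z => cjac z j p).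
Proof.
apply: (@csm_ext R n U oU (d_z j (zeta p))) => [z _|]; first by rewrite mxE.
exact: (dv_smooth (derivation_d_z oU j)) (csm_zeta p).
Qed.

Lemma d_z_conj_jac j l p z : U z -> d_z j (fun y => (d_z l (zeta p) y)^*) z = 0.
Proof.
move=> Uz.
have s1 := dv_smooth (derivation_d_z oU l) (csm_zeta p).
rewrite (d_z_conj _ s1 Uz).
rewrite -(commute_dz_dzbar oU l j (csm_zeta p) Uz).
have -> : d_z l (d_zbar j (zeta p)) z = d_z l (fun=> 0) z.
  by apply: (dv_ext (derivation_d_z oU l)) => // y Uy; have [_ ->] := hol p.
by rewrite (dv_cst (derivation_d_z oU l)) // rmorph0.
Qed.

(** The conjugated Jacobian of a holomorphic map is antiholomorphic, so [d_z j] annihilates it and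
    no second derivatives of [psi] appear: [ddbarC] transforms as a tensor. *)
Lemma ddbar_comp (F : E -> C) z : csm V F -> U z ->
  ddbarC (fun y => F (psi y)) z =
  cjac z *m ddbarC F (psi z) *m (map_mx Num.conj (cjac z))^T.
Proof.
move=> hF Uz; apply/matrixP => j l; rewrite mxE.
have s1 p := dv_smooth (derivation_d_zbar oV p) hF.
have s2 p := csm_conj oU (dv_smooth (derivation_d_z oU l) (csm_zeta p)).
have -> : d_z j (d_zbar l (fun y => F (psi y))) z =
    d_z j (fun y => \sum_p (d_z l (zeta p) y)^* * d_zbar p F (psi y)) z.
  by apply: (dv_ext (derivation_d_z oU j)) => // y Uy; exact: d_zbar_comp.
rewrite (dv_sum oU (derivation_d_z oU j) _ (fun p _ => csmM oU (s2 p) (csm_comp (s1 p))) Uz).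
rewrite mxE; apply: eq_bigr => p _.
rewrite (dvM (derivation_d_z oU j) (s2 p) (csm_comp (s1 p)) Uz).
rewrite (d_z_conj_jac _ _ _ Uz) mul0r add0r (d_z_comp _ (s1 p) Uz) [(map_mx _ _)^T _ _]mxE mulrC.
rewrite [map_mx _ _ _ _]mxE [cjac _ _ _]mxE [(_ *m _) _ _]mxE; congr (_ * _).
by apply: eq_bigr => q _; rewrite !mxE.
Qed.

End ComplexChainRule.

(** * The real Jacobian determinant of a holomorphic map *)

Section RealJacobian.
Variable R : realType.
Notation C := R[i].

(** Two complex shears [L] and [K] of determinant 1 make the block matrix lower triangular with
    diagonal blocks [A + i B] and [A - i B]. *)
Lemma det_real_block n (A B : 'M[R]_n) :
  Complex (\det (block_mx A B (- B) A)) 0 =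
  \det (map_mx (real_complex R) A + Complex 0 1 *: map_mx (real_complex R) B) *
  \det (map_mx (real_complex R) A - Complex 0 1 *: map_mx (real_complex R) B).
Proof.
have -> (x : R) : Complex x 0 = real_complex R x by [].
rewrite -det_map_mx map_block_mx map_mxN.
set A' := map_mx _ A; set B' := map_mx _ B; set I := Complex 0 1.
have ii : I * I = -1 by apply: complexE2; rewrite /= ?mul0r ?mulr0 ?mul1r; lra.
pose L : 'M[C]_(n + n) := block_mx 1%:M (- I)%:M 0 1%:M.
pose K : 'M[C]_(n + n) := block_mx 1%:M I%:M 0 1%:M.
have dL : \det L = 1 by rewrite det_ublock !det1 mulr1.
have dK : \det K = 1 by rewrite det_ublock !det1 mulr1.
have E : L *m block_mx A' B' (- B') A' *m K =
   block_mx (A' + I *: B') 0 (- B') (A' - I *: B').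
  rewrite !mulmx_block !mul1mx !mul0mx !mulmx1 !mulmx0 !addr0 !add0r.
  rewrite !mul_scalar_mx !mul_mx_scalar !scaleNr !scalerN !opprK scalerDr scalerA ii.
  rewrite scaleN1r.
  congr block_mx; last by rewrite addrC.
  by rewrite addrA subrK subrr.
have : \det (L *m block_mx A' B' (- B') A' *m K) = \det (block_mx A' B' (- B') A').
  by rewrite !det_mulmx dL dK mul1r mulr1.
by rewrite E det_lblock => <-.
Qed.

Lemma partial_coord m (i l : 'I_m) (x : 'rV[R]_m) :
  partial i (fun y => y 0 l) x = (i == l)%:R.
Proof.
pose g (t : R) := (i == l)%:R * t + x 0 l.
have := @derive_affine_eq R 'rV[R]_m R R (fun y => y 0 l) g x (delta_mx 0 i) 0 (1 : R).
case=> [h|_].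
  by rewrite /g !mxE addr0 /= [l == i]eq_sym [_ *: _]mulr1 mulrC.
rewrite /partial => <-.
have h := @is_derive_affine R id (i == l)%:R (x 0 l) 0 1 (@is_derive_id R R _ (1 : R)).
rewrite -[RHS]mulr1; exact: derive_val.
Qed.

End RealJacobian.

Section HolomorphicChange.
Variables (R : realType) (n : nat).
Notation E := 'rV[R]_(n + n).
Notation C := R[i].
Opaque smooth_on.
Opaque csmooth_on.
Variables (U V K : set E) (psi chi : E -> E) (f g : E -> R).
Hypotheses (oU : open U) (oV : open V) (cK : compact K) (KV : K `<=` V).
Hypothesis psiV : forall x, U x -> V (psi x) /\ chi (psi x) = x.
Hypothesis chiU : forall y, V y -> U (chi y) /\ psi (chi y) = y.
Hypothesis hpsi : forall l, holomorphic_on U (fun z => zcoord (psi z) l).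
Hypothesis hchi : forall l, holomorphic_on V (fun z => zcoord (chi z) l).
Hypothesis cf : forall y, V y -> {for y, continuous f}.
Hypothesis f0 : forall y, ~ K y -> f y = 0.
Hypothesis g0 : forall x, ~ U x -> g x = 0.

Definition real_jac (psi : E -> E) x : 'M[R]_(n + n) :=
  \matrix_(i, p) partial i (fun y => psi y 0 p) x.

Let psiV1 z : U z -> V (psi z). Proof. by move=> /psiV[]. Qed.
Let chiU1 z : V z -> U (chi z). Proof. by move=> /chiU[]. Qed.
Let sp := smooth_psi hpsi.
Let sc := smooth_psi hchi.

Lemma real_jac_unit x : U x -> real_jac psi x \in unitmx.
Proof.
move=> Ux.
have : real_jac psi x *m real_jac chi (psi x) = 1%:M.
  apply/matrixP => i l; rewrite !mxE.
  have [_] := partial_comp i oU oV Ux (psiV1 Ux) sp (sc l).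
  have [-> _] := partial_ext oU (fun y Uy => congr1 (fun v : E => v 0 l) (psiV Uy).2) Ux i.
  rewrite partial_coord => ->; apply: eq_bigr => q _; by rewrite !mxE.
by move=> /mulmx1_unit[].
Qed.

(** By the Cauchy-Riemann equations the real Jacobian has the block shape of [det_real_block], and
    [A + i B] is the complex Jacobian. The real determinant is thus nonnegative and equal to the
    absolute value in the real change of variables. *)
Lemma det_real_jac x : U x -> Complex (\det (real_jac psi x)) 0 =
  \det (cjac psi x) * (\det (cjac psi x))^*.
Proof.
move=> Ux.
pose A : 'M[R]_n := \matrix_(j, p) partial (lshift n j) (fun y => psi y 0 (lshift n p)) x.
pose B : 'M[R]_n := \matrix_(j, p) partial (lshift n j) (fun y => psi y 0 (rshift n p)) x.
have CR j p : cpartial (lshift n j) (fun z => zcoord (psi z) p) x =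
    - Complex 0 1 * cpartial (rshift n j) (fun z => zcoord (psi z) p) x.
  have [_ /(_ x Ux j)] := hpsi p; rewrite d_zbarP => /eqP.
  rewrite mulf_eq0 invr_eq0 pnatr_eq0 orbF addr_eq0 => /eqP ->.
  by rewrite mulNr.
have CR1 j p : partial (rshift n j) (fun y => psi y 0 (lshift n p)) x = - B j p.
  by have := congr1 (@complex.Im R) (CR j p); rewrite mxE /= => ->; lra.
have CR2 j p : partial (rshift n j) (fun y => psi y 0 (rshift n p)) x = A j p.
  by have := congr1 (@complex.Re R) (CR j p); rewrite mxE /= => ->; lra.
have -> : real_jac psi x = block_mx A B (- B) A.
  apply/matrixP => i l; rewrite mxE.
  case: (split_ordP i) => j ->; case: (split_ordP l) => p ->.
  - by rewrite block_mxEul mxE.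
  - by rewrite block_mxEur mxE.
  - by rewrite block_mxEdl mxE CR1.
  - by rewrite block_mxEdr CR2.
have EJ : cjac psi x = map_mx (real_complex R) A + Complex 0 1 *: map_mx (real_complex R) B.
  apply/matrixP => j p; rewrite mxE.
  have -> : d_z j (fun z => zcoord (psi z) p) x = cpartial (lshift n j) (fun z => zcoord (psi z) p) x.
    by rewrite cpartial_xE; have [_ ->] := hpsi p; rewrite ?addr0.
  rewrite !mxE; apply: complexE2 => /=; lra.
rewrite det_real_block -EJ; congr (_ * _).
rewrite -det_map_mx EJ; congr (\det _); apply/matrixP => j p; rewrite !mxE.
by apply: complexE2 => /=; rewrite ?Re_conj ?Im_conj /=; lra.
Qed.

Hypothesis gE : forall x, U x -> g x = f (psi x) *
  complex.Re (\det (cjac psi x) * (\det (cjac psi x))^*).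

Lemma real_jac_abs x : U x ->
  `|\det (real_jac psi x)| = complex.Re (\det (cjac psi x) * (\det (cjac psi x))^*).
Proof.
move=> Ux; rewrite -(det_real_jac Ux) /= ger0_norm //.
have : 0 <= \det (cjac psi x) * (\det (cjac psi x))^* by rewrite -normCK exprn_ge0.
by rewrite -(det_real_jac Ux) lecE /= => /andP[].
Qed.

Lemma integral_holomorphic_change : integral_rV g = integral_rV f.
Proof.
have cpsi x : U x -> {for x, continuous psi}.
  by move=> Ux; apply: continuous_coords => l; exact: (smooth_cont (sp l)).
have cchi y : V y -> {for y, continuous chi}.
  by move=> Vy; apply: continuous_coords => l; exact: (smooth_cont (sc l)).
have cK' : compact (chi @` K).
  apply: continuous_compact => //; apply: continuous_in_subspaceT => y /set_mem Ky.
  exact: cchi (KV Ky).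
have cg x : U x -> {for x, continuous g}.
  move=> Ux; apply: (cont_ext oU (f := fun y => f (psi y) *
     complex.Re (\det (cjac psi y) * (\det (cjac psi y))^*))) => [y Uy|//|].
    by rewrite gE.
  have hd : csmooth_on U (fun y => \det (cjac psi y) * (\det (cjac psi y))^*).
    have s1 : csmooth_on U (fun y => \det (cjac psi y)).
      by apply: csm_det => // i j; exact: csm_cjac.
    by exact: (csmM oU s1 (csm_conj oU s1)).
  move: hd => /csmP[hd _].
  apply: continuousM; last exact: (smooth_cont hd Ux).
  by apply: (continuous_comp (cpsi x Ux)); apply: cf; exact: psiV1.
have gK x : ~ (chi @` K) x -> g x = 0.
  move=> nK; have [Ux|nU] := pselect (U x); last exact: g0.
  rewrite gE // f0 ?mul0r // => Kp; apply: nK; exists (psi x) => //.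
  by have [] := psiV Ux.
have K'U : chi @` K `<=` U by move=> _ [y Ky <-]; exact: chiU1 (KV Ky).
have [N1 N10 hg] := cc_compact oU cK' K'U cg gK.
have [N2 N20 hf] := cc_compact oV cK KV cf f0.
have N0 : 0 <= N1 + N2 by rewrite addr_ge0.
apply: (change_of_variables N0 (ccW _ hf) (ccW _ hg) oU oV cK KV psiV chiU cpsi cchi
  real_jac_unit _ f0 g0).
- by rewrite lerDr.
- by rewrite lerDl.
- move=> x0 Ux0 e e0.
  have H l : exists2 d : R, 0 < d & forall x x', `|x - x0| < d -> `|x' - x0| < d ->
     `|psi x' 0 l - psi x 0 l - \sum_i (x' - x) 0 i * partial i (fun y => psi y 0 l) x0|
       <= e * `|x' - x|.
    by have /(_ e e0) := strict_differentiable oU (sp l) Ux0.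
  pose dd l := sval (cid2 (H l)).
  have dd0 l : 0 < dd l by rewrite /dd; case: cid2.
  exists (\big[Num.min/1]_l dd l).
    by elim/big_ind: _ => // a b a0 b0; rewrite lt_min a0.
  move=> x x' hx hx'; apply: norm_le_coord => [|l].
    by rewrite mulr_ge0 // ltW.
  have h1 : `|x - x0| < dd l by apply: lt_le_trans hx _; rewrite (bigD1 l) //= ge_min lexx.
  have h2 : `|x' - x0| < dd l by apply: lt_le_trans hx' _; rewrite (bigD1 l) //= ge_min lexx.
  move: h1 h2; rewrite /dd; case: cid2 => /= d _ hd h1 h2.
  have := hd _ _ h1 h2; rewrite !mxE.
  by under [in X in _ -> X]eq_bigr do rewrite !mxE; under eq_bigr do rewrite !mxE.
- by move=> x Ux; rewrite gE // real_jac_abs.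
Qed.

End HolomorphicChange.

(** * Integration by parts and change of coordinates with compact support *)

Section LocalIntegral.
Variables (R : realType) (n : nat).
Notation E := 'rV[R]_(n + n).
Notation C := R[i].
Notation Re := complex.Re.
Notation Im := complex.Im.
Opaque smooth_on.
Opaque csmooth_on.
Opaque integral_rV.
Implicit Types (U V K : set E) (F G : E -> C).

Definition cint U F : C :=
  Complex (integral_rV (fun z => \1_U z * Re (F z)))
          (integral_rV (fun z => \1_U z * Im (F z))).

Definition supp_in U F := exists K, [/\ compact K, K `<=` U &
  forall z, U z -> ~ K z -> F z = 0].

Lemma supp_inM U F G : supp_in U F -> supp_in U (fun z => F z * G z).
Proof. by move=> [K [cK KU h]]; exists K; split=> // z Uz nK; rewrite h // mul0r. Qed.

Lemma supp_inMr U F G : supp_in U F -> supp_in U (fun z => G z * F z).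
Proof. by move=> [K [cK KU h]]; exists K; split=> // z Uz nK; rewrite h // mulr0. Qed.

Lemma supp_in0 U : supp_in U (fun _ => 0).
Proof. by exists set0; split=> //; exact: compact0. Qed.

Lemma supp_inD U F G : supp_in U F -> supp_in U G -> supp_in U (fun z => F z + G z).
Proof.
move=> [K [cK KU h]] [K' [cK' KU' h']]; exists (K `|` K'); split=> //.
- exact: compactU.
- by move=> z [/KU|/KU'].
by move=> z Uz nK; rewrite h // ?h' ?addr0 // => Kz; apply: nK; [right|left].
Qed.

Lemma supp_in_ext U F G : (forall z, U z -> F z = G z) -> supp_in U F -> supp_in U G.
Proof. by move=> FG [K [cK KU h]]; exists K; split=> // z Uz nK; rewrite -FG // h. Qed.

Lemma supp_in_sum U (I : Type) (r : seq I) (F : I -> E -> C) :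
  (forall i, supp_in U (F i)) -> supp_in U (fun z => \sum_(i <- r) F i z).
Proof.
move=> h; elim: r => [|i r IH].
  by apply: supp_in_ext (supp_in0 U) => z _; rewrite big_nil.
by apply: supp_in_ext (supp_inD (h i) IH) => z _; rewrite big_cons.
Qed.

Lemma indicT U z : U z -> \1_U z = 1 :> R.
Proof. by move=> Uz; rewrite indicE mem_set. Qed.

Lemma indicF U z : ~ U z -> \1_U z = 0 :> R.
Proof. by move=> Uz; rewrite indicE memNset. Qed.

Lemma cint_ext U F G : (forall z, U z -> F z = G z) -> cint U F = cint U G.
Proof.
move=> h; apply: complexE2 => /=; congr integral_rV; apply/funext => z;
  have [/h ->//|nU] := pselect (U z); by rewrite indicF // !mul0r.
Qed.

Lemma open_setD U K : open U -> compact K -> open (U `&` ~` K).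
Proof.
move=> oU cK; apply: openI => //; by rewrite openC; apply: compact_closed.
Qed.

Section Real.
Variables (U K : set E) (f : E -> R).
Hypotheses (oU : open U) (cK : compact K) (KU : K `<=` U).
Hypothesis sf : smooth_on U f.
Hypothesis f0 : forall z, U z -> ~ K z -> f z = 0.

Lemma patch_eq z : U z -> \1_U z * f z = f z.
Proof. by move=> Uz; rewrite indicT // mul1r. Qed.

Lemma patch_eq0 z : ~ K z -> \1_U z * f z = 0.
Proof.
move=> nK; have [Uz|nU] := pselect (U z); first by rewrite f0 ?mulr0.
by rewrite indicF // mul0r.
Qed.

Lemma patch_cc : exists2 N : R, 0 <= N & cc N (fun z => \1_U z * f z).
Proof.
apply: (cc_compact oU cK KU) => [x Ux|]; last exact: patch_eq0.
apply: (cont_ext oU (f := f)) (Ux) _ => [y Uy|]; first by rewrite patch_eq.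
exact: (smooth_cont sf Ux).
Qed.

(** Outside [U] the complement of the closed set [K] is a neighbourhood on which the extension by
    zero vanishes, so the extension causes no jump in the derivatives. *)
Lemma patch_partial i z : derivable (fun z => \1_U z * f z) z (delta_mx 0 i) /\
  partial i (fun z => \1_U z * f z) z = \1_U z * partial i f z.
Proof.
have [Uz|nU] := pselect (U z).
  have E1 y : U y -> f y = \1_U y * f y by move=> Uy; rewrite patch_eq.
  have [<- h] := partial_ext oU E1 Uz i.
  split; last by rewrite indicT // mul1r.
  by apply: h; exact: (smooth_derivable sf Uz).
have oK : open (~` K).
  by rewrite openC; exact: compact_closed.
have nK : (~` K) z by move=> /KU.
have E1 y : (~` K) y -> (0 : R) = \1_U y * f y by move=> Ky; rewrite patch_eq0.
have [<- h] := partial_ext oK E1 nK i.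
rewrite indicF // mul0r /partial derive_cst; split=> //; apply: h.
exact: derivable_cst.
Qed.

End Real.

Lemma integral_patch_partial U K (f : E -> R) i : open U -> compact K ->
  K `<=` U -> smooth_on U f -> (forall z, U z -> ~ K z -> f z = 0) ->
  integral_rV (fun z => \1_U z * partial i f z) = 0.
Proof.
move=> oU cK KU sf f0.
have P z := patch_partial oU cK KU sf f0 i z.
have -> : (fun z => \1_U z * partial i f z) = partial i (fun z => \1_U z * f z).
  by apply/funext => z; have [_ ->] := P z.
have [N N0 h1] := patch_cc oU cK KU sf f0.
have p0 z : U z -> ~ K z -> partial i f z = 0.
  move=> Uz nK.
  have E1 y : (U `&` ~` K) y -> (0 : R) = f y by move=> [Uy Ky]; rewrite f0.
  have [<- _] := partial_ext (open_setD oU cK) E1 (conj Uz nK) i.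
  by rewrite /partial derive_cst.
have [N' N'0 h2] := patch_cc oU cK KU (@smooth_partial _ _ _ _ i sf) p0.
have E2 : (fun z => \1_U z * partial i f z) = partial i (fun z => \1_U z * f z).
  by apply/funext => z; have [_ ->] := P z.
rewrite E2 in h2.
apply: (@integral_partial0 _ _ (N + N') _ i).
- by rewrite addr_ge0.
- by apply: ccW h1; rewrite lerDl.
- by move=> x; have [] := P x.
- by apply: ccW h2; rewrite lerDr.
Qed.

Lemma cint_cc U F : open U -> csm U F -> supp_in U F ->
  exists N : R, [/\ 0 <= N, cc N (fun z => \1_U z * Re (F z)) &
    cc N (fun z => \1_U z * Im (F z))].
Proof.
move=> oU /csmP[s1 s2] [K [cK KU F0]].
have [|N1 N10 h1] := patch_cc oU cK KU s1; first by move=> z Uz nK; rewrite F0.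
have [|N2 N20 h2] := patch_cc oU cK KU s2; first by move=> z Uz nK; rewrite F0.
exists (N1 + N2); split; first by rewrite addr_ge0.
  by apply: ccW h1; rewrite lerDl.
by apply: ccW h2; rewrite lerDr.
Qed.

Lemma cintD U F G : open U -> csm U F -> csm U G -> supp_in U F -> supp_in U G ->
  cint U (fun z => F z + G z) = cint U F + cint U G.
Proof.
move=> oU sF sG pF pG; have [N [N0 h1 h2]] := cint_cc oU sF pF.
have [M [M0 h3 h4]] := cint_cc oU sG pG.
have L : N <= N + M by rewrite lerDl.
have L' : M <= N + M by rewrite lerDr.
have NM : 0 <= N + M by rewrite addr_ge0.
apply: complexE2; rewrite ?(@ReD R) ?(@ImD R) /=.
  rewrite -(integral_rVD NM (ccW L h1) (ccW L' h3)); congr integral_rV.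
  by apply/funext => z; rewrite (@ReD R) mulrDr.
rewrite -(integral_rVD NM (ccW L h2) (ccW L' h4)); congr integral_rV.
by apply/funext => z; rewrite (@ImD R) mulrDr.
Qed.

Lemma cintZ U (c : C) F : open U -> csm U F -> supp_in U F ->
  cint U (fun z => c * F z) = c * cint U F.
Proof.
move=> oU sF pF; have [N [N0 h1 h2]] := cint_cc oU sF pF.
apply: complexE2; rewrite ?(@ReM R) ?(@ImM R) /=.
  rewrite -!(integral_rVZ _ N0) // -(integral_rVB N0); try exact: ccZ.
  by congr integral_rV; apply/funext => z; rewrite (@ReM R); ring.
rewrite -!(integral_rVZ _ N0) // -(integral_rVD N0); try exact: ccZ.
by congr integral_rV; apply/funext => z; rewrite (@ImM R); ring.
Qed.

Lemma cint0 U : cint U (fun _ => 0) = 0.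
Proof.
by apply: complexE2 => /=; rewrite -[RHS](@integral_rV0 R (n + n)); congr integral_rV;
  apply/funext => z; rewrite mulr0.
Qed.

Lemma cint_sum U (I : Type) (r : seq I) (F : I -> E -> C) : open U ->
  (forall i, csm U (F i)) -> (forall i, supp_in U (F i)) ->
  cint U (fun z => \sum_(i <- r) F i z) = \sum_(i <- r) cint U (F i).
Proof.
move=> oU sF pF; elim: r => [|i r IH].
  by rewrite big_nil -[RHS](cint0 U); apply: cint_ext => z _; rewrite big_nil.
rewrite big_cons -IH -cintD //.
- by apply: cint_ext => z _; rewrite big_cons.
- by apply: csm_sum => // j _; exact: sF.
- exact: supp_in_sum.
Qed.

Lemma cint_cpartial U F i : open U -> csm U F -> supp_in U F ->
  cint U (cpartial i F) = 0.
Proof.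
move=> oU /csmP[s1 s2] [K [cK KU F0]]; apply: complexE2 => /=.
  by apply: (integral_patch_partial i oU cK KU s1) => z Uz nK; rewrite F0.
by apply: (integral_patch_partial i oU cK KU s2) => z Uz nK; rewrite F0.
Qed.

Lemma supp_in_cpartial U F i : open U -> supp_in U F -> supp_in U (cpartial i F).
Proof.
move=> oU [K [cK KU F0]]; exists K; split=> // z Uz nK.
have E1 y : (U `&` ~` K) y -> F y = (fun _ => 0) y by move=> [Uy Ky]; rewrite F0.
have Wz : (U `&` ~` K) z by [].
have oW := open_setD oU cK.
by rewrite (dv_ext (derivation_cpartial oW i) E1 Wz) (dv_cst (derivation_cpartial oW i)).
Qed.

(** Collects what [stokes] needs of a derivative. Being stable under combinations, it passes from
    the real partial derivatives to [d_z] and [d_zbar], and Stokes' theorem is proved for both at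
    once. *)
Record stokes_on (D : (E -> C) -> E -> C) : Prop := StokesOn {
  so_dv : forall U, open U -> derivation_on U D;
  so_supp : forall U F, open U -> supp_in U F -> supp_in U (D F);
  so_int : forall U F, open U -> csm U F -> supp_in U F -> cint U (D F) = 0 }.

Lemma stokes_comb a b D1 D2 : stokes_on D1 -> stokes_on D2 ->
  stokes_on (fun F z => a * D1 F z + b * D2 F z).
Proof.
move=> [d1 s1 i1] [d2 s2 i2]; split.
- by move=> U oU; exact: (derivation_comb oU a b (d1 U oU) (d2 U oU)).
- move=> U F oU pF; apply: supp_inD; apply: supp_inMr; [exact: s1|exact: s2].
move=> U F oU sF pF.
have c1 := dv_smooth (d1 _ oU) sF; have c2 := dv_smooth (d2 _ oU) sF.
have p1 := s1 _ _ oU pF; have p2 := s2 _ _ oU pF.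
rewrite (cintD oU (csmZ oU a c1) (csmZ oU b c2) (supp_inMr _ p1) (supp_inMr _ p2)).
by rewrite !cintZ // i1 // i2 // !mulr0 addr0.
Qed.

Lemma stokes_cpartial i : stokes_on (cpartial i).
Proof.
split.
- by move=> U oU; exact: derivation_cpartial.
- by move=> U F; exact: supp_in_cpartial.
- by move=> U F; exact: cint_cpartial.
Qed.

Lemma stokes_d_z j : stokes_on (d_z j).
Proof. by rewrite d_zE; apply: stokes_comb; exact: stokes_cpartial. Qed.

Lemma stokes_d_zbar j : stokes_on (d_zbar j).
Proof. by rewrite d_zbarE; apply: stokes_comb; exact: stokes_cpartial. Qed.

Lemma cint_by_parts D U F G : stokes_on D -> open U -> csm U F -> csm U G ->
  supp_in U F -> cint U (fun z => F z * D G z) = - cint U (fun z => D F z * G z).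
Proof.
move=> hD oU sF sG pF; have dU := so_dv hD oU.
have sDF := dv_smooth dU sF; have sDG := dv_smooth dU sG.
have := so_int hD oU (csmM oU sF sG) (supp_inM G pF).
rewrite (cint_ext (G := fun z => D F z * G z + F z * D G z)); last first.
  by move=> z Uz; exact: (dvM dU).
rewrite (cintD oU (csmM oU sDF sG) (csmM oU sF sDG) (supp_inM _ (so_supp hD oU pF)) (supp_inM _ pF)).
by move=> /eqP; rewrite addrC addr_eq0 => /eqP.
Qed.

Lemma cint_shrink U U' F : U' `<=` U -> (forall z, U z -> ~ U' z -> F z = 0) ->
  cint U F = cint U' F.
Proof.
move=> U'U F0; apply: complexE2 => /=; congr integral_rV; apply/funext => z;
  (have [U'z|nU] := pselect (U' z); [by rewrite !indicT //; exact: U'U|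
   rewrite [in RHS]indicF // mul0r;
   have [Uz|nUz] := pselect (U z); [by rewrite F0 // mulr0|by rewrite indicF // mul0r]]).
Qed.

Lemma cint_change U V psi chi F G : open U -> open V ->
  (forall x, U x -> V (psi x) /\ chi (psi x) = x) ->
  (forall y, V y -> U (chi y) /\ psi (chi y) = y) ->
  (forall l, holomorphic_on U (fun z => zcoord (psi z) l)) ->
  (forall l, holomorphic_on V (fun z => zcoord (chi z) l)) ->
  csm V G -> supp_in V G ->
  (forall x, U x -> F x = G (psi x) * (\det (cjac psi x) * (\det (cjac psi x))^*)) ->
  cint U F = cint V G.
Proof.
move=> oU oV psiV chiU hpsi hchi /csmP[s1 s2] [K [cK KV G0]] FG.
have r x : U x -> Im (\det (cjac psi x) * (\det (cjac psi x))^*) = 0.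
  by move=> Ux; rewrite (@ImM R) (@Re_conj R) (@Im_conj R); ring.
apply: complexE2 => /=.
  apply: (integral_holomorphic_change oU oV cK KV psiV chiU hpsi hchi).
  - move=> y Vy; apply: (cont_ext oV (f := fun z => Re (G z))) (Vy) _ => [z Vz|].
      by rewrite indicT // mul1r.
    by move: y Vy; apply: smooth_cont.
  - by move=> y nK; apply: (@patch_eq0 V K (fun z => Re (G z))) => // z Vz nKz; rewrite G0.
  - by move=> x nU; rewrite indicF // mul0r.
  - move=> x Ux; have [Vx _] := psiV x Ux.
    rewrite !indicT // !mul1r FG // [LHS](@ReM R) r // mulr0 subr0 //.
apply: (integral_holomorphic_change oU oV cK KV psiV chiU hpsi hchi).
- move=> y Vy; apply: (cont_ext oV (f := fun z => Im (G z))) (Vy) _ => [z Vz|].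
    by rewrite indicT // mul1r.
  by move: y Vy; apply: smooth_cont.
- by move=> y nK; apply: (@patch_eq0 V K (fun z => Im (G z))) => // z Vz nKz; rewrite G0.
- by move=> x nU; rewrite indicF // mul0r.
- move=> x Ux; have [Vx _] := psiV x Ux.
  rewrite !indicT // !mul1r FG // [LHS](@ImM R) r // mulr0 add0r //.
Qed.

End LocalIntegral.

(** * Integration and closed forms on a compact complex manifold *)

Section ManifoldIntegral.
Variables (R : realType) (n : nat) (X : compactComplexManifold R n).
Notation E := 'rV[R]_(n + n).
Notation C := R[i].
Notation Re := complex.Re.
Notation Im := complex.Im.
Notation U_ a := (im a (@setT (carrier (mfd X)))).
Opaque smooth_on.
Opaque csmooth_on.
Opaque integral_rV.
Implicit Types (a b c : idx X) (x : X) (z : E) (tau : idx X -> E -> C).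

Definition trn a b z := chart b (chartV a z).

Lemma im_E a (V : set X) z : im a V z <-> U_ a z /\ V (chartV a z).
Proof.
have [_ _ h _ _] := mfd_atlas X.
split; first by move=> [x [dx Vx] <-]; rewrite (h _ _ dx).1; split=> //; exists x.
by move=> [[x [dx _] <-]]; rewrite (h _ _ dx).1 => Vx; exists x.
Qed.

Lemma im_chart a x : dom a x -> U_ a (chart a x) /\ chartV a (chart a x) = x.
Proof.
move=> dx; have [_ _ h _ _] := mfd_atlas X.
by split; [exists x|exact: (h _ _ dx).1].
Qed.

Lemma im_dom a z : U_ a z -> dom a (chartV a z) /\ chart a (chartV a z) = z.
Proof. by move=> [x [dx _] <-]; rewrite (im_chart dx).2. Qed.

Lemma dom_cover x : exists a, dom a x.
Proof. by have [h _ _ _ _] := mfd_atlas X. Qed.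

Lemma open_im a (V : set X) : open V -> open (im a V).
Proof.
move=> oV; have [_ /(_ a)[_ oU] _ h _] := mfd_atlas X.
rewrite topology_structure.openE => z /im_E[Uz Vz].
have h1 : nbhs z (U_ a) by exact: open_nbhs_nbhs.
have h2 : nbhs z (chartV a @^-1` V) by apply: (h a z Uz); exact: open_nbhs_nbhs.
by apply: filterS2 h1 h2 => y Uy Vy; apply/im_E.
Qed.

Lemma open_U a : open (U_ a).
Proof. by have [_ /(_ a)[_ oU] _ _ _] := mfd_atlas X. Qed.
Arguments open_U : clear implicits.

Lemma open_dom a : open (dom a).
Proof. by have [_ /(_ a)[oU _] _ _ _] := mfd_atlas X. Qed.

Lemma open_imdom a b : open (im a (dom b)).
Proof. by apply: open_im; exact: open_dom. Qed.
Arguments open_imdom : clear implicits.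

Lemma imdom_sub a b z : im a (dom b) z -> U_ a z.
Proof. by move=> /im_E[]. Qed.

Lemma trnP a b z : im a (dom b) z ->
  [/\ im b (dom a) (trn a b z), trn b a (trn a b z) = z &
      chartV b (trn a b z) = chartV a z].
Proof.
move=> /im_E[Uz dz]; have [h1 h2] := im_chart dz; have [h3 h4] := im_dom Uz.
split; last exact: h2; last by rewrite /trn h2.
by apply/im_E; rewrite /trn h2.
Qed.

Lemma trn_holo a b l :
  holomorphic_on (im a (dom b)) (fun z => zcoord (trn a b z) l).
Proof. by have [_ _ _ _ h] := mfd_atlas X; exact: h. Qed.

(* Families of local functions, one per chart, that glue to a function
   ([scalar]) or to a top-degree form ([density]) on X. *)
Definition scalar tau := forall a b z, im a (dom b) z ->
  tau a z = tau b (trn a b z).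
Definition density tau := forall a b z, im a (dom b) z ->
  tau a z = tau b (trn a b z) *
    (\det (cjac (trn a b) z) * (\det (cjac (trn a b) z))^*).
Definition sfam tau := forall a, csm (U_ a) (tau a).

Lemma sfam_dom tau a b : sfam tau -> csm (im a (dom b)) (tau a).
Proof.
move=> /(_ a)/csmP[h1 h2]; apply/csmP; split.
Transparent smooth_on.
  by move=> s x /imdom_sub; exact: h1.
by move=> s x /imdom_sub; exact: h2.
Qed.
Opaque smooth_on.

Definition supp c := closure [set x : X | pou c x != 0].
Definition Rho c a z : C := Complex (pou c (chartV a z)) 0.

Lemma supp_dom c : supp c `<=` dom c.
Proof. by have [_ _ h _] := mfd_pou X; exact: h. Qed.

Lemma supp_compact c : compact (supp c).
Proof.
apply: (subclosed_compact _ (@mfd_compact R n X)) => //.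
exact: closed_closure.
Qed.

Lemma pou_supp c x : ~ supp c x -> pou c x = 0.
Proof.
by move=> h; apply/eqP/negPn/negP => h'; apply: h; exact: subset_closure.
Qed.

Lemma chart_compact a (S : set X) : compact S -> S `<=` dom a ->
  compact (chart a @` S).
Proof.
move=> cS Sa; apply: continuous_compact => //.
have [_ _ h _ _] := mfd_atlas X.
by apply: continuous_in_subspaceT => y /set_mem /Sa /h[].
Qed.

Lemma Rho_csm c : sfam (Rho c).
Proof.
move=> a; apply: csm_real; first exact: open_U.
have [h _ _ _] := mfd_pou X; exact: (h c a).
Qed.
Arguments Rho_csm : clear implicits.

Lemma Rho_scalar c : scalar (Rho c).
Proof. by move=> a b z h; rewrite /Rho; have [_ _ ->] := trnP h. Qed.

Lemma Rho_sum a z : \sum_c Rho c a z = 1.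
Proof.
have [_ _ _ h] := mfd_pou X.
apply: complexE2; rewrite ?(big_morph _ (@ReD R) (erefl : Re (0 : C) = 0))
  ?(big_morph _ (@ImD R) (erefl : Im (0 : C) = 0)) /=; first exact: h.
by rewrite big1.
Qed.

Lemma supp_Rho2 a c (F G : E -> C) :
  (forall z, U_ a z -> ~ supp a (chartV a z) -> F z = 0) ->
  (forall z, U_ a z -> ~ supp c (chartV a z) -> G z = 0) ->
  supp_in (im a (dom c)) (fun z => F z * G z).
Proof.
move=> hF hG; have Sac : supp a `&` supp c `<=` dom a by move=> x [/supp_dom].
exists (chart a @` (supp a `&` supp c)); split.
- apply: chart_compact => //; apply: compact_closedI; first exact: supp_compact.
  exact: closed_closure.
- move=> _ [x [/supp_dom dx /supp_dom dx'] <-]; apply/im_E.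
  by have [h1 h2] := im_chart dx; rewrite h2.
move=> z /im_E[Uz dz] nK.
have [h|h] := pselect (supp a (chartV a z)); last by rewrite hF // mul0r.
have [h'|h'] := pselect (supp c (chartV a z)); last by rewrite hG // mulr0.
by exfalso; apply: nK; exists (chartV a z) => //; exact: (im_dom Uz).2.
Qed.

Lemma Rho0 c a z : ~ supp c (chartV a z) -> Rho c a z = 0.
Proof. by move=> h; rewrite /Rho pou_supp. Qed.

Lemma Rho_D0 D c a z : (forall U, open U -> derivation_on U D) ->
  U_ a z -> ~ supp c (chartV a z) -> D (Rho c a) z = 0.
Proof.
move=> hD Uz nS.
have oW : open (im a (~` supp c)).
  by apply: open_im; rewrite openC; exact: closed_closure.
have Wz : im a (~` supp c) z by apply/im_E.
have E1 y : im a (~` supp c) y -> Rho c a y = (fun _ => 0) y.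
  by move=> /im_E[Uy Sy]; rewrite Rho0.
by rewrite (dv_ext (hD _ oW) E1 Wz) (dv_cst (hD _ oW)).
Qed.

Lemma supp_Rho a (F : E -> C) : supp_in (U_ a) (fun z => Rho a a z * F z).
Proof.
apply: supp_inM; exists (chart a @` supp a); split.
- by apply: chart_compact; [exact: supp_compact|exact: supp_dom].
- by move=> _ [x /supp_dom dx <-]; exists x.
move=> z Uz nK; apply: Rho0 => h; apply: nK; exists (chartV a z) => //.
exact: (im_dom Uz).2.
Qed.

(** Here the change of variables enters the global theory: the transformation rule of a density is
    exactly the squared complex Jacobian of [cint_change]. *)
Lemma cint_density tau a c : sfam tau -> density tau ->
  (forall z, U_ a z -> ~ dom c (chartV a z) -> tau a z = 0) ->
  (forall z, U_ c z -> ~ dom a (chartV c z) -> tau c z = 0) ->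
  supp_in (im c (dom a)) (tau c) ->
  cint (U_ a) (tau a) = cint (U_ c) (tau c).
Proof.
move=> st dt h1 h2 hs.
rewrite (cint_shrink (U' := im a (dom c))); last 2 first.
- by move=> z; exact: imdom_sub.
- by move=> z Uz nU; apply: h1 => // dz; apply: nU; apply/im_E.
rewrite [RHS](cint_shrink (U' := im c (dom a))); last 2 first.
- by move=> z; exact: imdom_sub.
- by move=> z Uz nU; apply: h2 => // dz; apply: nU; apply/im_E.
apply: (@cint_change R n _ _ (trn a c) (trn c a)) => //.
- exact: open_imdom.
- exact: open_imdom.
- by move=> x /trnP[].
- by move=> x /trnP[].
- exact: trn_holo.
- exact: trn_holo.
- exact: sfam_dom.
- by move=> x; exact: dt.
Qed.

Definition two_n : C := Complex (2 ^+ n) 0.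
Definition integ tau : C := \sum_a cint (U_ a) (fun z => Rho a a z * (two_n * tau a z)).

Lemma integral_cmfdE tau : integral_cmfd tau = integ tau.
Proof.
apply: complexE2; rewrite /integ ?(big_morph _ (@ReD R) (erefl : Re (0 : C) = 0))
  ?(big_morph _ (@ImD R) (erefl : Im (0 : C) = 0)) /=;
  apply: eq_bigr => a _; congr integral_rV; apply/funext => z; congr (_ * _).
  by rewrite (@ReM R) (@ReM R) /= !mul0r !subr0; ring.
by rewrite (@ImM R) (@ImM R) /= !mul0r !addr0; ring.
Qed.

Lemma csm_integrand tau a : sfam tau ->
  csm (U_ a) (fun z => Rho a a z * (two_n * tau a z)).
Proof.
move=> h; apply: csmM; [exact: open_U|exact: Rho_csm|].
by apply: csmZ; [exact: open_U|exact: h].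
Qed.

Lemma integ_ext tau tau' : (forall a z, U_ a z -> tau a z = tau' a z) ->
  integ tau = integ tau'.
Proof.
by move=> h; apply: eq_bigr => a _; apply: cint_ext => z Uz; rewrite h.
Qed.

Lemma integD tau tau' : sfam tau -> sfam tau' ->
  integ (fun a z => tau a z + tau' a z) = integ tau + integ tau'.
Proof.
move=> h h'; rewrite /integ -big_split; apply: eq_bigr => a _ /=.
rewrite -(cintD (open_U a) (csm_integrand a h) (csm_integrand a h')
  (supp_Rho _ _) (supp_Rho _ _)).
by apply: cint_ext => z _; rewrite !mulrDr.
Qed.

Lemma integZ (k : C) tau : sfam tau ->
  integ (fun a z => k * tau a z) = k * integ tau.
Proof.
move=> h; rewrite /integ mulr_sumr; apply: eq_bigr => a _ /=.
rewrite -(cintZ k (open_U a) (csm_integrand a h) (supp_Rho _ _)).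
by apply: cint_ext => z _; ring.
Qed.

Lemma sfam_cst (k : C) : sfam (fun _ _ => k).
Proof. by move=> a; apply: csm_cst; exact: open_U. Qed.

Lemma sfamD tau tau' : sfam tau -> sfam tau' -> sfam (fun a z => tau a z + tau' a z).
Proof. by move=> h h' a; apply: csmD; [exact: open_U|exact: h|exact: h']. Qed.

Lemma sfamM tau tau' : sfam tau -> sfam tau' -> sfam (fun a z => tau a z * tau' a z).
Proof. by move=> h h' a; apply: csmM; [exact: open_U|exact: h|exact: h']. Qed.

Lemma sfamZ (k : C) tau : sfam tau -> sfam (fun a z => k * tau a z).
Proof. by move=> h a; apply: csmZ; [exact: open_U|exact: h]. Qed.

Lemma sfamN tau : sfam tau -> sfam (fun a z => - tau a z).
Proof. by move=> h a; apply: csmN; [exact: open_U|exact: h]. Qed.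

Lemma sfamB tau tau' : sfam tau -> sfam tau' -> sfam (fun a z => tau a z - tau' a z).
Proof. by move=> h h'; exact: (sfamD h (sfamN h')). Qed.

Lemma sfam_sum (I : Type) (r : seq I) (P : pred I) (F : I -> idx X -> E -> C) :
  (forall i, P i -> sfam (F i)) -> sfam (fun a z => \sum_(i <- r | P i) F i a z).
Proof. by move=> h a; apply: csm_sum => [|i Pi]; [exact: open_U|exact: h]. Qed.

Lemma sfam_ext tau tau' : (forall a z, U_ a z -> tau a z = tau' a z) ->
  sfam tau -> sfam tau'.
Proof. by move=> h s a; apply: csm_ext (s a) => [|z Uz]; [exact: open_U|exact: h]. Qed.

Lemma sfam_conj tau : sfam tau -> sfam (fun a z => (tau a z)^*).
Proof. by move=> h a; apply: csm_conj; [exact: open_U|exact: h]. Qed.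

Lemma integN tau : sfam tau -> integ (fun a z => - tau a z) = - integ tau.
Proof.
move=> h; rewrite -mulN1r -integZ //; apply: integ_ext => a z _; by rewrite mulN1r.
Qed.

Lemma integB tau tau' : sfam tau -> sfam tau' ->
  integ (fun a z => tau a z - tau' a z) = integ tau - integ tau'.
Proof. by move=> h h'; rewrite (integD h (sfamN h')) (integN h'). Qed.

Lemma integ0 : integ (fun _ _ => 0) = 0.
Proof.
rewrite -[RHS](mul0r (integ (fun _ _ => 0))) -(integZ 0 (sfam_cst 0)).
by apply: integ_ext => a z _; rewrite mul0r.
Qed.

Lemma integ_sum (I : Type) (r : seq I) (P : pred I) (F : I -> idx X -> E -> C) :
  (forall i, P i -> sfam (F i)) ->
  integ (fun a z => \sum_(i <- r | P i) F i a z) = \sum_(i <- r | P i) integ (F i).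
Proof.
move=> h; elim: r => [|i r IH].
  by rewrite big_nil -[RHS]integ0; apply: integ_ext => a z _; rewrite big_nil.
rewrite big_cons; case Pi : (P i).
  rewrite -IH -integD //; [|exact: h|exact: sfam_sum].
  by apply: integ_ext => a z _; rewrite big_cons Pi.
by rewrite -IH; apply: integ_ext => a z _; rewrite big_cons Pi.
Qed.

Lemma cint_ge0 U F : open U -> csm U F -> supp_in U F ->
  (forall z, U z -> 0 <= F z) ->
  0 <= cint U F /\ (cint U F = 0 -> forall z, U z -> F z = 0).
Proof.
move=> oU sF pF F0; have [N [N0 h1 h2]] := cint_cc oU sF pF.
have ImF z : \1_U z * Im (F z) = 0.
  have [Uz|nU] := pselect (U z); last by rewrite indicF // mul0r.
  by have := F0 z Uz; rewrite lecE => /andP[/eqP -> _]; rewrite mulr0.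
have ReF z : 0 <= \1_U z * Re (F z).
  have [Uz|nU] := pselect (U z); last by rewrite indicF // mul0r.
  by have := F0 z Uz; rewrite lecE indicT // mul1r => /andP[].
split.
  rewrite lecE /=; apply/andP; split; last exact: (integral_rV_ge0 N0 h1).
  apply/eqP; rewrite -[RHS](@integral_rV0 R (n + n)); congr integral_rV.
  by apply/funext => z; rewrite ImF.
move=> /(congr1 (@complex.Re R)) /= h z Uz.
have := integral_rV_eq0 N0 h1 ReF h z; rewrite indicT // mul1r => hz.
by apply: complexE2 => //; have := ImF z; rewrite indicT // mul1r.
Qed.

Lemma two_n_gt0 : 0 < two_n.
Proof. by rewrite ltcE /= eqxx /= exprn_gt0. Qed.

Lemma Rho_ge0 c a z : 0 <= Rho c a z.
Proof.
have [_ h _ _] := mfd_pou X; by rewrite lecE /= eqxx /=.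
Qed.

(** In chart [a] a zero integral controls [tau] only where the partition function of [a] is nonzero.
    Every point has some chart [c] whose partition function is nonzero there, and the vanishing in
    chart [c] is carried back by the transformation rule of a density. *)
Lemma integ_ge0 tau : sfam tau -> density tau ->
  (forall a z, U_ a z -> 0 <= tau a z) ->
  0 <= integ tau /\ (integ tau = 0 -> forall a z, U_ a z -> tau a z = 0).
Proof.
move=> st dt t0.
have H a : 0 <= cint (U_ a) (fun z => Rho a a z * (two_n * tau a z)) /\
   (cint (U_ a) (fun z => Rho a a z * (two_n * tau a z)) = 0 -> forall z, U_ a z ->
     Rho a a z * (two_n * tau a z) = 0).
  apply: cint_ge0; [exact: open_U|exact: csm_integrand|exact: supp_Rho|].
  move=> z Uz; apply: mulr_ge0; first exact: Rho_ge0.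
  by apply: mulr_ge0; [exact: ltW two_n_gt0|exact: t0].
split; first by apply: sumr_ge0 => a _; have [] := H a.
move=> /eqP; rewrite psumr_eq0 => [/allP h|a _]; last by have [] := H a.
have h' a z : U_ a z -> Rho a a z * (two_n * tau a z) = 0.
  move=> Uz; have [_] := H a; apply => //; apply/eqP.
  by have := h a (mem_index_enum a).
move=> a z Uz; have [_ _ _ hs] := mfd_pou X.
have [c hc] : exists c, pou c (chartV a z) != 0.
  apply/existsP; rewrite -negb_forall; apply/negP => /forallP hn.
  have := hs (chartV a z); rewrite big1 => [/eqP|c _]; first by rewrite eq_sym oner_eq0.
  by apply/eqP; have := hn c.
have dz : im a (dom c) z.
  by apply/im_E; split=> //; apply: supp_dom; exact: subset_closure.
rewrite (dt _ _ _ dz); have [hy _ hy3] := trnP dz.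
have := h' c _ (imdom_sub hy) => /eqP.
rewrite mulf_eq0 mulf_eq0 (gt_eqF two_n_gt0) /= => /orP[|/eqP ->]; last by rewrite mul0r.
by move=> /eqP [] ; rewrite hy3 => /eqP; rewrite (negPf hc).
Qed.

(** In chart [a] integration by parts replaces the divergence by [T a], the pairing of [P] with the
    gradient of [Rho a]; the transformation law of [P] is encoded by requiring this pairing to be a
    density. The pieces [Rho c * T a] are transported to chart [c], and summing over [a] yields the
    gradient of the constant 1. *)
Lemma stokes (D : 'I_n -> (E -> C) -> E -> C) (P : 'I_n -> idx X -> E -> C) :
  (forall j, stokes_on (D j)) -> (forall j, sfam (P j)) ->
  (forall c, density (fun a z => \sum_j D j (Rho c a) z * P j a z)) ->
  integ (fun a z => \sum_j D j (P j a) z) = 0.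
Proof.
move=> hD sP dP.
have oU := open_U.
have dU a j := so_dv (hD j) (oU a).
have sDR c j : sfam (fun a => D j (Rho c a)).
  move=> a; exact (dv_smooth (dU a j) (Rho_csm c a)).
have sDP j : sfam (fun a => D j (P j a)).
  by move=> a; exact (dv_smooth (dU a j) (sP j a)).
pose T c a z := \sum_j D j (Rho c a) z * P j a z.
have sT c : sfam (T c) by apply: sfam_sum => j _; exact: sfamM.
have T0 c a z : U_ a z -> ~ supp c (chartV a z) -> T c a z = 0.
  move=> Uz nS; rewrite /T big1 // => j _.
  by rewrite (@Rho_D0 (D j) c a z (fun U oU' => so_dv (hD j) oU') Uz nS) mul0r.
have step1 a : cint (U_ a) (fun z => Rho a a z * (two_n * \sum_j D j (P j a) z)) =
   - (two_n * cint (U_ a) (T a a)).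
  transitivity (\sum_j cint (U_ a) (fun z => Rho a a z * D j (fun y => two_n * P j a y) z)).
    rewrite -cint_sum //; last 2 first.
    - move=> j; apply: csmM; [exact: oU|exact: Rho_csm|].
      apply: (dv_smooth (dU a j)); apply: csmZ; [exact: oU|exact: sP].
    - by move=> j; exact: supp_Rho.
    apply: cint_ext => z Uz; rewrite !mulr_sumr; apply: eq_bigr => j _.
    by rewrite (dvZ (oU a) (dU a j)) //; exact: sP.
  have pR : supp_in (U_ a) (Rho a a).
    by apply: supp_in_ext (supp_Rho a (fun _ => 1)) => z _; rewrite mulr1.
  have -> : cint (U_ a) (T a a) = \sum_j cint (U_ a) (fun z => D j (Rho a a) z * P j a z).
    rewrite -cint_sum // => j; first exact (csmM (oU a) (sDR a j a) (sP j a)).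
    by apply: supp_inM; exact (so_supp (hD j) (oU a) pR).
  rewrite mulr_sumr -sumrN; apply: eq_bigr => j _.
  have s2 : csm (U_ a) (fun y => two_n * P j a y) by apply: csmZ; [exact: oU|exact: sP].
  rewrite (cint_by_parts (hD j) (oU a) (Rho_csm a a) s2 pR).
  rewrite -cintZ; last 3 first.
  - exact: oU.
  - exact (csmM (oU a) (sDR a j a) (sP j a)).
  - by apply: supp_inM; exact (so_supp (hD j) (oU a) pR).
  by congr (- _); apply: cint_ext => z _; ring.
rewrite /integ (eq_bigr _ (fun a _ => step1 a)) sumrN -mulr_sumr.
have step2 a c : cint (U_ a) (fun z => Rho c a z * T a a z) =
    cint (U_ c) (fun z => Rho c c z * T a c z).
  apply: (@cint_density (fun b z => Rho c b z * T a b z)).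
  - by apply: sfamM; [exact: Rho_csm|exact: sT].
  - move=> b b' z hz; rewrite (Rho_scalar c hz) -mulrA; congr (_ * _); exact: dP.
  - by move=> z Uz nd; rewrite Rho0 ?mul0r // => /supp_dom.
  - by move=> z Uz nd; rewrite T0 ?mulr0 // => /supp_dom.
  apply: supp_Rho2 => z Uz nS; first by rewrite Rho0.
  exact: T0.
have -> : \sum_a cint (U_ a) (T a a) = \sum_c \sum_a cint (U_ c) (fun z => Rho c c z * T a c z).
  rewrite exchange_big; apply: eq_bigr => a _ /=.
  rewrite -(eq_bigr _ (fun c _ => step2 a c)) -cint_sum.
  - by apply: cint_ext => z _; rewrite -mulr_suml Rho_sum mul1r.
  - exact: oU.
  - by move=> c; exact (csmM (oU a) (Rho_csm c a) (sT a a)).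
  move=> c; apply: supp_inMr.
  exists (chart a @` supp a); split.
  - by apply: chart_compact; [exact: supp_compact|exact: supp_dom].
  - by move=> _ [x /supp_dom dx <-]; exists x.
  move=> z Uz nK; apply: T0 => // h; apply: nK; exists (chartV a z) => //.
  exact: (im_dom Uz).2.
rewrite big1 ?mulr0 ?oppr0 // => c _.
rewrite -cint_sum; last 3 first.
- exact: oU.
- by move=> a; exact (csmM (oU c) (Rho_csm c c) (sT a c)).
- by move=> a; exact: supp_Rho.
rewrite -[RHS](cint0 (U_ c)); apply: cint_ext => z Uz.
rewrite -mulr_sumr exchange_big big1 ?mulr0 // => j _ /=.
rewrite -mulr_suml -(dv_sum (oU c) (dU c j)) //; last by move=> a _; exact: Rho_csm.
rewrite (dv_ext (dU c j) (G := fun _ => 1)) // => [|y _]; last exact: Rho_sum.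
by rewrite (dv_cst (dU c j)) // mul0r.
Qed.

End ManifoldIntegral.
Arguments open_U {R n X} a.
Arguments open_imdom {R n X} a b.
Arguments Rho_csm {R n X} c.

(** * Closed (1,1)-forms and integration by parts against a Hessian *)

Section Forms.
Variables (R : realType) (n : nat) (X : compactComplexManifold R n).
Notation E := 'rV[R]_(n + n).
Notation C := R[i].
Notation U_ a := (im a (@setT (carrier (mfd X)))).
Opaque smooth_on.
Opaque csmooth_on.
Opaque integral_rV.
Opaque d_z d_zbar cpartial integ.
Implicit Types (a b c : idx X) (z : E) (s u tau : idx X -> E -> C).
Implicit Types (M N : form11 X).

Notation J_ a b z := (cjac (trn a b) z).

Definition is_form M := forall a b z, im a (dom b) z ->
  M a z = J_ a b z *m M b (trn a b z) *m ct (J_ a b z).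

Definition mfam M := forall i j, sfam (fun a z => M a z i j).

(** The last two fields are the coordinate versions of the vanishing of [partial M] and
    [partialbar M]; they are the symmetry that [piola] requires for [d_z] and, after transposition,
    for [d_zbar]. *)
Record closed_form M : Prop := ClosedForm {
  cf_smooth : mfam M;
  cf_form : is_form M;
  cf_dz : forall a z, U_ a z -> forall j p q,
    d_z j (fun y => M a y p q) z = d_z p (fun y => M a y j q) z;
  cf_dzbar : forall a z, U_ a z -> forall j p q,
    d_zbar j (fun y => M a y p q) z = d_zbar q (fun y => M a y p j) z }.

Definition gz s a z : 'cV[C]_n := \col_j d_z j (s a) z.
Definition gzb s a z : 'rV[C]_n := \row_l d_zbar l (s a) z.
Definition hess s a z : 'M[C]_n := ddbarC (s a) z.

Lemma gzE s a z j i : gz s a z j i = d_z j (s a) z.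
Proof. by rewrite mxE. Qed.

Lemma gzbE s a z i l : gzb s a z i l = d_zbar l (s a) z.
Proof. by rewrite mxE. Qed.

Lemma hessE s a z j l : hess s a z j l = d_z j (d_zbar l (s a)) z.
Proof. by rewrite mxE. Qed.

Lemma mfam_entry M a i j : mfam M -> csm (U_ a) (fun z => M a z i j).
Proof. by move=> h; exact: (h i j a). Qed.

Lemma sfam_det M : mfam M -> sfam (fun a z => \det (M a z)).
Proof.
by move=> h a; apply: csm_det => [|i j]; [exact: open_U|exact: mfam_entry].
Qed.

Lemma sfam_adj M : mfam M -> mfam (fun a z => \adj (M a z)).
Proof.
move=> h i j a.
by apply: csm_adj => [|k l]; [exact: open_U|exact: mfam_entry].
Qed.

Lemma sfam_d_z s j : sfam s -> sfam (fun a => d_z j (s a)).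
Proof.
by move=> h a; exact (dv_smooth (derivation_d_z (open_U a) j) (h a)).
Qed.

Lemma sfam_d_zbar s j : sfam s -> sfam (fun a => d_zbar j (s a)).
Proof.
by move=> h a; exact (dv_smooth (derivation_d_zbar (open_U a) j) (h a)).
Qed.

Lemma sfam_gz s : sfam s -> forall j, sfam (fun a z => gz s a z j 0).
Proof.
move=> h j; apply: sfam_ext (sfam_d_z j h) => a z _; by rewrite mxE.
Qed.

Lemma sfam_gzb s : sfam s -> forall j, sfam (fun a z => gzb s a z 0 j).
Proof.
move=> h j; apply: sfam_ext (sfam_d_zbar j h) => a z _; by rewrite mxE.
Qed.

Lemma mfam_hess s : sfam s -> mfam (hess s).
Proof.
move=> h i j; apply: sfam_ext (sfam_d_z i (sfam_d_zbar j h)) => a z _; by rewrite mxE.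
Qed.

Lemma mfam_mul M N : mfam M -> mfam N -> mfam (fun a z => M a z *m N a z).
Proof.
move=> hM hN i j; apply: (@sfam_ext _ _ _ (fun a z => \sum_k M a z i k * N a z k j)).
  by move=> a z _; rewrite mxE.
by apply: sfam_sum => k _; apply: sfamM; [exact: hM|exact: hN].
Qed.

Lemma mfamD M N : mfam M -> mfam N -> mfam (fun a z => M a z + N a z).
Proof.
move=> hM hN i j; apply: (@sfam_ext _ _ _ (fun a z => M a z i j + N a z i j)).
  by move=> a z _; rewrite mxE.
by apply: sfamD; [exact: hM|exact: hN].
Qed.

Lemma mfamZ (k : C) M : mfam M -> mfam (fun a z => k *: M a z).
Proof.
move=> hM i j; apply: (@sfam_ext _ _ _ (fun a z => k * M a z i j)).
  by move=> a z _; rewrite mxE.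
by apply: sfamZ; exact: hM.
Qed.

Lemma sfam_tr M : mfam M -> sfam (fun a z => \tr (M a z)).
Proof. by move=> h; apply: sfam_sum => i _; exact: h. Qed.

Lemma mfam_outer s u : sfam s -> sfam u -> mfam (fun a z => gz s a z *m gzb u a z).
Proof.
move=> hs hu i j; apply: (@sfam_ext _ _ _ (fun a z => gz s a z i 0 * gzb u a z 0 j)).
  by move=> a z _; rewrite [RHS]mxE big_ord1.
by apply: sfamM; [exact: sfam_gz|exact: sfam_gzb].
Qed.

Lemma sfam_tr_adj M N : mfam M -> mfam N -> sfam (fun a z => \tr (\adj (M a z) *m N a z)).
Proof.
by move=> hM hN; apply: sfam_tr; apply: (mfam_mul (sfam_adj hM) hN).
Qed.

Lemma gz_trn s a b z : sfam s -> scalar s -> im a (dom b) z ->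
  gz s a z = J_ a b z *m gz s b (trn a b z).
Proof.
move=> hs ss hz; apply/colP => j; rewrite !mxE.
have oI := open_imdom a b; have oI' := open_imdom b a.
rewrite (dv_ext (derivation_d_z oI j) (fun y hy => ss _ _ _ hy) hz).
rewrite (d_z_comp oI oI' _ (@trn_holo R n X a b) j (@sfam_dom R n X s b a hs) hz); last first.
  by move=> y /trnP[].
by apply: eq_bigr => p _; rewrite !mxE.
Qed.

Lemma gzb_trn s a b z : sfam s -> scalar s -> im a (dom b) z ->
  gzb s a z = gzb s b (trn a b z) *m ct (J_ a b z).
Proof.
move=> hs ss hz; apply/rowP => j; rewrite !mxE.
have oI := open_imdom a b; have oI' := open_imdom b a.
rewrite (dv_ext (derivation_d_zbar oI j) (fun y hy => ss _ _ _ hy) hz).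
rewrite (d_zbar_comp oI oI' _ (@trn_holo R n X a b) j (@sfam_dom R n X s b a hs) hz); last first.
  by move=> y /trnP[].
by apply: eq_bigr => p _; rewrite !mxE mulrC.
Qed.

Lemma is_form_outer s u : sfam s -> scalar s -> sfam u -> scalar u ->
  is_form (fun a z => gz s a z *m gzb u a z).
Proof.
by move=> hs ss hu su a b z hz; rewrite (gz_trn hs ss hz) (gzb_trn hu su hz) !mulmxA.
Qed.

Lemma hess_ext (F G : E -> C) (U : set E) z : open U -> U z ->
  (forall y, U y -> F y = G y) -> ddbarC F z = ddbarC G z.
Proof.
move=> oU Uz FG; apply/matrixP => j l; rewrite [LHS]mxE [RHS]mxE.
apply: (dv_ext (derivation_d_z oU j)) => // y Uy.
exact: (dv_ext (derivation_d_zbar oU l)).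
Qed.

Lemma is_form_hess s : sfam s -> scalar s -> is_form (hess s).
Proof.
move=> hs ss a b z hz.
have oI := open_imdom a b; have oI' := open_imdom b a.
rewrite {1}/hess (hess_ext oI hz (fun y hy => ss _ _ _ hy)).
rewrite (ddbar_comp oI oI' _ (@trn_holo R n X a b) (@sfam_dom R n X s b a hs) hz) //.
by move=> y /trnP[].
Qed.

Lemma closed_hess s : sfam s -> scalar s -> closed_form (hess s).
Proof.
move=> hs ss; split.
- exact: mfam_hess.
- exact: is_form_hess.
- move=> a z Uz j p q; have oU := open_U a.
  have e k m : (fun y => hess s a y k m) = d_z k (d_zbar m (s a)).
    by apply/funext => y; rewrite mxE.
  rewrite !e; apply: (commute_dz_dz oU) => //; exact: (sfam_d_zbar q hs a).
- move=> a z Uz j p q; have oU := open_U a.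
  have e k m : (fun y => hess s a y k m) = d_z k (d_zbar m (s a)).
    by apply/funext => y; rewrite mxE.
  rewrite !e -(commute_dz_dzbar oU p j (sfam_d_zbar q hs a) Uz).
  rewrite -(commute_dz_dzbar oU p q (sfam_d_zbar j hs a) Uz).
  apply: (dv_ext (derivation_d_z oU p)) => [y Uy|]; last exact: Uz.
  exact: (commute_dzbar_dzbar oU j q (hs a) Uy).
Qed.

Lemma is_formD M N : is_form M -> is_form N -> is_form (fun a z => M a z + N a z).
Proof. by move=> hM hN a b z hz; rewrite (hM _ _ _ hz) (hN _ _ _ hz) mulmxDr mulmxDl. Qed.

Lemma is_formZ (k : C) M : is_form M -> is_form (fun a z => k *: M a z).
Proof. by move=> hM a b z hz; rewrite (hM _ _ _ hz) -scalemxAr -scalemxAl. Qed.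

Lemma closedD M N : closed_form M -> closed_form N ->
  closed_form (fun a z => M a z + N a z).
Proof.
move=> [s1 f1 d1 b1] [s2 f2 d2 b2]; split; [exact: mfamD|exact: is_formD| |].
- move=> a z Uz j p q; have oU := open_U a.
  have e D (hD : derivation_on (U_ a) D) k m :
      D (fun y => (M a y + N a y) k m) z = D (fun y => M a y k m) z + D (fun y => N a y k m) z.
    rewrite -(dvD hD) //; try exact: mfam_entry.
    by apply: (dv_ext hD) => // y _; rewrite mxE.
  by rewrite !(fun j => e _ (derivation_d_z oU j)) (d1 _ _ Uz) (d2 _ _ Uz).
- move=> a z Uz j p q; have oU := open_U a.
  have e D (hD : derivation_on (U_ a) D) k m :
      D (fun y => (M a y + N a y) k m) z = D (fun y => M a y k m) z + D (fun y => N a y k m) z.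
    rewrite -(dvD hD) //; try exact: mfam_entry.
    by apply: (dv_ext hD) => // y _; rewrite mxE.
  by rewrite !(fun j => e _ (derivation_d_zbar oU j)) (b1 _ _ Uz) (b2 _ _ Uz).
Qed.

Lemma closedZ (k : C) M : closed_form M -> closed_form (fun a z => k *: M a z).
Proof.
move=> [s1 f1 d1 b1]; split; [exact: mfamZ|exact: is_formZ| |].
- move=> a z Uz j p q; have oU := open_U a.
  have e D (hD : derivation_on (U_ a) D) i m :
      D (fun y => (k *: M a y) i m) z = k * D (fun y => M a y i m) z.
    rewrite -(dvZ oU hD) //; try exact: mfam_entry.
    by apply: (dv_ext hD) => // y _; rewrite mxE.
  by rewrite !(fun j => e _ (derivation_d_z oU j)) (d1 _ _ Uz).
- move=> a z Uz j p q; have oU := open_U a.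
  have e D (hD : derivation_on (U_ a) D) i m :
      D (fun y => (k *: M a y) i m) z = k * D (fun y => M a y i m) z.
    rewrite -(dvZ oU hD) //; try exact: mfam_entry.
    by apply: (dv_ext hD) => // y _; rewrite mxE.
  by rewrite !(fun j => e _ (derivation_d_zbar oU j)) (b1 _ _ Uz).
Qed.

Lemma density_tr_adj M N : is_form M -> is_form N ->
  density (fun a z => \tr (\adj (M a z) *m N a z)).
Proof.
move=> hM hN a b z hz; rewrite (hM _ _ _ hz) (hN _ _ _ hz) adj_congr det_ct.
by rewrite mulrC.
Qed.

Lemma density_det M : is_form M -> density (fun a z => \det (M a z)).
Proof.
by move=> hM a b z hz; rewrite (hM _ _ _ hz) !det_mulmx det_ct; ring.
Qed.

Lemma densityZ s tau : scalar s -> density tau -> density (fun a z => s a z * tau a z).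
Proof. by move=> hs ht a b z hz; rewrite (hs _ _ _ hz) (ht _ _ _ hz) mulrA. Qed.

Lemma scalarD s u : scalar s -> scalar u -> scalar (fun a z => s a z + u a z).
Proof. by move=> h h' a b z hz; rewrite (h _ _ _ hz) (h' _ _ _ hz). Qed.

Lemma scalarM s u : scalar s -> scalar u -> scalar (fun a z => s a z * u a z).
Proof. by move=> h h' a b z hz; rewrite (h _ _ _ hz) (h' _ _ _ hz). Qed.

Lemma scalar_cst (k : C) : scalar (fun (_ : idx X) (_ : E) => k).
Proof. by []. Qed.

Lemma tr_adj_outer (M : 'M[C]_n) (a : 'cV[C]_n) (b : 'rV[C]_n) :
  \tr (\adj M *m (a *m b)) = \sum_j a j 0 * \sum_l (\adj M) l j * b 0 l.
Proof.
rewrite mulmxA mxtrace_mulC trace_mx11 !mxE; under eq_bigr do rewrite mxE mulr_sumr.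
rewrite exchange_big; apply: eq_bigr => j _; rewrite mulr_sumr; apply: eq_bigr => l _ /=.
ring.
Qed.

Lemma tr_mul_sum (A B : 'M[C]_n) : \tr (A *m B) = \sum_j \sum_l A l j * B j l.
Proof. by rewrite exchange_big; apply: eq_bigr => l _; rewrite mxE. Qed.

(** In terms of forms, [\tr (\adj M *m N)] is the coefficient of [N] wedge [M^(n-1) / (n-1)!]. By
    [piola] the adjugate of a closed form is divergence free, so only the derivative of [s]
    survives. *)
Lemma integral_hess M s u : closed_form M -> sfam s -> scalar s -> sfam u ->
  scalar u ->
  integ (fun a z => s a z * \tr (\adj (M a z) *m hess u a z)) =
  - integ (fun a z => \tr (\adj (M a z) *m (gz s a z *m gzb u a z))).
Proof.
move=> [sM fM dM bM] hs ss hu su.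
pose P j a z := s a z * \sum_l (\adj (M a z)) l j * d_zbar l (u a) z.
have sA := sfam_adj sM.
have sq j : sfam (fun a z => \sum_l (\adj (M a z)) l j * d_zbar l (u a) z).
  by apply: sfam_sum => l _; apply: sfamM; [exact: sA|exact: sfam_d_zbar].
have sP j : sfam (P j) by exact: (sfamM hs (sq j)).
have dP c : density (fun a z => \sum_j d_z j (Rho c a) z * P j a z).
  have h := densityZ ss (density_tr_adj fM
    (is_form_outer (Rho_csm c) (@Rho_scalar _ _ _ c) hu su)).
  have E1 a z : \sum_j d_z j (Rho c a) z * P j a z =
     s a z * \tr (\adj (M a z) *m (gz (Rho c) a z *m gzb u a z)).
    rewrite tr_adj_outer mulr_sumr; apply: eq_bigr => j _; rewrite gzE /P mulrCA.
    by congr (_ * (_ * _)); apply: eq_bigr => l _; rewrite gzbE.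
  by move=> a b z hz; exact (etrans (E1 a z) (etrans (h a b z hz) (f_equal (fun x : C => x * _) (esym (E1 b _))))).
have := stokes (fun j => @stokes_d_z R n j) sP dP.
have s1 : sfam (fun a z => s a z * \tr (\adj (M a z) *m hess u a z)).
  by apply: sfamM hs (sfam_tr_adj sM (mfam_hess hu)).
have s2 : sfam (fun a z => \tr (\adj (M a z) *m (gz s a z *m gzb u a z))).
  exact: (sfam_tr_adj sM (mfam_outer hs hu)).
rewrite (integ_ext (tau' := fun a z => s a z * \tr (\adj (M a z) *m hess u a z) +
  \tr (\adj (M a z) *m (gz s a z *m gzb u a z)))).
  by rewrite (integD s1 s2) => /eqP; rewrite addr_eq0 => /eqP.
move=> a z Uz; have oU := open_U a; have D j := derivation_d_z oU j.
transitivity (\sum_j (d_z j (s a) z * (\sum_l (\adj (M a z)) l j * d_zbar l (u a) z) +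
   s a z * \sum_l ((\adj (M a z)) l j * hess u a z j l +
      d_z j (fun y => (\adj (M a y)) l j) z * d_zbar l (u a) z))).
  apply: eq_bigr => j _; rewrite (dvM (D j) (hs a) (sq j a) Uz); congr (_ + _ * _).
  rewrite (dv_sum oU (D j)); last exact: Uz; last first.
    by move=> l _; apply: csmM; [exact: oU|exact: (sA l j a)|exact: (sfam_d_zbar l hu a)].
  apply: eq_bigr => l _.
  rewrite (dvM (D j) (sA l j a) (sfam_d_zbar l hu a) Uz) addrC; congr (_ * _ + _).
  by rewrite hessE.
have p0 l : \sum_j d_z j (fun y => (\adj (M a y)) l j) z = 0.
  apply: (@piola R n (U_ a) oU (@d_z R n) D (M a) z l) => [i j||j p q].
  - exact: (sM i j a).
  - exact: Uz.
  exact: dM.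
rewrite tr_adj_outer big_split addrC /=; congr (_ + _).
  apply: eq_bigr => j _; rewrite gzE; congr (_ * _).
  by apply: eq_bigr => l _; rewrite gzbE.
rewrite -mulr_sumr tr_mul_sum; congr (_ * _).
under eq_bigr do rewrite big_split.
rewrite big_split /= [X in _ + X]exchange_big /= [X in _ + X]big1 ?addr0 // => l _.
by rewrite -mulr_suml p0 mul0r.
Qed.

(** Here [d_zbar] is moved instead of [d_z], and [piola] is applied to the transpose. Together the
    two versions give the symmetry of Green's formula in [s] and [u]. *)
Lemma integral_hess' M s u : closed_form M -> sfam s -> scalar s -> sfam u ->
  scalar u ->
  integ (fun a z => s a z * \tr (\adj (M a z) *m hess u a z)) =
  - integ (fun a z => \tr (\adj (M a z) *m (gz u a z *m gzb s a z))).
Proof.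
move=> [sM fM dM bM] hs ss hu su.
pose P l a z := s a z * \sum_j (\adj (M a z)) l j * d_z j (u a) z.
have sA := sfam_adj sM.
have sq l : sfam (fun a z => \sum_j (\adj (M a z)) l j * d_z j (u a) z).
  by apply: sfam_sum => j _; apply: sfamM; [exact: sA|exact: sfam_d_z].
have sP l : sfam (P l) by exact: (sfamM hs (sq l)).
have outer' a z (w : idx X -> E -> C) : \sum_l d_zbar l (w a) z *
    (\sum_j (\adj (M a z)) l j * d_z j (u a) z) =
    \tr (\adj (M a z) *m (gz u a z *m gzb w a z)).
  rewrite tr_adj_outer; under eq_bigr do rewrite mulr_sumr.
  rewrite exchange_big; apply: eq_bigr => j _; rewrite gzE mulr_sumr.
  by apply: eq_bigr => l _; rewrite gzbE; ring.
have dP c : density (fun a z => \sum_l d_zbar l (Rho c a) z * P l a z).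
  have h := densityZ ss (density_tr_adj fM
    (is_form_outer hu su (Rho_csm c) (@Rho_scalar _ _ _ c))).
  have E1 a z : \sum_l d_zbar l (Rho c a) z * P l a z =
     s a z * \tr (\adj (M a z) *m (gz u a z *m gzb (Rho c) a z)).
    rewrite -outer' mulr_sumr; apply: eq_bigr => l _; by rewrite /P mulrCA.
  by move=> a b z hz; exact (etrans (E1 a z) (etrans (h a b z hz) (f_equal (fun x : C => x * _) (esym (E1 b _))))).
have := stokes (fun l => @stokes_d_zbar R n l) sP dP.
have s1 : sfam (fun a z => s a z * \tr (\adj (M a z) *m hess u a z)).
  by apply: sfamM hs (sfam_tr_adj sM (mfam_hess hu)).
have s2 : sfam (fun a z => \tr (\adj (M a z) *m (gz u a z *m gzb s a z))).
  exact: (sfam_tr_adj sM (mfam_outer hu hs)).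
rewrite (integ_ext (tau' := fun a z => s a z * \tr (\adj (M a z) *m hess u a z) +
  \tr (\adj (M a z) *m (gz u a z *m gzb s a z)))).
  by rewrite (integD s1 s2) => /eqP; rewrite addr_eq0 => /eqP.
move=> a z Uz; have oU := open_U a; have D j := derivation_d_zbar oU j.
transitivity (\sum_l (d_zbar l (s a) z * (\sum_j (\adj (M a z)) l j * d_z j (u a) z) +
   s a z * \sum_j ((\adj (M a z)) l j * hess u a z j l +
      d_zbar l (fun y => (\adj (M a y)) l j) z * d_z j (u a) z))).
  apply: eq_bigr => l _; rewrite (dvM (D l) (hs a) (sq l a) Uz); congr (_ + _ * _).
  rewrite (dv_sum oU (D l)); last exact: Uz; last first.
    by move=> j _; apply: csmM; [exact: oU|exact: (sA l j a)|exact: (sfam_d_z j hu a)].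
  apply: eq_bigr => j _.
  rewrite (dvM (D l) (sA l j a) (sfam_d_z j hu a) Uz) addrC; congr (_ * _ + _).
  rewrite hessE; symmetry; exact: (commute_dz_dzbar oU j l (hu a) Uz).
have p0 j : \sum_l d_zbar l (fun y => (\adj (M a y)) l j) z = 0.
  have h0 : \sum_l d_zbar l (fun y => (\adj (M a y)^T) j l) z = 0.
    apply: (@piola R n (U_ a) oU (@d_zbar R n) D (fun y => (M a y)^T) z j).
    - by move=> i m; apply: csm_ext (sM m i a) => [|y _]; [exact: oU|rewrite mxE].
    - exact: Uz.
    move=> l p q.
    have E1 i m k : d_zbar k (fun y => (M a y)^T i m) z = d_zbar k (fun y => M a y m i) z.
      by apply: (dv_ext (D k)); last exact: Uz; move=> y Uy; rewrite mxE.
    by rewrite !E1; exact: bM.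
  rewrite -[RHS]h0; apply: eq_bigr => l _; apply: (dv_ext (D l)); last exact: Uz.
  by move=> y Uy; rewrite -trmx_adj [RHS]mxE.
rewrite -(outer' a z s) big_split addrC /=; congr (_ + _).
rewrite -mulr_sumr tr_mul_sum; congr (_ * _).
under eq_bigr do rewrite big_split.
rewrite big_split /= exchange_big /= [X in _ + X]exchange_big /=.
rewrite [X in _ + X]big1 ?addr0 // => j _.
by rewrite -mulr_suml p0 mul0r.
Qed.

End Forms.

Section CoefficientExtraction.
Variable F : numFieldType.

(** Inversion of the Vandermonde matrix at the nodes [0, ..., N]. The weights do not depend on [P],
    so they pass through smoothness and integrals, and a coefficient of a determinantal polynomial
    becomes a combination of determinants. *)
Lemma coef_extract N q : (q <= N)%N -> exists lam : 'I_N.+1 -> F,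
  forall P : {poly F}, (size P <= N.+1)%N -> P`_q = \sum_k lam k * P.[(k : nat)%:R].
Proof.
move=> qN; pose x : 'rV[F]_N.+1 := \row_k (k : nat)%:R.
pose V := Vandermonde N.+1 x.
have uV : V \in unitmx.
  rewrite unitmxE unitfE det_Vandermonde; apply/prodf_neq0 => i _.
  apply/prodf_neq0 => j ij; rewrite !mxE subr_eq0 eqr_nat.
  by rewrite gtn_eqF.
exists (fun k => invmx V k (inord q)) => P sP.
pose r : 'rV[F]_N.+1 := \row_i P`_i.
have E : r *m V = \row_k P.[(k : nat)%:R].
  apply/rowP => k; rewrite !mxE (horner_coef_wide _ sP).
  by apply: eq_bigr => i _; rewrite !mxE.
have : r 0 (inord q) = (r *m V *m invmx V) 0 (inord q) by rewrite mulmxK.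
rewrite E !mxE inordK // => ->; apply: eq_bigr => k _.
by rewrite !mxE mulrC.
Qed.

Lemma poly_eq0_eval (P : {poly F}) : (forall s, P.[s] = 0) -> P = 0.
Proof.
move=> h; apply/polyP => q; rewrite coef0.
have [lam hl] := coef_extract (leq_addr (size P) q).
rewrite hl; last by rewrite ltnW // ltnS leq_addl.
by rewrite big1 // => k _; rewrite h mulr0.
Qed.

Lemma deriv_eq0_eval (P : {poly F}) : (forall s, P^`().[s] = 0) ->
  forall s t, P.[s] = P.[t].
Proof.
move=> /poly_eq0_eval h.
have -> : P = (P`_0)%:P.
  apply/polyP => -[|q]; rewrite coefC //=.
  have := congr1 (fun p : {poly F} => p`_q) h; rewrite coef_deriv coef0 => /eqP.
  by rewrite mulrn_eq0 /= => /eqP.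
by move=> s t; rewrite !hornerC.
Qed.

Lemma pencil_deriv_eval k (M U : 'M[F]_k) s :
  (pencil M U)^`().[s] = \tr (\adj (M + s *: U) *m U).
Proof.
rewrite /pencil deriv_det -[_.[s]]/(horner_eval s _) -trace_map_mx map_mxM map_mx_adj.
rewrite pencil_mx_eval; congr (\tr (_ *m _)); apply/matrixP => i j.
by rewrite /pencil_mx !mxE /= derivD derivM !derivC derivX mul1r mulr0 addr0 add0r /horner_eval hornerC.
Qed.

End CoefficientExtraction.

(** * Invariance of the Futaki pairing *)

Section Invariance.
Variables (R : realType) (n : nat) (X : compactComplexManifold R n).
Notation E := 'rV[R]_(n + n).
Notation C := R[i].
Notation U_ a := (im a (@setT (carrier (mfd X)))).
Opaque smooth_on.
Opaque csmooth_on.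
Opaque integral_rV.
Opaque d_z d_zbar cpartial integ.
Implicit Types (a b c : idx X) (z : E) (s u tau Th : idx X -> E -> C).
Implicit Types (M W : form11 X) (xi : vfield X).

(** Integrating coefficient by coefficient makes differentiation in the parameter a formal operation
    on polynomials. *)
Definition pinteg N (P : idx X -> E -> {poly C}) : {poly C} :=
  \poly_(q < N) integ (fun a z => (P a z)`_q).

Record pfam N (P : idx X -> E -> {poly C}) : Prop := PFam {
  pf_size : forall a z, (size (P a z) <= N)%N;
  pf_coef : forall q, sfam (fun a z => (P a z)`_q) }.

Lemma pinteg_coef N P q : pfam N P -> (pinteg N P)`_q = integ (fun a z => (P a z)`_q).
Proof.
move=> [sz _]; rewrite coef_poly; case: ltnP => // Nq.
rewrite -[LHS](@integ0 R n X); apply: integ_ext => a z _.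
by rewrite nth_default // (leq_trans (sz a z)).
Qed.

Lemma pinteg_eval N P (s : C) : pfam N P -> (pinteg N P).[s] = integ (fun a z => (P a z).[s]).
Proof.
move=> hP; have [sz sc] := hP.
rewrite (horner_coef_wide _ (size_poly _ _)).
rewrite (integ_ext (tau' := fun a z => \sum_(i < N) s ^+ i * (P a z)`_i)); last first.
  move=> a z _; rewrite (horner_coef_wide _ (sz a z)); apply: eq_bigr => i _.
  by rewrite mulrC.
rewrite integ_sum => [|i _]; last by apply: sfamZ; exact: sc.
apply: eq_bigr => i _; rewrite integZ; last exact: sc.
by rewrite pinteg_coef // mulrC.
Qed.

Lemma sfamMn tau k : sfam tau -> sfam (fun a z => tau a z *+ k).
Proof.
move=> h; apply: (sfam_ext (tau := fun a z => k%:R * tau a z)); last exact: sfamZ.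
by move=> a z _; rewrite mulr_natl.
Qed.

Lemma pfam_deriv N P : pfam N P -> pfam N (fun a z => (P a z)^`()).
Proof.
move=> [sz sc]; split=> [a z|q].
  by apply: leq_trans (size_poly _ _) _; apply: leq_trans (leq_pred _) _.
apply: (sfam_ext (tau := fun a z => (P a z)`_q.+1 *+ q.+1)).
  by move=> a z _; rewrite coef_deriv.
by apply: sfamMn; exact: sc.
Qed.

Lemma pinteg_deriv N P : pfam N P ->
  (pinteg N P)^`() = pinteg N (fun a z => (P a z)^`()).
Proof.
move=> hP; apply/polyP => q; rewrite coef_deriv pinteg_coef // pinteg_coef; last first.
  exact: pfam_deriv.
rewrite -mulr_natl -integZ; last exact: (pf_coef hP).
by apply: integ_ext => a z _; rewrite coef_deriv mulr_natl.
Qed.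

Lemma pfamM N N' P P' : pfam N P -> pfam N' P' ->
  pfam (N + N') (fun a z => P a z * P' a z).
Proof.
move=> [s1 c1] [s2 c2]; split=> [a z|q].
  apply: leq_trans (size_polyMleq _ _) _; apply: leq_trans (leq_pred _) _.
  by apply: leq_add; [exact: s1|exact: s2].
apply: (sfam_ext (tau := fun a z => \sum_(i < q.+1) (P a z)`_i * (P' a z)`_(q - i))).
  by move=> a z _; rewrite coefM.
by apply: sfam_sum => i _; apply: sfamM; [exact: c1|exact: c2].
Qed.

Lemma pfamW N N' P : (N <= N')%N -> pfam N P -> pfam N' P.
Proof. by move=> NN [sz c]; split=> // a z; exact: leq_trans (sz a z) NN. Qed.

Lemma pfamD N P P' : pfam N P -> pfam N P' -> pfam N (fun a z => P a z + P' a z).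
Proof.
move=> [s1 c1] [s2 c2]; split=> [a z|q].
  by apply: leq_trans (size_polyD _ _) _; rewrite geq_max s1 s2.
apply: (sfam_ext (tau := fun a z => (P a z)`_q + (P' a z)`_q)).
  by move=> a z _; rewrite coefD.
by apply: sfamD.
Qed.

Lemma pfamC s : sfam s -> pfam 1 (fun a z => (s a z)%:P).
Proof.
move=> hs; split=> [a z|[|q]]; first exact: size_polyC_leq1.
  by apply: sfam_ext hs => a z _; rewrite coefC.
by apply: sfam_ext (@sfam_cst R n X 0) => a z _; rewrite coefC.
Qed.

Lemma pfamCX s : sfam s -> pfam 2 (fun a z => (s a z)%:P * 'X).
Proof.
move=> hs; split=> [a z|[|[|q]]].
- by apply: leq_trans (size_polyMleq _ _) _; rewrite size_polyX addn2 ltnS size_polyC_leq1.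
- by apply: sfam_ext (@sfam_cst R n X 0) => a z _; rewrite coefMX.
- by apply: sfam_ext hs => a z _; rewrite coefMX coefC.
- by apply: sfam_ext (@sfam_cst R n X 0) => a z _; rewrite coefMX coefC.
Qed.

Lemma pencil_pfam M W : mfam M -> mfam W -> pfam n.+1 (fun a z => pencil (M a z) (W a z)).
Proof.
move=> hM hN; split=> [a z|q]; first exact: size_pencil.
case: (leqP q n) => [qn|nq]; last first.
  apply: sfam_ext (@sfam_cst R n X 0) => a z _.
  by rewrite nth_default // (leq_trans (size_pencil _ _)).
have [lam hl] := @coef_extract C n q qn.
apply: (sfam_ext (tau := fun a z => \sum_k lam k * \det (M a z + (k : nat)%:R *: W a z))).
  move=> a z _; rewrite hl ?size_pencil //; apply: eq_bigr => k _.
  by rewrite pencil_eval.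
apply: sfam_sum => k _; apply: sfamZ; apply: (sfam_det (mfamD hM (mfamZ _ hN))).
Qed.

Definition lie xi u a z : C := \sum_j xi a z 0 j * d_z j (u a) z.

Lemma lieE xi u a z : xi a z *m gz u a z = (lie xi u a z)%:M.
Proof.
apply/matrixP => i j; rewrite !ord1 !mxE mulr1n.
by apply: eq_bigr => l _; rewrite gzE.
Qed.

Lemma sfam_xi xi j : holomorphic_vfield xi -> sfam (fun a z => xi a z 0 j).
Proof. by move=> [h _] a; have [] := h a j. Qed.

Lemma sfam_lie xi u : holomorphic_vfield xi -> sfam u -> sfam (lie xi u).
Proof.
move=> hx hu; apply: sfam_sum => j _; apply: sfamM; first exact: sfam_xi.
exact: sfam_d_z.
Qed.

Lemma scalar_lie xi u : holomorphic_vfield xi -> sfam u -> scalar u -> scalar (lie xi u).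
Proof.
move=> [_ hx] hu su a b z hz.
have h : xi b (trn a b z) = xi a z *m cjac (trn a b) z.
  apply/rowP => l; rewrite [LHS](hx a b z hz l) [RHS]mxE.
  by apply: eq_bigr => j _; rewrite [cjac _ _ _ _]mxE.
have := lieE xi u a z; rewrite (gz_trn hu su hz) mulmxA -h lieE.
move=> /(congr1 (fun m : 'M[C]_1 => m 0 0)) e.
have s11 (x : C) : (x%:M : 'M[C]_1) 0 0 = x by rewrite mxE mulr1n.
exact (etrans (esym (s11 _)) (etrans (esym e) (s11 _))).
Qed.

Definition potential M xi Th := forall a z, U_ a z ->
  Complex 0 1 *: (xi a z *m M a z) = gzb Th a z.

(** As [xi] is holomorphic, the [d_zbar] derivatives of [lie xi u] are the contraction of [xi] with
    [hess u], so the potential changes affinely with the form. *)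
Lemma potential_hess M xi Th u (k : C) : closed_form M -> holomorphic_vfield xi ->
  sfam Th -> sfam u -> potential M xi Th ->
  potential (fun a z => M a z + k *: hess u a z) xi
    (fun a z => Th a z + k * (Complex 0 1 * lie xi u a z)).
Proof.
move=> hM hx hT hu pot a z Uz; have oU := open_U a.
have D l := derivation_d_zbar oU l.
have sl := sfam_lie hx hu.
apply/rowP => l; rewrite gzbE.
rewrite (dvD (D l) (hT a) (sfamZ k (sfamZ _ sl) a) Uz).
rewrite (dvZ oU (D l) k (sfamZ _ sl a) Uz) (dvZ oU (D l) _ (sl a) Uz).
rewrite mulmxDr scalerDr [LHS]mxE (pot a z Uz) gzbE; congr (_ + _).
rewrite -scalemxAr scalerA mulrC -scalerA [LHS]mxE; congr (_ * _).
rewrite [LHS]mxE; congr (_ * _); rewrite [LHS]mxE /lie.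
have sx j := @sfam_xi xi j hx.
rewrite (dv_sum oU (D l)); last exact: Uz; last first.
  by move=> j _; exact: (sfamM (sx j) (sfam_d_z j hu) a).
apply: eq_bigr => j _.
rewrite (dvM (D l) (sx j a) (sfam_d_z j hu a) Uz).
have [hx1 _] := hx; have [_ h0] := hx1 a j; rewrite h0 // mul0r add0r hessE.
congr (_ * _); exact: (commute_dz_dzbar oU j l (hu a) Uz).
Qed.

(** Along [M + s *: hess u] the integral is a polynomial in [s]. Its derivative has one term from
    the potential and one from the determinant; after integration by parts of the latter, the
    potential equation for [Ts] and [Ms] turns it into the negative of the former. *)
Lemma integral_invariant M xi Th u : closed_form M -> holomorphic_vfield xi ->
  sfam Th -> scalar Th -> sfam u -> scalar u -> potential M xi Th ->
  integ (fun a z => (Th a z + Complex 0 1 * lie xi u a z) * \det (M a z + hess u a z)) =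
  integ (fun a z => Th a z * \det (M a z)).
Proof.
move=> hM hx hT sT hu su pot.
have sl := sfam_lie hx hu; have scl := scalar_lie hx hu su.
pose I := Complex 0 1 : C.
pose P a z : {poly C} := ((Th a z)%:P + (I * lie xi u a z)%:P * 'X) * pencil (M a z) (hess u a z).
have hP : pfam (2 + n.+1) P.
  apply: pfamM; last by apply: pencil_pfam; [exact: cf_smooth|exact: mfam_hess].
  by apply: pfamD; [apply: pfamW (pfamC hT)|apply: pfamCX; exact: sfamZ].
suff h0 : forall s : C, (pinteg (2 + n.+1) P)^`().[s] = 0.
  have := deriv_eq0_eval h0 1 0; rewrite !pinteg_eval // => h.
  transitivity (integ (fun a z => (P a z).[1])).
    apply: integ_ext => a z _; rewrite hornerM pencil_eval scale1r.
    by rewrite hornerD hornerM !hornerC hornerX mulr1.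
  rewrite h; apply: integ_ext => a z _; rewrite hornerM pencil_eval scale0r addr0.
  by rewrite hornerD hornerM !hornerC hornerX mulr0 addr0.
move=> s; rewrite pinteg_deriv // pinteg_eval; last exact: pfam_deriv.
pose Ms : form11 X := fun a z => M a z + s *: hess u a z.
pose Ts a z := Th a z + s * (I * lie xi u a z).
have cMs : closed_form Ms by exact: (closedD hM (closedZ _ (closed_hess hu su))).
have pots : potential Ms xi Ts by exact: potential_hess.
have sTs : sfam Ts := sfamD hT (sfamZ s (sfamZ I sl)).
have scTs : scalar Ts := scalarD sT (scalarM (scalar_cst s) (scalarM (scalar_cst I) scl)).
have E1 a z : ((P a z)^`()).[s] = I * lie xi u a z * \det (Ms a z) +
    Ts a z * \tr (\adj (Ms a z) *m hess u a z).
  rewrite derivM hornerD !hornerM pencil_eval pencil_deriv_eval.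
  congr (_ * _ + _ * _).
    by rewrite derivD derivM !derivC derivX mul0r add0r add0r mulr1 hornerC.
  by rewrite hornerD hornerM !hornerC hornerX mulrC.
rewrite (integ_ext (fun a z _ => E1 a z)) integD; last 2 first.
- by apply: sfamM; [exact: sfamZ|apply: sfam_det; exact: (cf_smooth cMs)].
- exact: (sfamM sTs (sfam_tr_adj (cf_smooth cMs) (mfam_hess hu))).
rewrite (integral_hess' cMs sTs scTs hu su); apply/eqP; rewrite subr_eq0; apply/eqP.
apply: integ_ext => a z Uz; rewrite -(pots a z Uz) -scalemxAr -scalemxAr linearZ /=.
rewrite !mulmxA mxtrace_mulC !mulmxA mul_mx_adj mul_scalar_mx -scalemxAl linearZ /=.
rewrite mxtrace_mulC lieE mxtrace_scalar mulr1n -mulrA; congr (_ * _).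
by rewrite mulrC.
Qed.

End Invariance.

(** * Curvature forms and Ricci forms *)

Section Geometry.
Variables (R : realType) (n : nat) (X : compactComplexManifold R n).
Notation E := 'rV[R]_(n + n).
Notation C := R[i].
Notation Re := complex.Re.
Notation Im := complex.Im.
Notation U_ a := (im a (@setT (carrier (mfd X)))).
Opaque smooth_on.
Opaque csmooth_on.
Opaque integral_rV.
Opaque d_z d_zbar cpartial integ.
Implicit Types (a b c : idx X) (z : E) (s tau : idx X -> E -> C).
Implicit Types (M : form11 X) (h : X -> R).

Lemma csm_local (U : set E) (F : E -> C) :
  (forall z, U z -> exists W, W z /\ csm W F) -> csm U F.
Proof.
move=> H; apply/csmP; split.
Transparent smooth_on.
  by move=> s x Ux; have [W [Wx /csmP[h _]]] := H x Ux; exact: h.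
by move=> s x Ux; have [W [Wx /csmP[_ h]]] := H x Ux; exact: h.
Qed.
Opaque smooth_on.

Lemma csm_sub (U W : set E) (F : E -> C) : W `<=` U -> csm U F -> csm W F.
Proof. by move=> WU h; apply: csm_local => z /WU Uz; exists U. Qed.

Lemma holo_sub (U W : set E) (F : E -> C) : W `<=` U -> holomorphic_on U F ->
  holomorphic_on W F.
Proof. by move=> WU [h1 h2]; split; [exact: csm_sub h1|move=> z /WU/h2]. Qed.

Notation cr u := (fun y => Complex (u y) 0).

Lemma csm_ddbar (U : set E) (u : E -> R) p q : open U -> smooth_on U u ->
  csm U (fun y => ddbar u y p q).
Proof.
move=> oU su.
apply: (@csm_ext R n U oU (d_z p (d_zbar q (cr u)))) => [y _|]; first by rewrite mxE.
exact: (dv_smooth (derivation_d_z oU p) (dv_smooth (derivation_d_zbar oU q) (csm_real oU su))).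
Qed.

Lemma ddbar_entry (u : E -> R) p q :
  (fun y => ddbar u y p q) = d_z p (d_zbar q (cr u)).
Proof. by apply/funext => y; rewrite mxE. Qed.

Lemma ddbar_dz (U : set E) (u : E -> R) z j p q : open U -> smooth_on U u -> U z ->
  d_z j (fun y => ddbar u y p q) z = d_z p (fun y => ddbar u y j q) z.
Proof.
move=> oU su Uz; rewrite !ddbar_entry.
exact: (commute_dz_dz oU j p (dv_smooth (derivation_d_zbar oU q) (csm_real oU su)) Uz).
Qed.

Lemma ddbar_dzbar (U : set E) (u : E -> R) z j p q : open U -> smooth_on U u -> U z ->
  d_zbar j (fun y => ddbar u y p q) z = d_zbar q (fun y => ddbar u y p j) z.
Proof.
move=> oU su Uz; rewrite !ddbar_entry; have sc := csm_real oU su.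
have h l := dv_smooth (derivation_d_zbar oU l) sc.
rewrite -(commute_dz_dzbar oU p j (h q) Uz) -(commute_dz_dzbar oU p q (h j) Uz).
apply: (dv_ext (derivation_d_z oU p)); last exact: Uz.
by move=> y Uy; exact: (commute_dzbar_dzbar oU j q sc Uy).
Qed.

Lemma ddbar_herm (U : set E) (u : E -> R) z : open U -> smooth_on U u -> U z ->
  herm (ddbar u z).
Proof.
move=> oU su Uz; apply/matrixP => j l; rewrite ctE !mxE; have sc := csm_real oU su.
rewrite -(d_zbar_conj l (dv_smooth (derivation_d_zbar oU j) sc) Uz).
rewrite (commute_dz_dzbar oU j l sc Uz).
apply: (dv_ext (derivation_d_zbar oU l)); last exact: Uz.
move=> y Uy; rewrite -(d_z_conj j sc Uy).
apply: (dv_ext (derivation_d_z oU j)); last exact: Uy.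
by move=> t _; apply: complexE2; rewrite ?(@Re_conj R) ?(@Im_conj R) /= ?oppr0.
Qed.

(** Common source of closedness and hermitian symmetry for curvature forms, whose local potentials
    are the metrics [phi], and for Ricci forms, whose potential is [- ln det]. *)
Definition locally_ddbar M := forall a z, U_ a z -> exists (W : set E) (u : E -> R),
  [/\ open W, W z, smooth_on W u & forall y, W y -> M a y = ddbar u y].

Lemma locally_ddbar_herm M a z : locally_ddbar M -> U_ a z -> herm (M a z).
Proof.
by move=> H Uz; have [W [u [oW Wz su E1]]] := H a z Uz; rewrite E1 //; exact: ddbar_herm su Wz.
Qed.

Lemma locally_ddbar_closed M : locally_ddbar M -> is_form M -> closed_form M.
Proof.
move=> H fM; split; [|exact: fM| |].
- move=> i j a; apply: csm_local => z Uz; have [W [u [oW Wz su E1]]] := H a z Uz.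
  exists W; split; first exact: Wz.
  apply: (@csm_ext R n W oW (fun y => ddbar u y i j)); first by move=> y Wy; rewrite E1.
  exact: (csm_ddbar i j oW su).
- move=> a z Uz j p q; have [W [u [oW Wz su E1]]] := H a z Uz.
  have e k l m : d_z k (fun y => M a y l m) z = d_z k (fun y => ddbar u y l m) z.
    by apply: (dv_ext (derivation_d_z oW k)); [move=> y Wy; rewrite E1|exact: Wz].
  by rewrite !e; exact: (ddbar_dz j p q oW su Wz).
- move=> a z Uz j p q; have [W [u [oW Wz su E1]]] := H a z Uz.
  have e k l m : d_zbar k (fun y => M a y l m) z = d_zbar k (fun y => ddbar u y l m) z.
    by apply: (dv_ext (derivation_d_zbar oW k)); [move=> y Wy; rewrite E1|exact: Wz].
  by rewrite !e; exact: (ddbar_dzbar j p q oW su Wz).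
Qed.

Lemma curvature_locally (L : lineBundle X) (phi : lidx L -> X -> R) M :
  hermitian_metric phi -> curvature_form phi M -> locally_ddbar M.
Proof.
move=> [sphi _] hc a z Uz; have [al hal] := ldom_cover L (chartV a z).
exists (im a (ldom al)), (phi al \o chartV a); split.
- by apply: open_im; exact: ldom_open.
- by apply/im_E.
- exact: sphi.
- by move=> y Wy; exact: hc Wy.
Qed.

Lemma trn_ddbar a b (V : set X) z (u : E -> R) : open V ->
  smooth_on (im b V) u -> im a (dom b `&` V) z ->
  ddbarC (fun y => Complex (u (trn a b y)) 0) z =
  cjac (trn a b) z *m ddbar u (trn a b z) *m ct (cjac (trn a b) z).
Proof.
move=> oV su hz.
have oA : open (im a (dom b `&` V)) by apply: open_im; apply: openI => //; exact: open_dom.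
have oB : open (im b V) by exact: open_im.
have hp y : im a (dom b `&` V) y -> im b V (trn a b y).
  move=> /im_E[Uy [dy Vy]]; have hy : im a (dom b) y by apply/im_E.
  by have [h1 _ h3] := trnP hy; apply/im_E; rewrite h3; split=> //; exact: imdom_sub h1.
have hh l : holomorphic_on (im a (dom b `&` V)) (fun y => zcoord (trn a b y) l).
  by apply: holo_sub (@trn_holo R n X a b l) => y /im_E[Uy [dy _]]; apply/im_E.
exact: (ddbar_comp oA oB hp hh (csm_real oB su) hz).
Qed.

Lemma curvature_is_form (L : lineBundle X) (phi : lidx L -> X -> R) M :
  hermitian_metric phi -> curvature_form phi M -> is_form M.
Proof.
move=> [sphi _] hc a b z hz; have /im_E[Uz dz] := hz.
have [al hal] := ldom_cover L (chartV a z).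
have [h1 _ h3] := trnP hz.
rewrite (hc al a z); last by apply/im_E.
rewrite (hc al b (trn a b z)); last first.
  by apply/im_E; rewrite h3; split=> //; exact: imdom_sub h1.
have oV := @ldom_open _ _ _ L al.
have hzV : im a (dom b `&` ldom al) z by apply/im_E.
rewrite -(trn_ddbar oV (sphi al b) hzV).
have oA : open (im a (dom b `&` ldom al)) by apply: open_im; apply: openI => //; exact: open_dom.
apply: (hess_ext oA hzV) => y /im_E[Uy [dy _]].
have hy : im a (dom b) y by apply/im_E.
by have [_ _ /= ->] := trnP hy.
Qed.

Definition rf h a z : C := Complex (h (chartV a z)) 0.

Lemma sfam_rf h : mfd_smooth h -> sfam (rf h).
Proof. by move=> sh a; apply: csm_real; [exact: open_U|exact: (sh a)]. Qed.

Lemma scalar_rf h : scalar (rf h).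
Proof. by move=> a b z hz; rewrite /rf; have [_ _ ->] := trnP hz. Qed.

(** The [zbar] derivative of [ln |g|^2] is the conjugate of the holomorphic function [d_z l g / g],
    and [d_z] annihilates conjugates of holomorphic functions. *)
Lemma pluriharmonic (U : set E) (g : E -> C) z j l : open U -> holomorphic_on U g ->
  (forall y, U y -> g y != 0) -> U z ->
  d_z j (d_zbar l (fun y => Complex (ln (Re (g y * (g y)^*))) 0)) z = 0.
Proof.
move=> oU [sg hg] g0 Uz.
have Dl k := derivation_d_zbar oU k; have Dj k := derivation_d_z oU k.
have sgc := csm_conj oU sg; have sgg := csmM oU sg sgc.
have gg y : g y * (g y)^* = Complex (Re (g y * (g y)^*)) 0.
  by apply: complexE2 => //=; rewrite (@ImM R) (@Re_conj R) (@Im_conj R); ring.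
have u0 y : U y -> 0 < Re (g y * (g y)^*).
  move=> /g0 gy; have : 0 < g y * (g y)^* by rewrite -normCK exprn_gt0 // normr_gt0.
  by rewrite {1}gg ltcE /= => /andP[].
have su : smooth_on U (fun y => Re (g y * (g y)^*)) := csmRe sgg.
have sq : csm U (fun y => d_z l g y * (g y)^-1).
  by apply: (csmM oU (dv_smooth (Dj l) sg)); exact: csmV.
have E1 y : U y -> d_zbar l (fun y => Complex (ln (Re (g y * (g y)^*))) 0) y =
    (d_z l g y * (g y)^-1)^*.
  move=> Uy; rewrite (d_zbar_ln l u0 su Uy) -gg.
  have -> : (fun y => Complex (Re (g y * (g y)^*)) 0) = (fun y => g y * (g y)^*).
    by apply/funext => t; rewrite -gg.
  rewrite (dvM (Dl l) sg sgc Uy) hg // mul0r add0r (d_zbar_conj l sg Uy).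
  have c0 : (g y)^* != 0 by rewrite conjC_eq0 g0.
  have -> : (d_z l g y / g y)^* = (d_z l g y)^* / (g y)^* by rewrite rmorphM fmorphV.
  by rewrite invfM mulrACA divff ?mul1r //; exact: g0.
rewrite (dv_ext (Dj j) E1 Uz) (d_z_conj j sq Uz).
rewrite (dvM (Dl j) (dv_smooth (Dj l) sg) (csmV oU g0 sg) Uz).
rewrite (dvV oU (Dl j) g0 sg Uz) hg // oppr0 mul0r mulr0 addr0.
rewrite -(commute_dz_dzbar oU l j sg Uz).
rewrite (dv_ext (Dj l) (G := fun _ => 0)) // => [|y Uy]; last exact: hg.
by rewrite (dv_cst (Dj l)) // mul0r rmorph0.
Qed.

(** Nonvanishing comes from the real Jacobian, which is invertible because the transition map has an
    inverse; [det_real_jac] transfers it to the complex one. *)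
Lemma holo_det_jac a b : holomorphic_on (im a (dom b)) (fun z => \det (cjac (trn a b) z)) /\
  forall z, im a (dom b) z -> \det (cjac (trn a b) z) != 0.
Proof.
have oI := open_imdom a b; have oI' := open_imdom b a.
have hol := @trn_holo R n X a b.
have sJ := csm_cjac oI hol; split; last first.
  move=> z hz; have [hy k _] := trnP hz.
  have u := real_jac_unit oI oI' (fun x hx => conj (let: And3 p _ _ := trnP hx in p) (let: And3 _ q _ := trnP hx in q)) hol (@trn_holo R n X b a) hz.
  have := det_real_jac hol hz; move: u; rewrite unitmxE unitfE => u h.
  apply: contra u => /eqP d0; move: h; rewrite d0 mul0r => /(congr1 (@complex.Re R)) /= ->.
  by [].
split; first by apply: csm_det.
move=> z hz l; have D := derivation_d_zbar oI l.
rewrite (dv_det oI D sJ hz).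
suff -> : Dmx (d_zbar l) (cjac (trn a b)) z = 0 by rewrite mulmx0 mxtrace0.
apply/matrixP => j p; rewrite [LHS]mxE [RHS]mxE.
rewrite (dv_ext D (G := d_z j (fun y => zcoord (trn a b y) p))) // => [|y _]; last by rewrite [LHS]mxE.
have [sz hzb] := hol p.
rewrite -(commute_dz_dzbar oI j l sz hz).
rewrite (dv_ext (derivation_d_z oI j) (G := fun _ => 0)) // => [|y hy]; last exact: hzb.
by rewrite (dv_cst (derivation_d_z oI j)).
Qed.

Section Ricci.
Variable M : form11 X.
Hypotheses (fM : is_form M) (sM : mfam M) (hM : forall a z, U_ a z -> 0 < \det (M a z)).

Definition lndet a z : R := ln (Re (\det (M a z))).

Lemma Redet_gt0 a z : U_ a z -> 0 < Re (\det (M a z)).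
Proof. by move=> Uz; have := hM Uz; rewrite ltcE /= => /andP[]. Qed.

Lemma Redet a z : U_ a z -> \det (M a z) = Complex (Re (\det (M a z))) 0.
Proof.
by move=> Uz; apply: complexE2 => //=; have := hM Uz; rewrite ltcE /= => /andP[/eqP ->].
Qed.

Lemma smooth_lndet a : smooth_on (U_ a) (lndet a).
Proof.
apply: (smooth_ln (open_U a)); first by move=> z; exact: Redet_gt0.
exact: (csmRe (sfam_det sM a)).
Qed.

Lemma lndet_trn a b z : im a (dom b) z -> lndet a z = lndet b (trn a b z) +
  ln (Re (\det (cjac (trn a b) z) * (\det (cjac (trn a b) z))^*)).
Proof.
move=> hz; have [hy _ _] := trnP hz.
have [_ /(_ z hz) J0] := holo_det_jac a b.
have p : 0 < \det (cjac (trn a b) z) * (\det (cjac (trn a b) z))^*.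
  by rewrite -normCK exprn_gt0 // normr_gt0.
move: p; set q := _ * _; rewrite ltcE /= => /andP[/eqP q0 p].
rewrite -lnM //; last exact: Redet_gt0 (imdom_sub hy).
rewrite /lndet (density_det fM hz) -/q; congr ln.
by rewrite [LHS](@ReM R) q0 mulr0 subr0.
Qed.

(** Between charts [ln det] changes by [ln |det J|^2] with [det J] holomorphic and nowhere zero, and
    [pluriharmonic] disposes of that term. *)
Lemma Ric_is_form : is_form (Ric M).
Proof.
move=> a b z hz; rewrite /Ric mulmxN mulNmx; congr (- _).
have oI := open_imdom a b.
have hzT : im a (dom b `&` setT) z by rewrite setIT.
rewrite -[ddbar _ (trn a b z)]/(ddbar (lndet b) (trn a b z)).
rewrite -(trn_ddbar (openT) (@smooth_lndet b) hzT).
rewrite -[LHS]/(ddbarC (fun y => Complex (lndet a y) 0) z).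
have [[sJ hJ] J0] := holo_det_jac a b.
pose g y := \det (cjac (trn a b) y).
have s1 : csm (im a (dom b)) (fun y => Complex (lndet b (trn a b y)) 0).
  apply: (@csm_comp R n _ _ (trn a b) oI (open_imdom b a) _ (@trn_holo R n X a b)
    (fun y => Complex (lndet b y) 0)); first by move=> y /trnP[].
  apply: csm_real; first exact: open_imdom.
  have := csm_real (open_U b) (@smooth_lndet b) => hb.
  exact: (csmRe (csm_sub (W := im b (dom a)) (fun y hy => imdom_sub hy) hb)).
have s2 : csm (im a (dom b)) (fun y => Complex (ln (Re (g y * (g y)^*))) 0).
  apply: csm_ln => //.
    move=> y hy; have : 0 < g y * (g y)^* by rewrite -normCK exprn_gt0 // normr_gt0 J0.
    by rewrite ltcE /= => /andP[].
  exact: (csmRe (csmM oI sJ (csm_conj oI sJ))).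
rewrite (hess_ext oI hz (G := fun y => Complex (lndet b (trn a b y)) 0 + Complex (ln (Re (g y * (g y)^*))) 0)); last first.
  by move=> y hy; rewrite (lndet_trn hy); apply: complexE2 => //=; rewrite addr0.
apply/matrixP => j l; rewrite [LHS]mxE [RHS]mxE.
have D := derivation_d_z oI j; have D' := derivation_d_zbar oI l.
rewrite (dv_ext D (fun y hy => dvD D' s1 s2 hy) hz).
rewrite (dvD D (dv_smooth D' s1) (dv_smooth D' s2) hz).
by rewrite (pluriharmonic j l oI (conj sJ hJ) J0 hz) addr0.
Qed.

Lemma Ric_locally : locally_ddbar (Ric M).
Proof.
move=> a z Uz; exists (U_ a), (fun y => - lndet a y); have oU := open_U a; split=> //.
  exact: smoothN (@smooth_lndet a).
move=> y Uy; have sl := csm_real oU (@smooth_lndet a).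
apply/matrixP => j l; rewrite [RHS]mxE [LHS]mxE [X in - X]mxE.
have -> : (fun y => Complex (- lndet a y) 0) = (fun y => - Complex (lndet a y) 0).
  by apply/funext => t; apply: complexE2 => //=; rewrite oppr0.
rewrite (dv_ext (derivation_d_z oU j) (fun t Ut => dvN oU (derivation_d_zbar oU l) sl Ut) Uy).
by rewrite (dvN oU (derivation_d_z oU j) (dv_smooth (derivation_d_zbar oU l) sl) Uy).
Qed.

Lemma Ric_closed : closed_form (Ric M).
Proof. exact: locally_ddbar_closed Ric_locally Ric_is_form. Qed.

End Ricci.

(** The chart at [x] is picked by choice; for a [scalar] family the value does not depend on it. *)
Definition descend tau (x : X) : C :=
  let c := sval (cid (@dom_cover R n X x)) in tau c (chart c x).

Lemma descendE tau a z : scalar tau -> U_ a z -> descend tau (chartV a z) = tau a z.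
Proof.
move=> st Uz; rewrite /descend; case: cid => c /= dc.
by rewrite (st a c) //; apply/im_E.
Qed.

Lemma descend_csmooth tau : sfam tau -> scalar tau -> mfd_csmooth (descend tau).
Proof.
move=> hs st; split=> a; have oU := open_U a; have := hs a => /csmP[h1 h2].
  by apply: (smooth_ext oU _ h1) => z Uz /=; rewrite descendE.
by apply: (smooth_ext oU _ h2) => z Uz /=; rewrite descendE.
Qed.

End Geometry.

(** * Potentials along a holomorphic vector field and the Ricci potential *)

Section Futaki.
Variables (R : realType) (n : nat) (X : compactComplexManifold R n).
Notation E := 'rV[R]_(n + n).
Notation C := R[i].
Notation Re := complex.Re.
Notation Im := complex.Im.
Notation U_ a := (im a (@setT (carrier (mfd X)))).
Opaque smooth_on.
Opaque csmooth_on.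
Opaque integral_rV.
Opaque d_z d_zbar cpartial integ hess gz gzb.
Implicit Types (a b c : idx X) (z : E) (s u tau Th : idx X -> E -> C).
Implicit Types (M W : form11 X) (xi : vfield X).

(** A positive determinant is what divisions and logarithms require, and along a ray it is
    controlled by a single ratio. Positive definiteness is invoked separately, for the given forms
    and at the extremal metric. *)
Record nondegenerate M : Prop := Nondegenerate {
  kh_closed : closed_form M;
  kh_herm : forall a z, U_ a z -> herm (M a z);
  kh_det : forall a z, U_ a z -> 0 < \det (M a z) }.

(* Up to the normalisation of the determinant, W^q M^(n-q) / (q! (n-q)!). *)
Definition NN q W M a z : C := (pencil (M a z) (W a z))`_q.

Lemma sfam_NN q W M : mfam M -> mfam W -> sfam (NN q W M).
Proof. by move=> hM hW; exact: (pf_coef (pencil_pfam hM hW)). Qed.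

Lemma density_NN q W M : is_form M -> is_form W -> density (NN q W M).
Proof.
move=> hM hW a b z hz; rewrite /NN (hM _ _ _ hz) (hW _ _ _ hz) pencil_congr coefCM det_ct.
by rewrite mulrC.
Qed.

Lemma scalemxE p q (k : C) (A : 'M[C]_(p, q)) i j : (k *: A) i j = k * A i j.
Proof. by rewrite mxE. Qed.

Lemma hessD s u a z : sfam s -> sfam u -> U_ a z ->
  hess (fun a z => s a z + u a z) a z = hess s a z + hess u a z.
Proof.
move=> hs hu Uz; have oU := open_U a; apply/matrixP => j l.
apply: (etrans (hessE _ _ _ _ _)).
apply: (etrans (y := d_z j (d_zbar l (s a)) z + d_z j (d_zbar l (u a)) z)); last first.
  by rewrite [RHS]mxE; congr (_ + _); exact: esym (hessE _ _ _ _ _).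
have D := derivation_d_z oU j; have D' := derivation_d_zbar oU l.
rewrite (dv_ext D (fun t Ut => dvD D' (hs a) (hu a) Ut) Uz).
exact: (dvD D (sfam_d_zbar l hs a) (sfam_d_zbar l hu a) Uz).
Qed.

Lemma hessZ (k : C) u a z : sfam u -> U_ a z ->
  hess (fun a z => k * u a z) a z = k *: hess u a z.
Proof.
move=> hu Uz; have oU := open_U a; apply/matrixP => j l.
apply: (etrans (hessE _ _ _ _ _)).
apply: (etrans (y := k * d_z j (d_zbar l (u a)) z)); last first.
  by rewrite [RHS]mxE; congr (_ * _); exact: esym (hessE _ _ _ _ _).
have D := derivation_d_z oU j; have D' := derivation_d_zbar oU l.
rewrite (dv_ext D (fun t Ut => dvZ oU D' k (hu a) Ut) Uz).
exact: (dvZ oU D k (sfam_d_zbar l hu a) Uz).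
Qed.

Lemma gzbD s u a z : sfam s -> sfam u -> U_ a z ->
  gzb (fun a z => s a z + u a z) a z = gzb s a z + gzb u a z.
Proof.
move=> hs hu Uz; apply/rowP => l; rewrite gzbE [RHS]mxE !gzbE.
exact: (dvD (derivation_d_zbar (open_U a) l) (hs a) (hu a) Uz).
Qed.

Lemma gzbZ (k : C) u a z : sfam u -> U_ a z ->
  gzb (fun a z => k * u a z) a z = k *: gzb u a z.
Proof.
move=> hu Uz; apply/rowP => l; rewrite gzbE [RHS]mxE !gzbE.
exact: (dvZ (open_U a) (derivation_d_zbar (open_U a) l) k (hu a) Uz).
Qed.

Lemma gzD s u a z : sfam s -> sfam u -> U_ a z ->
  gz (fun a z => s a z + u a z) a z = gz s a z + gz u a z.
Proof.
move=> hs hu Uz; apply/colP => l; rewrite gzE [RHS]mxE !gzE.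
exact: (dvD (derivation_d_z (open_U a) l) (hs a) (hu a) Uz).
Qed.

Lemma gzZ (k : C) u a z : sfam u -> U_ a z ->
  gz (fun a z => k * u a z) a z = k *: gz u a z.
Proof.
move=> hu Uz; apply/colP => l; rewrite gzE [RHS]mxE !gzE.
exact: (dvZ (open_U a) (derivation_d_z (open_U a) l) k (hu a) Uz).
Qed.

Lemma lieD xi s u a z : sfam s -> sfam u -> U_ a z ->
  lie xi (fun a z => s a z + u a z) a z = lie xi s a z + lie xi u a z.
Proof.
move=> hs hu Uz; rewrite /lie -big_split; apply: eq_bigr => j _ /=.
by rewrite (dvD (derivation_d_z (open_U a) j) (hs a) (hu a) Uz) mulrDr.
Qed.

Lemma lieZ xi (k : C) u a z : sfam u -> U_ a z ->
  lie xi (fun a z => k * u a z) a z = k * lie xi u a z.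
Proof.
move=> hu Uz; rewrite /lie mulr_sumr; apply: eq_bigr => j _ /=.
by rewrite (dvZ (open_U a) (derivation_d_z (open_U a) j) k (hu a) Uz) mulrCA.
Qed.

(* If Th is a potential of xi for M, this is one for M + hess u. *)
Definition shift xi Th u a z : C := Th a z + Complex 0 1 * lie xi u a z.

Lemma sfam_shift xi Th u : holomorphic_vfield xi -> sfam Th -> sfam u ->
  sfam (shift xi Th u).
Proof. by move=> hx hT hu; exact: (sfamD hT (sfamZ _ (sfam_lie hx hu))). Qed.

Lemma integ_coef_eq N (P P' : idx X -> E -> {poly C}) q : pfam N P -> pfam N P' ->
  (forall t : C, integ (fun a z => (P a z).[t]) = integ (fun a z => (P' a z).[t])) ->
  integ (fun a z => (P a z)`_q) = integ (fun a z => (P' a z)`_q).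
Proof.
move=> h1 h2 H; rewrite -(pinteg_coef _ h1) -(pinteg_coef _ h2).
suff -> : pinteg N P = pinteg N P' by [].
apply/eqP; rewrite -subr_eq0; apply/eqP; apply: poly_eq0_eval => t.
by rewrite hornerD hornerN (pinteg_eval _ h1) (pinteg_eval _ h2) H subrr.
Qed.

(** By [integral_invariant] for [M0 + t M1] with potential [Th0 + t Th1] and function [u0 + t u1],
    both sides agree as polynomials in [t]; both summands contribute to the coefficient of
    [t^(q+1)]. *)
Lemma integral_invariant2 M0 M1 xi Th0 Th1 u0 u1 q : closed_form M0 -> closed_form M1 ->
  holomorphic_vfield xi ->
  sfam Th0 -> scalar Th0 -> sfam Th1 -> scalar Th1 ->
  sfam u0 -> scalar u0 -> sfam u1 -> scalar u1 ->
  potential M0 xi Th0 -> potential M1 xi Th1 ->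
  let M0' := fun a z => M0 a z + hess u0 a z in
  let M1' := fun a z => M1 a z + hess u1 a z in
  integ (fun a z => shift xi Th0 u0 a z * NN q.+1 M1' M0' a z +
                    shift xi Th1 u1 a z * NN q M1' M0' a z) =
  integ (fun a z => Th0 a z * NN q.+1 M1 M0 a z + Th1 a z * NN q M1 M0 a z).
Proof.
move=> c0 c1 hx hT0 sT0 hT1 sT1 hu0 su0 hu1 su1 p0 p1 M0' M1'.
pose P (S0 S1 : idx X -> E -> C) (W0 W1 : form11 X) a z : {poly C} := ((S0 a z)%:P + (S1 a z)%:P * 'X) * pencil (W0 a z) (W1 a z).
have Pc (S0 S1 : idx X -> E -> C) (W0 W1 : form11 X) a z :
    (P S0 S1 W0 W1 a z)`_q.+1 = S0 a z * NN q.+1 W1 W0 a z + S1 a z * NN q W1 W0 a z.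
  by rewrite /P mulrDl coefD -mulrA !coefCM coefXM.
have Pe (S0 S1 : idx X -> E -> C) (W0 W1 : form11 X) a z (t : C) :
    (P S0 S1 W0 W1 a z).[t] = (S0 a z + t * S1 a z) * \det (W0 a z + t *: W1 a z).
  by rewrite /P hornerM pencil_eval hornerD hornerM !hornerC hornerX [t * _]mulrC.
have pP (S0 S1 : idx X -> E -> C) (W0 W1 : form11 X) : sfam S0 -> sfam S1 -> mfam W0 -> mfam W1 ->
    pfam (2 + n.+1) (P S0 S1 W0 W1).
  move=> h0 h1 h2 h3; apply: pfamM; last exact: pencil_pfam.
  by apply: pfamD; [apply: pfamW (pfamC h0)|exact: pfamCX].
have cM0' : closed_form M0' by exact: (closedD c0 (closed_hess hu0 su0)).
have cM1' : closed_form M1' by exact: (closedD c1 (closed_hess hu1 su1)).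
have h1 := pP _ _ _ _ (sfam_shift hx hT0 hu0) (sfam_shift hx hT1 hu1)
  (cf_smooth cM0') (cf_smooth cM1').
have h2 := pP _ _ _ _ hT0 hT1 (cf_smooth c0) (cf_smooth c1).
transitivity (integ (fun a z => (P (shift xi Th0 u0) (shift xi Th1 u1) M0' M1' a z)`_q.+1)).
  by apply: integ_ext => a z _; exact: esym (Pc _ _ _ _ _ _).
transitivity (integ (fun a z => (P Th0 Th1 M0 M1 a z)`_q.+1)); last first.
  by apply: integ_ext => a z _; exact: Pc.
apply: (integ_coef_eq _ h1 h2) => t.
transitivity (integ (fun a z => (shift xi Th0 u0 a z + t * shift xi Th1 u1 a z) *
    \det (M0' a z + t *: M1' a z))).
  by apply: integ_ext => a z _; exact: Pe.
transitivity (integ (fun a z => (Th0 a z + t * Th1 a z) * \det (M0 a z + t *: M1 a z))); last first.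
  by apply: integ_ext => a z _; exact: esym (Pe _ _ _ _ _ _ _).
have sut := sfamD hu0 (sfamZ t hu1).
rewrite -(integral_invariant (closedD c0 (closedZ t c1)) hx (sfamD hT0 (sfamZ t hT1))
  (scalarD sT0 (scalarM (scalar_cst t) sT1)) sut
  (scalarD su0 (scalarM (scalar_cst t) su1))).
  apply: integ_ext => a z Uz; congr (_ * _).
    by rewrite /shift (lieD xi hu0 (sfamZ t hu1) Uz) (lieZ xi t hu1 Uz); ring.
  congr (\det _); rewrite (hessD hu0 (sfamZ t hu1) Uz) (hessZ t hu1 Uz) /M0' /M1' scalerDr.
  by rewrite addrACA.
move=> a z Uz; rewrite (gzbD hT0 (sfamZ t hT1) Uz) (gzbZ t hT1 Uz) mulmxDr scalerDr.
by rewrite (p0 a z Uz) -scalemxAr scalerA mulrC -scalerA (p1 a z Uz).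
Qed.

Definition lnV M a z : C := Complex (lndet M a z) 0.
Definition NR M := NN 1 (Ric M) M.

Section Chi.
Variables (M : form11 X) (xi : vfield X) (Th : idx X -> E -> C).
Hypotheses (kM : nondegenerate M) (hx : holomorphic_vfield xi).
Hypotheses (hT : sfam Th) (sT : scalar Th) (pT : potential M xi Th).
Let sM := cf_smooth (kh_closed kM).
Let fM := cf_form (kh_closed kM).
Let dM := kh_det kM.

(* A potential of the Ricci form: minus i times the divergence of xi with respect
   to the volume form of M. *)
Definition chi a z : C := - (\tr (\adj (M a z) *m hess Th a z) / \det (M a z)).

Lemma det_neq0 a z : U_ a z -> \det (M a z) != 0.
Proof. by move=> Uz; rewrite gt_eqF // dM. Qed.

Lemma sfam_lnV : sfam (lnV M).
Proof. by move=> a; exact: (csm_real (open_U a) (smooth_lndet sM dM (a := a))). Qed.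

Lemma d_z_lnV j a z : U_ a z -> d_z j (lnV M a) z = d_z j (fun y => \det (M a y)) z / \det (M a z).
Proof.
move=> Uz; have oU := open_U a.
have su : smooth_on (U_ a) (fun y => Re (\det (M a y))) by exact: (csmRe (sfam_det sM a)).
rewrite (d_z_ln j (fun y Uy => Redet_gt0 dM Uy) su Uz) -(Redet dM Uz); congr (_ / _).
by apply: (dv_ext (derivation_d_z oU j)); [move=> y Uy; rewrite -(Redet dM Uy)|exact: Uz].
Qed.

Lemma sfam_chi : sfam chi.
Proof.
apply: sfamN; apply: sfamM; first exact: (sfam_tr_adj sM (mfam_hess hT)).
move=> a; apply: (csmV (open_U a)); first by move=> z; exact: det_neq0.
exact: (sfam_det sM a).
Qed.

Lemma scalar_chi : scalar chi.
Proof.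
move=> a b z hz; have [hy _ _] := trnP hz.
pose J := \det (cjac (trn a b) z) * (\det (cjac (trn a b) z))^*.
have e1 : \tr (\adj (M a z) *m hess Th a z) =
    \tr (\adj (M b (trn a b z)) *m hess Th b (trn a b z)) * J.
  exact: (density_tr_adj fM (is_form_hess hT sT) hz).
have e2 : \det (M a z) = \det (M b (trn a b z)) * J by exact: (density_det fM hz).
have [_ /(_ z hz) J0] := holo_det_jac a b.
have J1 : J != 0 by rewrite /J mulf_neq0 // conjC_eq0.
transitivity (- ((\tr (\adj (M b (trn a b z)) *m hess Th b (trn a b z)) * J) /
  (\det (M b (trn a b z)) * J))).
  by congr (- (_ / _)); [exact: e1|exact: e2].
by rewrite -mulf_div divff // mulr1.
Qed.

Lemma integral_chi : integ (fun a z => chi a z * \det (M a z)) = 0.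
Proof.
rewrite (integ_ext (tau' := fun a z => - (1 * \tr (\adj (M a z) *m hess Th a z)))); last first.
  by move=> a z Uz; rewrite /chi mulNr divfK ?mul1r // det_neq0.
have s1 := sfam_tr_adj sM (mfam_hess hT).
rewrite integN; last exact: (sfamM (sfam_cst 1) s1).
rewrite (integral_hess (kh_closed kM) (sfam_cst 1) (scalar_cst 1) hT sT) opprK.
rewrite -[RHS](@integ0 R n X); apply: integ_ext => a z Uz.
have -> : gz (fun=> (fun=> 1)) a z = 0.
  apply/colP => j; rewrite gzE [RHS]mxE.
  by rewrite (dv_cst (derivation_d_z (open_U a) j)).
by rewrite mul0mx mulmx0 mxtrace0.
Qed.

(** Differentiating [i xi M = dbar Th] expresses [hess Th] by derivatives of [xi] and [M];
    closedness of [M] and Jacobi's formula assemble the latter into [xi (det M)]. In this form [chi]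
    depends on [M] only through [lnV M], which gives both its potential equation and its change with
    [M]. *)
Lemma chi_formula a z : U_ a z -> chi a z =
  - Complex 0 1 * (\sum_j d_z j (fun y => xi a y 0 j) z + lie xi (lnV M) a z).
Proof.
move=> Uz; have oU := open_U a; have D j := derivation_d_z oU j.
have V0 := det_neq0 Uz.
pose I : C := Complex 0 1.
have sx j : csm (U_ a) (fun y => xi a y 0 j) := sfam_xi j hx a.
have hessT j l : hess Th a z j l = I * \sum_q (d_z j (fun y => xi a y 0 q) z * M a z q l +
    xi a z 0 q * d_z j (fun y => M a y q l) z).
  rewrite hessE.
  rewrite (dv_ext (D j) (G := fun y => I * \sum_q xi a y 0 q * M a y q l) _ Uz); last first.
    by move=> y Uy; rewrite -(gzbE _ _ _ 0) -(pT Uy) scalemxE; congr (_ * _); rewrite [LHS]mxE.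
  have sq q : csm (U_ a) (fun y => xi a y 0 q * M a y q l) := csmM oU (sx q) (sM q l a).
  rewrite (dvZ oU (D j) I (csm_sum oU _ (fun q _ => sq q)) Uz); congr (_ * _).
  rewrite (dv_sum oU (D j) _ (fun q _ => sq q) Uz); apply: eq_bigr => q _.
  by rewrite (dvM (D j) (sx q) (sM q l a) Uz).
have dV q : d_z q (fun y => \det (M a y)) z = \sum_j \sum_l \adj (M a z) l j * d_z j (fun y => M a y q l) z.
  rewrite (dv_det oU (D q) (fun i j => sM i j a) Uz) tr_mul_sum.
  apply: eq_bigr => j _; apply: eq_bigr => l _; congr (_ * _).
  by rewrite [LHS]mxE; exact: (cf_dz (kh_closed kM) Uz).
have key : \tr (\adj (M a z) *m hess Th a z) =
   I * (\det (M a z) * \sum_j d_z j (fun y => xi a y 0 j) z +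
     \sum_q xi a z 0 q * d_z q (fun y => \det (M a y)) z).
  rewrite tr_mul_sum.
  transitivity (I * \sum_j \sum_l \sum_q (d_z j (fun y => xi a y 0 q) z * (M a z q l * \adj (M a z) l j) +
    xi a z 0 q * (\adj (M a z) l j * d_z j (fun y => M a y q l) z))).
    rewrite mulr_sumr; apply: eq_bigr => j _; rewrite mulr_sumr; apply: eq_bigr => l _.
    apply: etrans (congr1 (fun x => \adj (M a z) l j * x) (hessT j l)) _.
    rewrite mulrCA; congr (_ * _); rewrite mulr_sumr; apply: eq_bigr => q _; ring.
  congr (_ * _).
  transitivity (\sum_j \sum_q (d_z j (fun y => xi a y 0 q) z * (M a z *m \adj (M a z)) q j +
      xi a z 0 q * \sum_l \adj (M a z) l j * d_z j (fun y => M a y q l) z)).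
    apply: eq_bigr => j _; rewrite exchange_big; apply: eq_bigr => q _ /=.
    by rewrite big_split -!mulr_sumr [(_ *m _) _ _]mxE.
  under eq_bigr do rewrite big_split.
  rewrite big_split /=; congr (_ + _).
    rewrite mulr_sumr; apply: eq_bigr => j _; rewrite mul_mx_adj (bigD1 j) //= big1 ?addr0.
      by rewrite [_%:M _ _]mxE eqxx mulr1n mulrC.
    by move=> q qj; rewrite [_%:M _ _]mxE (negPf qj) mulr0n mulr0.
  rewrite exchange_big; apply: eq_bigr => q _ /=; rewrite -mulr_sumr dV.
  by [].
rewrite /chi key -mulrA mulNr; congr (- (_ * _)).
rewrite mulrDl mulrC mulKf //; congr (_ + _); rewrite mulr_suml.
by apply: eq_bigr => q _; rewrite d_z_lnV // mulrA.
Qed.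

Lemma chi_potential : potential (Ric M) xi chi.
Proof.
move=> a z Uz; have oU := open_U a; have D l := derivation_d_zbar oU l.
have Dz l := derivation_d_z oU l.
have sx j : csm (U_ a) (fun y => xi a y 0 j) := sfam_xi j hx a.
have [hxa _] := hx; have hxz j l y (Uy : U_ a y) := (hxa a j).2 y Uy l.
apply/rowP => l; rewrite gzbE.
rewrite (dv_ext (D l) (fun y Uy => chi_formula Uy) Uz).
have s1 j := dv_smooth (Dz j) (sx j).
have s2 := sfam_lie hx sfam_lnV a.
have s3 := csm_sum oU (index_enum _) (fun j (_ : predT j) => s1 j).
rewrite (dvZ oU (D l) _ (csmD oU s3 s2) Uz) (dvD (D l) s3 s2 Uz).
rewrite (dv_sum oU (D l) _ (fun j _ => s1 j) Uz) big1 ?add0r => [|j _]; last first.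
  rewrite -(commute_dz_dzbar oU j l (sx j) Uz).
  rewrite (dv_ext (Dz j) (G := fun _ => 0)) // => [|y Uy]; last exact: hxz.
  by rewrite (dv_cst (Dz j)).
have s4 j := dv_smooth (Dz j) (sfam_lnV a).
rewrite (dv_sum oU (D l) _ (fun j _ => csmM oU (sx j) (s4 j)) Uz).
rewrite scalemxE mulNr -mulrN; congr (_ * _); rewrite [LHS]mxE -sumrN.
apply: eq_bigr => j _; rewrite (dvM (D l) (sx j) (s4 j) Uz) hxz // mul0r add0r -mulrN.
congr (_ * _); rewrite [LHS]mxE; congr (- _); rewrite [LHS]mxE.
exact: (commute_dz_dzbar oU j l (sfam_lnV a) Uz).
Qed.

End Chi.

End Futaki.

(** * Independence of the Futaki pairing of the representatives *)

Section FutakiInvariance.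
Variables (R : realType) (n : nat) (X : compactComplexManifold R n).
Notation E := 'rV[R]_(n + n).
Notation C := R[i].
Notation Re := complex.Re.
Notation Im := complex.Im.
Notation U_ a := (im a (@setT (carrier (mfd X)))).
Opaque smooth_on.
Opaque csmooth_on.
Opaque integral_rV.
Opaque d_z d_zbar cpartial integ hess gz gzb.
Implicit Types (a b c : idx X) (z : E) (s u tau Th : idx X -> E -> C).
Implicit Types (M : form11 X) (xi : vfield X).

Definition add_hess M u : form11 X := fun a z => M a z + hess u a z.

Section Perturbation.
Variables (M : form11 X) (u : idx X -> E -> C).
Hypotheses (kM : nondegenerate M) (kM' : nondegenerate (add_hess M u)).
Hypotheses (hu : sfam u) (su : scalar u).
Notation M' := (add_hess M u).
Let dM := kh_det kM.
Let dM' := kh_det kM'.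
Let cM := kh_closed kM.
Let cM' := kh_closed kM'.

Definition dlnV a z : C := lnV M a z - lnV M' a z.

Lemma sfam_dlnV : sfam dlnV.
Proof. exact: (sfamB (sfam_lnV kM) (sfam_lnV kM')). Qed.

Lemma scalar_dlnV : scalar dlnV.
Proof.
move=> a b z hz; rewrite /dlnV /lnV.
rewrite (lndet_trn (cf_form cM) dM hz) (lndet_trn (cf_form cM') dM' hz).
by apply: complexE2; rewrite ?(@ReD R) ?(@ImD R) ?(@ReN R) ?(@ImN R) /=; ring.
Qed.

Lemma RicE W : nondegenerate W -> forall a z, U_ a z -> Ric W a z = - hess (lnV W) a z.
Proof.
move=> kW a z Uz; apply/matrixP => j l; by rewrite /Ric [LHS]mxE [RHS]mxE; congr (- _).
Qed.

Lemma Ric_add_hess a z : U_ a z -> Ric M a z + hess dlnV a z = Ric M' a z.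
Proof.
move=> Uz; rewrite (RicE kM Uz) (RicE kM' Uz).
have h1 := sfam_lnV kM; have h2 := sfam_lnV kM'.
have e : hess dlnV a z = hess (lnV M) a z + (-1) *: hess (lnV M') a z.
  rewrite -(hessZ (-1) h2 Uz) -(hessD h1 (sfamZ (-1) h2) Uz).
  apply: (hess_ext (open_U a) Uz) => y _; by rewrite mulN1r.
by rewrite e scaleN1r addrA addNr add0r.
Qed.

Variables (xi : vfield X) (Th : idx X -> E -> C).
Hypotheses (hx : holomorphic_vfield xi) (hT : sfam Th) (sT : scalar Th).
Hypothesis pT : potential M xi Th.

Lemma scalar_shift xi' Th' u' : holomorphic_vfield xi' -> scalar Th' ->
  sfam u' -> scalar u' -> scalar (@shift R n X xi' Th' u').
Proof.
move=> h1 h2 h3 h4; apply: scalarD h2 _; apply: scalarM (scalar_cst _) _.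
exact: scalar_lie.
Qed.

Lemma potential_shift : potential M' xi (shift xi Th u).
Proof.
move=> a z Uz; have := potential_hess 1 cM hx hT hu pT Uz; rewrite scale1r => ->.
apply/rowP => l; rewrite !gzbE.
by apply: (dv_ext (derivation_d_zbar (open_U a) l)); [move=> y _; rewrite mul1r|exact: Uz].
Qed.

Lemma integral_det_shift :
  integ (fun a z => shift xi Th u a z * \det (M' a z)) =
  integ (fun a z => Th a z * \det (M a z)).
Proof. exact: (integral_invariant cM hx hT sT hu su pT). Qed.

Lemma chi_shift a z : U_ a z ->
  shift xi (chi M Th) dlnV a z = chi M' (shift xi Th u) a z.
Proof.
move=> Uz; rewrite /shift (chi_formula kM hx pT Uz).
apply: (etrans _ (esym (chi_formula kM' hx potential_shift Uz))).
have -> : lie xi dlnV a z = lie xi (lnV M) a z - lie xi (lnV M') a z.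
  have h1 := sfam_lnV kM; have h2 := sfam_lnV kM'.
  rewrite -mulN1r -(lieZ xi (-1) h2 Uz) -(lieD xi h1 (sfamZ (-1) h2) Uz).
  apply: eq_bigr => j _; congr (_ * _).
  by apply: (dv_ext (derivation_d_z (open_U a) j)); [move=> y _; rewrite mulN1r|exact: Uz].
have gen (x s l l' : C) : - x * (s + l) + x * (l - l') = - x * (s + l') by ring.
exact: gen.
Qed.

(** The Ricci form is taken as the second form of [integral_invariant2] with [q = 0], with potential
    [chi] and correction [dlnV]. The extra summand is the integral of [chi * det], which vanishes
    for both metrics by [integral_chi]. *)
Lemma integral_NR_shift :
  integ (fun a z => shift xi Th u a z * NR M' a z) =
  integ (fun a z => Th a z * NR M a z).
Proof.
have sR := Ric_closed (cf_form cM) (cf_smooth cM) dM.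
have sR' := Ric_closed (cf_form cM') (cf_smooth cM') dM'.
have sdl := sfam_dlnV; have scdl := scalar_dlnV.
have sch := sfam_chi kM hT.
have := integral_invariant2 0 cM sR hx hT sT sch (scalar_chi kM hT sT) hu su
  sdl scdl pT (chi_potential kM hx pT).
have dN M0 W0 a z : NN 0 W0 M0 a z = \det (M0 a z) by exact: pencil0.
move=> /= H.
have s1 : sfam (fun a z => shift xi Th u a z * NR M' a z).
  exact: (sfamM (sfam_shift hx hT hu) (sfam_NN 1 (cf_smooth cM') (cf_smooth sR'))).
have s2 : sfam (fun a z => Th a z * NR M a z).
  exact: (sfamM hT (sfam_NN 1 (cf_smooth cM) (cf_smooth sR))).
have s3 : sfam (fun a z => chi M Th a z * \det (M a z)).
  exact: (sfamM sch (sfam_det (cf_smooth cM))).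
have s4 : sfam (fun a z => chi M' (shift xi Th u) a z * \det (M' a z)).
  exact: (sfamM (sfam_chi kM' (sfam_shift hx hT hu)) (sfam_det (cf_smooth cM'))).
have i3 := integral_chi kM hT sT.
have i4 := integral_chi kM' (sfam_shift hx hT hu) (scalar_shift hx sT hu su).
transitivity (integ (fun a z => shift xi Th u a z * NR M' a z +
    chi M' (shift xi Th u) a z * \det (M' a z))).
  by rewrite (integD s1 s4) i4 addr0.
transitivity (integ (fun a z => Th a z * NR M a z + chi M Th a z * \det (M a z))); last first.
  by rewrite (integD s2 s3) i3 addr0.
apply: (etrans _ (etrans H _)); apply: integ_ext => a z Uz; last first.
  by congr (_ + _ * _); exact: dN.
have mm (x y y' t t' v v' : C) : y = y' -> t = t' -> v = v' ->
    x * y + t * v = x * y' + t' * v' by move=> -> -> ->.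
apply: mm.
- by rewrite /NR /NN -(Ric_add_hess Uz).
- exact: esym (chi_shift Uz).
- exact: esym (dN _ _ _ _).
Qed.

End Perturbation.

Section ConstantPotential.
Variables (M : form11 X) (u : idx X -> E -> C).
Hypotheses (kM : nondegenerate M) (kM' : nondegenerate (add_hess M u)).
Hypotheses (hu : sfam u) (su : scalar u).

(** For the zero field every constant is a potential and [shift] changes nothing, so the invariance
    of volumes and mixed volumes is a special case of the invariance of weighted integrals. *)
Definition xi0 : vfield X := fun _ _ => 0.

Lemma holomorphic_xi0 : holomorphic_vfield xi0.
Proof.
split=> [a j|a b z hz l].
  have oU := open_U a.
  have e : (fun z => xi0 a z 0 j) = (fun _ => 0) by apply/funext => z; rewrite mxE.
  rewrite e; split; first exact: csm_cst.
  by move=> z Uz l; rewrite (dv_cst (derivation_d_zbar oU l)).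
by rewrite mxE big1 // => j _; rewrite mxE mul0r.
Qed.

Lemma potential_xi0 (W : form11 X) (k : C) : potential W xi0 (fun _ _ => k).
Proof.
move=> a z Uz; rewrite mul0mx scaler0; apply/rowP => l; rewrite gzbE [LHS]mxE.
by rewrite (dv_cst (derivation_d_zbar (open_U a) l)).
Qed.

Lemma shift_xi0 (k : C) s a z : shift xi0 (fun _ _ => k) s a z = k.
Proof. by rewrite /shift /lie big1 ?mulr0 ?addr0 // => j _; rewrite mxE mul0r. Qed.

Lemma integral_det_inv :
  integ (fun a z => \det (add_hess M u a z)) = integ (fun a z => \det (M a z)).
Proof.
have := integral_det_shift kM hu su holomorphic_xi0 (sfam_cst 1) (scalar_cst 1)
  (potential_xi0 M 1).
move=> H; apply: (etrans _ (etrans H _)); apply: integ_ext => a z _.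
  by rewrite shift_xi0 mul1r.
by rewrite mul1r.
Qed.

Lemma integral_NR_inv : integ (NR (add_hess M u)) = integ (NR M).
Proof.
have := integral_NR_shift kM kM' hu su holomorphic_xi0 (sfam_cst 1) (scalar_cst 1)
  (potential_xi0 M 1).
move=> H; apply: (etrans _ (etrans H _)); apply: integ_ext => a z _.
  by rewrite shift_xi0 mul1r.
by rewrite mul1r.
Qed.

End ConstantPotential.

Lemma integral_NN_inv q M0 M1 u0 u1 : closed_form M0 -> closed_form M1 ->
  sfam u0 -> scalar u0 -> sfam u1 -> scalar u1 ->
  integ (NN q (add_hess M1 u1) (add_hess M0 u0)) = integ (NN q M1 M0).
Proof.
move=> c0 c1 h0 s0 h1 s1.
have := integral_invariant2 q c0 c1 holomorphic_xi0 (sfam_cst 0) (scalar_cst 0)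
  (sfam_cst 1) (scalar_cst 1) h0 s0 h1 s1 (potential_xi0 M0 0) (potential_xi0 M1 1).
move=> /= H; apply: (etrans _ (etrans H _)); apply: integ_ext => a z _.
  by rewrite !shift_xi0 mul0r add0r mul1r.
by rewrite mul0r add0r mul1r.
Qed.

Section System.
Variables (k : nat) (p : 'I_k -> nat).

Definition mix0 (w : forms X k) a z : C :=
  \sum_i NN (p i).+1 (w (lift ord0 i)) (w ord0) a z - NR (w ord0) a z.
Definition mixi (w : forms X k) i a z : C := NN (p i) (w (lift ord0 i)) (w ord0) a z.
Definition Vol (w : forms X k) i a z : C := \det (w i a z).

Definition pairing Th (tau v : idx X -> E -> C) : C :=
  integ (fun a z => Th a z * tau a z) - integ tau / integ v * integ (fun a z => Th a z * v a z).

Definition futakiC (w : forms X k) (Th : 'I_k.+1 -> idx X -> E -> C) : C :=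
  pairing (Th ord0) (mix0 w) (Vol w ord0) +
  \sum_i pairing (Th (lift ord0 i)) (mixi w i) (Vol w (lift ord0 i)).

Variables (w : forms X k) (u : 'I_k.+1 -> idx X -> E -> C).
Notation w' := (fun i => add_hess (w i) (u i)).
Hypotheses (kw : forall i, nondegenerate (w i)) (kw' : forall i, nondegenerate (w' i)).
Hypotheses (hu : forall i, sfam (u i)) (su : forall i, scalar (u i)).

Lemma sfam_NR (M : form11 X) : nondegenerate M -> sfam (NR M).
Proof.
move=> kM; have cM := kh_closed kM.
exact: (sfam_NN 1 (cf_smooth cM) (cf_smooth (Ric_closed (cf_form cM) (cf_smooth cM) (kh_det kM)))).
Qed.

Lemma sfam_NNk q (M W : form11 X) : nondegenerate M -> nondegenerate W -> sfam (NN q W M).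
Proof. by move=> kM kW; exact: (sfam_NN q (cf_smooth (kh_closed kM)) (cf_smooth (kh_closed kW))). Qed.

Lemma sfam_mix0 (v : forms X k) : (forall i, nondegenerate (v i)) -> sfam (mix0 v).
Proof.
move=> kv; apply: sfamB; last exact: (sfam_NR (kv ord0)).
by apply: sfam_sum => i _; exact: (sfam_NNk _ (kv _) (kv _)).
Qed.

Lemma integ_mix0 (v : forms X k) Th : (forall i, nondegenerate (v i)) -> sfam Th ->
  integ (fun a z => Th a z * mix0 v a z) =
  \sum_i integ (fun a z => Th a z * NN (p i).+1 (v (lift ord0 i)) (v ord0) a z) -
  integ (fun a z => Th a z * NR (v ord0) a z).
Proof.
move=> kv hT.
have s i : sfam (fun a z => Th a z * NN (p i).+1 (v (lift ord0 i)) (v ord0) a z).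
  exact: (sfamM hT (sfam_NNk _ (kv _) (kv _))).
have s' := sfamM hT (sfam_NR (kv ord0)).
rewrite -integ_sum => [|i _]; last exact: s.
rewrite -integB; [|by apply: sfam_sum => i _; exact: s|exact: s'].
by apply: integ_ext => a z _; rewrite mulrBr mulr_sumr.
Qed.

Lemma integ_mix0_inv : integ (mix0 w') = integ (mix0 w).
Proof.
have E1 (v : forms X k) : (forall i, nondegenerate (v i)) -> integ (mix0 v) =
    \sum_i integ (NN (p i).+1 (v (lift ord0 i)) (v ord0)) - integ (NR (v ord0)).
  move=> kv; rewrite -integ_sum => [|i _]; last exact: (sfam_NNk _ (kv _) (kv _)).
  rewrite -integB //; last exact: (sfam_NR (kv ord0)).
  by apply: sfam_sum => i _; exact: (sfam_NNk _ (kv _) (kv _)).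
apply: (etrans (E1 _ kw')); apply: (etrans _ (esym (E1 _ kw))).
apply: (f_equal2 (fun x y : C => x - y)); last first.
  exact: (integral_NR_inv (kw ord0) (kw' ord0) (hu ord0) (su ord0)).
apply: eq_bigr => i _.
exact: (integral_NN_inv _ (kh_closed (kw _)) (kh_closed (kw _)) (hu _) (su _) (hu _) (su _)).
Qed.

Lemma integ_mixi_inv i : integ (mixi w' i) = integ (mixi w i).
Proof.
exact: (integral_NN_inv _ (kh_closed (kw _)) (kh_closed (kw _)) (hu _) (su _) (hu _) (su _)).
Qed.

Lemma integ_Vol_inv i : integ (Vol w' i) = integ (Vol w i).
Proof. exact: (integral_det_inv (kw _) (hu _) (su _)). Qed.

(** Means and volume integrals are invariant one by one, and [E0] sets them aside. In the rest, the
    term of [Th ord0] with exponent [p i + 1] is joined to the term of [Th (lift ord0 i)] with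
    exponent [p i], as in [integral_invariant2]; the Ricci term is treated by itself. *)
Lemma futakiC_invariant xi (Th : 'I_k.+1 -> idx X -> E -> C) :
  holomorphic_vfield xi -> (forall i, sfam (Th i)) -> (forall i, scalar (Th i)) ->
  (forall i, potential (w i) xi (Th i)) ->
  futakiC w' (fun i => shift xi (Th i) (u i)) = futakiC w Th.
Proof.
move=> hx hT sT pT.
have hT' i := sfam_shift hx (hT i) (hu i).
have E0 (S0 S0' c0 c0' d0 d0' : C) (Sb Sb' cb cb' db db' : 'I_k -> C) :
    S0 + \sum_i Sb i = S0' + \sum_i Sb' i -> c0 = c0' -> d0 = d0' ->
    (forall i, cb i = cb' i) -> (forall i, db i = db' i) ->
    (S0 - c0 * d0) + \sum_i (Sb i - cb i * db i) =
    (S0' - c0' * d0') + \sum_i (Sb' i - cb' i * db' i).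
  move=> H -> -> hc hd.
  have -> : \sum_i (Sb i - cb i * db i) = \sum_i (Sb i - cb' i * db' i).
    by apply: eq_bigr => i _; rewrite hc hd.
  by rewrite !sumrB addrACA H addrACA.
have hV i := integral_det_shift (kw i) (hu i) (su i) hx (hT i) (sT i) (pT i).
have e2 (x x' y y' : C) : x = x' -> y = y' -> x / y = x' / y' by move=> -> ->.
apply: E0; last 4 first.
- by apply: e2; [exact: integ_mix0_inv|exact: integ_Vol_inv].
- exact: hV.
- by move=> i; apply: e2; [exact: integ_mixi_inv|exact: integ_Vol_inv].
- by move=> i; exact: hV.
have eN := integral_NR_shift (kw ord0) (kw' ord0) (hu _) (su _) hx (hT _) (sT _) (pT _).
have s1 (v : forms X k) T0 T1 i : (forall i, nondegenerate (v i)) -> sfam T0 -> sfam T1 ->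
  integ (fun a z => T0 a z * NN (p i).+1 (v (lift ord0 i)) (v ord0) a z) +
  integ (fun a z => T1 a z * mixi v i a z) =
  integ (fun a z => T0 a z * NN (p i).+1 (v (lift ord0 i)) (v ord0) a z +
                    T1 a z * NN (p i) (v (lift ord0 i)) (v ord0) a z).
  move=> kv h0 h1; apply: esym; apply: integD.
    exact: (sfamM h0 (sfam_NNk _ (kv _) (kv _))).
  exact: (sfamM h1 (sfam_NNk _ (kv _) (kv _))).
have F0 (A A' B : C) (Sb Sb' : 'I_k -> C) (Q Q' N N' : C) :
    A = Q - N -> A' = Q' - N' -> N = N' -> Q + \sum_i Sb i = Q' + \sum_i Sb' i ->
    A + \sum_i Sb i = A' + \sum_i Sb' i.
  by move=> -> -> -> H; rewrite addrAC H addrAC.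
apply: (F0 _ _ 0 _ _ _ _ _ _ (integ_mix0 kw' (hT' ord0)) (integ_mix0 kw (hT ord0)) eN).
apply: (etrans (esym (big_split _ _ _ _ _))); apply: (etrans _ (big_split _ _ _ _ _)).
apply: eq_bigr => i _.
apply: (etrans (s1 _ _ _ i kw' (hT' _) (hT' _))).
apply: (etrans _ (esym (s1 _ _ _ i kw (hT _) (hT _)))).
exact: (integral_invariant2 (p i) (kh_closed (kw _)) (kh_closed (kw _)) hx
  (hT _) (sT _) (hT _) (sT _) (hu _) (su _) (hu _) (su _) (pT _) (pT _)).
Qed.

End System.

End FutakiInvariance.

Section PencilSymmetry.
Variables (R : realType) (n : nat).
Notation C := R[i].

(** Reversal of the coefficients corresponds to [t^n * det (A + t^-1 B) = det (B + t A)]. As [t = 0]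
    is excluded, the difference of the two polynomials is first multiplied by ['X]. *)
Lemma pencil_sym (A B : 'M[C]_n) q : (q <= n)%N ->
  (pencil A B)`_(n - q) = (pencil B A)`_q.
Proof.
move=> qn.
pose P : {poly C} := \poly_(i < n.+1) (pencil A B)`_(n - i).
have EP t : t != 0 -> P.[t] = (pencil B A).[t].
  move=> t0.
  have -> : P.[t] = t ^+ n * (pencil A B).[t^-1].
    rewrite (horner_coef_wide _ (size_poly _ _)) (horner_coef_wide _ (size_pencil _ _)).
    rewrite mulr_sumr (reindex_inj rev_ord_inj) /=; apply: eq_bigr => i _.
    have hi : (i <= n)%N by rewrite -ltnS.
    rewrite coef_poly subSS ltnS leq_subr subKn // mulrCA; congr (_ * _).
    by rewrite exprVn -expfB_cond // (negPf t0).
  have e1 := pencil_eval A B t^-1; have e2 := pencil_eval B A t.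
  apply: (etrans (f_equal (fun x : C => t ^+ n * x) e1)); apply: (etrans (esym (detZ t _))).
  apply: (etrans _ (esym e2)); apply: (f_equal (fun m : 'M[C]_n => \det m)).
  by rewrite scalerDr scalerA divff // scale1r addrC.
have D0 : 'X * (P - pencil B A) = 0.
  apply: poly_eq0_eval => t; rewrite hornerM hornerX hornerD hornerN.
  have [->|t0] := eqVneq t 0; first by rewrite mul0r.
  by rewrite EP // subrr mulr0.
have : P = pencil B A.
  by apply/eqP; rewrite -subr_eq0; move/eqP: D0; rewrite mulf_eq0 polyX_eq0.
by move=> <-; rewrite coef_poly ltnS qn.
Qed.

Lemma pencil_real (A B : 'M[C]_n) q : herm A -> herm B ->
  ((pencil A B)`_q)^* = (pencil A B)`_q.
Proof.
move=> hA hB.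
have cA (W : 'M[C]_n) : herm W -> map_mx Num.conj W = W^T.
  by move=> hW; rewrite -[in RHS]hW /ct trmxK.
have e : map_poly Num.conj (pencil A B) = pencil A B.
  rewrite /pencil -det_map_mx -[RHS]det_tr; congr (\det _).
  apply/matrixP => i j; rewrite !mxE rmorphD rmorphM /= map_polyX !map_polyC /=.
  have e1 (W : 'M[C]_n) : herm W -> (W i j)^* = W j i.
    by move=> /cA /matrixP /(_ i j); rewrite !mxE.
  by rewrite !e1.
by rewrite -[in RHS]e coef_map.
Qed.

Lemma realC (x : C) : x^* = x -> x = Complex (complex.Re x) 0.
Proof.
move=> h; apply: complexE2 => //=; have := congr1 (@complex.Im R) h.
rewrite (@Im_conj R) => ?; lra.
Qed.

End PencilSymmetry.

(** * The Futaki invariant and the averages in terms of determinants *)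

Section Translation.
Variables (R : realType) (n : nat) (X : compactComplexManifold R n).
Notation E := 'rV[R]_(n + n).
Notation C := R[i].
Notation Re := complex.Re.
Notation Im := complex.Im.
Notation U_ a := (im a (@setT (carrier (mfd X)))).
Opaque smooth_on.
Opaque csmooth_on.
Opaque integral_rV.
Opaque d_z d_zbar cpartial integ hess gz gzb.
Implicit Types (a b c : idx X) (z : E) (s u : idx X -> E -> C).
Implicit Types (M : form11 X) (xi : vfield X).

Definition cR (tau : lfun X) a z : C := Complex (tau a z) 0.

Lemma integral_mfdE (tau : lfun X) : Complex (integral_mfd tau) 0 = integ (cR tau).
Proof.
rewrite -integral_cmfdE; apply: complexE2 => //=.
rewrite /integral_mfd big1 // => a _.
rewrite -[RHS](@integral_rV0 R (n + n)); congr integral_rV; apply/funext => z.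
by rewrite mulr0 mul0r mulr0.
Qed.

Lemma CplxD (x y : R) : Complex (x + y) 0 = Complex x 0 + Complex y 0 :> C.
Proof. by apply: complexE2; rewrite ?(@ReD R) ?(@ImD R) /= ?addr0. Qed.
Lemma CplxN (x : R) : Complex (- x) 0 = - Complex x 0 :> C.
Proof. by apply: complexE2; rewrite ?(@ReN R) ?(@ImN R) /= ?oppr0. Qed.
Lemma CplxM (x y : R) : Complex (x * y) 0 = Complex x 0 * Complex y 0 :> C.
Proof. by apply: complexE2; rewrite ?(@ReM R) ?(@ImM R) /=; ring. Qed.
Lemma CplxV (x : R) : Complex (x^-1) 0 = (Complex x 0)^-1 :> C.
Proof. exact: (fmorphV (real_complex R) x). Qed.
Lemma CplxB (x y : R) : Complex (x - y) 0 = Complex x 0 - Complex y 0 :> C.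
Proof. by rewrite CplxD CplxN. Qed.
Lemma Cplx_sum (I : finType) (f : I -> R) :
  Complex (\sum_i f i) 0 = \sum_i Complex (f i) 0 :> C.
Proof. exact: (rmorph_sum (real_complex R)). Qed.
Lemma Cplx_nat k : Complex (k%:R) 0 = k%:R :> C.
Proof. exact: (rmorph_nat (real_complex R)). Qed.

Lemma against_normalized (th : X -> C) M (tau : lfun X) (T V : idx X -> E -> C) :
  (forall a z, U_ a z -> cR tau a z = T a z) ->
  (forall a z, U_ a z -> cR (vol M) a z = V a z) ->
  sfam T -> sfam V -> sfam (fun a z => th (chartV a z)) ->
  integral_against th (normalized M tau) = pairing (fun a z => th (chartV a z)) T V.
Proof.
move=> hT hV sT sV sth.
rewrite /integral_against integral_cmfdE.
pose c : C := integ T / integ V.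
transitivity (integ (fun a z => th (chartV a z) * T a z - c * (th (chartV a z) * V a z))).
  apply: integ_ext => a z Uz; rewrite mulrCA -mulrBr; congr (_ * _).
  rewrite /normalized CplxB CplxM CplxM CplxV !integral_mfdE.
  rewrite (integ_ext hT) (integ_ext hV); congr (_ - _ * _); [exact: hT|exact: hV].
have s1 := sfamM sth sT; have s2 := sfamM sth sV.
by rewrite (integB s1 (sfamZ c s2)) (integZ c s2).
Qed.

Section ForOne.
Variable M : form11 X.
Hypothesis kM : nondegenerate M.

Lemma vol_det a z : U_ a z -> cR (vol M) a z = \det (M a z).
Proof.
move=> Uz; rewrite /cR /vol top_powE mulrC mulKf; last by rewrite pnatr_eq0 -lt0n fact_gt0.
by rewrite -(Redet (kh_det kM) Uz).
Qed.

Lemma top_pow_det a z : U_ a z -> Complex (top_pow (M a z)) 0 = n`!%:R * \det (M a z).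
Proof.
by move=> Uz; rewrite top_powE CplxM Cplx_nat -(Redet (kh_det kM) Uz).
Qed.

Lemma Ric_herm a z : U_ a z -> herm (Ric M a z).
Proof.
have cM := kh_closed kM.
exact: (locally_ddbar_herm (Ric_locally (cf_smooth cM) (kh_det kM))).
Qed.

Lemma factC0 k : (k`!)%:R != 0 :> C.
Proof. by rewrite pnatr_eq0 -lt0n fact_gt0. Qed.

Lemma wedge_pow_NR a z : (0 < n)%N -> U_ a z ->
  Complex (wedge_pow 1 (Ric M a z) (M a z)) 0 = (n.-1)`!%:R * NR M a z.
Proof.
move=> n0 Uz; rewrite wedge_powE // mul1n subn1 CplxM Cplx_nat; congr (_ * _).
apply: esym; apply: realC; apply: pencil_real; [exact: (kh_herm kM)|exact: Ric_herm].
Qed.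

Lemma scalar_curvatureE a z : (0 < n)%N -> U_ a z ->
  cR (scalar_curvature M) a z = NR M a z / \det (M a z).
Proof.
move=> n0 Uz; rewrite /cR /scalar_curvature !CplxM !CplxV CplxM CplxV !Cplx_nat.
rewrite wedge_pow_NR // top_pow_det //.
have V0 : \det (M a z) != 0 by rewrite gt_eqF // (kh_det kM).
by field; rewrite V0 !factC0.
Qed.

Lemma averageE (f : lfun X) (F : idx X -> E -> C) : sfam F ->
  (forall a z, U_ a z -> cR f a z * \det (M a z) = F a z) ->
  Complex (average M f) 0 = integ F / integ (fun a z => \det (M a z)).
Proof.
move=> sF hF; rewrite /average CplxM CplxV !integral_mfdE.
have sV := sfam_det (cf_smooth (kh_closed kM)).
have -> : integ (cR (fun a z => f a z * top_pow (M a z))) = n`!%:R * integ F.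
  rewrite -integZ //; apply: integ_ext => a z Uz.
  by rewrite /cR CplxM top_pow_det // mulrCA -hF.
have -> : integ (cR (fun a z => top_pow (M a z))) = n`!%:R * integ (fun a z => \det (M a z)).
  by rewrite -integZ //; apply: integ_ext => a z Uz; rewrite /cR top_pow_det.
by rewrite -mulf_div divff ?mul1r // factC0.
Qed.

Lemma integ_det_gt0 : 0 < integ (fun a z => \det (M a z)).
Proof.
have cM := kh_closed kM.
have [h1 h2] := integ_ge0 (sfam_det (cf_smooth cM)) (density_det (cf_form cM))
  (fun a z Uz => ltW (kh_det kM Uz)).
rewrite lt_neqAle h1 andbT eq_sym; apply/eqP => /h2 h.
have [x _] := @mfd_nonempty R n X.
have [a dx] := @dom_cover R n X x; have [Uz _] := im_chart dx.
by have := kh_det kM Uz; rewrite (h _ _ Uz) ltxx.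
Qed.

End ForOne.

Section System.
Variables (k : nat) (p : 'I_k -> nat) (w : forms X k).
Hypotheses (n0 : (0 < n)%N) (pn : forall i, (p i <= n - 1)%N).
Hypothesis kw : forall i, nondegenerate (w i).

Let pn' i : (p i < n)%N.
Proof. by have := pn i; rewrite -ltnS subn1 prednK. Qed.

Lemma NN_real q i j a z : U_ a z -> (NN q (w i) (w j) a z)^* = NN q (w i) (w j) a z.
Proof. by move=> Uz; apply: pencil_real; exact: (kh_herm (kw _)). Qed.

Lemma wedge_pow_NN q i j a z : (q <= n)%N -> U_ a z ->
  Complex (wedge_pow q (w i a z) (w j a z)) 0 = (q`! * (n - q)`!)%:R * NN q (w i) (w j) a z.
Proof.
move=> qn Uz; rewrite wedge_powE // CplxM Cplx_nat; congr (_ * _).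
by apply: esym; apply: realC; exact: NN_real.
Qed.

Lemma coefAE i a z : U_ a z -> cR (coefA p w i) a z =
  NN (p i).+1 (w (lift ord0 i)) (w ord0) a z / \det (w ord0 a z).
Proof.
move=> Uz; rewrite /cR /coefA !CplxM !CplxV CplxM !Cplx_nat wedge_pow_NN //.
rewrite (top_pow_det (kw _)) // natrM -subnDA addn1.
have V0 : \det (w ord0 a z) != 0 by rewrite gt_eqF // (kh_det (kw _)).
by field; rewrite V0 !factC0.
Qed.

Lemma coefBE i a z : U_ a z -> cR (coefB p w i) a z =
  mixi p w i a z / \det (w (lift ord0 i) a z).
Proof.
move=> Uz; rewrite /cR /coefB !CplxM !CplxV CplxM !Cplx_nat wedge_pow_NN ?leq_subr //.
rewrite (top_pow_det (kw _)) // natrM subKn; last exact: ltnW.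
(* In [coefB] the exponent counted is the power [n - p i] of [w ord0], whereas [mixi] counts the
   power [p i] of the other form. *)
rewrite /NN pencil_sym; last exact: ltnW.
have V0 : \det (w (lift ord0 i) a z) != 0 by rewrite gt_eqF // (kh_det (kw _)).
by rewrite /mixi /NN; field; rewrite V0 !factC0.
Qed.

Lemma futaki_top0E a z : U_ a z -> cR (futaki_top0 p w) a z = mix0 p w a z.
Proof.
move=> Uz; rewrite /cR /futaki_top0 CplxB Cplx_sum CplxM CplxV Cplx_nat.
rewrite (wedge_pow_NR (kw _)) // mulrC mulKf ?factC0 //; congr (_ - _).
apply: eq_bigr => i _; rewrite CplxM CplxV CplxM !Cplx_nat wedge_pow_NN // natrM -subnDA addn1.
by rewrite mulrC mulKf // mulf_neq0 ?factC0.
Qed.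

Lemma futaki_topE i a z : U_ a z -> cR (futaki_top p w i) a z = mixi p w i a z.
Proof.
move=> Uz; rewrite /cR /futaki_top CplxM CplxV CplxM !Cplx_nat wedge_pow_NN ?(ltnW (pn' i)) // natrM.
by rewrite mulrC mulKf // mulf_neq0 ?factC0.
Qed.

Lemma futakiE (th : 'I_k.+1 -> X -> C) :
  (forall i, sfam (fun a z => th i (chartV a z))) ->
  futaki p w th = futakiC p w (fun i a z => th i (chartV a z)).
Proof.
move=> sth; have sV i := sfam_det (cf_smooth (kh_closed (kw i))).
apply: (f_equal2 (fun x y : C => x + y)).
  apply: against_normalized => //.
  - exact: futaki_top0E.
  - exact: (vol_det (kw _)).
  - exact: sfam_mix0.
  - exact: sV.
apply: eq_bigr => i _; apply: against_normalized => //.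
- exact: futaki_topE.
- exact: (vol_det (kw _)).
- exact: sfam_NNk.
- exact: sV.
Qed.

Definition mean0 : C := integ (mix0 p w) / integ (Vol w ord0).
Definition meani i : C := integ (mixi p w i) / integ (Vol w (lift ord0 i)).

Lemma averageBE i : Complex (average (w (lift ord0 i)) (coefB p w i)) 0 = meani i.
Proof.
apply: (averageE (kw _)); first exact: sfam_NNk.
move=> a z Uz; rewrite coefBE // divfK // gt_eqF // (kh_det (kw _)) //.
Qed.

Lemma averageAE : \sum_i Complex (average (w ord0) (coefA p w i)) 0 -
  Complex (average (w ord0) (scalar_curvature (w ord0))) 0 = mean0.
Proof.
have V0 a z : U_ a z -> \det (w ord0 a z) != 0.
  by move=> Uz; rewrite gt_eqF // (kh_det (kw _)).
have sN i := sfam_NNk (p i).+1 (kw ord0) (kw (lift ord0 i)).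
have sR := sfam_NR (kw ord0).
rewrite (averageE (kw ord0) sR) => [|a z Uz]; last first.
  by rewrite scalar_curvatureE // divfK // V0.
have e i : Complex (average (w ord0) (coefA p w i)) 0 =
    integ (NN (p i).+1 (w (lift ord0 i)) (w ord0)) / integ (Vol w ord0).
  apply: (averageE (kw _)); first exact: sN.
  by move=> a z Uz; rewrite coefAE // divfK // V0.
rewrite (eq_bigr _ (fun i _ => e i)) -mulr_suml -mulrBl; congr (_ / _).
rewrite -integ_sum; last by move=> i _; exact: sN.
have sS : sfam (fun a z => \sum_i NN (p i).+1 (w (lift ord0 i)) (w ord0) a z).
  by apply: sfam_sum => i _; exact: sN.
by rewrite -(integB sS sR).
Qed.

End System.

End Translation.

(** * The equation and the vanishing of the Futaki pairing *)

Section Forward.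
Variables (R : realType) (n k : nat) (X : compactComplexManifold R n).
Notation E := 'rV[R]_(n + n).
Notation C := R[i].
Notation Re := complex.Re.
Notation Im := complex.Im.
Notation U_ a := (im a (@setT (carrier (mfd X)))).
Opaque smooth_on.
Opaque csmooth_on.
Opaque integral_rV.
Opaque d_z d_zbar cpartial integ hess gz gzb.

Lemma hermD (A B : 'M[C]_n) : herm A -> herm B -> herm (A + B).
Proof. by move=> hA hB; rewrite /herm ctD hA hB. Qed.

Lemma hess_rf_herm (h : X -> R) a z : mfd_smooth h -> U_ a z -> herm (hess (rf h) a z).
Proof. by move=> sh Uz; exact: (ddbar_herm (open_U a) (sh a) Uz). Qed.

Lemma curvature_closed (L : lineBundle X) (phi : lidx L -> X -> R) (M : form11 X) :
  hermitian_metric phi -> curvature_form phi M ->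
  closed_form M /\ forall a z, U_ a z -> herm (M a z).
Proof.
move=> h1 h2; have hl := curvature_locally h1 h2; split.
  exact: (locally_ddbar_closed hl (curvature_is_form h1 h2)).
by move=> a z; exact: locally_ddbar_herm.
Qed.

Lemma add_hess_nondegenerate (M : form11 X) (h : X -> R) : closed_form M ->
  (forall a z, U_ a z -> herm (M a z)) -> mfd_smooth h ->
  (forall a z, U_ a z -> 0 < \det (add_hess M (rf h) a z)) ->
  nondegenerate (add_hess M (rf h)).
Proof.
move=> cM hM sh pM; split => //.
  exact: (closedD cM (closed_hess (sfam_rf sh) (@scalar_rf R n X h))).
by move=> a z Uz; apply: hermD; [exact: hM|exact: hess_rf_herm].
Qed.

Lemma nondegenerate_perturb (M : form11 X) (h : X -> R) : closed_form M ->
  (forall a z, U_ a z -> herm (M a z)) -> PSH M h -> nondegenerate (add_hess M (rf h)).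
Proof.
move=> cM hM [sh pM]; apply: add_hess_nondegenerate => // a z Uz.
apply: posdef_det_gt0; last exact: pM.
by apply: hermD; [exact: hM|exact: hess_rf_herm].
Qed.

Variables (p : 'I_k -> nat) (w : forms X k).
Hypotheses (n0 : (0 < n)%N) (pn : forall i, (p i <= n - 1)%N).
Hypothesis kw : forall i, nondegenerate (w i).

Definition moment_zeroC := forall a z, U_ a z ->
  mix0 p w a z = mean0 p w * Vol w ord0 a z /\
  forall j, mixi p w j a z = meani p w j * Vol w (lift ord0 j) a z.

Lemma Cplx_inj (x y : R) : Complex x 0 = Complex y 0 :> C -> x = y.
Proof. by case. Qed.

Lemma coefA_sum a z : U_ a z ->
  Complex (\sum_i coefA p w i a z - scalar_curvature (w ord0) a z) 0 =
  mix0 p w a z / Vol w ord0 a z.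
Proof.
move=> Uz; rewrite CplxB Cplx_sum [Complex (scalar_curvature _ _ _) 0](scalar_curvatureE (kw _)) //.
rewrite (eq_bigr _ (fun i _ => coefAE n0 pn kw i Uz)) -mulr_suml -mulrBl.
by [].
Qed.

Lemma averageA_sum : Complex (\sum_i average (w ord0) (coefA p w i)
        - average (w ord0) (scalar_curvature (w ord0))) 0 = mean0 p w.
Proof. by rewrite CplxB Cplx_sum averageAE. Qed.

Lemma Vol_neq0 i a z : U_ a z -> Vol w i a z != 0.
Proof. by move=> Uz; rewrite gt_eqF // (kh_det (kw _)). Qed.

Lemma moment_zeroP : (forall a z, U_ a z ->
    \sum_i coefA p w i a z - scalar_curvature (w ord0) a z
      = \sum_i average (w ord0) (coefA p w i)
        - average (w ord0) (scalar_curvature (w ord0))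
    /\ forall j, coefB p w j a z = average (w (lift ord0 j)) (coefB p w j))
  <-> moment_zeroC.
Proof.
split=> H a z Uz; have [H1 H2] := H a z Uz; split.
- have := congr1 (fun x => Complex x 0 : C) H1; rewrite coefA_sum // averageA_sum.
  by move=> <-; rewrite divfK // Vol_neq0.
- move=> j; have := congr1 (fun x => Complex x 0 : C) (H2 j).
  rewrite [LHS](coefBE n0 pn kw j Uz) averageBE // => <-; rewrite divfK //.
  exact: Vol_neq0.
- apply: Cplx_inj; rewrite coefA_sum // averageA_sum H1 mulfK // Vol_neq0 //.
- move=> j; apply: Cplx_inj; rewrite [LHS](coefBE n0 pn kw j Uz) averageBE // H2 mulfK //.
  exact: Vol_neq0.
Qed.

Lemma pairing_proportional Th (T V : idx X -> E -> C) (m : C) : sfam Th -> sfam V ->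
  integ V != 0 -> (forall a z, U_ a z -> T a z = m * V a z) -> pairing Th T V = 0.
Proof.
move=> hT hV V0 H; rewrite /pairing (integ_ext H) integZ // mulfK //.
rewrite (integ_ext (tau' := fun a z => m * (Th a z * V a z))); last first.
  by move=> a z Uz; rewrite H // mulrCA.
by rewrite (integZ m (sfamM hT hV)) subrr.
Qed.

Lemma moment_zero_futakiC Th : moment_zeroC -> (forall i, sfam (Th i)) ->
  futakiC p w Th = 0.
Proof.
move=> H hT; have sV i := sfam_det (cf_smooth (kh_closed (kw i))).
have V0 i : integ (Vol w i) != 0 by rewrite gt_eqF //; exact: integ_det_gt0 (kw i).
rewrite /futakiC (pairing_proportional (m := mean0 p w) (hT _) (sV _) (V0 _)); last first.
  by move=> a z Uz; exact: (H a z Uz).1.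
rewrite add0r big1 // => i _.
apply: (pairing_proportional (m := meani p w i) (hT _) (sV _) (V0 _)) => a z Uz.
exact: (H a z Uz).2.
Qed.

End Forward.

(** * Bochner's identity *)

Section Bochner.
Variables (R : realType) (n : nat) (X : compactComplexManifold R n).
Notation E := 'rV[R]_(n + n).
Notation C := R[i].
Notation Re := complex.Re.
Notation Im := complex.Im.
Notation U_ a := (im a (@setT (carrier (mfd X)))).
Opaque smooth_on.
Opaque csmooth_on.
Opaque integral_rV.
Opaque d_z d_zbar cpartial integ hess gz gzb.
Implicit Types (a b c : idx X) (z : E) (s : idx X -> E -> C).

Lemma d_zbar_jac a b j k p z : im a (dom b) z ->
  d_zbar k (fun y => cjac (trn a b) y j p) z = 0.
Proof.
move=> hz; have oI := open_imdom a b; have D := derivation_d_zbar oI k.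
have [sz hzb] := @trn_holo R n X a b p.
rewrite (dv_ext D (G := d_z j (fun y => zcoord (trn a b y) p)) _ hz); last first.
  by move=> y _; rewrite [LHS]mxE.
rewrite -(commute_dz_dzbar oI j k sz hz).
rewrite (dv_ext (derivation_d_z oI j) (G := fun _ => 0) _ hz); last by move=> y hy; exact: hzb.
by rewrite (dv_cst (derivation_d_z oI j)).
Qed.

Variables (M : form11 X) (u : idx X -> E -> C).
Hypotheses (kM : nondegenerate M) (hu : sfam u) (su : scalar u).
Hypothesis ru : forall a z, (u a z)^* = u a z.
Let cM := kh_closed kM.
Let sM := cf_smooth cM.
Let fM := cf_form cM.
Let V a z := \det (M a z).
Let sV : sfam V := sfam_det sM.

Let V0 a z : U_ a z -> V a z != 0.
Proof. by move=> Uz; rewrite gt_eqF // (kh_det kM). Qed.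

Let uM a z : U_ a z -> M a z \in unitmx.
Proof. by move=> /V0; rewrite unitmxE unitfE. Qed.

(** The components [v^j] of the gradient of type (1,0), determined by [v M = dbar u]; [gradc] and
    [gradr] below are its conjugate as a column and as a row. *)
Definition grad a z : 'rV[C]_n := gzb u a z *m invmx (M a z).

Lemma gradK a z : U_ a z -> grad a z *m M a z = gzb u a z.
Proof. by move=> Uz; rewrite /grad mulmxKV // uM. Qed.

Lemma gradE a z j : U_ a z ->
  V a z * grad a z 0 j = \sum_l (\adj (M a z)) l j * d_zbar l (u a) z.
Proof.
move=> Uz; have h : V a z *: grad a z = gzb u a z *m \adj (M a z).
  by rewrite -(gradK Uz) -mulmxA mul_mx_adj mul_mx_scalar.
have -> : V a z * grad a z 0 j = (V a z *: grad a z) 0 j by rewrite [RHS]mxE.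
rewrite h [LHS]mxE; apply: eq_bigr => l _; by rewrite gzbE mulrC.
Qed.

Lemma sfam_Vgrad j : sfam (fun a z => \sum_l (\adj (M a z)) l j * d_zbar l (u a) z).
Proof.
by apply: sfam_sum => l _; exact: (sfamM (sfam_adj sM l j) (sfam_d_zbar l hu)).
Qed.

Lemma sfam_Vinv : sfam (fun a z => (V a z)^-1).
Proof.
by move=> a; apply: (csmV (open_U a)); [move=> z; exact: V0|exact: (sV a)].
Qed.

Lemma sfam_grad j : sfam (fun a z => grad a z 0 j).
Proof.
apply: (sfam_ext _ (sfamM sfam_Vinv (sfam_Vgrad j))) => a z Uz.
by rewrite -gradE // mulKf // V0.
Qed.

Lemma grad_trn a b z : im a (dom b) z ->
  grad a z *m cjac (trn a b) z = grad b (trn a b z).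
Proof.
move=> hz; have [hy _ _] := trnP hz; have Uz := imdom_sub hz; have Uy := imdom_sub hy.
have [_ /(_ z hz) J0] := holo_det_jac a b.
have uJ : ct (cjac (trn a b) z) \in unitmx by rewrite ct_unit unitmxE unitfE.
apply: (can_inj (mulmxK (uM Uy))); apply: (can_inj (mulmxK uJ)).
by rewrite (gradK Uy) -(gzb_trn hu su hz) -(gradK Uz) (fM hz) !mulmxA.
Qed.

Lemma gz_real a z : U_ a z -> gz u a z = ct (gzb u a z).
Proof.
move=> Uz; apply/colP => j; rewrite ctE gzE gzbE.
rewrite -(d_z_conj j (hu a) Uz).
by apply: (dv_ext (derivation_d_z (open_U a) j)); [move=> y _; rewrite ru|exact: Uz].
Qed.

Definition gradc a z : 'cV[C]_n := ct (grad a z).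

Lemma gradcE a z : U_ a z -> gradc a z = invmx (M a z) *m gz u a z.
Proof.
by move=> Uz; rewrite /gradc /grad ctM ct_inv (kh_herm kM Uz) gz_real.
Qed.

Lemma gradc_adj a z : U_ a z -> V a z *: gradc a z = \adj (M a z) *m gz u a z.
Proof.
move=> Uz; rewrite (gradcE Uz) /invmx (uM Uz) -scalemxAl scalerA.
by rewrite divff ?V0 // scale1r.
Qed.

Definition dbargrad a z : 'M[C]_n := \matrix_(k, j) d_zbar k (fun y => grad a y 0 j) z.

Lemma dbargradE a z k j : dbargrad a z k j = d_zbar k (fun y => grad a y 0 j) z.
Proof. by rewrite mxE. Qed.

Lemma mfam_dbargrad : mfam dbargrad.
Proof.
move=> k j; apply: (sfam_ext _ (sfam_d_zbar k (sfam_grad j))) => a z _.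
by rewrite dbargradE.
Qed.

Lemma dbargrad_trn a b z : im a (dom b) z ->
  dbargrad a z *m cjac (trn a b) z =
  map_mx Num.conj (cjac (trn a b) z) *m dbargrad b (trn a b z).
Proof.
move=> hz; have oI := open_imdom a b; have oI' := open_imdom b a.
have hol := @trn_holo R n X a b; have sJ := csm_cjac oI hol.
apply/matrixP => k p; rewrite [LHS]mxE [RHS]mxE.
have D := derivation_d_zbar oI k.
have sg c j := @sfam_dom R n X _ c a (sfam_grad j).
have sg' j := @sfam_dom R n X _ b a (sfam_grad j).
have sga j := @sfam_dom R n X _ a b (sfam_grad j).
transitivity (d_zbar k (fun y => grad b (trn a b y) 0 p) z).
  rewrite (dv_ext D (G := fun y => \sum_j grad a y 0 j * cjac (trn a b) y j p) _ hz); last first.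
    by move=> y hy; rewrite -(grad_trn hy) [LHS]mxE.
  rewrite (dv_sum oI D _ (fun j _ => csmM oI (sga j) (sJ j p)) hz).
  apply: eq_bigr => j _; rewrite (dvM D (sga j) (sJ j p) hz) d_zbar_jac // mulr0 addr0.
  by rewrite dbargradE.
rewrite (@d_zbar_comp R n _ _ (trn a b) oI oI' _ hol _ k z (sg' p) hz); last first.
  by move=> y /trnP[].
apply: eq_bigr => q _; rewrite dbargradE; congr (_ * _).
by rewrite [RHS]mxE [X in _ = X^*]mxE.
Qed.

Definition lap a z : C := \tr (\adj (M a z) *m hess u a z) / V a z.

Lemma sfam_lap : sfam lap.
Proof. exact: (sfamM (sfam_tr_adj sM (mfam_hess hu)) sfam_Vinv). Qed.

Lemma scalar_lap : scalar lap.
Proof.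
move=> a b z hz; have := scalar_chi kM hu su hz; rewrite /chi => /eqP.
by rewrite eqr_opp => /eqP.
Qed.

Lemma div_Vgrad a z : U_ a z ->
  \sum_j d_z j (fun y => \sum_l (\adj (M a y)) l j * d_zbar l (u a) y) z =
  V a z * lap a z.
Proof.
move=> Uz; have oU := open_U a; have D j := derivation_d_z oU j.
have sA := sfam_adj sM.
rewrite /lap mulrC divfK ?V0 // tr_mul_sum.
transitivity (\sum_j \sum_l ((\adj (M a z)) l j * hess u a z j l +
      d_z j (fun y => (\adj (M a y)) l j) z * d_zbar l (u a) z)).
  apply: eq_bigr => j _.
  rewrite (dv_sum oU (D j) _ (fun l _ => csmM oU (sA l j a) (sfam_d_zbar l hu a)) Uz).
  apply: eq_bigr => l _.
  rewrite (dvM (D j) (sA l j a) (sfam_d_zbar l hu a) Uz) addrC; congr (_ * _ + _).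
  by rewrite hessE.
under eq_bigr do rewrite big_split.
rewrite big_split /= [X in _ + X]exchange_big /= [X in _ + X]big1 ?addr0 // => l _.
rewrite -mulr_suml; suff -> : \sum_j d_z j (fun y => (\adj (M a y)) l j) z = 0 by rewrite mul0r.
apply: (@piola R n (U_ a) oU (@d_z R n) D (M a) z l) => [i j||j q r].
- exact: (sM i j a).
- exact: Uz.
exact: (cf_dz cM).
Qed.

Lemma Ric_VE j k a z : U_ a z -> V a z * Ric M a z j k =
  d_zbar k (V a) z * d_z j (V a) z / V a z - d_z j (d_zbar k (V a)) z.
Proof.
move=> Uz; have oU := open_U a; have D := derivation_d_z oU j; have D' := derivation_d_zbar oU k.
have eR : Ric M a z j k = - d_z j (d_zbar k (lnV M a)) z.
  by rewrite (RicE kM Uz) [LHS]mxE; congr (- _); exact: hessE.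
rewrite eR.
have e y : U_ a y -> d_zbar k (lnV M a) y = d_zbar k (V a) y * (V a y)^-1.
  move=> Uy.
  have sR : smooth_on (U_ a) (fun y => Re (\det (M a y))) by exact: (csmRe (sV a)).
  rewrite (d_zbar_ln k (fun y Uy => Redet_gt0 (kh_det kM) Uy) sR Uy).
  rewrite -(Redet (kh_det kM) Uy); congr (_ / _).
  by apply: (dv_ext D'); [move=> t Ut; rewrite -(Redet (kh_det kM) Ut)|exact: Uy].
rewrite (dv_ext D e Uz).
rewrite (dvM D (sfam_d_zbar k sV a) (sfam_Vinv a) Uz).
rewrite (dvV oU D (@V0 a) (sV a) Uz).
by have v0 := V0 Uz; field.
Qed.

(** The commutation rule for second covariant derivatives, written with ordinary derivatives
    weighted by the volume density [V]. Exchanging [d_z j] with [d_zbar k] leaves derivatives of [V]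
    that combine to the Ricci form, which is [- ddbar (ln V)]. *)
Lemma div_Vdbargrad k a z : U_ a z ->
  \sum_j d_z j (fun y => V a y * dbargrad a y k j) z =
  V a z * d_zbar k (lap a) z + V a z * (grad a z *m Ric M a z) 0 k.
Proof.
move=> Uz; have oU := open_U a; have D j := derivation_d_z oU j.
have D' := derivation_d_zbar oU k.
pose Q j y := \sum_l (\adj (M a y)) l j * d_zbar l (u a) y.
have sQ j : csm (U_ a) (Q j) := sfam_Vgrad j a.
have sg j : csm (U_ a) (fun y => grad a y 0 j) := sfam_grad j a.
have sVa := sV a; have sdV := dv_smooth D' sVa.
have e y j : U_ a y -> V a y * dbargrad a y k j =
    d_zbar k (Q j) y - grad a y 0 j * d_zbar k (V a) y.
  move=> Uy; rewrite dbargradE.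
  rewrite (dv_ext D' (F := Q j) (G := fun y => V a y * grad a y 0 j) _ Uy); last first.
    by move=> t Ut; rewrite gradE.
  by rewrite (dvM D' sVa (sg j) Uy); ring.
transitivity (\sum_j (d_zbar k (d_z j (Q j)) z -
   (d_z j (fun y => grad a y 0 j) z * d_zbar k (V a) z + grad a z 0 j * d_z j (d_zbar k (V a)) z))).
  apply: eq_bigr => j _; rewrite (dv_ext (D j) (fun y Uy => e y j Uy) Uz).
  rewrite (dvB oU (D j) (dv_smooth D' (sQ j)) (csmM oU (sg j) sdV) Uz).
  by rewrite (dvM (D j) (sg j) sdV Uz) (commute_dz_dzbar oU j k (sQ j) Uz).
have eQ : \sum_j d_zbar k (d_z j (Q j)) z = d_zbar k (V a) z * lap a z + V a z * d_zbar k (lap a) z.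
  rewrite -(dv_sum oU D' _ (fun j _ => dv_smooth (D j) (sQ j)) Uz).
  rewrite (dv_ext D' (G := fun y => V a y * lap a y) _ Uz); last first.
    by move=> y Uy; exact: div_Vgrad.
  exact: (dvM D' sVa (sfam_lap a) Uz).
have eV : V a z * \sum_j d_z j (fun y => grad a y 0 j) z =
    V a z * lap a z - \sum_j grad a z 0 j * d_z j (V a) z.
  rewrite -(div_Vgrad Uz) mulr_sumr -sumrB; apply: eq_bigr => j _.
  rewrite (dv_ext (D j) (F := fun y => \sum_l (\adj (M a y)) l j * d_zbar l (u a) y)
    (G := fun y => V a y * grad a y 0 j) _ Uz); last by move=> t Ut; rewrite gradE.
  by rewrite (dvM (D j) sVa (sg j) Uz); ring.
have v0 := V0 Uz.
have eV' : \sum_j d_z j (fun y => grad a y 0 j) z =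
    lap a z - (\sum_j grad a z 0 j * d_z j (V a) z) / V a z.
  by apply: (mulfI v0); rewrite eV; field.
have eR : V a z * (grad a z *m Ric M a z) 0 k =
    d_zbar k (V a) z * (\sum_j grad a z 0 j * d_z j (V a) z) / V a z -
    \sum_j grad a z 0 j * d_z j (d_zbar k (V a)) z.
  rewrite [(grad a z *m _) 0 k]mxE mulr_sumr mulr_sumr mulr_suml -sumrB.
  apply: eq_bigr => j _; rewrite mulrCA (Ric_VE j k Uz); field.
  exact: v0.
rewrite sumrB eQ big_split /= -mulr_suml eV' eR.
by field.
Qed.

Definition gradr a z : 'rV[C]_n := map_mx Num.conj (grad a z).

Lemma gradr_trn a b z : im a (dom b) z ->
  gradr a z *m map_mx Num.conj (cjac (trn a b) z) = gradr b (trn a b z).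
Proof. by move=> hz; rewrite /gradr -map_mxM (grad_trn hz). Qed.

Lemma gradrE a z k : gradr a z 0 k = (grad a z 0 k)^*.
Proof. by rewrite mxE. Qed.

Lemma gradcE' a z k : gradc a z k 0 = (grad a z 0 k)^*.
Proof. by rewrite ctE. Qed.

Lemma bochner_density s : sfam s -> scalar s -> density (fun a z =>
  \sum_j d_z j (s a) z * (V a z * \sum_k (grad a z 0 k)^* * dbargrad a z k j)).
Proof.
move=> hs ss.
have E1 a z : \sum_j d_z j (s a) z * (V a z * \sum_k (grad a z 0 k)^* * dbargrad a z k j) =
    (gradr a z *m dbargrad a z *m gz s a z) 0 0 * V a z.
  rewrite [(_ *m gz s a z) 0 0]mxE mulr_suml; apply: eq_bigr => j _.
  rewrite gzE [(gradr a z *m _) 0 j]mxE.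
  have -> : \sum_j0 gradr a z 0 j0 * dbargrad a z j0 j = \sum_k (grad a z 0 k)^* * dbargrad a z k j.
    by apply: eq_bigr => k _; rewrite gradrE.
  by ring.
have sc : scalar (fun a z => (gradr a z *m dbargrad a z *m gz s a z) 0 0).
  move=> a b z hz; apply: (congr1 (fun m : 'M[C]_1 => m 0 0)).
  have H (r r' : 'rV[C]_n) (B B' J cJ : 'M[C]_n) (g g' : 'cV[C]_n) :
      g = J *m g' -> B *m J = cJ *m B' -> r *m cJ = r' -> r *m B *m g = r' *m B' *m g'.
    by move=> -> H1 H2; rewrite mulmxA -(mulmxA r) H1 mulmxA H2.
  exact (H _ _ _ _ _ _ _ _ (gz_trn hs ss hz) (dbargrad_trn hz) (gradr_trn hz)).
move=> a b z hz; have ht := densityZ sc (density_det fM) hz.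
apply: (etrans (E1 a z)); apply: (etrans ht).
exact: (congr1 (fun x => x * _) (esym (E1 b _))).
Qed.

Lemma sfam_form_entry : sfam (fun a z => V a z * (grad a z *m Ric M a z *m gradc a z) 0 0).
Proof.
have sR := cf_smooth (Ric_closed fM sM (kh_det kM)).
apply: (@sfam_ext R n X (fun a z => V a z * \sum_k (\sum_j grad a z 0 j * Ric M a z j k) * (grad a z 0 k)^*)).
  move=> a z _; congr (_ * _); rewrite [RHS]mxE; apply: eq_bigr => k _.
  by rewrite gradcE'; congr (_ * _); rewrite [RHS]mxE.
apply: (sfamM sV); apply: sfam_sum => k _.
apply: (@sfamM R n X (fun a z => \sum_j grad a z 0 j * Ric M a z j k) _ _ (sfam_conj (sfam_grad k))).
by apply: sfam_sum => j _; exact: (sfamM (sfam_grad j) (sR j k)).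
Qed.

Lemma sfam_dbar_norm :
  sfam (fun a z => V a z * \tr (map_mx Num.conj (dbargrad a z) *m dbargrad a z)).
Proof.
apply: (sfamM sV).
apply: (sfam_tr (M := fun a z => map_mx Num.conj (dbargrad a z) *m dbargrad a z)).
apply: mfam_mul mfam_dbargrad => k j.
apply: (sfam_ext _ (sfam_conj (mfam_dbargrad k j))) => a z _.
by rewrite [RHS]mxE.
Qed.

(** Stokes' theorem is applied to [P j], the contraction of the conjugate gradient with [dbargrad],
    weighted by [V]. Its divergence consists of the squared norm of [dbargrad], the Ricci term of
    [div_Vdbargrad], and the gradient of [lap] paired with that of [u], which integrates to minus
    the integral of [lap^2 V]. *)
Lemma bochner :
  integ (fun a z => lap a z ^+ 2 * V a z) -
  integ (fun a z => V a z * (grad a z *m Ric M a z *m gradc a z) 0 0) =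
  integ (fun a z => V a z * \tr (map_mx Num.conj (dbargrad a z) *m dbargrad a z)).
Proof.
pose P j a z := V a z * \sum_k (grad a z 0 k)^* * dbargrad a z k j.
have sgc k : sfam (fun a z => (grad a z 0 k)^*) := sfam_conj (sfam_grad k).
have sP j : sfam (P j).
  by apply: (sfamM sV); apply: sfam_sum => k _; exact: (sfamM (sgc k) (mfam_dbargrad k j)).
have St := stokes (fun j => @stokes_d_z R n j) sP
  (fun c => bochner_density (Rho_csm c) (@Rho_scalar _ _ _ c)).
have s1 := sfam_dbar_norm; have s3 := sfam_form_entry.
have s2 : sfam (fun a z => \tr (\adj (M a z) *m (gz u a z *m gzb lap a z))).
  exact: (sfam_tr_adj sM (mfam_outer hu sfam_lap)).
have div a z : U_ a z -> \sum_j d_z j (P j a) z =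
    V a z * \tr (map_mx Num.conj (dbargrad a z) *m dbargrad a z) +
    (\tr (\adj (M a z) *m (gz u a z *m gzb lap a z)) +
     V a z * (grad a z *m Ric M a z *m gradc a z) 0 0).
  move=> Uz; have oU := open_U a; have D j := derivation_d_z oU j.
  have sVB k j : csm (U_ a) (fun y => V a y * dbargrad a y k j) := sfamM sV (mfam_dbargrad k j) a.
  transitivity (\sum_j \sum_k ((dbargrad a z j k)^* * (V a z * dbargrad a z k j) +
     (grad a z 0 k)^* * d_z j (fun y => V a y * dbargrad a y k j) z)).
    apply: eq_bigr => j _.
    rewrite (dv_ext (D j) (G := fun y => \sum_k (grad a y 0 k)^* * (V a y * dbargrad a y k j)) _ Uz); last first.
      by move=> y _; rewrite /P mulr_sumr; apply: eq_bigr => k _; ring.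
    rewrite (dv_sum oU (D j) _ (fun k _ => csmM oU (sgc k a) (sVB k j)) Uz).
    apply: eq_bigr => k _; rewrite (dvM (D j) (sgc k a) (sVB k j) Uz); congr (_ * _ + _).
    by rewrite (d_z_conj j (sfam_grad k a) Uz) dbargradE.
  under eq_bigr do rewrite big_split.
  rewrite big_split /=; congr (_ + _).
    rewrite /mxtrace mulr_sumr; apply: eq_bigr => j _; rewrite [(_ *m _) j j]mxE mulr_sumr.
    by apply: eq_bigr => k _; rewrite [(map_mx _ _) j k]mxE; ring.
  rewrite exchange_big /=.
  transitivity (\sum_k (grad a z 0 k)^* * (V a z * d_zbar k (lap a) z + V a z * (grad a z *m Ric M a z) 0 k)).
    by apply: eq_bigr => k _; rewrite -(div_Vdbargrad k Uz) mulr_sumr.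
  have -> : \adj (M a z) *m (gz u a z *m gzb lap a z) = (V a z *: gradc a z) *m gzb lap a z.
    by rewrite (gradc_adj Uz) mulmxA.
  rewrite mxtrace_mulC trace_mx11 [(gzb lap a z *m _) 0 0]mxE.
  rewrite [(_ *m gradc a z) 0 0]mxE mulr_sumr -big_split; apply: eq_bigr => k _ /=.
  have e4 : (V a z *: gradc a z) k 0 = V a z * (grad a z 0 k)^*.
    by rewrite [LHS]mxE gradcE'.
  by rewrite gzbE e4 gradcE'; ring.
move: St; rewrite (integ_ext div) integD; [|exact: s1|exact: (sfamD s2 s3)].
rewrite (integD s2 s3).
have eL : integ (fun a z => lap a z * \tr (\adj (M a z) *m hess u a z)) =
    integ (fun a z => lap a z ^+ 2 * V a z).
  apply: integ_ext => a z Uz; rewrite expr2 -mulrA; apply: (congr1 (fun x => lap a z * x)).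
  by rewrite /lap divfK // V0.
have fin (A B D N I : C) : A = - B -> A = I -> N + (B + D) = 0 -> I - D = N.
  by move=> -> <- /eqP; rewrite addr_eq0 => /eqP ->; rewrite opprD.
exact (fin _ _ _ _ _ (integral_hess' cM sfam_lap scalar_lap hu su) eL).
Qed.

End Bochner.

(** * Expansion of the adjugate along a pencil *)

Section SecondDerivative.
Variables (R : realType) (n : nat).
Notation C := R[i].
Implicit Types (M N U : 'M[C]_n).

Lemma size_adj_pencil M N i j : (0 < n)%N -> (size ((\adj (pencil_mx M N)) i j) <= n)%N.
Proof.
move=> n0; rewrite mxE /cofactor.
have -> : row' j (col' i (pencil_mx M N)) =
    pencil_mx (row' j (col' i M)) (row' j (col' i N)).
  by apply/matrixP => k l; rewrite !mxE.
have hs := size_pencil (row' j (col' i M)) (row' j (col' i N)).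
rewrite /pencil prednK // in hs.
have -> : (-1) ^+ (j + i) = ((-1) ^+ (j + i))%:P :> {poly C} by rewrite rmorphXn rmorphN1.
by rewrite mul_polyC; apply: leq_trans (size_scale_leq _ _) _.
Qed.

Definition adj_pairing M N U : {poly C} :=
  \tr (\adj (pencil_mx M N) *m map_mx polyC U).

Lemma adj_pairing_eval M N U t :
  (adj_pairing M N U).[t] = \tr (\adj (M + t *: N) *m U).
Proof.
rewrite /adj_pairing -[_.[t]]/(horner_eval t _) -trace_map_mx map_mxM map_mx_adj.
rewrite pencil_mx_eval; congr (\tr (_ *m _)); apply/matrixP => i j.
by rewrite !mxE /= /horner_eval hornerC.
Qed.

Lemma size_adj_pairing M N U : (0 < n)%N -> (size (adj_pairing M N U) <= n)%N.
Proof.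
move=> n0; rewrite /adj_pairing.
have hb (I : finType) (F : I -> {poly C}) : (forall i, (size (F i) <= n)%N) ->
    (size (\sum_i F i)%R <= n)%N.
  move=> h; apply: (big_ind (fun p : {poly C} => (size p <= n)%N)) => [|p q hp hq|//].
    by rewrite size_poly0.
  by apply: leq_trans (size_polyD _ _) _; rewrite geq_max hp.
apply: (hb) => i; rewrite mxE; apply: (hb) => k.
rewrite [(map_mx _ _) k i]mxE mulrC mul_polyC; apply: leq_trans (size_scale_leq _ _) _.
exact: size_adj_pencil.
Qed.

(** The linear coefficient [A1] of the adjugate is obtained by comparing linear coefficients in
    [\adj (M + X N) (M + X N) = det (M + X N)] and solving with [invmx M]. *)
Lemma adj_pairing1 M N U : M \in unitmx ->
  (adj_pairing M N U)`_1 = \tr (\adj M *m U) * \tr (\adj M *m N) / \det M -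
   \det M * \tr (invmx M *m N *m invmx M *m U).
Proof.
move=> uM; have V0 : \det M != 0 by move: uM; rewrite unitmxE unitfE.
pose A1 : 'M[C]_n := \matrix_(i, j) ((\adj (pencil_mx M N)) i j)`_1.
have E1 : A1 *m M + \adj M *m N = (\tr (\adj M *m N))%:M.
  have E i j : \sum_l (\adj (pencil_mx M N)) i l * pencil_mx M N l j =
      (\det (pencil_mx M N))%:M i j.
    by rewrite -mul_adj_mx [RHS]mxE.
  apply/matrixP => i j; have := congr1 (fun p : {poly C} => p`_1) (E i j).
  rewrite coef_sum => H.
  have -> : (\tr (\adj M *m N))%:M i j = ((\det (pencil_mx M N))%:M i j)`_1.
    by rewrite !mxE coefMn -/(pencil M N) pencil1.
  rewrite -H !mxE -big_split; apply: eq_bigr => l _ /=.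
  have -> : pencil_mx M N l j = (M l j)%:P + (N l j)%:P * 'X by rewrite !mxE mulrC.
  rewrite mulrDr coefD coefMC mulrA coefMX coefMC /= mxE; congr (_ + _ * _).
  have -> : ((\adj (pencil_mx M N)) i l)`_0 = \adj (M + 0 *: N) i l.
    rewrite -horner_coef0 -pencil_mx_eval -map_mx_adj [RHS]mxE //.
  by rewrite scale0r addr0.
have A1E : A1 = (\tr (\adj M *m N) *: 1%:M - \adj M *m N) *m invmx M.
  have -> : \tr (\adj M *m N) *: 1%:M = A1 *m M + \adj M *m N.
    by rewrite E1 scalemx1.
  by rewrite addrK mulmxK.
have aE : \adj M = \det M *: invmx M.
  by rewrite /invmx uM scalerA divff // scale1r.
have -> : (adj_pairing M N U)`_1 = \tr (A1 *m U).
  rewrite /adj_pairing /mxtrace coef_sum; apply: eq_bigr => i _.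
  rewrite !mxE coef_sum; apply: eq_bigr => l _.
  by rewrite [(map_mx _ _) l i]mxE coefMC [A1 i l]mxE.
rewrite A1E mulmxBl mulmxBl raddfB /= -scalemxAl mul1mx -scalemxAl mxtraceZ.
congr (_ - _).
  have -> : \tr (\adj M *m U) = \det M * \tr (invmx M *m U).
    by rewrite aE -scalemxAl mxtraceZ.
  by field.
by rewrite aE -!scalemxAl mxtraceZ.
Qed.

Lemma mixed_defect_eval (W0 W1 : 'M[C]_n) (b a : 'cV[C]_n) t :
  (mixed_defect W0 W1 b a).[t] =
  (gradsq W0 b + t * gradsq W1 a) * \det (W0 + t *: W1) -
  \tr (\adj (W0 + t *: W1) *m ((b + t *: a) *m (ct b + t *: ct a))).
Proof.
rewrite /mixed_defect hornerD hornerN hornerM pencil_eval; congr (_ * _ - _).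
  by rewrite hornerD hornerM !hornerC hornerX addrC mulrC.
rewrite -[_.[t]]/(horner_eval t _) -trace_map_mx map_mxM map_mx_adj.
rewrite pencil_mx_eval map_mxM; congr (\tr (_ *m (_ *m _))).
  apply/matrixP => i j; rewrite !mxE /= /horner_eval hornerD hornerM hornerX !hornerC //.
by apply/matrixP => i j; rewrite !mxE /= /horner_eval hornerD hornerM hornerX !hornerC.
Qed.

Lemma size_mixed_defect (W0 W1 : 'M[C]_n) (b a : 'cV[C]_n) : (0 < n)%N ->
  (size (mixed_defect W0 W1 b a) <= n.+2)%N.
Proof.
move=> n0; rewrite /mixed_defect.
have hb (I : finType) (F : I -> {poly C}) m : (forall i, (size (F i) <= m)%N) ->
    (size (\sum_i F i)%R <= m)%N.
  move=> h; apply: (big_ind (fun p : {poly C} => (size p <= m)%N)) => [|p q hp hq|//].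
    by rewrite size_poly0.
  by apply: leq_trans (size_polyD _ _) _; rewrite geq_max hp.
have h1 (x y : C) : (size (x%:P * 'X + y%:P)%R <= 2)%N.
  by rewrite -cons_poly_def size_cons_poly; case: ifP => // _; exact: size_polyC_leq1.
have hM (p q : {poly C}) m m' : (size p <= m.+1)%N -> (size q <= m')%N ->
    (size (p * q)%R <= m + m')%N.
  move=> hp hq; apply: leq_trans (size_polyMleq _ _) _.
  by rewrite -[(m + m')%N]/((m.+1 + m').-1) -!subn1; apply: leq_sub2r; exact: leq_add.
apply: leq_trans (size_polyD _ _) _; rewrite geq_max size_polyN; apply/andP; split.
  exact: (hM _ _ 1 n.+1 (h1 _ _) (size_pencil _ _)).
apply: (hb) => i; rewrite mxE; apply: (hb) => j.
have sA := size_adj_pencil W0 W1 i j n0.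
rewrite mulrC.
apply: (hM _ _ 2 n _ sA); rewrite mxE big_ord1.
apply: (hM _ _ 1 2).
  by rewrite !mxE addrC mulrC; exact: h1.
by rewrite !mxE addrC mulrC; exact: h1.
Qed.

End SecondDerivative.

(** * Second-order estimates for polynomials and the logarithm *)

Section Estimates.
Variable R : realType.
Notation C := R[i].

Lemma ln_remainder (y : R) : `|y| <= 2^-1 -> `|ln (1 + y) - y| <= 2 * y ^+ 2.
Proof.
move=> hy; have [y1 y2] : -2^-1 <= y /\ y <= 2^-1.
  by move: hy; rewrite ler_norml => /andP[].
have p : 0 < 1 + y by lra.
have p0 : 1 + y != 0 by rewrite gt_eqF.
have h1 : ln (1 + y) <= y by apply: le_ln1Dx; lra.
have h2 : - ln (1 + y) <= - (y / (1 + y)).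
  have -> : - ln (1 + y) = ln (1 + y)^-1 by rewrite (exp.lnV p).
  have e : (1 + y)^-1 = 1 + - (y / (1 + y)) by field.
  rewrite [X in ln X]e.
  apply: le_ln1Dx; rewrite ltrN2 ltr_pdivrMr //; lra.
have h3 : y - y / (1 + y) <= 2 * y ^+ 2.
  have -> : y - y / (1 + y) = (1 + y)^-1 * y ^+ 2 by field.
  rewrite ler_wpM2r ?sqr_ge0 //.
  by rewrite -[leRHS]invrK lef_pV2 ?posrE ?invr_gt0 //; lra.
have h4 : 0 <= y ^+ 2 by exact: sqr_ge0.
rewrite ler_norml; apply/andP; split; lra.
Qed.

Lemma normC_real (x : R) : `|Complex x 0 : C| = Complex `|x| 0.
Proof. by rewrite normc_def /= expr0n /= addr0 sqrtr_sqr. Qed.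

Lemma Re_le_norm (x : C) (B : R) : `|x| <= Complex B 0 -> `|complex.Re x| <= B.
Proof.
move=> h; have := le_trans (normc_ge_Re x) h.
by rewrite lecE /= => /andP[].
Qed.

Lemma poly_bound (p : {poly C}) N (b s : C) : (size p <= N)%N ->
  (forall q, `|p`_q| <= b) -> `|s| <= 1 ->
  `|p.[s] - p`_0| <= N%:R * b * `|s| /\
  `|p.[s] - p`_0 - s * p`_1| <= N%:R * b * `|s| ^+ 2.
Proof.
move=> sz hb s1; have b0 : 0 <= b by exact: le_trans (normr_ge0 _) (hb 0).
have hs q : `|s ^+ q| <= 1 by rewrite normrX exprn_ile1.
split.
  have sz1 : (size p <= N.+1)%N by exact: leqW.
  rewrite (horner_coef_wide _ sz1) big_ord_recl expr0 mulr1 addrC addKr.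
  apply: le_trans (ler_norm_sum _ _ _) _.
  have -> : N%:R * b * `|s| = \sum_(i < N) b * `|s|.
    by rewrite sumr_const card_ord -[RHS]mulr_natl !mulrA.
  apply: ler_sum => i _; rewrite lift0 exprS normrM ler_pM // normrM.
  by rewrite -[leRHS]mulr1 ler_pM.
have sz2 : (size p <= N.+2)%N by exact: leqW (leqW sz).
rewrite (horner_coef_wide _ sz2) !big_ord_recl expr0 mulr1 /=.
set T := \sum_(i < N) _.
have -> : p`_0 + (p`_1 * s ^+ 1 + T) - p`_0 - s * p`_1 = T by rewrite expr1; ring.
rewrite {}/T /bump /=.
apply: le_trans (ler_norm_sum _ _ _) _.
have -> : N%:R * b * `|s| ^+ 2 = \sum_(i < N) b * `|s| ^+ 2.
  by rewrite sumr_const card_ord -[RHS]mulr_natl !mulrA.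
apply: ler_sum => i _; rewrite !add1n normrM ler_pM // -[i.+2]addn2 exprD normrM.
by rewrite [X in _ * X]normrX -[leRHS]mul1r ler_pM // exprn_ge0.
Qed.

Lemma poly_bound_exists (p : {poly C}) : exists2 B : R, 0 <= B &
  forall s : R, `|s| <= 1 ->
  `|complex.Re (p.[Complex s 0]) - complex.Re p`_0 - s * complex.Re p`_1| <= B * s ^+ 2.
Proof.
pose b := \sum_(q < size p) `|p`_q|.
have hb q : `|p`_q| <= b.
  case: (ltnP q (size p)) => h; last by rewrite nth_default // normr0 sumr_ge0.
  by rewrite /b (bigD1 (Ordinal h)) //= lerDl sumr_ge0.
have b0 : 0 <= b by apply: sumr_ge0.
have bE : b = Complex (complex.Re b) 0.
  by apply: complexE2 => //=; move: b0; rewrite lecE /= => /andP[/eqP ->].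
exists ((size p)%:R * complex.Re b).
  by rewrite mulr_ge0 //; move: b0; rewrite lecE /= => /andP[].
move=> s hs; have [|_ h] := poly_bound (leqnn _) hb (s := Complex s 0).
  by rewrite normC_real lecE /= eqxx.
have -> : complex.Re (p.[Complex s 0]) - complex.Re p`_0 - s * complex.Re p`_1 =
    complex.Re (p.[Complex s 0] - p`_0 - Complex s 0 * p`_1).
  by rewrite !(@ReD R) !(@ReN R) (@ReM R) /= mul0r subr0.
apply: Re_le_norm; apply: le_trans h _; rewrite normC_real {1}bE.
rewrite -(Cplx_nat R (size p)) -CplxM -[Complex `|s| 0 ^+ 2]/(Complex `|s| 0 * Complex `|s| 0).
by rewrite -CplxM -CplxM -expr2 real_normK ?num_real.
Qed.

End Estimates.

Section FamilyBounds.
Variables (R : realType) (n : nat) (X : compactComplexManifold R n).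
Notation E := 'rV[R]_(n + n).
Notation C := R[i].
Notation U_ a := (im a (@setT (carrier (mfd X)))).
Opaque smooth_on.
Opaque csmooth_on.
Opaque integral_rV.
Opaque d_z d_zbar cpartial integ hess gz gzb.
Implicit Types (a b c : idx X) (z : E) (s tau : idx X -> E -> C).

Lemma continuous_bounded m (K U : set 'rV[R]_m) (f : 'rV[R]_m -> R) : compact K ->
  K `<=` U -> (forall x, U x -> {for x, continuous f}) ->
  exists2 B : R, 0 <= B & forall x, K x -> `|f x| <= B.
Proof.
move=> cK KU cf.
have [||t t0 ht] := @compact_uniform R m K (fun t y => `|f y| <= t^-1) cK.
- move=> t t' y t0 tt' h; apply: le_trans h _.
  by rewrite lef_pV2 ?posrE //; exact: lt_le_trans tt'.
- move=> y0 Ky; have /continuousER/(_ 1 ltr01)[d d0 hd] := cf y0 (KU _ Ky).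
  have p : 0 < `|f y0| + 1 by rewrite ltr_wpDl.
  exists (Num.min d (`|f y0| + 1)^-1); first by rewrite lt_min d0 invr_gt0.
  move=> y hy; have hy1 : `|y - y0| < d by apply: lt_le_trans hy _; rewrite ge_min lexx.
  have h1 := hd y hy1; have h2 : `|f y| <= `|f y0| + 1.
    rewrite -(subrK (f y0) (f y)); apply: le_trans (ler_normD _ _) _.
    by rewrite addrC lerD2l ltW.
  apply: le_trans h2 _; rewrite -[leLHS]invrK lef_pV2 ?posrE ?invr_gt0 //.
    by rewrite ge_min lexx orbT.
  by rewrite lt_min d0 invr_gt0.
by exists t^-1; rewrite ?invr_ge0 ?ltW.
Qed.

(** Chart images need not be compact, so bounds are taken on the compact supports of the partition
    functions. These cover the manifold, and a [scalar] family has the same value in every chart. *)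
Lemma scalar_bounded tau : sfam tau -> scalar tau ->
  exists2 b : C, 0 <= b & forall a z, U_ a z -> `|tau a z| <= b.
Proof.
move=> hs ss.
have H c : exists2 B : R, 0 <= B & forall x, (chart c @` supp c) x ->
    `|complex.Re (tau c x)| <= B /\ `|complex.Im (tau c x)| <= B.
  have /csmP[h1 h2] := hs c.
  have cK : compact (chart c @` supp c).
    by apply: chart_compact; [exact: supp_compact|exact: supp_dom].
  have KU : chart c @` supp c `<=` U_ c by move=> _ [x /supp_dom dx <-]; exists x.
  have [B1 B10 hB1] := continuous_bounded cK KU (smooth_cont h1).
  have [B2 B20 hB2] := continuous_bounded cK KU (smooth_cont h2).
  exists (B1 + B2); first by rewrite addr_ge0.
  move=> x Kx; split.
    by apply: le_trans (hB1 x Kx) _; rewrite lerDl.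
  by apply: le_trans (hB2 x Kx) _; rewrite lerDr.
pose B c := sval (cid2 (H c)).
have B0 c : 0 <= B c by rewrite /B; case: cid2.
exists (Complex (2 * \sum_c B c) 0).
  by rewrite lecE /= eqxx /= mulr_ge0 // sumr_ge0.
move=> a z Uz; have [_ _ _ hsum] := mfd_pou X.
have [c hc] : exists c, pou c (chartV a z) != 0.
  apply/existsP; rewrite -negb_forall; apply/negP => /forallP hn.
  have := hsum (chartV a z); rewrite big1 => [/eqP|c _]; first by rewrite eq_sym oner_eq0.
  by apply/eqP; have := hn c.
have sz : supp c (chartV a z) by exact: subset_closure.
have dz : im a (dom c) z by apply/im_E; split=> //; exact: supp_dom.
rewrite (ss _ _ _ dz).
have [h1 h2] : `|complex.Re (tau c (trn a c z))| <= B c /\ `|complex.Im (tau c (trn a c z))| <= B c.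
  by rewrite /B; case: cid2 => /= t _; apply; exists (chartV a z).
have hB : B c <= \sum_c B c by rewrite (bigD1 c) //= lerDl sumr_ge0.
set x := tau c _ in h1 h2 *.
have -> : x = Complex (complex.Re x) 0 + Complex 0 1 * Complex (complex.Im x) 0.
  by apply: complexE2; rewrite ?(@ReD R) ?(@ImD R) ?(@ReM R) ?(@ImM R) /=; ring.
apply: le_trans (ler_normD _ _) _; rewrite normrM !normC_real.
have -> : `|Complex 0 1 : C| = 1 by rewrite normc_def /= expr0n expr1n /= add0r sqrtr1.
rewrite mul1r -CplxD lecE /= eqxx /=; lra.
Qed.

Lemma pfam_bound N (P : idx X -> E -> {poly C}) : pfam N P ->
  (forall q, scalar (fun a z => (P a z)`_q)) ->
  exists2 b : C, 0 <= b & forall a z, U_ a z -> forall s : C, `|s| <= 1 ->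
  `|(P a z).[s] - (P a z)`_0| <= b * `|s| /\
  `|(P a z).[s] - (P a z)`_0 - s * (P a z)`_1| <= b * `|s| ^+ 2.
Proof.
move=> [sz sc] ss.
have H q : exists2 b : C, 0 <= b & forall a z, U_ a z -> `|(P a z)`_q| <= b.
  exact: (scalar_bounded (sc q) (ss q)).
pose b q := sval (cid2 (H q)).
have b0 q : 0 <= b q by rewrite /b; case: cid2.
have hb q a z : U_ a z -> `|(P a z)`_q| <= b q by rewrite /b; case: cid2 => /= t _; apply.
exists (N%:R * \sum_(q < N) b q); first by rewrite mulr_ge0 // sumr_ge0.
move=> a z Uz s hs; apply: poly_bound => // q.
case: (ltnP q N) => qN; last first.
  by rewrite nth_default ?normr0 ?sumr_ge0 //; exact: leq_trans (sz a z) qN.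
apply: le_trans (hb q a z Uz) _.
by rewrite (bigD1 (Ordinal qN)) //= lerDl sumr_ge0.
Qed.

Lemma integ_mono tau tau' : sfam tau -> density tau -> sfam tau' -> density tau' ->
  (forall a z, U_ a z -> tau a z <= tau' a z) -> integ tau <= integ tau'.
Proof.
move=> h1 d1 h2 d2 h; rewrite -subr_ge0 -(integB h2 h1).
have sB := sfamB h2 h1.
have dB : density (fun a z => tau' a z - tau a z).
  by move=> a b z hz; rewrite (d1 _ _ _ hz) (d2 _ _ _ hz) mulrBl.
have [|h0 _] := integ_ge0 sB dB; last exact: h0.
by move=> a z Uz; rewrite subr_ge0; exact: h.
Qed.

End FamilyBounds.

(** * A dual lower bound for the Calabi functional *)

Section CalabiFunctional.
Variables (R : realType) (n k : nat) (X : compactComplexManifold R n).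
Notation E := 'rV[R]_(n + n).
Notation C := R[i].
Notation Re := complex.Re.
Notation Im := complex.Im.
Notation U_ a := (im a (@setT (carrier (mfd X)))).
Opaque smooth_on.
Opaque csmooth_on.
Opaque integral_rV.
Opaque d_z d_zbar cpartial integ hess gz gzb.
Implicit Types (a b c : idx X) (z : E).
Variables (p : 'I_k -> nat).
Hypotheses (n0 : (0 < n)%N) (pn : forall i, (p i <= n - 1)%N).

Definition dev (N V : idx X -> E -> C) (m : C) a z : C := N a z / V a z - m.

Definition calabiC (v : forms X k) : C :=
  integ (fun a z => dev (mix0 p v) (Vol v ord0) (mean0 p v) a z ^+ 2 * Vol v ord0 a z) +
  \sum_j integ (fun a z =>
    dev (mixi p v j) (Vol v (lift ord0 j)) (meani p v j) a z ^+ 2 * Vol v (lift ord0 j) a z).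

Lemma calabiE (om : forms X k) (h : 'I_k.+1 -> X -> R) :
  (forall i, nondegenerate (perturbs om h i)) ->
  Complex (calabi p om h) 0 = calabiC (perturbs om h).
Proof.
set v := perturbs om h => kv.
have sq (x : R) : Complex (`|x| ^+ 2) 0 = Complex x 0 ^+ 2 :> C.
  by rewrite real_normK ?num_real // expr2 CplxM -expr2.
rewrite /calabi -/v; apply: (etrans (CplxD _ _)); apply: (f_equal2 (fun x y : C => x + y)).
  apply: (etrans (integral_mfdE _)); apply: integ_ext => a z Uz.
  apply: (etrans (CplxM _ _)); apply: (f_equal2 (fun x y : C => x * y)); last exact: (vol_det (kv ord0) Uz).
  apply: (etrans (sq _)); apply: (f_equal (fun x : C => x ^+ 2)).
  transitivity (Complex ((\sum_i coefA p v i a z - scalar_curvature (v ord0) a z) -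
     (\sum_i average (v ord0) (coefA p v i) - average (v ord0) (scalar_curvature (v ord0)))) 0 : C).
    by apply: (f_equal (fun x : R => Complex x 0)); rewrite opprB addrA addrAC.
  apply: (etrans (CplxB _ _)); apply: (f_equal2 (fun x y : C => x - y)).
    exact: (coefA_sum n0 pn kv Uz).
  exact: (averageA_sum n0 pn kv).
apply: (etrans (Cplx_sum _)); apply: eq_bigr => j _.
apply: (etrans (integral_mfdE _)); apply: integ_ext => a z Uz.
apply: (etrans (CplxM _ _)); apply: (f_equal2 (fun x y : C => x * y)); last exact: (vol_det (kv _) Uz).
apply: (etrans (sq _)); apply: (f_equal (fun x : C => x ^+ 2)).
apply: (etrans (CplxB _ _)); apply: (f_equal2 (fun x y : C => x - y)).
  exact: (coefBE n0 pn kv j Uz).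
exact: (averageBE n0 pn kv).
Qed.

(** Perturbing by [h + s f] and moving along the ray give the same coefficients on chart images,
    which is all that the integrals see. *)
Definition forms_eq (v v' : forms X k) := forall i a z, U_ a z -> v i a z = v' i a z.

Lemma Ric_congr (M M' : form11 X) a z : U_ a z ->
  (forall y, U_ a y -> M a y = M' a y) -> Ric M a z = Ric M' a z.
Proof.
move=> Uz H; apply: (f_equal (fun m : 'M[C]_n => - m)).
apply: (@hess_ext R n (fun y => Complex (ln (Re (\det (M a y)))) 0)
  (fun y => Complex (ln (Re (\det (M' a y)))) 0) _ _ (open_U a) Uz) => y Uy.
by rewrite (H y Uy).
Qed.

Lemma NN_congr q (M M' W W' : form11 X) a z : M a z = M' a z -> W a z = W' a z ->
  NN q W M a z = NN q W' M' a z.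
Proof. by move=> e e'; rewrite /NN e e'. Qed.

Lemma mix0_congr v v' a z : forms_eq v v' -> U_ a z -> mix0 p v a z = mix0 p v' a z.
Proof.
move=> H Uz; apply: (f_equal2 (fun x y : C => x - y)).
  by apply: eq_bigr => i _; exact: (NN_congr _ (H _ _ _ Uz) (H _ _ _ Uz)).
by apply: (NN_congr _ (H _ _ _ Uz)); apply: (Ric_congr Uz) => y; exact: H.
Qed.

Lemma mixi_congr v v' j a z : forms_eq v v' -> U_ a z -> mixi p v j a z = mixi p v' j a z.
Proof. by move=> H Uz; rewrite /mixi /NN !(H _ _ _ Uz). Qed.

Lemma Vol_congr v v' i a z : forms_eq v v' -> U_ a z -> Vol v i a z = Vol v' i a z.
Proof. by move=> H Uz; rewrite /Vol (H _ _ _ Uz). Qed.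

Lemma mean0_congr v v' : forms_eq v v' -> mean0 p v = mean0 p v'.
Proof.
move=> H; apply: (f_equal2 (fun x y : C => x / y)); apply: integ_ext => a z Uz.
  exact: mix0_congr.
exact: Vol_congr.
Qed.

Lemma meani_congr v v' j : forms_eq v v' -> meani p v j = meani p v' j.
Proof.
move=> H; apply: (f_equal2 (fun x y : C => x / y)); apply: integ_ext => a z Uz.
  exact: mixi_congr.
exact: Vol_congr.
Qed.

Lemma calabiC_congr v v' : forms_eq v v' -> calabiC v = calabiC v'.
Proof.
move=> H; apply: (f_equal2 (fun x y : C => x + y)).
  apply: integ_ext => a z Uz.
  by rewrite /dev (mix0_congr H Uz) (Vol_congr _ H Uz) (mean0_congr H).
apply: eq_bigr => j _; apply: integ_ext => a z Uz.
by rewrite /dev (mixi_congr _ H Uz) (Vol_congr _ H Uz) (meani_congr _ H).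
Qed.

Section Duality.
Variables (H : 'I_k.+1 -> idx X -> E -> C).
Hypotheses (hH : forall i, sfam (H i)) (sH : forall i, scalar (H i)).
Hypothesis rH : forall i a z, (H i a z)^* = H i a z.

(* The bound [(N - m V)^2 / V >= 2 H (N - m V) - H^2 V], with equality iff
   [H = N / V - m]. *)
Definition dualt (Hi N V : idx X -> E -> C) (m : C) a z : C :=
  2 * Hi a z * (N a z - m * V a z) - Hi a z ^+ 2 * V a z.

(** The constants [m0] and [mi] are arguments rather than means of [v]: the means are invariants of
    the classes, so those at the extremal metric serve along the whole ray. *)
Definition dualC (m0 : C) (mi : 'I_k -> C) (v : forms X k) : C :=
  integ (dualt (H ord0) (mix0 p v) (Vol v ord0) m0) +
  \sum_j integ (dualt (H (lift ord0 j)) (mixi p v j) (Vol v (lift ord0 j)) (mi j)).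

Lemma dev_family (N V : idx X -> E -> C) (m : C) :
  sfam N -> density N -> sfam V -> density V ->
  (forall a z, U_ a z -> 0 < V a z) -> (forall a z, U_ a z -> (N a z)^* = N a z) -> m^* = m ->
  [/\ sfam (dev N V m), scalar (dev N V m) &
      forall a z, U_ a z -> (dev N V m a z)^* = dev N V m a z].
Proof.
move=> sN dN sV dV Vp rN rm; split.
- have sVi : sfam (fun a z => (V a z)^-1).
    move=> a; apply: (csmV (open_U a)); last exact: (sV a).
    by move=> z Uz; rewrite gt_eqF // Vp.
  exact: (sfamB (sfamM sN sVi) (sfam_cst m)).
- move=> a b z hz; rewrite /dev (dN _ _ _ hz) (dV _ _ _ hz); congr (_ - _).
  have [_ /(_ z hz) J0] := holo_det_jac a b.
  by rewrite -mulf_div divff ?mulr1 // mulf_neq0 // conjC_eq0.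
- move=> a z Uz; have rV : (V a z)^* = V a z by rewrite geC0_conj // ltW // Vp.
  have g (x y t : C) : x^* = x -> y^* = y -> t^* = t -> (x / y - t)^* = x / y - t.
    by move=> ex ey et; rewrite !rmorphB rmorphM fmorphV /= ex ey et.
  exact: (g _ _ _ (rN a z Uz) rV rm).
Qed.

(** The gap between the two integrals is the integral of [(dev N V m - Hi)^2 * V], by completing the
    square. *)
Lemma dual_term (Hi N V : idx X -> E -> C) (m : C) :
  sfam Hi -> scalar Hi -> sfam N -> density N -> sfam V -> density V ->
  (forall a z, U_ a z -> 0 < V a z) -> (forall a z, U_ a z -> (N a z)^* = N a z) ->
  (forall a z, (Hi a z)^* = Hi a z) -> m^* = m ->
  [/\ integ (dualt Hi N V m) <= integ (fun a z => dev N V m a z ^+ 2 * V a z),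
      sfam (dualt Hi N V m) &
      (forall a z, U_ a z -> dev N V m a z = Hi a z) ->
      integ (dualt Hi N V m) = integ (fun a z => dev N V m a z ^+ 2 * V a z)].
Proof.
move=> hHi sHi sN dN sV dV Vp rN rHi rm.
have [sdev scdev rdev] := dev_family sN dN sV dV Vp rN rm.
have V0 a z : U_ a z -> V a z != 0 by move=> Uz; rewrite gt_eqF // Vp.
have ssq : sfam (fun a z => dev N V m a z ^+ 2 * V a z) by exact: (sfamM (sfamM sdev sdev) sV).
have sd : sfam (dualt Hi N V m).
  have s1 := sfamM (sfamZ 2 hHi) (sfamB sN (sfamZ m sV)).
  exact: (sfamB s1 (sfamM (sfamM hHi hHi) sV)).
have ddiff : density (fun a z => (dev N V m a z - Hi a z) ^+ 2 * V a z).
  have sc2 : scalar (fun a z => (dev N V m a z - Hi a z) ^+ 2).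
    by move=> a b z hz; rewrite (scdev _ _ _ hz) (sHi _ _ _ hz).
  exact: (densityZ sc2 dV).
have sdiff : sfam (fun a z => (dev N V m a z - Hi a z) ^+ 2 * V a z).
  have s3 := sfamB sdev hHi; exact: (sfamM (sfamM s3 s3) sV).
have E1 a z : U_ a z -> (dev N V m a z - Hi a z) ^+ 2 * V a z =
    dev N V m a z ^+ 2 * V a z - dualt Hi N V m a z.
  by move=> /V0 v0; rewrite /dev /dualt; field.
have [|h0 _] := integ_ge0 sdiff ddiff.
  move=> a z Uz; apply: mulr_ge0; last exact: ltW (Vp a z Uz).
  have r : (dev N V m a z - Hi a z)^* = dev N V m a z - Hi a z.
    by rewrite rmorphB /= rHi (rdev a z Uz).
  by rewrite expr2 -{2}r -normCK exprn_ge0.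
rewrite (integ_ext E1) (integB ssq sd) subr_ge0 in h0.
split=> // He; apply: integ_ext => a z Uz.
have e : 0 * V a z = dev N V m a z ^+ 2 * V a z - dualt Hi N V m a z.
  by rewrite -(E1 a z Uz) (He a z Uz) subrr expr0n.
by apply/esym/eqP; rewrite -subr_eq0 -e mul0r.
Qed.

Section AtForms.
Variables (v : forms X k) (m0 : C) (mi : 'I_k -> C).
Hypothesis kv : forall i, nondegenerate (v i).
Hypotheses (rm0 : m0^* = m0) (rmi : forall j, (mi j)^* = mi j).

Lemma density_NNk q (M W : form11 X) : nondegenerate M -> nondegenerate W -> density (NN q W M).
Proof. by move=> kM kW; exact: (density_NN q (cf_form (kh_closed kM)) (cf_form (kh_closed kW))). Qed.

Lemma density_mix0 : density (mix0 p v).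
Proof.
have cM := kh_closed (kv ord0).
have dR : density (NR (v ord0)).
  exact: (density_NN 1 (cf_form cM) (Ric_is_form (cf_form cM) (cf_smooth cM) (kh_det (kv ord0)))).
move=> a b z hz; apply: (etrans _ (esym (mulrBl _ _ _))).
apply: (f_equal2 (fun x y : C => x - y)); last exact: (dR _ _ _ hz).
apply: (etrans _ (esym (mulr_suml _ _ _ _))); apply: eq_bigr => i _.
exact: (density_NNk (p i).+1 (kv ord0) (kv (lift ord0 i)) hz).
Qed.

Lemma density_Vol i : density (Vol v i).
Proof. exact: (density_det (cf_form (kh_closed (kv i)))). Qed.

Lemma sfam_Vol i : sfam (Vol v i).
Proof. exact: (sfam_det (cf_smooth (kh_closed (kv i)))). Qed.

Lemma mix0_real a z : U_ a z -> (mix0 p v a z)^* = mix0 p v a z.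
Proof.
move=> Uz; rewrite /mix0 rmorphB rmorph_sum /=; congr (_ - _).
  by apply: eq_bigr => i _; exact: (NN_real kv).
by apply: pencil_real; [exact: (kh_herm (kv _))|exact: (Ric_herm (kv _))].
Qed.

Let t0 := dual_term (hH ord0) (sH ord0) (sfam_mix0 p kv) density_mix0 (sfam_Vol ord0)
  (density_Vol ord0) (fun a z Uz => kh_det (kv ord0) Uz) mix0_real (rH ord0) rm0.

Let ti j := dual_term (hH (lift ord0 j)) (sH (lift ord0 j)) (sfam_NNk (p j) (kv ord0) (kv (lift ord0 j)))
  (density_NNk (p j) (kv ord0) (kv (lift ord0 j))) (sfam_Vol (lift ord0 j)) (density_Vol (lift ord0 j))
  (fun a z Uz => kh_det (kv (lift ord0 j)) Uz) (@NN_real R n X k v kv (p j) (lift ord0 j) ord0)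
  (rH (lift ord0 j)) (rmi j).

Lemma dualC_le : m0 = mean0 p v -> (forall j, mi j = meani p v j) ->
  dualC m0 mi v <= calabiC v.
Proof.
move=> e0 ei; rewrite /calabiC -e0; apply: lerD; first by have [] := t0.
by apply: ler_sum => j _; rewrite -ei; have [] := ti j.
Qed.

Lemma dualC_eq : m0 = mean0 p v -> (forall j, mi j = meani p v j) ->
  (forall a z, U_ a z -> dev (mix0 p v) (Vol v ord0) m0 a z = H ord0 a z) ->
  (forall j a z, U_ a z -> dev (mixi p v j) (Vol v (lift ord0 j)) (mi j) a z = H (lift ord0 j) a z) ->
  dualC m0 mi v = calabiC v.
Proof.
move=> e0 ei h0 hi; rewrite /calabiC -e0; apply: (f_equal2 (fun x y : C => x + y)).
  by have [_ _] := t0; apply.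
by apply: eq_bigr => j _; rewrite -ei; have [_ _] := ti j; apply; exact: hi.
Qed.

End AtForms.

Lemma dualC_congr m0 mi v v' : forms_eq v v' -> dualC m0 mi v = dualC m0 mi v'.
Proof.
move=> Hv; apply: (f_equal2 (fun x y : C => x + y)).
  apply: integ_ext => a z Uz.
  by rewrite /dualt (mix0_congr Hv Uz) (Vol_congr _ Hv Uz).
apply: eq_bigr => j _; apply: integ_ext => a z Uz.
by rewrite /dualt (mixi_congr _ Hv Uz) (Vol_congr _ Hv Uz).
Qed.

End Duality.

End CalabiFunctional.

(** * Expansion of the dual bound along a ray *)

Section DualityExpansion.
Variables (R : realType) (n k : nat) (X : compactComplexManifold R n).
Notation E := 'rV[R]_(n + n).
Notation C := R[i].
Notation Re := complex.Re.
Notation Im := complex.Im.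
Notation U_ a := (im a (@setT (carrier (mfd X)))).
Opaque smooth_on.
Opaque csmooth_on.
Opaque integral_rV.
Opaque d_z d_zbar cpartial integ hess gz gzb.
Implicit Types (a b c : idx X) (z : E) (M W : form11 X) (u s : idx X -> E -> C) (t : C).
Hypothesis n0 : (0 < n)%N.

Definition ray M t u : form11 X := add_hess M (fun a z => t * u a z).

Lemma rayE M t u a z : sfam u -> U_ a z -> ray M t u a z = M a z + t *: hess u a z.
Proof. by move=> hu Uz; rewrite /ray /add_hess (hessZ t hu Uz). Qed.

Lemma mfam_ray M t u : mfam M -> sfam u -> mfam (ray M t u).
Proof. by move=> hM hu; exact: (mfamD hM (mfam_hess (sfamZ t hu))). Qed.

Lemma det_ray M t u a z : sfam u -> U_ a z ->
  \det (ray M t u a z) = (pencil (M a z) (hess u a z)).[t].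
Proof. by move=> hu Uz; rewrite (rayE _ _ hu Uz) pencil_eval. Qed.

(** The building block of the expansion: the other terms that are polynomial in [t] reduce to it, by
    interpolation where mixed products occur, so that integration by parts involves a single
    determinant. *)
Lemma det_term M s u : closed_form M -> sfam s -> scalar s -> sfam u -> scalar u ->
  exists2 P : {poly C},
    forall t, integ (fun a z => s a z * \det (ray M t u a z)) = P.[t] &
    P`_1 = - integ (fun a z => \tr (\adj (M a z) *m (gz s a z *m gzb u a z))).
Proof.
move=> cM hs ss hu su.
have pf : pfam (1 + n.+1) (fun a z => (s a z)%:P * pencil (M a z) (hess u a z)).
  exact: (pfamM (pfamC hs) (pencil_pfam (cf_smooth cM) (mfam_hess hu))).
exists (pinteg (1 + n.+1) (fun a z => (s a z)%:P * pencil (M a z) (hess u a z))).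
  move=> t; rewrite (pinteg_eval _ pf); apply: integ_ext => a z Uz.
  by rewrite (det_ray _ _ hu Uz) hornerM hornerC.
rewrite (pinteg_coef _ pf) -(integral_hess cM hs ss hu su); apply: integ_ext => a z Uz.
by rewrite coefCM pencil1.
Qed.

Lemma gradsqE M u a z : sfam u -> (forall a z, (u a z)^* = u a z) -> U_ a z ->
  gradsq (M a z) (gz u a z) = \tr (\adj (M a z) *m (gz u a z *m gzb u a z)) / \det (M a z).
Proof. by move=> hu ru Uz; rewrite /gradsq {2}(gz_real hu ru Uz) ctK. Qed.

Lemma sfam_gradsq M u : nondegenerate M -> sfam u -> (forall a z, (u a z)^* = u a z) ->
  sfam (fun a z => gradsq (M a z) (gz u a z)).
Proof.
move=> kM hu ru; have sM := cf_smooth (kh_closed kM).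
apply: (sfam_ext _ (sfamM (sfam_tr_adj sM (mfam_outer hu hu)) (sfam_Vinv kM))) => a z Uz.
by rewrite (gradsqE _ hu ru Uz).
Qed.

Lemma size_linear_pencil (x y : C) (A B : 'M[C]_n) :
  (size ((x%:P * 'X + y%:P) * pencil A B)%R <= n.+2)%N.
Proof.
apply: (leq_trans (size_polyMleq _ _)).
have h1 : (size (x%:P * 'X + y%:P)%R <= 2)%N.
  by rewrite size_MXaddC; case: ifP => // _; rewrite ltnS size_polyC_leq1.
have h2 := leq_add h1 (size_pencil A B).
by rewrite -subn1 leq_subLR add1n.
Qed.

Section Mixed.
Variables (M0 M1 : form11 X) (u0 u1 : idx X -> E -> C).
Hypotheses (k0 : nondegenerate M0) (k1 : nondegenerate M1).
Hypotheses (hu0 : sfam u0) (su0 : scalar u0) (hu1 : sfam u1) (su1 : scalar u1).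
Hypotheses (ru0 : forall a z, (u0 a z)^* = u0 a z) (ru1 : forall a z, (u1 a z)^* = u1 a z).

Definition defect q a z : C :=
  (mixed_defect (M0 a z) (M1 a z) (gz u0 a z) (gz u1 a z))`_q.

Lemma defect_eval a z t : U_ a z ->
  (mixed_defect (M0 a z) (M1 a z) (gz u0 a z) (gz u1 a z)).[t] =
  (gradsq (M0 a z) (gz u0 a z) + t * gradsq (M1 a z) (gz u1 a z)) *
    \det (M0 a z + t *: M1 a z) -
  \tr (\adj (M0 a z + t *: M1 a z) *m
    ((gz u0 a z + t *: gz u1 a z) *m (gzb u0 a z + t *: gzb u1 a z))).
Proof.
move=> Uz; rewrite mixed_defect_eval.
have -> : ct (gz u0 a z) = gzb u0 a z by rewrite (gz_real hu0 ru0 Uz) ctK.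
by have -> : ct (gz u1 a z) = gzb u1 a z by rewrite (gz_real hu1 ru1 Uz) ctK.
Qed.

Lemma sfam_defect q : sfam (defect q).
Proof.
have [qn|qn] := leqP q n.+1; last first.
  apply: (sfam_ext (tau := fun _ _ => 0)) (@sfam_cst R n X 0) => a z Uz.
  by rewrite /defect nth_default //; exact: (leq_trans (size_mixed_defect _ _ _ _ n0) qn).
have [lam hlam] := @coef_extract C n.+1 q qn.
pose D (j : 'I_n.+2) a z := lam j *
  (mixed_defect (M0 a z) (M1 a z) (gz u0 a z) (gz u1 a z)).[(j : nat)%:R].
apply: (sfam_ext (tau := fun a z => \sum_j D j a z)).
  by move=> a z Uz; rewrite /defect hlam ?size_mixed_defect.
apply: sfam_sum => j _; apply: sfamZ.
pose M (j : 'I_n.+2) : form11 X := fun a z => M0 a z + (j : nat)%:R *: M1 a z.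
pose u (j : 'I_n.+2) a z := u0 a z + (j : nat)%:R * u1 a z.
have cM : mfam (M j) by exact: (mfamD (cf_smooth (kh_closed k0)) (mfamZ _ (cf_smooth (kh_closed k1)))).
have hu : sfam (u j) by exact: (sfamD hu0 (sfamZ _ hu1)).
have h1 := sfamM (sfamD (sfam_gradsq k0 hu0 ru0) (sfamZ (j : nat)%:R (sfam_gradsq k1 hu1 ru1)))
  (sfam_det cM).
apply: (sfam_ext _ (sfamB h1 (sfam_tr_adj cM (mfam_outer hu hu)))) => a z Uz.
rewrite (defect_eval _ Uz); apply: (f_equal (fun x : C => _ - x)).
by rewrite (gzD hu0 (sfamZ _ hu1) Uz) (gzbD hu0 (sfamZ _ hu1) Uz) (gzZ _ hu1 Uz) (gzbZ _ hu1 Uz).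
Qed.

Lemma density_defect q : density (defect q).
Proof.
move=> a b z hz.
have Ju : cjac (trn a b) z \in unitmx.
  by rewrite unitmxE unitfE; have [_ /(_ z hz)] := holo_det_jac a b.
rewrite /defect (cf_form (kh_closed k0) hz) (cf_form (kh_closed k1) hz).
rewrite (gz_trn hu0 su0 hz) (gz_trn hu1 su1 hz) (mixed_defect_congr _ _ _ _ Ju).
by rewrite coefCM det_ct mulrC.
Qed.

(* The coefficient of X^(q+1) is a combination of values at integers j, and at
   each of them the integral is [det_term] for [M0 + j M1] and [u0 + j u1]. *)
Lemma mixed_term q : (q <= n)%N ->
  exists2 P : {poly C},
    forall t, integ (fun a z =>
      u0 a z * NN q.+1 (ray M1 t u1) (ray M0 t u0) a z +
      u1 a z * NN q (ray M1 t u1) (ray M0 t u0) a z) = P.[t] &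
    P`_1 = integ (defect q.+1) - integ (fun a z =>
      gradsq (M0 a z) (gz u0 a z) * NN q.+1 M1 M0 a z +
      gradsq (M1 a z) (gz u1 a z) * NN q M1 M0 a z).
Proof.
move=> qn; have [lam hlam] := @coef_extract C n.+1 q.+1 qn.
pose M (j : 'I_n.+2) : form11 X := fun a z => M0 a z + (j : nat)%:R *: M1 a z.
pose u (j : 'I_n.+2) a z := u0 a z + (j : nat)%:R * u1 a z.
have cM j : closed_form (M j) by exact: (closedD (kh_closed k0) (closedZ _ (kh_closed k1))).
have hu j : sfam (u j) by exact: (sfamD hu0 (sfamZ _ hu1)).
have su j : scalar (u j) by exact: (scalarD su0 (@scalarM R n X (fun _ _ => (j : nat)%:R) u1 (scalar_cst _) su1)).
have /fin_all_exists2 [P hP hP1] := fun j => det_term (cM j) (hu j) (su j) (hu j) (su j).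
have hD j t : sfam (fun a z => u j a z * \det (ray (M j) t (u j) a z)).
  exact: (sfamM (hu j) (sfam_det (mfam_ray t (cf_smooth (cM j)) (hu j)))).
exists (\sum_j (lam j)%:P * P j).
  move=> t; rewrite horner_sum.
  transitivity (\sum_j integ (fun a z => lam j * (u j a z * \det (ray (M j) t (u j) a z)))).
    rewrite -integ_sum; last by move=> j _; exact: (sfamZ _ (hD j t)).
    apply: integ_ext => a z Uz.
    have e j : \det (ray (M j) t (u j) a z) =
        (pencil (ray M0 t u0 a z) (ray M1 t u1 a z)).[(j : nat)%:R].
      rewrite pencil_eval (rayE _ _ (hu j) Uz) (rayE _ _ hu0 Uz) (rayE _ _ hu1 Uz).
      rewrite (hessD hu0 (sfamZ _ hu1) Uz) (hessZ _ hu1 Uz).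
      by rewrite !scalerDr !scalerA [t * _]mulrC addrACA.
    pose Q := ((u1 a z)%:P * 'X + (u0 a z)%:P) * pencil (ray M0 t u0 a z) (ray M1 t u1 a z).
    transitivity (Q`_q.+1).
      rewrite /Q mulrDl coefD coefCM addrC; congr (_ + _).
      by rewrite -mulrA coefCM ['X * _]mulrC coefMX.
    rewrite hlam; last by exact: size_linear_pencil.
    apply: eq_bigr => j _; rewrite e /Q hornerM hornerD hornerM !hornerC hornerX.
    by rewrite /u [u1 a z * _]mulrC [_ * _ + u0 a z]addrC.
  apply: eq_bigr => j _; rewrite (integZ _ (hD j t)) hP hornerM hornerC; by [].
have sN q' : sfam (NN q' M1 M0) := sfam_NN q' (cf_smooth (kh_closed k0)) (cf_smooth (kh_closed k1)).
have g0 := sfam_gradsq k0 hu0 ru0; have g1 := sfam_gradsq k1 hu1 ru1.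
rewrite -(integB (sfam_defect q.+1) (sfamD (sfamM g0 (sN q.+1)) (sfamM g1 (sN q)))).
have hT j : sfam (fun a z => \tr (\adj (M j a z) *m (gz (u j) a z *m gzb (u j) a z))).
  exact: (sfam_tr_adj (cf_smooth (cM j)) (mfam_outer (hu j) (hu j))).
transitivity (\sum_j integ (fun a z => - lam j *
    \tr (\adj (M j a z) *m (gz (u j) a z *m gzb (u j) a z)))).
  rewrite coef_sum; apply: eq_bigr => j _.
  by rewrite coefCM hP1 (integZ _ (hT j)) mulrN mulNr.
rewrite -integ_sum; last by move=> j _; exact: (sfamZ _ (hT j)).
apply: integ_ext => a z Uz.
set G0 := gradsq _ _; set G1 := gradsq _ _.
pose S := (G1%:P * 'X + G0%:P) * pencil (M0 a z) (M1 a z).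
pose D := mixed_defect (M0 a z) (M1 a z) (gz u0 a z) (gz u1 a z).
transitivity ((D - S)`_q.+1); last first.
  rewrite coefD coefN; apply: (f_equal (fun x : C => _ - x)).
  rewrite /S mulrDl coefD coefCM addrC; apply: (f_equal (fun x : C => _ + x)).
  by rewrite -mulrA coefCM ['X * _]mulrC coefMX.
rewrite hlam; last first.
  apply: (leq_trans (size_polyD _ _)); rewrite size_polyN geq_max size_mixed_defect //=.
  exact: size_linear_pencil.
apply: eq_bigr => j _; rewrite mulNr -mulrN; apply: (f_equal (fun x : C => lam j * x)).
rewrite hornerD hornerN (defect_eval _ Uz) /S hornerM pencil_eval hornerD hornerM !hornerC hornerX.
rewrite (gzD hu0 (sfamZ _ hu1) Uz) (gzbD hu0 (sfamZ _ hu1) Uz) (gzZ _ hu1 Uz) (gzbZ _ hu1 Uz).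
by rewrite [G0 + _]addrC [G1 * _]mulrC addrAC subrr sub0r.
Qed.

End Mixed.

(** Here [W] stays fixed while [M] moves. With [W] the Ricci form of [M], the variation of the Ricci
    form itself is left to the logarithmic term of [NR_ray]. *)
Lemma Ricci_term M W u : closed_form M -> (forall a z, U_ a z -> \det (M a z) != 0) ->
  closed_form W -> sfam u -> scalar u -> exists2 P : {poly C},
    forall t, integ (fun a z => u a z * NN 1 W (ray M t u) a z) = P.[t] &
    P`_1 = - integ (fun a z => (adj_pairing (M a z) (W a z) (gz u a z *m gzb u a z))`_1).
Proof.
move=> cM dM cW hu su; have [lam hlam] := @coef_extract C n 1 n0.
pose N (j : 'I_n.+1) : form11 X := fun a z => M a z + (j : nat)%:R *: W a z.
have cN j : closed_form (N j) by exact: (closedD cM (closedZ _ cW)).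
have /fin_all_exists2 [P hP hP1] := fun j => det_term (cN j) hu su hu su.
have hD j t : sfam (fun a z => u a z * \det (ray (N j) t u a z)).
  exact: (sfamM hu (sfam_det (mfam_ray t (cf_smooth (cN j)) hu))).
exists (\sum_j (lam j)%:P * P j).
  move=> t; rewrite horner_sum.
  transitivity (\sum_j integ (fun a z => lam j * (u a z * \det (ray (N j) t u a z)))).
    rewrite -integ_sum; last by move=> j _; exact: (sfamZ _ (hD j t)).
    apply: integ_ext => a z Uz.
    rewrite /NN hlam ?size_pencil // mulr_sumr; apply: eq_bigr => j _.
    rewrite mulrCA pencil_eval; apply: (f_equal (fun x : C => lam j * (u a z * x))).
    by rewrite (rayE _ _ hu Uz) (rayE _ _ hu Uz) addrAC.
  by apply: eq_bigr => j _; rewrite (integZ _ (hD j t)) hP hornerM hornerC.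
have hT j : sfam (fun a z => \tr (\adj (N j a z) *m (gz u a z *m gzb u a z))).
  exact: (sfam_tr_adj (cf_smooth (cN j)) (mfam_outer hu hu)).
transitivity (\sum_j integ (fun a z => - lam j *
    \tr (\adj (N j a z) *m (gz u a z *m gzb u a z)))).
  rewrite coef_sum; apply: eq_bigr => j _.
  by rewrite coefCM hP1 (integZ _ (hT j)) mulrN mulNr.
rewrite -integ_sum; last by move=> j _; exact: (sfamZ _ (hT j)).
have sA : sfam (fun a z => \sum_j lam j * \tr (\adj (N j a z) *m (gz u a z *m gzb u a z))).
  by apply: sfam_sum => j _; exact: (sfamZ _ (hT j)).
transitivity (- integ (fun a z => \sum_j lam j *
    \tr (\adj (N j a z) *m (gz u a z *m gzb u a z)))).
  rewrite -(integN sA); apply: integ_ext => a z Uz.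
  by rewrite -sumrN; apply: eq_bigr => j _; rewrite mulNr.
apply: (f_equal (fun x : C => - x)); apply: integ_ext => a z Uz.
rewrite hlam; last exact: (leq_trans (size_adj_pairing _ _ _ n0) (leqnSn n)).
by apply: eq_bigr => j _; rewrite adj_pairing_eval.
Qed.

End DualityExpansion.

(** * The slope of the dual bound *)

Section DualitySlope.
Variables (R : realType) (n k : nat) (X : compactComplexManifold R n).
Notation E := 'rV[R]_(n + n).
Notation C := R[i].
Notation Re := complex.Re.
Notation Im := complex.Im.
Notation U_ a := (im a (@setT (carrier (mfd X)))).
Opaque smooth_on.
Opaque csmooth_on.
Opaque integral_rV.
Opaque d_z d_zbar cpartial integ hess gz gzb.
Implicit Types (a b c : idx X) (z : E) (M W : form11 X) (u s : idx X -> E -> C) (t : C).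
Hypothesis n0 : (0 < n)%N.

Lemma gz_square u (m : C) a z : sfam u -> U_ a z ->
  gz (fun a z => (u a z + m) * u a z) a z = (2 * u a z + m) *: gz u a z.
Proof.
move=> hu Uz; apply/matrixP => j i; rewrite scalemxE (ord1 i) !gzE.
have D := derivation_d_z (open_U a) j.
have s1 : csm (U_ a) (fun y => u a y + m) := sfamD hu (sfam_cst m) a.
have e := dvM D s1 (hu a) Uz; have e' := dvD D (hu a) (sfam_cst m a) Uz.
apply: (etrans e); rewrite e' (dv_cst D m Uz); ring.
Qed.

(** In [dualt] the volume enters as [- (Hi + 2 * m) * Hi * V]. Differentiating [(u + 2 * m) * u]
    produces twice [u + m], the factor by which [mix0] and [mixi] are proportional to the volume at
    the extremal metric. *)
Lemma vol_term M u (m : C) : nondegenerate M -> sfam u -> scalar u ->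
  (forall a z, (u a z)^* = u a z) -> exists2 P : {poly C},
    forall t, integ (fun a z => (u a z + 2 * m) * u a z * \det (ray M t u a z)) = P.[t] &
    P`_1 = - (2 * integ (fun a z => gradsq (M a z) (gz u a z) *
      ((u a z + m) * \det (M a z)))).
Proof.
move=> kM hu su ru.
have hs : sfam (fun a z => (u a z + 2 * m) * u a z).
  exact: (sfamM (sfamD hu (sfam_cst (2 * m))) hu).
have ss : scalar (fun a z => (u a z + 2 * m) * u a z).
  by move=> a b z hz; rewrite (su a b z hz).
have [P hP hP1] := det_term (kh_closed kM) hs ss hu su.
exists P => //; rewrite hP1; apply: (f_equal (fun x : C => - x)).
have h1 : sfam (fun a z => gradsq (M a z) (gz u a z) * ((u a z + m) * \det (M a z))).
  exact: (sfamM (sfam_gradsq kM hu ru) (sfamM (sfamD hu (sfam_cst m)) (sfam_det (cf_smooth (kh_closed kM))))).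
rewrite -(integZ 2 h1); apply: integ_ext => a z Uz.
rewrite (gz_square _ hu Uz) (gradsqE _ hu ru Uz).
rewrite -scalemxAl -scalemxAr mxtraceZ.
have gen (x y v T : C) : v != 0 -> (2 * x + 2 * y) * T = 2 * (T / v * ((x + y) * v)).
  by move=> v0; field.
exact: (gen _ _ _ _ (det_neq0 kM Uz)).
Qed.

(** The Ricci form of the ray is [Ric M] plus the Hessian of [dlnV], and the coefficient of [X] is
    linear in it; Green's formula then moves the Hessian to [s]. All dependence on [t] that is not
    polynomial is thereby confined to the factor [dlnV]. *)
Lemma NR_ray M t u s : nondegenerate M -> sfam u -> scalar u -> nondegenerate (ray M t u) ->
  sfam s -> scalar s ->
  integ (fun a z => s a z * NR (ray M t u) a z) =
  integ (fun a z => s a z * NN 1 (Ric M) (ray M t u) a z) +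
  integ (fun a z => dlnV M (fun a z => t * u a z) a z *
    \tr (\adj (ray M t u a z) *m hess s a z)).
Proof.
move=> kM hu su kr hs ss; have hu' := sfamZ t hu.
have su' : scalar (fun a z => t * u a z) by move=> a b z hz; rewrite (su a b z hz).
have hG := sfam_dlnV kM kr; have sG := scalar_dlnV kM kr.
have cr := kh_closed kr; have cM := kh_closed kM.
have cR := Ric_closed (cf_form cM) (cf_smooth cM) (kh_det kM).
rewrite (integral_hess' cr hG sG hs ss) -(integral_hess cr hs ss hG sG).
have h1 : sfam (fun a z => s a z * NN 1 (Ric M) (ray M t u) a z).
  exact: (sfamM hs (sfam_NN 1 (cf_smooth cr) (cf_smooth cR))).
rewrite -(integD h1 (sfamM hs (sfam_tr_adj (cf_smooth cr) (mfam_hess hG)))).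
apply: integ_ext => a z Uz.
have gen (x : C) (A B G : 'M[C]_n) :
    x * (pencil A (B + G))`_1 = x * (pencil A B)`_1 + x * \tr (\adj A *m G).
  have tD := mxtraceD (\adj A *m B) (\adj A *m G).
  have e1 := pencil1 A (B + G); have e2 := pencil1 A B; have e3 := mulmxDr (\adj A) B G.
  have e4 : (pencil A (B + G))`_1 = (pencil A B)`_1 + \tr (\adj A *m G).
    by apply: (etrans e1); apply: (etrans (f_equal (fun m : 'M[C]_n => \tr m) e3)); apply: (etrans tD); rewrite e2.
  have dist (y v : C) : x * (y + v) = x * y + x * v by rewrite mulrDr.
  exact (etrans (f_equal (fun y : C => x * y) e4) (dist _ _)).
apply: (etrans _ (gen (s a z) (ray M t u a z) (Ric M a z) _)).
exact (f_equal (fun m => s a z * (pencil (ray M t u a z) m)`_1) (esym (Ric_add_hess kM kr Uz))).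
Qed.

Lemma Ricci_pairing M u a z : nondegenerate M -> sfam u ->
  (forall a z, (u a z)^* = u a z) -> U_ a z ->
  (adj_pairing (M a z) (Ric M a z) (gz u a z *m gzb u a z))`_1 =
  gradsq (M a z) (gz u a z) * NR M a z -
  \det (M a z) * (grad M u a z *m Ric M a z *m gradc M u a z) 0 0.
Proof.
move=> kM hu ru Uz; have V0 := det_neq0 kM Uz.
have uM : M a z \in unitmx by rewrite unitmxE unitfE.
rewrite (adj_pairing1 _ _ uM) (gradsqE _ hu ru Uz) /NR /NN pencil1 mulrAC.
apply: (f_equal (fun x : C => _ - \det (M a z) * x)).
rewrite (gradcE kM hu ru Uz) /grad mulmxA mxtrace_mulC.
by rewrite !mulmxA /mxtrace big_ord1.
Qed.

Section System.
Variables (p : 'I_k -> nat) (w : forms X k) (H : 'I_k.+1 -> idx X -> E -> C).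
Variables (m0 : C) (mi : 'I_k -> C).
Hypothesis pn : forall i, (p i <= n - 1)%N.
Hypothesis kw : forall i, nondegenerate (w i).
Hypotheses (hH : forall i, sfam (H i)) (sH : forall i, scalar (H i)).
Hypothesis rH : forall i a z, (H i a z)^* = H i a z.
Hypothesis mix0E : forall a z, U_ a z ->
  mix0 p w a z = (H ord0 a z + m0) * \det (w ord0 a z).
Hypothesis mixiE : forall j a z, U_ a z ->
  mixi p w j a z = (H (lift ord0 j) a z + mi j) * \det (w (lift ord0 j) a z).

Notation ws := (fun t i => ray (w i) t (H i)).

(* Half of the derivative at 0 of [dualC] along the ray. *)
Definition slope : C :=
  \sum_i integ (defect (w ord0) (w (lift ord0 i)) (H ord0) (H (lift ord0 i)) (p i).+1) +
  integ (fun a z => \det (w ord0 a z) *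
    \tr (map_mx Num.conj (dbargrad (w ord0) (H ord0) a z) *m dbargrad (w ord0) (H ord0) a z)).

Let vm (i : 'I_k.+1) : C := if unlift ord0 i is Some j then mi j else m0.

Lemma dualC_split t : (forall i, nondegenerate (ws t i)) ->
  dualC p H m0 mi (ws t) =
  2 * (\sum_i integ (fun a z =>
      H ord0 a z * NN (p i).+1 (ray (w (lift ord0 i)) t (H (lift ord0 i))) (ray (w ord0) t (H ord0)) a z +
      H (lift ord0 i) a z * NN (p i) (ray (w (lift ord0 i)) t (H (lift ord0 i))) (ray (w ord0) t (H ord0)) a z)) -
  \sum_i integ (fun a z => (H i a z + 2 * vm i) * H i a z * \det (ws t i a z)) -
  2 * integ (fun a z => H ord0 a z * NR (ws t ord0) a z).
Proof.
move=> kt.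
have hN q i : sfam (NN q (ws t i) (ws t ord0)) := sfam_NNk q (kt ord0) (kt i).
have hR : sfam (NR (ws t ord0)) := sfam_NR (kt ord0).
have hV i : sfam (fun a z => (H i a z + 2 * vm i) * H i a z * \det (ws t i a z)).
  exact: (sfamM (sfamM (sfamD (hH i) (sfam_cst (2 * vm i))) (hH i)) (sfam_det (cf_smooth (kh_closed (kt i))))).
have vm0 : vm ord0 = m0 by rewrite /vm unlift_none.
have vmi j : vm (lift ord0 j) = mi j by rewrite /vm liftK.
have hs1 i : sfam (fun a z => H ord0 a z * NN (p i).+1 (ws t (lift ord0 i)) (ws t ord0) a z) := sfamM (hH ord0) (hN _ _).
have hs2 i : sfam (fun a z => H (lift ord0 i) a z * NN (p i) (ws t (lift ord0 i)) (ws t ord0) a z) := sfamM (hH _) (hN _ _).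
have hs3 := sfamM (hH ord0) hR.
have e0 : integ (dualt (H ord0) (mix0 p (ws t)) (Vol (ws t) ord0) m0) =
  2 * (\sum_i integ (fun a z => H ord0 a z * NN (p i).+1 (ws t (lift ord0 i)) (ws t ord0) a z)) -
  2 * integ (fun a z => H ord0 a z * NR (ws t ord0) a z) -
  integ (fun a z => (H ord0 a z + 2 * vm ord0) * H ord0 a z * \det (ws t ord0 a z)).
  rewrite -mulrBr -(integ_mix0 p kt (hH ord0)).
  have h1 := sfamM (hH ord0) (sfam_mix0 p kt).
  rewrite -(integZ 2 h1) -(integB (sfamZ 2 h1) (hV ord0)); apply: integ_ext => a z Uz.
  rewrite vm0 /dualt /Vol; move: (mix0 p _ a z) (\det _) (H ord0 a z) => x y s; ring.
have ei (j : 'I_k) : integ (dualt (H (lift ord0 j)) (mixi p (ws t) j) (Vol (ws t) (lift ord0 j)) (mi j)) =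
  2 * integ (fun a z => H (lift ord0 j) a z * NN (p j) (ws t (lift ord0 j)) (ws t ord0) a z) -
  integ (fun a z => (H (lift ord0 j) a z + 2 * vm (lift ord0 j)) * H (lift ord0 j) a z * \det (ws t (lift ord0 j) a z)).
  rewrite -(integZ 2 (hs2 j)) -(integB (sfamZ 2 (hs2 j)) (hV (lift ord0 j))); apply: integ_ext => a z Uz.
  rewrite vmi /dualt /Vol /mixi; move: (NN _ _ _ a z) (\det _) (H (lift ord0 j) a z) => x y s; ring.
have alg (r v0 : C) (f1 f2 f12 v : 'I_k -> C) : (forall i, f12 i = f1 i + f2 i) ->
    2 * (\sum_i f1 i) - 2 * r - v0 + \sum_i (2 * f2 i - v i) =
    2 * (\sum_i f12 i) - (v0 + \sum_i v i) - 2 * r.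
  move=> e; rewrite (eq_bigr _ (fun i _ => e i)) !big_split /= -mulr_sumr sumrN.
  set S1 := \sum_(i < k) f1 i; set S2 := \sum_(i < k) f2 i; set S3 := \sum_(i < k) _; ring.
apply: (etrans (f_equal2 (fun x y : C => x + y) e0 (eq_bigr _ (fun j _ => ei j)))).
apply: (etrans (alg _ _ _ _ _ _ (fun i => integD (hs1 i) (hs2 i)))).
by apply: (f_equal (fun x : C => _ - x - _)); rewrite big_ord_recl.
Qed.

(** The squared gradients from [mixed_term] and [Ricci_term] cancel against those of [vol_term],
    because [mix0] and [mixi] equal [(H + m) * det] at [t = 0]. What is left is the defects and a
    Ricci term, which [bochner] combines with the integral of [lap^2]. That integral is the
    first-order contribution of the logarithmic term, which [P] does not contain. *)
Lemma dualC_expansion : exists2 P : {poly C},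
  forall t, (forall i, nondegenerate (ws t i)) ->
    dualC p H m0 mi (ws t) = P.[t] - 2 * integ (fun a z =>
      dlnV (w ord0) (fun a z => t * H ord0 a z) a z *
      \tr (\adj (ws t ord0 a z) *m hess (H ord0) a z)) &
  P`_1 + 2 * integ (fun a z => lap (w ord0) (H ord0) a z ^+ 2 * \det (w ord0 a z)) = 2 * slope.
Proof.
have pn' i : (p i <= n)%N by exact: (leq_trans (pn i) (leq_subr 1 n)).
have /fin_all_exists2 [P hP hP1] := fun i => mixed_term n0 (kw ord0) (kw (lift ord0 i))
  (hH ord0) (sH ord0) (hH (lift ord0 i)) (sH (lift ord0 i)) (rH ord0) (rH (lift ord0 i)) (pn' i).
have /fin_all_exists2 [Q hQ hQ1] := fun i => vol_term (vm i) (kw i) (hH i) (sH i) (rH i).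
have cM := kh_closed (kw ord0).
have cR := Ric_closed (cf_form cM) (cf_smooth cM) (kh_det (kw ord0)).
have [S hS hS1] := Ricci_term n0 cM (fun a z => @det_neq0 R n X (w ord0) (kw ord0) a z) cR (hH ord0) (sH ord0).
exists (2%:P * (\sum_i P i) - \sum_i Q i - 2%:P * S).
  move=> t kt; rewrite (dualC_split kt) (NR_ray (kw ord0) (hH ord0) (sH ord0) (kt ord0) (hH ord0) (sH ord0)).
  rewrite hS (eq_bigr _ (fun i _ => hP i t)) (eq_bigr _ (fun i _ => hQ i t)).
  rewrite !hornerD !hornerN !hornerM !hornerC !horner_sum mulrDr opprD addrA.
  by [].
pose g i a z := gradsq (w i a z) (gz (H i) a z).
have hg i : sfam (g i) := sfam_gradsq (kw i) (hH i) (rH i).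
have hN q i : sfam (NN q (w i) (w ord0)) := sfam_NNk q (kw ord0) (kw i).
have hR : sfam (NR (w ord0)) := sfam_NR (kw ord0).
have hy : sfam (fun a z => \det (w ord0 a z) * (grad (w ord0) (H ord0) a z *m Ric (w ord0) a z *m
    gradc (w ord0) (H ord0) a z) 0 0) := sfam_form_entry (kw ord0) (hH ord0).
have eA : integ (fun a z => (adj_pairing (w ord0 a z) (Ric (w ord0) a z)
      (gz (H ord0) a z *m gzb (H ord0) a z))`_1) =
    integ (fun a z => g ord0 a z * NR (w ord0) a z) -
    integ (fun a z => \det (w ord0 a z) * (grad (w ord0) (H ord0) a z *m Ric (w ord0) a z *m
      gradc (w ord0) (H ord0) a z) 0 0).
  rewrite -(integB (sfamM (hg ord0) hR) hy); apply: integ_ext => a z Uz.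
  exact (Ricci_pairing (kw ord0) (hH ord0) (rH ord0) Uz).
have eV0 : integ (fun a z => g ord0 a z * ((H ord0 a z + vm ord0) * \det (w ord0 a z))) =
    \sum_i integ (fun a z => g ord0 a z * NN (p i).+1 (w (lift ord0 i)) (w ord0) a z) -
    integ (fun a z => g ord0 a z * NR (w ord0) a z).
  rewrite -(integ_mix0 p kw (hg ord0)); apply: integ_ext => a z Uz.
  by rewrite (mix0E Uz) /vm unlift_none.
have eVj (j : 'I_k) : integ (fun a z => g (lift ord0 j) a z *
    ((H (lift ord0 j) a z + vm (lift ord0 j)) * \det (w (lift ord0 j) a z))) =
    integ (fun a z => g (lift ord0 j) a z * NN (p j) (w (lift ord0 j)) (w ord0) a z).
  by apply: integ_ext => a z Uz; rewrite /vm liftK -(mixiE j Uz).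
have eAi (i : 'I_k) : integ (fun a z =>
      gradsq (w ord0 a z) (gz (H ord0) a z) * NN (p i).+1 (w (lift ord0 i)) (w ord0) a z +
      gradsq (w (lift ord0 i) a z) (gz (H (lift ord0 i)) a z) * NN (p i) (w (lift ord0 i)) (w ord0) a z) =
    integ (fun a z => g ord0 a z * NN (p i).+1 (w (lift ord0 i)) (w ord0) a z) +
    integ (fun a z => g (lift ord0 i) a z * NN (p i) (w (lift ord0 i)) (w ord0) a z).
  exact (integD (sfamM (hg ord0) (hN (p i).+1 (lift ord0 i))) (sfamM (hg (lift ord0 i)) (hN (p i) (lift ord0 i)))).
have B := bochner (kw ord0) (hH ord0) (sH ord0) (rH ord0).
have alg (d a b : 'I_k -> C) (r y L : C) :
    2 * (\sum_i (d i - (a i + b i))) - (- (2 * (\sum_i a i - r)) + \sum_i - (2 * b i)) -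
    2 * - (r - y) + 2 * L = 2 * (\sum_i d i + (L - y)).
  rewrite !big_split /= !sumrN !big_split /= -mulr_sumr.
  set S1 := \sum_i d i; set S2 := \sum_i a i; set S3 := \sum_i b i; ring.
rewrite /slope -B.
apply: (etrans _ (alg _ (fun i => integ (fun a z => g ord0 a z * NN (p i).+1 (w (lift ord0 i)) (w ord0) a z))
  (fun i => integ (fun a z => g (lift ord0 i) a z * NN (p i) (w (lift ord0 i)) (w ord0) a z))
  (integ (fun a z => g ord0 a z * NR (w ord0) a z)) _ _)).
rewrite !coefD !coefN !coefCM !coef_sum hS1 eA.
apply: (f_equal2 (fun x y : C => x + y)) => //.
apply: (f_equal (fun x : C => x - _)).
apply: (f_equal2 (fun x y : C => 2 * x - y)).
  by apply: eq_bigr => i _; rewrite hP1 (eAi i).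
rewrite big_ord_recl hQ1 eV0; apply: (f_equal (fun x : C => _ + x)).
by apply: eq_bigr => i _; rewrite hQ1 (eVj i).
Qed.

End System.
End DualitySlope.

Section RealEstimates.
Variable R : realType.
Notation C := R[i].

(** For [y] the ratio of determinants minus 1, [D] its derivative and [L] the Laplacian, the product
    is [s * L^2] to first order. The constant is [(2 b^2 + b) * 2 b], from replacing [ln (1 + y)] by
    [s * L], plus [b^2], from replacing [D] by [L]. *)
Lemma log_product_lower (b s y L D : R) : 1 <= b -> 0 <= s -> 2 * (b * s) <= 1 ->
  `|y| <= b * s -> `|y - s * L| <= b * s ^+ 2 -> `|L| <= b -> `|D - L| <= b * s ->
  s * L ^+ 2 - (4 * b ^+ 3 + 3 * b ^+ 2) * s ^+ 2 <= ln (1 + y) * D.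
Proof.
move=> b1 s0 bs hy hyL hL hD.
have b0 : 0 <= b by lra.
have y2 : `|y| <= 2^-1 by apply: (le_trans hy); lra.
have h1 : `|ln (1 + y) - s * L| <= (2 * b ^+ 2 + b) * s ^+ 2.
  have -> : ln (1 + y) - s * L = (ln (1 + y) - y) + (y - s * L) by ring.
  apply: (le_trans (ler_normD _ _)); rewrite mulrDl; apply: lerD => //.
  apply: (le_trans (ln_remainder y2)); rewrite -mulrA ler_pM2l // -exprMn -[y ^+ 2]real_normK ?num_real //.
  by rewrite lerXn2r // ?nnegrE // ?mulr_ge0.
have h2 : `|D| <= 2 * b.
  have -> : D = (D - L) + L by ring.
  apply: (le_trans (ler_normD _ _)); apply: (le_trans (lerD hD hL)); lra.
have h3 : `|(ln (1 + y) - s * L) * D| <= (2 * b ^+ 2 + b) * s ^+ 2 * (2 * b).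
  by rewrite normrM ler_pM.
have h4 : `|s * L * (D - L)| <= s * b * (b * s).
  rewrite normrM ler_pM // normrM ger0_norm //; exact: ler_wpM2l.
have -> : ln (1 + y) * D = s * L ^+ 2 + ((ln (1 + y) - s * L) * D + s * L * (D - L)) by ring.
have := ler_norm (- ((ln (1 + y) - s * L) * D)); rewrite normrN => h5.
have := ler_norm (- (s * L * (D - L))); rewrite normrN => h6.
have E : (4 * b ^+ 3 + 3 * b ^+ 2) * s ^+ 2 = (2 * b ^+ 2 + b) * s ^+ 2 * (2 * b) + s * b * (b * s) by ring.
lra.
Qed.

Lemma horner_real (P : {poly C}) (s : R) : (forall q, (P`_q)^* = P`_q) ->
  (P.[Complex s 0])^* = P.[Complex s 0].
Proof.
move=> h; rewrite horner_coef rmorph_sum; apply: eq_bigr => i _.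
rewrite rmorphM rmorphXn /= h; apply: (f_equal (fun x : C => _ * x ^+ _)).
by apply: complexE2 => //=; rewrite oppr0.
Qed.

End RealEstimates.

(** * The logarithmic term along a ray *)

Section LogTerm.
Variables (R : realType) (n : nat) (X : compactComplexManifold R n).
Notation E := 'rV[R]_(n + n).
Notation C := R[i].
Notation Re := complex.Re.
Notation Im := complex.Im.
Notation U_ a := (im a (@setT (carrier (mfd X)))).
Opaque smooth_on.
Opaque csmooth_on.
Opaque integral_rV.
Opaque d_z d_zbar cpartial integ hess gz gzb.
Implicit Types (a b c : idx X) (z : E) (t : C) (s : R).
Variables (M : form11 X) (f : X -> R).
Hypotheses (kM : nondegenerate M) (sf : mfd_smooth f).
Let hu : sfam (rf f) := sfam_rf sf.
Let cM := kh_closed kM.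

(* det (M + t hess f) / det M as a polynomial in t. *)
Definition detratio a z : {poly C} :=
  ((\det (M a z))^-1)%:P * pencil (M a z) (hess (rf f) a z).

Lemma detratioE a z t : U_ a z -> \det (ray M t (rf f) a z) = \det (M a z) * (detratio a z).[t].
Proof.
move=> Uz; rewrite (det_ray _ _ hu Uz) hornerM hornerC mulrA divff ?mul1r //.
exact: (det_neq0 kM Uz).
Qed.

Lemma detratio_deriv a z t : U_ a z ->
  \tr (\adj (ray M t (rf f) a z) *m hess (rf f) a z) = \det (M a z) * (detratio a z)^`().[t].
Proof.
move=> Uz; rewrite (rayE _ _ hu Uz) -pencil_deriv_eval derivM derivC mul0r add0r hornerM hornerC.
by rewrite mulrA divff ?mul1r //; exact: (det_neq0 kM Uz).
Qed.

Lemma pfam_detratio : pfam (1 + n.+1) detratio.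
Proof. exact: (pfamM (pfamC (sfam_Vinv kM)) (pencil_pfam (cf_smooth cM) (mfam_hess hu))). Qed.

Lemma detratio_scalar q : scalar (fun a z => (detratio a z)`_q).
Proof.
move=> a b z hz.
have eC c y : (detratio c y)`_q = (\det (M c y))^-1 * (pencil (M c y) (hess (rf f) c y))`_q := coefCM _ _ _.
have e1 := density_NN q (cf_form cM) (is_form_hess hu (scalar_rf f)) hz.
have e2 := density_det (cf_form cM) hz.
have [_ /(_ z hz) J0] := holo_det_jac a b.
apply: (etrans (eC a z)); apply: (etrans _ (esym (eC b _))).
apply: (etrans (f_equal2 (fun x y : C => x^-1 * y) e2 e1)).
have gen (x y j : C) : j != 0 -> (x * j)^-1 * (y * j) = x^-1 * y.
  by move=> j0; rewrite invfM mulrACA mulVf ?mulr1.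
by apply: gen; rewrite mulf_neq0 ?conjC_eq0.
Qed.

Lemma detratio_real q a z : U_ a z -> ((detratio a z)`_q)^* = (detratio a z)`_q.
Proof.
move=> Uz; rewrite !coefCM rmorphM fmorphV /=.
rewrite (pencil_real q (kh_herm kM Uz) (hess_rf_herm sf Uz)).
by rewrite geC0_conj // ltW // (kh_det kM Uz).
Qed.

Lemma detratio0 a z : U_ a z -> (detratio a z)`_0 = 1.
Proof. by move=> Uz; rewrite coefCM pencil0 mulVf // (det_neq0 kM Uz). Qed.

Lemma detratio1 a z : (detratio a z)`_1 = lap M (rf f) a z.
Proof. by rewrite coefCM pencil1 mulrC. Qed.

Lemma detratio_bounds : exists2 b : R, 1 <= b & forall a z s, U_ a z -> 0 <= s <= 1 ->
  [/\ `|Re (detratio a z).[Complex s 0] - 1| <= b * s,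
      `|Re (detratio a z).[Complex s 0] - 1 - s * Re (lap M (rf f) a z)| <= b * s ^+ 2,
      `|Re (lap M (rf f) a z)| <= b &
      `|Re (detratio a z)^`().[Complex s 0] - Re (lap M (rf f) a z)| <= b * s].
Proof.
have [b1 b10 h1] := pfam_bound pfam_detratio detratio_scalar.
have sc' q : scalar (fun a z => ((detratio a z)^`())`_q).
  move=> a b z hz.
  have eD c y : ((detratio c y)^`())`_q = (detratio c y)`_q.+1 *+ q.+1 := coef_deriv _ _.
  exact (etrans (eD a z) (etrans (f_equal (fun x : C => x *+ q.+1) (detratio_scalar q.+1 hz)) (esym (eD b _)))).
have [b2 b20 h2] := pfam_bound (pfam_deriv pfam_detratio) sc'.
have [b3 b30 h3] := scalar_bounded (sfam_lap kM hu) (scalar_lap kM hu (scalar_rf f)).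
have bE (x : C) : 0 <= x -> x = Complex (Re x) 0 /\ 0 <= Re x.
  rewrite lecE /= => /andP[/eqP e ->]; split=> //; exact: complexE2.
have [e1 p1] := bE _ b10; have [e2 p2] := bE _ b20; have [e3 p3] := bE _ b30.
exists (1 + Re b1 + Re b2 + Re b3); first lra.
move=> a z s Uz /andP[s0 s1].
have ns : `|Complex s 0 : C| = Complex s 0 by rewrite normC_real ger0_norm.
have ns1 : `|Complex s 0 : C| <= 1 by rewrite ns lecE /= eqxx.
have [g1 g2] := h1 a z Uz _ ns1; have [g3 _] := h2 a z Uz _ ns1; have g4 := h3 a z Uz.
rewrite (detratio0 Uz) detratio1 in g1 g2; rewrite (coef_deriv _ 0) mulr1n detratio1 in g3.
rewrite ns e1 expr2 -!CplxM in g1 g2; rewrite ns e2 -CplxM in g3; rewrite e3 in g4.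
have := Re_le_norm g1; have := Re_le_norm g2; have := Re_le_norm g3; have := Re_le_norm g4.
have eB (x y : C) : Re (x - y) = Re x - Re y by case: x; case: y.
have eZ (y : C) : Re (Complex s 0 * y) = s * Re y by case: y => ? ? /=; rewrite mul0r subr0.
rewrite eB eB eB eZ => k4 k3 k2 k1.
have s2 : 0 <= s ^+ 2 by rewrite exprn_ge0.
have w (x y : R) : Re b1 <= x -> 0 <= y -> Re b1 * y <= x * y by move=> *; rewrite ler_wpM2r.
split.
- by apply: (le_trans k1); apply: ler_wpM2r => //; lra.
- by apply: (le_trans k2); rewrite -expr2; apply: ler_wpM2r => //; lra.
- by apply: (le_trans k4); lra.
- by apply: (le_trans k3); apply: ler_wpM2r => //; lra.
Qed.

Lemma small_ray : exists2 d : R, 0 < d & exists2 K : R, 0 <= K & forall s, 0 <= s <= d ->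
  nondegenerate (ray M (Complex s 0) (rf f)) /\
  forall a z, U_ a z ->
    (Complex s 0 * lap M (rf f) a z ^+ 2 - Complex (K * s ^+ 2) 0) * \det (M a z) <=
    - (dlnV M (fun a z => Complex s 0 * rf f a z) a z *
      \tr (\adj (ray M (Complex s 0) (rf f) a z) *m hess (rf f) a z)).
Proof.
have [b b1 hb] := detratio_bounds.
have b0 : 0 < b by lra.
(* For [s <= (2 * b)^-1] the ratio of determinants is at least [1/2], so the determinant stays
   positive on the ray and [ln_remainder] applies. *)
exists (2 * b)^-1; first by rewrite invr_gt0; lra.
exists (4 * b ^+ 3 + 3 * b ^+ 2); first by rewrite addr_ge0 // mulr_ge0 // exprn_ge0 // ltW.
move=> s /andP[s0 sd].
have bs : 2 * (b * s) <= 1.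
  by have := ler_wpM2l (ltW (mulr_gt0 (ltr0n _ 2) b0)) sd; rewrite divff ?mulrA //; lra.
have s1 : 0 <= s <= 1.
  rewrite s0 (le_trans _ bs) //; have := ler_wpM2r s0 b1; lra.
pose r a z := Re (detratio a z).[Complex s 0].
pose d a z := Re (detratio a z)^`().[Complex s 0].
have rE a z : U_ a z -> (detratio a z).[Complex s 0] = Complex (r a z) 0.
  by move=> Uz; apply: realC; apply: horner_real => q; exact: detratio_real.
have dE a z : U_ a z -> (detratio a z)^`().[Complex s 0] = Complex (d a z) 0.
  move=> Uz; apply: realC; apply: horner_real => q.
  by rewrite coef_deriv rmorphMn /= (detratio_real q.+1 Uz).
have lE a z : U_ a z -> lap M (rf f) a z = Complex (Re (lap M (rf f) a z)) 0.
  by move=> Uz; apply: realC; rewrite -detratio1; exact: detratio_real.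
have r0 a z : U_ a z -> 0 < r a z.
  move=> Uz; have [h _ _ _] := hb a z s Uz s1.
  by move: h; rewrite ler_norml -/(r a z) => /andP[]; lra.
have detE a z : U_ a z -> \det (ray M (Complex s 0) (rf f) a z) =
    Complex (Re (\det (M a z)) * r a z) 0.
  by move=> Uz; rewrite (detratioE _ Uz) (rE a z Uz) {1}(Redet (kh_det kM) Uz) CplxM.
have v0 a z : U_ a z -> 0 < Re (\det (M a z)) by move=> Uz; exact: (Redet_gt0 (kh_det kM) Uz).
have kr : nondegenerate (ray M (Complex s 0) (rf f)).
  have hu' := sfamZ (Complex s 0) hu.
  have su' : scalar (fun a z => Complex s 0 * rf f a z) by move=> a c z hz; rewrite (scalar_rf f hz).
  split; first exact: (closedD cM (closed_hess hu' su')).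
    move=> a z Uz; rewrite (rayE _ _ hu Uz); apply: hermD; first exact: (kh_herm kM Uz).
    have h := hess_rf_herm sf Uz; apply/matrixP => i j; have hij := congr1 (fun m : 'M[C]_n => m i j) h.
    rewrite ctE !scalemxE rmorphM /= -[in RHS]hij ctE; apply: (f_equal (fun x : C => x * _)).
    by apply: complexE2 => //=; rewrite oppr0.
  move=> a z Uz; rewrite (detE a z Uz) ltcE /= eqxx mulr_gt0 //; [exact: v0|exact: r0].
split=> // a z Uz.
rewrite (detratio_deriv _ Uz) (dE a z Uz) (lE a z Uz) {1 2}(Redet (kh_det kM) Uz).
(* In [dlnV] the logarithm on the ray is subtracted from the one at the start, so the minus sign in
   front of the product turns it into [ln (r a z)]. *)
have -> : dlnV M (fun a z => Complex s 0 * rf f a z) a z = Complex (- ln (r a z)) 0.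
  rewrite /dlnV /lnV -CplxB; apply: (f_equal (fun x : R => Complex x 0)).
  rewrite /lndet -[add_hess _ _ a z]/(ray M (Complex s 0) (rf f) a z) (detE a z Uz) /=.
  by rewrite exp.lnM ?posrE ?v0 ?r0 //; ring.
rewrite expr2 -!CplxM -CplxB -!CplxM -CplxN lecR.
have [h1 h2 h3 h4] := hb a z s Uz s1.
have := log_product_lower b1 s0 bs h1 h2 h3 h4.
have -> : 1 + (Re (detratio a z).[Complex s 0] - 1) = r a z by rewrite /r addrC subrK.
rewrite -/(d a z) => h5.
have := ler_wpM2r (ltW (v0 a z Uz)) h5.
have -> : - (- ln (r a z) * (Re (\det (M a z)) * d a z)) = ln (r a z) * d a z * Re (\det (M a z)) by ring.
by rewrite expr2.
Qed.

Lemma log_term_lower : exists2 d : R, 0 < d & exists2 K : R, 0 <= K & forall s, 0 <= s <= d ->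
  nondegenerate (ray M (Complex s 0) (rf f)) /\
  s * Re (integ (fun a z => lap M (rf f) a z ^+ 2 * \det (M a z))) - K * s ^+ 2 <=
  Re (- integ (fun a z => dlnV M (fun a z => Complex s 0 * rf f a z) a z *
      \tr (\adj (ray M (Complex s 0) (rf f) a z) *m hess (rf f) a z))).
Proof.
have [d d0 [K K0 h]] := small_ray; exists d => //.
have hD := sfam_det (cf_smooth cM).
have V0 := integ_det_gt0 kM.
exists (K * Re (integ (fun a z => \det (M a z)))).
  by rewrite mulr_ge0 //; move: V0; rewrite ltcE /= => /andP[_ /ltW].
move=> s /h[kr hle]; split=> //.
have hu' := sfamZ (Complex s 0) hu.
have su' : scalar (fun a z => Complex s 0 * rf f a z) by move=> a c z hz; rewrite (scalar_rf f hz).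
have hG := sfam_dlnV kM kr; have sG := scalar_dlnV kM kr.
have hl := sfam_lap kM hu; have sl := scalar_lap kM hu (scalar_rf f).
have hT := sfamM hG (sfam_tr_adj (cf_smooth (kh_closed kr)) (mfam_hess hu)).
have dT : density (fun a z => dlnV M (fun a z => Complex s 0 * rf f a z) a z *
      \tr (\adj (ray M (Complex s 0) (rf f) a z) *m hess (rf f) a z)).
  exact: (densityZ sG (density_tr_adj (cf_form (kh_closed kr)) (is_form_hess hu (scalar_rf f)))).
have hL : sfam (fun a z => lap M (rf f) a z ^+ 2 * \det (M a z)) := sfamM (sfamM hl hl) hD.
have hS : sfam (fun a z => Complex s 0 * lap M (rf f) a z ^+ 2 - Complex (K * s ^+ 2) 0).
  exact: (sfamB (sfamZ (Complex s 0) (sfamM hl hl)) (sfam_cst (Complex (K * s ^+ 2) 0))).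
have sS : scalar (fun a z => Complex s 0 * lap M (rf f) a z ^+ 2 - Complex (K * s ^+ 2) 0).
  by move=> a c z hz; rewrite (sl a c z hz).
have dN : density (fun a z => - (dlnV M (fun a z => Complex s 0 * rf f a z) a z *
      \tr (\adj (ray M (Complex s 0) (rf f) a z) *m hess (rf f) a z))).
  by move=> a c z hz; rewrite mulNr; apply: (f_equal (fun x : C => - x)); exact: (dT a c z hz).
have := integ_mono (sfamM hS hD) (densityZ sS (density_det (cf_form cM))) (sfamN hT) dN hle.
rewrite (integN hT).
have -> : integ (fun a z => (Complex s 0 * lap M (rf f) a z ^+ 2 - Complex (K * s ^+ 2) 0) * \det (M a z)) =
    Complex s 0 * integ (fun a z => lap M (rf f) a z ^+ 2 * \det (M a z)) -
    Complex (K * s ^+ 2) 0 * integ (fun a z => \det (M a z)).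
  rewrite -(integZ _ hL) -(integZ _ hD) -(integB (sfamZ _ hL) (sfamZ _ hD)).
  by apply: integ_ext => a z Uz; rewrite mulrBl mulrA.
rewrite lecE => /andP[_]; rewrite !(@ReD R) !(@ReN R) !(@ReM R) /= !mul0r !subr0.
by rewrite [K * _ * s ^+ 2]mulrAC.
Qed.

End LogTerm.

(** If [x > 0], the difference quotient at a small [s > 0] is at least [2 * x - K * s >= x], whereas
    it tends to 0. A one-sided lower bound is therefore enough. *)
Lemma derive_zero_slope_le0 (R : realType) (g : R -> R) (d x K : R) :
  is_derive (0 : R) (1 : R) g 0 -> 0 < d ->
  (forall s, 0 <= s <= d -> g 0 + 2 * s * x - K * s ^+ 2 <= g s) -> x <= 0.
Proof.
move=> [dg g0] d0 h; rewrite leNgt; apply/negP => x0.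
have hd : (fun t : R => t^-1 *: (g (t *: 1 + 0) - g 0)) @ 0^' --> ('D_1 g 0 : R) by exact: dg.
rewrite g0 in hd; move: hd => /cvgrPdist_lt => /(_ x x0) [e /= e0 he].
(* Small enough for the lower bound ([d]), for the difference quotient to be below [x] ([e]), and
   for [K * s <= x]. *)
pose s := Num.min (Num.min d (e / 2)) (x / (`|K| + 1)).
have K1 : 0 < `|K| + 1 by rewrite ltr_wpDl.
have s0 : 0 < s by rewrite !lt_min d0 divr_gt0 //= divr_gt0.
have sd : s <= d by rewrite /s !ge_min lexx.
have se : s < e by apply: (@le_lt_trans _ _ (e / 2)); [rewrite /s !ge_min lexx orbT|lra].
have sx : s * (`|K| + 1) <= x by rewrite -ler_pdivlMr // /s ge_min lexx orbT.
have hs : `|s^-1 *: (g (s *: 1 + 0) - g 0)| < x.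
  have := he s; rewrite sub0r normrN; apply; last exact: lt0r_neq0.
  by rewrite /ball_ /= sub0r normrN gtr0_norm.
rewrite addr0 /GRing.scale /= mulr1 in hs.
have h1 := h s; rewrite (ltW s0) sd in h1; have h2 := h1 isT.
have : s^-1 * (g s - g 0) < x by exact: le_lt_trans (ler_norm _) hs.
rewrite mulrC ltr_pdivrMr // => h3.
have : K * s ^+ 2 <= x * s.
  rewrite expr2 mulrA ler_wpM2r ?(ltW s0) //; apply: le_trans sx; rewrite mulrC ler_wpM2l ?(ltW s0) //.
  by rewrite (le_trans (ler_norm _)) // lerDl.
have xs : 0 < x * s by rewrite mulr_gt0.
have E : 2 * s * x = x * s + x * s by ring.
by move=> h4; lra.
Qed.

(** * The slope at an extremal metric *)

Section ExtremalSlope.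
Variables (R : realType) (n k : nat) (X : compactComplexManifold R n).
Notation E := 'rV[R]_(n + n).
Notation C := R[i].
Notation Re := complex.Re.
Notation Im := complex.Im.
Notation U_ a := (im a (@setT (carrier (mfd X)))).
Opaque smooth_on.
Opaque csmooth_on.
Opaque integral_rV.
Opaque d_z d_zbar cpartial integ hess gz gzb.
Implicit Types (a b c : idx X) (z : E) (t : C) (s : R).
Hypothesis n0 : (0 < n)%N.

(** Variations in the definition of [extremal] are functions on [X], whereas deviations are families
    over charts; this passes from one to the other. *)
Lemma real_family (tau : idx X -> E -> C) : sfam tau -> scalar tau ->
  (forall a z, U_ a z -> (tau a z)^* = tau a z) ->
  exists2 f : X -> R, mfd_smooth f & forall a z, U_ a z -> rf f a z = tau a z.
Proof.
move=> ht st rt; have [sre _] := descend_csmooth ht st.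
exists (fun x => Re (descend tau x)) => // a z Uz.
by rewrite /rf (descendE st Uz); apply/esym; apply: realC; exact: rt.
Qed.

Variables (p : 'I_k -> nat) (om : forms X k) (h : 'I_k.+1 -> X -> R).
Hypothesis pn : forall i, (p i <= n - 1)%N.
Hypothesis com : forall i, closed_form (om i).
Hypothesis hom : forall i a z, U_ a z -> herm (om i a z).
Hypothesis sh : forall i, mfd_smooth (h i).
Let w := perturbs om h.
Hypothesis kw : forall i, nondegenerate (w i).

Lemma perturbsE f i : perturbs om f i = add_hess (om i) (rf (f i)).
Proof. by []. Qed.

Lemma perturbs_ray f s : (forall i, mfd_smooth (f i)) ->
  forms_eq (perturbs om (fun i x => h i x + s * f i x))
    (fun i => ray (w i) (Complex s 0) (rf (f i))).
Proof.
move=> sf i a z Uz; rewrite (rayE _ _ (sfam_rf (sf i)) Uz) /w !perturbsE /add_hess -addrA.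
apply: (f_equal (fun m : 'M[C]_n => om i a z + m)).
rewrite -(hessZ (Complex s 0) (sfam_rf (sf i)) Uz).
rewrite -(hessD (sfam_rf (sh i)) (sfamZ (Complex s 0) (sfam_rf (sf i))) Uz).
by apply: (hess_ext (open_U a) Uz) => y Uy; rewrite /rf CplxD CplxM.
Qed.

Lemma perturbs_nondegenerate f s : (forall i, mfd_smooth (f i)) ->
  (forall i, nondegenerate (ray (w i) (Complex s 0) (rf (f i)))) ->
  forall i, nondegenerate (perturbs om (fun i x => h i x + s * f i x) i).
Proof.
move=> sf kr i; rewrite perturbsE; apply: add_hess_nondegenerate.
- exact: com.
- exact: hom.
- move=> a; exact (smoothD (open_U a) (@sh i a) (smoothM (open_U a) (smooth_cst (open_U a) s) (sf i a))).
- move=> a z Uz; have e := perturbs_ray s sf i Uz; rewrite perturbsE in e.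
  by rewrite e; exact: (kh_det (kr i) Uz).
Qed.

Section Rays.
Variable f : 'I_k.+1 -> X -> R.
Hypothesis sf : forall i, mfd_smooth (f i).
Let H i := rf (f i).
Let hH i : sfam (H i) := sfam_rf (sf i).
Let sH i : scalar (H i) := scalar_rf (f i).
Lemma rf_real (g : X -> R) a z : (rf g a z)^* = rf g a z.
Proof. by apply: complexE2 => //=; rewrite oppr0. Qed.
Let rH i a z : (H i a z)^* = H i a z := rf_real (f i) a z.
Hypothesis dev0 : forall a z, U_ a z -> dev (mix0 p w) (Vol w ord0) (mean0 p w) a z = H ord0 a z.
Hypothesis devi : forall j a z, U_ a z ->
  dev (mixi p w j) (Vol w (lift ord0 j)) (meani p w j) a z = H (lift ord0 j) a z.

Lemma mean0_real : (mean0 p w)^* = mean0 p w.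
Proof. by rewrite -(averageA_sum n0 pn kw); apply: complexE2 => //=; rewrite oppr0. Qed.

Lemma meani_real j : (meani p w j)^* = meani p w j.
Proof. by rewrite -(averageBE n0 pn kw j); apply: complexE2 => //=; rewrite oppr0. Qed.

(** The constants computed at [h] are also the means of the perturbed forms, since the integrals of
    [mix0], [mixi] and the volumes depend only on the classes. *)
Lemma dual_le_calabi s : (forall i, nondegenerate (ray (w i) (Complex s 0) (H i))) ->
  dualC p H (mean0 p w) (meani p w) (fun i => ray (w i) (Complex s 0) (H i)) <=
  Complex (calabi p om (fun i x => h i x + s * f i x)) 0.
Proof.
move=> kr; rewrite (calabiE n0 pn (perturbs_nondegenerate sf kr)).
rewrite (calabiC_congr _ (perturbs_ray s sf)).
have hu i := sfamZ (Complex s 0) (hH i).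
have su i : scalar (fun a z => Complex s 0 * H i a z).
  by move=> a c z hz; rewrite (sH i hz).
apply: (dualC_le hH sH rH kr mean0_real meani_real).
  apply/esym; apply: (f_equal2 (fun x y : C => x / y)).
    exact: (integ_mix0_inv p kw kr hu su).
  exact: (integ_Vol_inv kw hu su ord0).
move=> j; apply/esym; apply: (f_equal2 (fun x y : C => x / y)).
  exact: (integ_mixi_inv p kw hu su j).
exact: (integ_Vol_inv kw hu su (lift ord0 j)).
Qed.

Lemma dual_eq_calabi : Complex (calabi p om h) 0 = dualC p H (mean0 p w) (meani p w) w.
Proof.
rewrite (calabiE n0 pn kw); apply/esym.
exact: (dualC_eq hH sH rH kw mean0_real meani_real erefl (fun=> erefl) dev0 devi).
Qed.

Lemma calabi_lower : exists2 d : R, 0 < d & exists K : R, forall s, 0 <= s <= d ->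
  calabi p om h + 2 * s * Re (slope p w H) - K * s ^+ 2 <=
  calabi p om (fun i x => h i x + s * f i x).
Proof.
have m0E a z : U_ a z -> mix0 p w a z = (H ord0 a z + mean0 p w) * \det (w ord0 a z).
  by move=> Uz; rewrite -(dev0 Uz) /dev subrK divfK // (det_neq0 (kw ord0) Uz).
have miE j a z : U_ a z -> mixi p w j a z = (H (lift ord0 j) a z + meani p w j) * \det (w (lift ord0 j) a z).
  by move=> Uz; rewrite -(devi j Uz) /dev subrK divfK // (det_neq0 (kw _) Uz).
have [P hP hP1] := dualC_expansion n0 pn kw hH sH rH m0E miE.
have [B B0 hB] := poly_bound_exists P.
have /fin_all_exists [d hd] := fun i => (let: ex_intro2 d d0 h' := small_ray (kw i) (sf i) in
  ex_intro (fun d => 0 < d /\ forall s, 0 <= s <= d -> nondegenerate (ray (w i) (Complex s 0) (H i)))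
   d (conj d0 (fun s hs => (let: ex_intro2 K _ h'' := h' in (h'' s hs).1)))).
have [d1 d10 [K K0 hK]] := log_term_lower (kw ord0) (sf ord0).
(* Up to [e] every form on the ray has to stay nondegenerate; the bound 1 is for the remainder of
   [P], and [d1] for the logarithmic term. *)
pose e := \big[Num.min/Num.min 1 d1]_i d i.
have e0 : 0 < e by apply: lt_bigmin => [|i _]; [rewrite lt_min ltr01 d10|have [] := hd i].
have ei i : e <= d i by exact: bigmin_le_cond.
have e1 : e <= Num.min 1 d1 by exact: bigmin_le_id.
exists e => //; exists (B + 2 * K) => s /andP[s0 se].
have s1 : s <= 1 by rewrite (le_trans se) // (le_trans e1) // ge_min lexx.
have sd1 : s <= d1 by rewrite (le_trans se) // (le_trans e1) // ge_min lexx orbT.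
have kr i : nondegenerate (ray (w i) (Complex s 0) (H i)).
  by have [_] := hd i; apply; rewrite s0 (le_trans se).
have := dual_le_calabi kr; rewrite (hP _ kr) lecE => /andP[_].
have : Complex (calabi p om h) 0 = P`_0.
  rewrite dual_eq_calabi.
  have k0 i : nondegenerate (ray (w i) (Complex 0 0) (H i)).
    by have [d0] := hd i; apply; rewrite lexx ltW.
  have e00 : forms_eq w (fun i => ray (w i) (Complex 0 0) (H i)).
    by move=> i a z Uz; rewrite (rayE _ _ (hH i) Uz) scale0r addr0.
  rewrite (dualC_congr _ _ _ _ e00) (hP _ k0) horner_coef0.
  have -> : integ (fun a z => dlnV (w ord0) (fun a z => Complex 0 0 * H ord0 a z) a z *
      \tr (\adj (ray (w ord0) (Complex 0 0) (H ord0) a z) *m hess (H ord0) a z)) = 0.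
    rewrite -[RHS](@integ0 R n X); apply: integ_ext => a z Uz.
    rewrite /dlnV /lnV /lndet -[add_hess _ _ a z]/(ray (w ord0) (Complex 0 0) (H ord0) a z).
    by rewrite -(e00 ord0 a z Uz) subrr mul0r.
  by rewrite mulr0 subr0.
move=> /(congr1 (fun x : C => Re x)) /= ->.
have [|_] := hK s; first by rewrite s0 sd1.
set L := integ (fun a z => lap _ _ a z ^+ 2 * _) in hP1 *; set T := integ _.
move: (congr1 (fun x : C => Re x) hP1) (hB s); rewrite ger0_norm // s1 => + /(_ isT).
have eB (x y : C) : Re (x - y) = Re x - Re y by case: x; case: y.
have eD (x y : C) : Re (x + y) = Re x + Re y by case: x; case: y.
have eN (x : C) : Re (- x) = - Re x by case: x.
have e2 (x : C) : Re (2 * x) = 2 * Re x by rewrite !mulr_natl !mulr2n eD.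
rewrite eB eD eN !e2 ler_norml => h1 /andP[h2 _] h3 h4.
have h5 := f_equal (fun x => s * x) h1; rewrite /= in h5; lra.
Qed.

End Rays.

(** The test direction is the deviation itself, the choice for which the dual bound is sharp at
    [s = 0]; the derivative of the Calabi functional in this direction then controls the slope. *)
Lemma extremal_slope : (forall f : 'I_k.+1 -> X -> R, (forall i, mfd_smooth (f i)) ->
    is_derive (0 : R) (1 : R) (fun t : R => calabi p om (fun i x => h i x + t * f i x)) (0 : R)) ->
  exists f : 'I_k.+1 -> X -> R, [/\ forall i, mfd_smooth (f i),
    forall a z, U_ a z -> mix0 p w a z = (rf (f ord0) a z + mean0 p w) * Vol w ord0 a z,
    forall j a z, U_ a z ->
      mixi p w j a z = (rf (f (lift ord0 j)) a z + meani p w j) * Vol w (lift ord0 j) a z &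
    Re (slope p w (fun i => rf (f i))) <= 0].
Proof.
move=> ext.
have V0 i a z : U_ a z -> 0 < Vol w i a z by move=> Uz; exact: (kh_det (kw i) Uz).
have [s0 c0 r0] := dev_family (sfam_mix0 p kw) (density_mix0 p kw) (sfam_Vol kw ord0)
  (density_Vol kw ord0) (V0 ord0) (mix0_real p kw) mean0_real.
have [f0 sf0 ef0] := real_family s0 c0 r0.
have /fin_all_exists2 [fi sfi efi] : forall j, exists2 f : X -> R, mfd_smooth f &
    forall a z, U_ a z -> rf f a z = dev (mixi p w j) (Vol w (lift ord0 j)) (meani p w j) a z.
  move=> j; have [sj cj rj] := dev_family (sfam_NNk (p j) (kw ord0) (kw (lift ord0 j)))
    (density_NNk (p j) (kw ord0) (kw (lift ord0 j))) (sfam_Vol kw (lift ord0 j))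
    (density_Vol kw (lift ord0 j)) (V0 (lift ord0 j)) (@NN_real R n X k w kw (p j) (lift ord0 j) ord0)
    (meani_real j).
  exact: (real_family sj cj rj).
pose f i := if unlift ord0 i is Some j then fi j else f0.
have fE0 : f ord0 = f0 by rewrite /f unlift_none.
have fEi j : f (lift ord0 j) = fi j by rewrite /f liftK.
have sf i : mfd_smooth (f i) by rewrite /f; case: unlift.
exists f; split=> //.
- move=> a z Uz; rewrite fE0 (ef0 a z Uz) /dev subrK divfK //.
  by rewrite gt_eqF // V0.
- move=> j a z Uz; rewrite fEi (efi j a z Uz) /dev subrK divfK //.
  by rewrite gt_eqF // V0.
have d0 a z : U_ a z -> dev (mix0 p w) (Vol w ord0) (mean0 p w) a z = rf (f ord0) a z.
  by move=> Uz; rewrite fE0 (ef0 a z Uz).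
have di j a z : U_ a z ->
    dev (mixi p w j) (Vol w (lift ord0 j)) (meani p w j) a z = rf (f (lift ord0 j)) a z.
  by move=> Uz; rewrite fEi (efi j a z Uz).
have [d d_gt0 [K hK]] := calabi_lower sf d0 di.
apply: (derive_zero_slope_le0 (ext f sf) d_gt0) => s hs.
have -> : calabi p om (fun i x => h i x + 0 * f i x) = calabi p om h.
  by congr calabi; apply/funext => i; apply/funext => x; rewrite mul0r addr0.
exact: hK.
Qed.

End ExtremalSlope.

(** * Rigidity at an extremal metric *)

Section VanishingSlope.
Variables (R : realType) (n k : nat) (X : compactComplexManifold R n).
Notation E := 'rV[R]_(n + n).
Notation C := R[i].
Notation Re := complex.Re.
Notation Im := complex.Im.
Notation U_ a := (im a (@setT (carrier (mfd X)))).
Opaque smooth_on.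
Opaque csmooth_on.
Opaque integral_rV.
Opaque d_z d_zbar cpartial integ hess gz gzb.
Implicit Types (a b c : idx X) (z : E) (M W : form11 X) (u : idx X -> E -> C).

(** Apply [d_zbar q] to [v^j M_jl = d_zbar l u]: the second derivatives of [u] are symmetric in [q]
    and [l], and so are the derivatives of [M] by closedness. *)
Lemma dbargrad_sym M u a z : nondegenerate M -> sfam u -> U_ a z ->
  (dbargrad M u a z *m M a z)^T = dbargrad M u a z *m M a z.
Proof.
move=> kM hu Uz; have oU := open_U a; have cM := kh_closed kM.
pose F q l := \sum_j d_zbar q (fun y => grad M u a y 0 j) z * M a z j l.
have sg j : csm (U_ a) (fun y => grad M u a y 0 j) := sfam_grad kM hu j a.
have sM j l : csm (U_ a) (fun y => M a y j l) := cf_smooth cM j l a.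
have key q l : F q l = d_zbar q (d_zbar l (u a)) z -
    \sum_j grad M u a z 0 j * d_zbar q (fun y => M a y j l) z.
  have D := derivation_d_zbar oU q.
  have -> : d_zbar q (d_zbar l (u a)) z =
      d_zbar q (fun y => \sum_j grad M u a y 0 j * M a y j l) z.
    apply: (dv_ext D _ Uz) => y Uy.
    by have := congr1 (fun m : 'rV[C]_n => m 0 l) (gradK u kM Uy); rewrite mxE gzbE => ->.
  rewrite (dv_sum oU D _ (fun j _ => csmM oU (sg j) (sM j l)) Uz) -sumrB.
  apply: eq_bigr => j _; rewrite (dvM D (sg j) (sM j l) Uz).
  by rewrite addrK.
have sym q l : F q l = F l q.
  rewrite !key (commute_dzbar_dzbar oU q l (hu a) Uz).
  apply: (f_equal (fun x : C => _ - x)); apply: eq_bigr => j _.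
  by rewrite (cf_dzbar cM Uz).
have E1 q l : (dbargrad M u a z *m M a z) q l = F q l.
  by rewrite mxE; apply: eq_bigr => j _; rewrite dbargradE.
by apply/matrixP => q l; rewrite [LHS]mxE !E1.
Qed.

Lemma tr_mul_congr (A B A' B' J J' : 'M[C]_n) : J \in unitmx ->
  A *m J = J' *m B -> A' *m J' = J *m B' -> \tr (A' *m A) = \tr (B' *m B).
Proof.
move=> Ju e e'; have eB : A = J' *m B *m invmx J by rewrite -e mulmxK.
rewrite eB mulmxA mxtrace_mulC mulmxA mulmxA -mulmxA e'.
by rewrite mulmxA mulmxA (mulVmx Ju) mul1mx.
Qed.

Lemma tr_conj_congr (A B J : 'M[C]_n) : J \in unitmx ->
  A *m J = map_mx Num.conj J *m B ->
  \tr (map_mx Num.conj A *m A) = \tr (map_mx Num.conj B *m B).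
Proof.
move=> Ju e; apply: (tr_mul_congr Ju e).
have cc : map_mx Num.conj (map_mx Num.conj J) = J.
  by apply/matrixP => i j; rewrite !mxE conjCK.
by rewrite -map_mxM e map_mxM cc.
Qed.

Lemma density_dbar_norm M u : nondegenerate M -> sfam u -> scalar u ->
  density (fun a z => \det (M a z) *
    \tr (map_mx Num.conj (dbargrad M u a z) *m dbargrad M u a z)).
Proof.
move=> kM hu su a b z hz.
have fM := cf_form (kh_closed kM).
have [_ /(_ z hz) J0] := holo_det_jac a b.
set J := cjac (trn a b) z in J0 *.
have Ju : J \in unitmx by rewrite unitmxE unitfE.
have e := dbargrad_trn kM hu su hz; rewrite -/J in e.
set B := dbargrad M u b _ in e *.
have eT := tr_conj_congr Ju e.
have e2 := density_det fM hz.
have gen (x y t : C) : x * t * y = x * y * t by rewrite mulrAC.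
exact (etrans (f_equal2 (fun x y : C => x * y) e2 eT) (gen _ _ _)).
Qed.

Variables (p : 'I_k -> nat) (w : forms X k) (H : 'I_k.+1 -> idx X -> E -> C).
Hypothesis n0 : (0 < n)%N.
Hypothesis pn : forall i, (p i <= n - 1)%N.
Hypothesis kw : forall i, nondegenerate (w i).
Hypothesis pw : forall i, positive_form (w i).
Hypotheses (hH : forall i, sfam (H i)) (sH : forall i, scalar (H i)).
Hypothesis rH : forall i a z, (H i a z)^* = H i a z.
Hypothesis slope0 : complex.Re (slope p w H) <= 0.

Lemma slope_rigidity :
  (forall a z, U_ a z -> dbargrad (w ord0) (H ord0) a z = 0) /\
  (forall i a z, U_ a z -> grad (w i) (H i) a z = grad (w ord0) (H ord0) a z).
Proof.
pose df i := defect (w ord0) (w (lift ord0 i)) (H ord0) (H (lift ord0 i)) (p i).+1.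
pose nb a z := \det (w ord0 a z) * \tr (map_mx Num.conj (dbargrad (w ord0) (H ord0) a z) *m dbargrad (w ord0) (H ord0) a z).
have P1 (i : 'I_k) a z : U_ a z -> 0 <= df i a z /\
    (df i a z = 0 -> invmx (w (lift ord0 i) a z) *m gz (H (lift ord0 i)) a z =
      invmx (w ord0 a z) *m gz (H ord0) a z).
  move=> Uz.
  have [g1 g2] := mixed_defect_ge0 (gz (H ord0) a z) (gz (H (lift ord0 i)) a z) (p i)
    (kh_herm (kw ord0) Uz) (pw ord0 Uz) (kh_herm (kw (lift ord0 i)) Uz) (pw (lift ord0 i) Uz).
  split; [exact g1|apply: g2].
  (* The bound [p i <= n - 1] gives the strict inequality under which a vanishing defect forces
     equal gradients. *)
  by rewrite (leq_ltn_trans (pn i)) // subn1 prednK.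
have P2 a z : U_ a z -> 0 <= nb a z /\ (nb a z = 0 -> dbargrad (w ord0) (H ord0) a z = 0).
  move=> Uz; have V0 := kh_det (kw ord0) Uz.
  have [g1 g2] := dbar_norm_ge0 (kh_herm (kw ord0) Uz) (pw ord0 Uz) (dbargrad_sym (kw ord0) (hH ord0) Uz).
  split; first exact: (mulr_ge0 (ltW V0) g1).
  move=> /eqP; rewrite mulf_eq0 (gt_eqF V0) /= => /eqP; exact: g2.
have I1 i := integ_ge0
  (sfam_defect n0 (kw ord0) (kw (lift ord0 i)) (hH ord0) (hH (lift ord0 i)) (rH ord0) (rH (lift ord0 i)) (p i).+1)
  (density_defect (kw ord0) (kw (lift ord0 i)) (hH ord0) (sH ord0) (hH (lift ord0 i)) (sH (lift ord0 i)) (p i).+1)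
  (fun a z Uz => (P1 i a z Uz).1).
have I2 := integ_ge0 (sfam_dbar_norm (kw ord0) (hH ord0))
  (density_dbar_norm (kw ord0) (hH ord0) (sH ord0)) (fun a z Uz => (P2 a z Uz).1).
have s1 : 0 <= \sum_i integ (df i) by apply: sumr_ge0 => i _; exact (I1 i).1.
(* The hypothesis bounds only the real part; the order on complex numbers makes the nonnegative sum
   real, so its imaginary part is 0 as well. *)
have S0 : slope p w H = 0.
  apply/eqP; rewrite eq_le (addr_ge0 s1 I2.1) andbT.
  have := addr_ge0 s1 I2.1; rewrite -/(slope p w H) !lecE => /andP[/eqP e _].
  by rewrite e eqxx slope0.
have /eqP := S0; rewrite /slope (paddr_eq0 s1 I2.1) => /andP[e1 /eqP e2].
split=> [a z Uz|]; first exact: ((P2 a z Uz).2 (I2.2 e2 a z Uz)).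
move=> i a z Uz; case: (unliftP ord0 i) => [j|] ->; last by [].
have e3 : integ (df j) = 0.
  apply/eqP; move: e1; rewrite psumr_eq0 => [/allP/(_ j)|q _]; last exact (I1 q).1.
  by rewrite mem_index_enum => /(_ isT).
have e4 := (P1 j a z Uz).2 ((I1 j).2 e3 a z Uz).
have e5 : gradc (w (lift ord0 j)) (H (lift ord0 j)) a z = gradc (w ord0) (H ord0) a z.
  by rewrite (gradcE (kw _) (hH _) (rH _) Uz) (gradcE (kw _) (hH _) (rH _) Uz).
by have := congr1 (fun m : 'cV[C]_n => ct m) e5; rewrite /gradc !ctK.
Qed.

End VanishingSlope.

(** * The Futaki invariant of the gradient field *)

Section FutakiCriterion.
Variables (R : realType) (n k : nat) (X : compactComplexManifold R n).
Notation E := 'rV[R]_(n + n).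
Notation C := R[i].
Notation Re := complex.Re.
Notation Im := complex.Im.
Notation U_ a := (im a (@setT (carrier (mfd X)))).
Opaque smooth_on.
Opaque csmooth_on.
Opaque integral_rV.
Opaque d_z d_zbar cpartial integ hess gz gzb.
Implicit Types (a b c : idx X) (z : E) (M W : form11 X) (u : idx X -> E -> C).

Lemma scalar_chartV (th : X -> C) : scalar (fun a z => th (chartV a z)).
Proof. by move=> a b z hz; have [_ _ ->] := trnP hz. Qed.

Lemma sfam_chartV (th : X -> C) : mfd_csmooth th -> sfam (fun a z => th (chartV a z)).
Proof. by move=> [h1 h2] a; exact: (conj (h1 a) (h2 a)). Qed.

Lemma gzb_ext (s u : idx X -> E -> C) a z : U_ a z ->
  (forall y, U_ a y -> s a y = u a y) -> gzb s a z = gzb u a z.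
Proof.
move=> Uz e; apply/rowP => l; rewrite !gzbE.
exact: (dv_ext (derivation_d_zbar (open_U a) l) e Uz).
Qed.

Lemma holomorphy_potentialP M (xi : vfield X) (th : X -> C) :
  holomorphy_potential M xi th <->
  mfd_csmooth th /\ potential M xi (fun a z => th (chartV a z)).
Proof.
have E1 a z l : (Complex 0 1 *: (xi a z *m M a z)) 0 l =
    \sum_j Complex 0 1 * xi a z 0 j * M a z j l.
  by rewrite !mxE mulr_sumr; apply: eq_bigr => j _; rewrite mulrA.
split=> -[h1 h2]; split=> //.
  by move=> a z Uz; apply/rowP => l; rewrite E1 gzbE (h2 a z Uz l).
by move=> a z Uz l; rewrite -E1 (h2 a z Uz) gzbE.
Qed.

Variables (p : 'I_k -> nat) (om : forms X k) (h : 'I_k.+1 -> X -> R).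
Hypothesis n0 : (0 < n)%N.
Hypothesis pn : forall i, (p i <= n - 1)%N.
Hypothesis com : forall i, closed_form (om i).
Hypothesis hom : forall i a z, U_ a z -> herm (om i a z).
Hypothesis pom : forall i, positive_form (om i).
Hypothesis hpsh : forall i, PSH (om i) (h i).
Let w := perturbs om h.

Let kom i : nondegenerate (om i).
Proof.
split; [exact: com|exact: (hom i)|move=> a z Uz].
exact: (posdef_det_gt0 (hom i Uz) (pom i Uz)).
Qed.

Let kw i : nondegenerate (w i).
Proof. exact: (nondegenerate_perturb (com i) (hom i) (hpsh i)). Qed.

Let sh i : mfd_smooth (h i) := (hpsh i).1.
Let hu i : sfam (rf (h i)) := sfam_rf (sh i).
Let su i : scalar (rf (h i)) := scalar_rf (h i).

Lemma futaki_perturbs xi (th : 'I_k.+1 -> X -> C) : holomorphic_vfield xi ->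
  (forall i, holomorphy_potential (om i) xi (th i)) ->
  futaki p om th =
  futakiC p w (fun i => shift xi (fun a z => th i (chartV a z)) (rf (h i))).
Proof.
move=> hxi hth; have hT i := (holomorphy_potentialP (om i) xi (th i)).1 (hth i).
rewrite (futakiE n0 pn kom (fun i => sfam_chartV (hT i).1)); apply/esym.
exact: (futakiC_invariant p kom kw hu su hxi (fun i => sfam_chartV (hT i).1)
  (fun i => scalar_chartV (th i)) (fun i => (hT i).2)).
Qed.

Lemma moment_zero_futaki : moment_zero p om h -> futaki_vanishes p om.
Proof.
move=> /(moment_zeroP n0 pn kw) mz xi th hxi hth; rewrite (futaki_perturbs hxi hth).
apply: (moment_zero_futakiC kw mz) => i.
have hT := (holomorphy_potentialP (om i) xi (th i)).1 (hth i).
exact: (sfam_shift hxi (sfam_chartV hT.1) (hu i)).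
Qed.

(** The factor [- i] is there so that [u] itself becomes a potential in the convention
    [i xi M = dbar Th]. *)
Lemma holomorphic_grad M u : nondegenerate M -> sfam u -> scalar u ->
  (forall a z, U_ a z -> dbargrad M u a z = 0) ->
  holomorphic_vfield (fun a z => - Complex 0 1 *: grad M u a z).
Proof.
move=> kM hsu ssu B0; split=> [a j|a b z hz l].
  have hs : csm (U_ a) (fun z => - Complex 0 1 * grad M u a z 0 j).
    exact: (sfamZ (- Complex 0 1) (sfam_grad kM hsu j) a).
  have eE : (fun z => (- Complex 0 1 *: grad M u a z) 0 j) = fun z => - Complex 0 1 * grad M u a z 0 j.
    by apply/funext => z; rewrite scalemxE.
  rewrite eE; split; first exact: hs.
  move=> z Uz q; rewrite (dvZ (open_U a) (derivation_d_zbar (open_U a) q) _ (sfam_grad kM hsu j a) Uz).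
  have e : dbargrad M u a z q j = 0 by rewrite (B0 a z Uz) mxE.
  by rewrite dbargradE in e; rewrite e mulr0.
have e := congr1 (fun m : 'rV[C]_n => m 0 l) (grad_trn kM hsu ssu hz).
rewrite /= in e; rewrite scalemxE -[chart b _]/(trn a b z) -e mxE mulr_sumr.
apply: eq_bigr => j _; rewrite scalemxE -mulrA.
by rewrite [cjac _ _ _ _]mxE.
Qed.

Lemma grad_potential M xi u s : closed_form M -> nondegenerate (add_hess M u) ->
  sfam s -> sfam u -> holomorphic_vfield xi ->
  (forall a z, U_ a z -> xi a z = - Complex 0 1 *: grad (add_hess M u) s a z) ->
  potential M xi (fun a z => s a z - Complex 0 1 * lie xi u a z).
Proof.
move=> cM kM' hs hsu hxi xE.
have pot : potential (add_hess M u) xi s.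
  move=> a z Uz; rewrite (xE a z Uz) -scalemxAl (gradK s kM' Uz) scalerA.
  have -> : Complex 0 1 * - Complex 0 1 = 1 :> C.
    by apply: complexE2 => /=; ring.
  by rewrite scale1r.
have := potential_hess (-1) (kh_closed kM') hxi hs hsu pot.
move=> P a z Uz; have e := P a z Uz.
have -> : M a z = add_hess M u a z + -1 *: hess u a z by rewrite /add_hess scaleN1r addrK.
by rewrite e; apply: gzb_ext => // y Uy; rewrite mulN1r.
Qed.

(** The mean [m] is the normalising constant of [pairing], so the two terms linear in [s] cancel. *)
Lemma pairing_square (s N V : idx X -> E -> C) (m : C) : sfam s -> sfam N -> sfam V ->
  m = integ N / integ V -> (forall a z, U_ a z -> N a z = (s a z + m) * V a z) ->
  pairing s N V = integ (fun a z => s a z ^+ 2 * V a z).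
Proof.
move=> hs hN hV em hE; rewrite /pairing -em.
have h1 := sfamM hs hN; have h2 := sfamM hs hV.
rewrite -(integZ m h2) -(integB h1 (sfamZ m h2)); apply: integ_ext => a z Uz.
rewrite (hE a z Uz); move: (s a z) (V a z) => x y; ring.
Qed.

Lemma extremal_futaki_moment_zero :
  (forall f : 'I_k.+1 -> X -> R, (forall i, mfd_smooth (f i)) ->
    is_derive (0 : R) (1 : R) (fun t : R => calabi p om (fun i x => h i x + t * f i x)) (0 : R)) ->
  futaki_vanishes p om -> moment_zero p om h.
Proof.
move=> ext fv.
have [f [sf m0E miE slope0]] := extremal_slope n0 pn com hom sh kw ext.
pose H i := rf (f i).
have hH i : sfam (H i) := sfam_rf (sf i).
have sH i : scalar (H i) := scalar_rf (f i).
have rH i a z : (H i a z)^* = H i a z := rf_real (f i) a z.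
have pw i : positive_form (w i) := (hpsh i).2.
have [B0 geq] := slope_rigidity n0 pn kw pw hH sH rH slope0.
pose xi : vfield X := fun a z => - Complex 0 1 *: grad (w ord0) (H ord0) a z.
have hxi : holomorphic_vfield xi := holomorphic_grad (kw ord0) (hH ord0) (sH ord0) B0.
(* In general complex valued, since [lie] differentiates the real function [h i] along a field of
   type (1,0); [shift] by [h i] turns it back into the real [H i]. *)
pose T i a z := H i a z - Complex 0 1 * lie xi (rf (h i)) a z.
have hT i : sfam (T i) := sfamB (hH i) (sfamZ (Complex 0 1) (sfam_lie hxi (hu i))).
have sT i : scalar (T i).
  move=> a b z hz; rewrite /T (sH i a b z hz); apply: (f_equal (fun x : C => _ - _ * x)).
  exact: (scalar_lie hxi (hu i) (su i) hz).
pose th i := descend (T i).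
have thE i a z : U_ a z -> th i (chartV a z) = T i a z by move=> Uz; exact: (descendE (sT i) Uz).
have hth i : holomorphy_potential (om i) xi (th i).
  apply/holomorphy_potentialP; split; first exact: (descend_csmooth (hT i) (sT i)).
  have pot : potential (om i) xi (T i).
    apply: (grad_potential (com i) (kw i) (hH i) (hu i) hxi) => a z Uz.
    by rewrite -/(w i) (geq i a z Uz).
  move=> a z Uz; exact (etrans (pot a z Uz) (gzb_ext Uz (fun y Uy => esym (thE i a y Uy)))).
have hV i := sfam_Vol kw i.
have F0 : \sum_i integ (fun a z => H i a z ^+ 2 * Vol w i a z) = 0.
  apply: (etrans _ (fv xi th hxi hth)); rewrite (futaki_perturbs hxi hth).
  have shE i a z : U_ a z -> shift xi (fun a z => th i (chartV a z)) (rf (h i)) a z = H i a z.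
    by move=> Uz; rewrite /shift (thE i a z Uz) /T subrK.
  have pE i N V : pairing (shift xi (fun a z => th i (chartV a z)) (rf (h i))) N V = pairing (H i) N V.
    by rewrite /pairing; congr (_ - _ * _); apply: integ_ext => a z Uz; rewrite (shE i a z Uz).
  rewrite /futakiC big_ord_recl; apply: (f_equal2 (fun x y : C => x + y)).
    rewrite pE; apply/esym.
    exact: (pairing_square (hH ord0) (sfam_mix0 p kw) (hV ord0) erefl m0E).
  apply: eq_bigr => j _; rewrite pE; apply/esym.
  exact: (pairing_square (hH (lift ord0 j)) (sfam_NNk (p j) (kw ord0) (kw (lift ord0 j)))
    (hV (lift ord0 j)) erefl (miE j)).
have sq i a z : U_ a z -> 0 <= H i a z ^+ 2 * Vol w i a z.
  move=> Uz; apply: mulr_ge0; last exact: (ltW (kh_det (kw i) Uz)).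
  by rewrite expr2 -{2}(rH i a z) -normCK exprn_ge0.
have dsq i : density (fun a z => H i a z ^+ 2 * Vol w i a z).
  have sc : scalar (fun a z => H i a z ^+ 2) by move=> a b z hz; rewrite (sH i a b z hz).
  exact: (densityZ sc (density_Vol kw i)).
have I i := integ_ge0 (sfamM (sfamM (hH i) (hH i)) (hV i)) (dsq i) (sq i).
have H0 i a z : U_ a z -> H i a z = 0.
  move=> Uz; have e : integ (fun a z => H i a z ^+ 2 * Vol w i a z) = 0.
    apply/eqP; move/eqP: F0; rewrite psumr_eq0 => [/allP/(_ i)|q _]; last exact (I q).1.
    by rewrite mem_index_enum => /(_ isT).
  have /eqP := (I i).2 e a z Uz.
  by rewrite mulf_eq0 (gt_eqF (kh_det (kw i) Uz)) orbF mulf_eq0 orbb => /eqP.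
apply/(moment_zeroP n0 pn kw) => a z Uz; split.
  by rewrite (m0E a z Uz) -/(H ord0 a z) (H0 ord0 a z Uz) add0r.
by move=> j; rewrite (miE j a z Uz) -/(H (lift ord0 j) a z) (H0 (lift ord0 j) a z Uz) add0r.
Qed.

End FutakiCriterion.

Theorem corollary4p5 (R : realType) (n k : nat)
    (X : compactComplexManifold R n)
    (L : 'I_k.+1 -> lineBundle X)
    (phi : forall i : 'I_k.+1, lidx (L i) -> X -> R)
    (om : 'I_k.+1 -> form11 X)
    (p : 'I_k -> nat)
    (h : 'I_k.+1 -> X -> R)
    (n_gt0 : (0 < n)%N)
    (X_projective : projective X)
    (phi_metric : forall i : 'I_k.+1, hermitian_metric (phi i))
    (om_curvature : forall i : 'I_k.+1, curvature_form (phi i) (om i))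
    (om_kahler : forall i : 'I_k.+1, positive_form (om i))
    (p_bound : forall i : 'I_k, (p i <= n - 1)%N)
    (h_extremal : extremal p om h) :
  moment_zero p om h <-> futaki_vanishes p om.
Proof.
have com i := (curvature_closed (phi_metric i) (om_curvature i)).1.
have hom i := (curvature_closed (phi_metric i) (om_curvature i)).2.
have [hpsh ext] := h_extremal; split.
  exact: (moment_zero_futaki n_gt0 p_bound com hom om_kahler hpsh).
exact: (extremal_futaki_moment_zero n_gt0 p_bound com hom om_kahler hpsh ext).
Qed.
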